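(* For every integer $j$ let $$f_{3,j}(\tau)=6E_{1,-3}(2\tau)+(-1)^j\sqrt{-3}\big(E_{1,-3}(\tau/2)-E_{1,-3}((\tau+1)/2)\big).$$ Then for all integers $j$ and $\tau\in\mathcal{H}$: $f_{3,j}^3(\tau)=F_{3,j}(\tau)$, $f_{3,j}(\tau)f_{3,j+1}(\tau)=E_{3,2}(\tau)$, $f_{3,j}\big(((-1)^j3+\sqrt{-3})/6\big)=0$, $f_{3,j}(\tau+1)=f_{3,j+1}(\tau)$, and $f_{3,j}(-1/(3\tau))=\frac{(-1)^j3-\sqrt{-3}}{2}\,\tau f_{3,j+1}(\tau)$.
   Context: $\mathcal{H}$ is the upper half-plane, $q=e^{2\pi i\tau}$, $\eta(\tau)=q^{1/24}\prod_{n\ge1}(1-q^n)$, $E_2=1-24\sum_{n\ge1}\sigma_1(n)q^n$, $E_4=1+240\sum_{n\ge1}\sigma_3(n)q^n$. $E_{1,-3}(\tau)=\frac16+\sum_{n\ge1}\big(\sum_{d\mid n}\left(\frac{-3}{d}\right)\big)q^n$. $E_{3,2}(\tau)=(3E_2(3\tau)-E_2(\tau))/2$ (one has $E_{3,2}=(6E_{1,-3})^2$), $E_{3,4}(\tau)=(9E_4(3\tau)-E_4(\tau))/8$, $\eta_3(\tau)=\eta(\tau)\eta(3\tau)$, and $F_{3,j}=E_{3,4}/(6E_{1,-3})-(-1)^j6\sqrt{-3}\,\eta_3^3$. $\sqrt{-3}=i\sqrt3$.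
   Formalization: The sign of the eta term in F_{3,j} is corrected to +(-1)^j 6√-3 η_3^3, since with the printed minus sign f_{3,j}^3=F_{3,j} fails at the q^{1/2} coefficient; at zeros of E_{1,-3}, F_{3,j} means its limit value. *)

(* Defs.v *)
From mathcomp Require Import all_boot.
From Stdlib Require Import Reals ZArith.
From Coquelicot Require Import Coquelicot.

Set Implicit Arguments.
Unset Strict Implicit.
Unset Printing Implicit Defensive.

(* (a/p) for an odd prime p *)
Definition legendre (a : Z) (p : nat) : Z :=
  if Z.eqb (Z.modulo a (Z.of_nat p)) 0 then 0%Z
  else if [exists x : 'I_p,
             Z.eqb (Z.modulo (Z.of_nat x * Z.of_nat x - a) (Z.of_nat p)) 0]
  then 1%Z else (-1)%Z.

(* (a/2) *)
Definition kronecker2 (a : Z) : Z :=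
  if Z.even a then 0%Z
  else if Z.eqb (Z.modulo a 8) 1 || Z.eqb (Z.modulo a 8) 7 then 1%Z
  else (-1)%Z.

(* The Kronecker symbol (a/n) for n >= 1; its value at n = 0 is not the
   conventional one. *)
Definition kronecker (a : Z) (n : nat) : Z :=
  \big[Z.mul/1%Z]_(f <- prime_decomp n)
    Z.pow (if f.1 == 2%N then kronecker2 a else legendre a f.1) (Z.of_nat f.2).

Definition divisor_sigma (k n : nat) : nat :=
  (\sum_(d <- divisors n) expn d k)%N.

Definition chi_sum (n : nat) : Z :=
  \big[Z.add/0%Z]_(d <- divisors n) kronecker (-3) d.

Open Scope R_scope.
Open Scope C_scope.

(* Total operators on C, meaningful when the limit in question exists. *)
Definition Ciota (P : C -> Prop) : C :=
  @iota (CompleteNormedModule.CompleteSpace _ C_CompleteNormedModule) P.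

Definition Cseries (a : nat -> C) : C :=
  Ciota (fun l => @is_series C_AbsRing C_NormedModule a l).

Definition Cinfprod (a : nat -> C) : C :=
  Ciota (fun l =>
    filterlim (fun N : nat => \big[Cmult/RtoC 1]_(0 <= n < N) a n)
      eventually (@locally C_UniformSpace l)).

Definition Clim (g : C -> C) (z : C) : C :=
  Ciota (fun l =>
    filterlim g (@locally' C_UniformSpace z) (@locally C_UniformSpace l)).

Definition Cexp (z : C) : C :=
  (exp (Re z) * cos (Im z), exp (Re z) * sin (Im z))%R.

Definition qpar (tau : C) : C := Cexp (2 * PI * Ci * tau).

(* Series and products over n >= 1 are indexed from 0, hence the n.+1. *)
Definition eta (tau : C) : C :=
  Cexp (2 * PI * Ci * tau / 24) *
  Cinfprod (fun n => 1 - Cpow (qpar tau) n.+1).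

Definition E2 (tau : C) : C :=
  1 - 24 * Cseries (fun n => INR (divisor_sigma 1 n.+1) * Cpow (qpar tau) n.+1).

Definition E4 (tau : C) : C :=
  1 + 240 * Cseries (fun n => INR (divisor_sigma 3 n.+1) * Cpow (qpar tau) n.+1).

(* E_{1,-3} *)
Definition E1m3 (tau : C) : C :=
  1 / 6 + Cseries (fun n => IZR (chi_sum n.+1) * Cpow (qpar tau) n.+1).

Definition E32 (tau : C) : C := (3 * E2 (3 * tau) - E2 tau) / 2.

Definition E34 (tau : C) : C := (9 * E4 (3 * tau) - E4 tau) / 8.

Definition eta3 (tau : C) : C := eta tau * eta (3 * tau).

Definition sqrtm3 : C := Ci * sqrt 3.

Definition sgn (j : Z) : C := powerRZ (-1) j.

(* The sign of the eta-term is + : as q -> 0,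
   f3 j = 1 + (-1)^j 2 sqrtm3 q^(1/2) + O(q), so that
   (f3 j)^3 = 1 + (-1)^j 6 sqrtm3 q^(1/2) + O(q), while eta3^3 = q^(1/2) + O(q).
   With the sign - the cube of f3 j would be F3 (j + 1). *)
Definition F3_quotient (j : Z) (tau : C) : C :=
  E34 tau / (6 * E1m3 tau) + sgn j * 6 * sqrtm3 * Cpow (eta3 tau) 3.

(* E1m3 has zeros in the upper half-plane, e.g. (3 + sqrtm3) / 6; the
   singularities of the quotient there are removable, and F3 takes there the
   value of the holomorphic extension. *)
Definition F3 (j : Z) (tau : C) : C :=
  if Ceq_dec (E1m3 tau) 0 then Clim (F3_quotient j) tau
  else F3_quotient j tau.

Definition f3 (j : Z) (tau : C) : C :=
  6 * E1m3 (2 * tau)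
  + sgn j * sqrtm3 * (E1m3 (tau / 2) - E1m3 ((tau + 1) / 2)).

(* Main.v *)
(** Put [L = 6 E1m3], [D = q d/dq], [P = (3 E2(3 tau) + E2(tau)) / 2], and let [f_s], [s = 1, -1],
    be the two functions [f3 j].  The inversion formulas for [E1m3] and [E2] come from exchanging
    the order of summation in the conditionally convergent lattice sum of [1 / (w^2 - t^2)].  They
    show that [f_s] is sent to [f_{-s}] by [tau + 1] and, up to the factor in the theorem, by the
    Fricke involution [W tau = -1 / (3 tau)].  Every orbit of the group generated by these two maps
    meets [Im tau >= c] for each [c < sqrt 3 / 6], so the maximum modulus principle
    in the variable [q^(1/2)] kills a form of weight [k] vanishing to order [nu] as soon as
    [k sqrt 3 < pi nu].  This yields four identities:
      [L^2 = E32],  [f_1 f_{-1} = L^2],  [f_1^3 + f_{-1}^3 = L P - 12 DL],  [4 DX = P X]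
    with [X = f_1^3 - f_{-1}^3].  Differentiating the first one and using Ramanujan's
    [12 D E2 = E2^2 - E4] turns the third into [(f_1^3 + f_{-1}^3) / 2 = E34 / L].  The fourth
    one says that [X] and [eta3^3] have the same logarithmic derivative, so [X = 12 sqrtm3 eta3^3]
    by comparing first coefficients.  Since [X] has no zero, the zeros of [L] are simple, and the
    singularities of [E34 / L] are removable with the expected values. *)

Require Import Defs.
From Stdlib Require Import Reals ZArith Lra Lia Psatz.
From Coquelicot Require Import Coquelicot.

Open Scope R_scope.
Open Scope C_scope.

(** * Absolutely convergent complex series *)

(** [sqrt 3 / 6] is the height of the lowest corners of the domain |Re tau| <= 1/2, |tau|^2 >= 1/3;
    they are the zeros of f_s in the theorem, each being fixed by W followed by a translation. For g
    of order nu at the cusp, |g|^2 y^k behaves like y^k exp (- 2 pi nu y), which decreases beyond y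
    = k / (2 pi nu); the condition on k and nu puts this point below the corners. The criterion is
    weaker than the valence formula, but it costs only power series: the identities, of weights 2,
    2, 3, 5, then ask for orders 2, 2, 2, 3 in q^(1/2). Translation by 1 is q^(1/2) -> - q^(1/2), so
    every second coefficient vanishes by parity and a single one is left to compute for each
    identity. This is why only symmetric and antisymmetric combinations of f_1 and f_{-1} occur:
    both generators exchange the two functions, and the two factors under W agree only after cubing.
    The combinations of DL and DX with P are Serre derivatives: the weight times P / 12 absorbs the
    non-modular part of a derivative. *)

Fixpoint Csum (a : nat -> C) (n : nat) : C :=
  match n with 0%nat => a 0%nat | S m => Csum a m + a (S m) end.

Lemma sum_n_Csum (a : nat -> C) n : sum_n a n = Csum a n.
Proof.
  induction n; [exact (sum_O a)|]. rewrite sum_Sn, IHn. reflexivity.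
Qed.

Definition csummable (a : nat -> C) : Prop := ex_series (fun n => Cmod (a n)).

Definition clim (u : nat -> C) (l : C) : Prop :=
  forall eps : R, (0 < eps)%R ->
  exists N, forall n, (N <= n)%nat -> (Cmod (u n - l) < eps)%R.

Lemma clim_filterlim u l :
  clim u l <-> filterlim u eventually (@locally C_UniformSpace l).
Proof.
  split.
  - intros H.
    apply (@filterlim_locally_ball_norm C_AbsRing nat C_NormedModule eventually _ u l).
    intros eps. destruct (H eps (cond_pos eps)) as [N HN].
    exists N. intros n Hn. exact (HN n Hn).
  - intros H eps He.
    assert (H' := proj1 (@filterlim_locally_ball_norm C_AbsRing nat
                  C_NormedModule eventually _ u l) H (mkposreal eps He)).
    destruct H' as [N HN]. exists N. intros n Hn. exact (HN n Hn).
Qed.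

Lemma is_series_clim (a : nat -> C) (l : C) :
  @is_series C_AbsRing C_NormedModule a l <-> clim (Csum a) l.
Proof.
  rewrite (clim_filterlim (Csum a)). unfold is_series.
  split; apply filterlim_ext; intros n; rewrite sum_n_Csum; reflexivity.
Qed.

Lemma Csum_ext_loc (a b : nat -> C) N :
  (forall n, (n <= N)%nat -> a n = b n) -> Csum a N = Csum b N.
Proof.
  intros H. induction N; simpl; [apply H; lia|].
  rewrite IHN, H; auto.
Qed.

Lemma Csum_ext (a b : nat -> C) N : (forall n, a n = b n) -> Csum a N = Csum b N.
Proof. intros H. apply Csum_ext_loc. auto. Qed.

Lemma clim_unique u l1 l2 : clim u l1 -> clim u l2 -> l1 = l2.
Proof.
  intros H1 H2.
  apply clim_filterlim in H1. apply clim_filterlim in H2.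
  exact (@filterlim_locally_unique nat C_AbsRing C_NormedModule eventually _ u l1 l2 H1 H2).
Qed.

Lemma clim_ext u v l : (forall n, u n = v n) -> clim u l -> clim v l.
Proof.
  intros H Hu eps He. destruct (Hu eps He) as [N HN].
  exists N. intros n Hn. rewrite <- H. auto.
Qed.

Lemma clim_ext_loc u v l N0 :
  (forall n, (N0 <= n)%nat -> u n = v n) -> clim u l -> clim v l.
Proof.
  intros H Hu eps He. destruct (Hu eps He) as [N HN].
  exists (max N0 N). intros n Hn. rewrite <- H by lia. apply HN. lia.
Qed.

Lemma clim_const c : clim (fun _ => c) c.
Proof.
  intros eps He. exists 0%nat. intros n _.
  replace (c - c) with (RtoC 0) by ring. rewrite Cmod_0. exact He.
Qed.

Lemma clim_plus u v a b : clim u a -> clim v b -> clim (fun n => u n + v n) (a + b).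
Proof.
  intros Hu Hv eps He.
  destruct (Hu (eps / 2)%R ltac:(lra)) as [N1 H1].
  destruct (Hv (eps / 2)%R ltac:(lra)) as [N2 H2].
  exists (max N1 N2). intros n Hn.
  replace (u n + v n - (a + b)) with ((u n - a) + (v n - b)) by ring.
  eapply Rle_lt_trans. apply Cmod_triangle.
  specialize (H1 n ltac:(lia)). specialize (H2 n ltac:(lia)). lra.
Qed.

Lemma clim_mult u v a b : clim u a -> clim v b -> clim (fun n => u n * v n) (a * b).
Proof.
  intros Hu Hv eps He.
  assert (Ha := Cmod_ge_0 a). assert (Hb := Cmod_ge_0 b).
  set (e2 := (eps / (2 * (Cmod a + 1)))%R).
  assert (He1 : (0 < eps / (2 * (Cmod b + 1)))%R)
    by (apply Rdiv_lt_0_compat; lra).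
  assert (He2 : (0 < e2)%R) by (apply Rdiv_lt_0_compat; lra).
  destruct (Hu (eps / (2 * (Cmod b + 1)))%R He1) as [N1 H1].
  destruct (Hv (Rmin 1 e2)) as [N2 H2]. { apply Rmin_pos; lra. }
  exists (max N1 N2). intros n Hn.
  specialize (H1 n ltac:(lia)). specialize (H2 n ltac:(lia)).
  replace (u n * v n - a * b) with ((u n - a) * v n + a * (v n - b)) by ring.
  eapply Rle_lt_trans. apply Cmod_triangle. rewrite 2!Cmod_mult.
  assert (Hvn : (Cmod (v n) <= Cmod b + 1)%R).
  { replace (v n) with (b + (v n - b)) by ring.
    eapply Rle_trans. apply Cmod_triangle.
    assert (Rmin 1 e2 <= 1)%R by apply Rmin_l. lra. }
  assert (Hvn2 : (Cmod (v n - b) < e2)%R).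
  { assert (Rmin 1 e2 <= e2)%R by apply Rmin_r. lra. }
  assert (A1 : (Cmod (u n - a) * Cmod (v n) <= eps / 2)%R).
  { apply Rle_trans with (eps / (2 * (Cmod b + 1)) * (Cmod b + 1))%R.
    - apply Rmult_le_compat; try apply Cmod_ge_0; lra.
    - right. field. lra. }
  assert (A2 : (Cmod a * Cmod (v n - b) < eps / 2)%R).
  { apply Rle_lt_trans with (Cmod a * e2)%R.
    - apply Rmult_le_compat_l; lra.
    - unfold e2. apply Rlt_le_trans with ((Cmod a + 1) * (eps / (2 * (Cmod a + 1))))%R.
      + apply Rmult_lt_compat_r. exact He2. lra.
      + right. field. lra. }
  lra.
Qed.

Lemma clim_scal c u l : clim u l -> clim (fun n => c * u n) (c * l).
Proof. intros H. apply clim_mult. apply clim_const. exact H. Qed.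

Lemma clim_Cmod_le u l (M : R) :
  clim u l -> (forall n, (Cmod (u n) <= M)%R) -> (Cmod l <= M)%R.
Proof.
  intros H HM. apply Rnot_lt_le. intros Hlt.
  destruct (H (Cmod l - M)%R ltac:(lra)) as [N HN].
  specialize (HN N (le_n N)). specialize (HM N).
  assert (Cmod l <= Cmod (u N) + Cmod (u N - l))%R.
  { replace l with (u N + - (u N - l)) at 1 by ring.
    eapply Rle_trans. apply Cmod_triangle. rewrite Cmod_opp. lra. }
  lra.
Qed.

(** Links the iota operator of the definition to convergence: limits being unique, it returns the
    sum whenever there is one. *)
Lemma Cseries_unique a l : @is_series C_AbsRing C_NormedModule a l -> Cseries a = l.
Proof.
  intros H. unfold Cseries, Ciota.
  apply (@iota_unique C_AbsRing C_CompleteNormedModule).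
  - intros y Hy. apply is_series_clim in Hy. apply is_series_clim in H.
    exact (clim_unique _ _ _ Hy H).
  - exact H.
Qed.

Lemma csummable_le a b : (forall n, (Cmod (a n) <= b n)%R) -> ex_series b -> csummable a.
Proof.
  intros H Hb. unfold csummable.
  apply (@ex_series_le R_AbsRing R_CompleteNormedModule (fun n => Cmod (a n)) b); auto.
  intros n. unfold norm; simpl. unfold abs; simpl.
  rewrite Rabs_pos_eq; auto. apply Cmod_ge_0.
Qed.

Lemma Cseries_correct a : csummable a -> @is_series C_AbsRing C_NormedModule a (Cseries a).
Proof.
  intros H.
  destruct (@ex_series_le C_AbsRing C_CompleteNormedModule a (fun n => Cmod (a n))) as [l Hl].
  - intros n. apply Rle_refl.
  - exact H.
  - rewrite (Cseries_unique _ _ Hl). exact Hl.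
Qed.

Lemma Cseries_clim a : csummable a -> clim (Csum a) (Cseries a).
Proof. intros H. apply is_series_clim, Cseries_correct, H. Qed.

Lemma Cseries_ext a b : (forall n, a n = b n) -> Cseries a = Cseries b.
Proof.
  intros H. f_equal. apply FunctionalExtensionality.functional_extensionality, H.
Qed.

Lemma csummable_ext a b : (forall n, a n = b n) -> csummable a -> csummable b.
Proof.
  intros H Ha. unfold csummable. apply (ex_series_ext (fun n => Cmod (a n))); auto.
  intros n. rewrite H. reflexivity.
Qed.

Lemma csummable_plus a b : csummable a -> csummable b -> csummable (fun n => a n + b n).
Proof.
  intros Ha Hb. apply csummable_le with (fun n => plus (Cmod (a n)) (Cmod (b n))).
  - intros n. apply Cmod_triangle.
  - exact (ex_series_plus _ _ Ha Hb).
Qed.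

Lemma csummable_scal c a : csummable a -> csummable (fun n => c * a n).
Proof.
  intros Ha. apply csummable_le with (fun n => scal (Cmod c) (Cmod (a n))).
  - intros n. rewrite Cmod_mult. apply Rle_refl.
  - exact (ex_series_scal_l _ _ Ha).
Qed.

Lemma csummable_0 : csummable (fun _ => RtoC 0).
Proof.
  exists 0%R. apply (is_series_ext (fun _ => 0%R)). { intros n. now rewrite Cmod_0. }
  unfold is_series. apply (filterlim_ext (fun _ => 0%R)).
  - intros n. rewrite sum_n_const. ring.
  - apply filterlim_const.
Qed.

Lemma Cseries_plus a b : csummable a -> csummable b ->
  Cseries (fun n => a n + b n) = Cseries a + Cseries b.
Proof.
  intros Ha Hb. apply Cseries_unique.
  exact (@is_series_plus C_AbsRing C_NormedModule a b _ _
           (Cseries_correct a Ha) (Cseries_correct b Hb)).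
Qed.

Lemma Cseries_scal c a : csummable a -> Cseries (fun n => c * a n) = c * Cseries a.
Proof.
  intros Ha. apply Cseries_unique.
  exact (@is_series_scal C_AbsRing C_NormedModule c a _ (Cseries_correct a Ha)).
Qed.

Lemma csummable_opp a : csummable a -> csummable (fun n => - a n).
Proof.
  intros Ha. apply csummable_ext with (fun n => (-(1)) * a n). { intros; ring. }
  apply csummable_scal, Ha.
Qed.

Lemma csummable_minus a b : csummable a -> csummable b -> csummable (fun n => a n - b n).
Proof. intros Ha Hb. apply csummable_plus; auto. apply csummable_opp, Hb. Qed.

Lemma Cseries_minus a b : csummable a -> csummable b ->
  Cseries (fun n => a n - b n) = Cseries a - Cseries b.
Proof.
  intros Ha Hb. unfold Cminus. rewrite Cseries_plus; auto using csummable_opp.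
  f_equal. rewrite (Cseries_ext _ (fun n => (-(1)) * b n)) by (intros; ring).
  rewrite Cseries_scal; auto. ring.
Qed.

Lemma Cmod_Csum_le (a : nat -> C) (b : nat -> R) N :
  (forall n, (Cmod (a n) <= b n)%R) -> (Cmod (Csum a N) <= sum_n b N)%R.
Proof.
  intros H. induction N.
  - rewrite sum_O. apply H.
  - rewrite sum_Sn. simpl. eapply Rle_trans. apply Cmod_triangle.
    apply Rplus_le_compat; auto.
Qed.

Lemma sum_n_le_Series (b : nat -> R) N :
  (forall n, (0 <= b n)%R) -> ex_series b -> (sum_n b N <= Series b)%R.
Proof.
  intros Hp Hb.
  apply (is_lim_seq_incr_compare (sum_n b)).
  - apply Series_correct in Hb. exact Hb.
  - intros n. rewrite sum_Sn. unfold plus; simpl. specialize (Hp (S n)). lra.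
Qed.

Lemma term_le_Series (b : nat -> R) k :
  (forall n, (0 <= b n)%R) -> ex_series b -> (b k <= Series b)%R.
Proof.
  intros Hp Hb. eapply Rle_trans. 2: apply (sum_n_le_Series b k); auto.
  destruct k; [rewrite sum_O; lra|]. rewrite sum_Sn. unfold plus; simpl.
  assert (0 <= sum_n b k)%R; [|lra].
  induction k; [rewrite sum_O; auto|].
  rewrite sum_Sn. unfold plus; simpl. specialize (Hp (S k)). lra.
Qed.

Lemma Cseries_le a b : (forall n, (Cmod (a n) <= b n)%R) -> ex_series b ->
  (Cmod (Cseries a) <= Series b)%R.
Proof.
  intros H Hb. apply clim_Cmod_le with (Csum a).
  - apply Cseries_clim. apply csummable_le with b; auto.
  - intros n. eapply Rle_trans. apply Cmod_Csum_le, H.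
    apply sum_n_le_Series; auto.
    intros k. eapply Rle_trans. apply Cmod_ge_0. apply H.
Qed.

Lemma csummable_incr_1 a : csummable a <-> csummable (fun n => a (S n)).
Proof. unfold csummable. apply (ex_series_incr_1 (fun n => Cmod (a n))). Qed.

Lemma Cseries_incr_1 a : csummable a -> Cseries a = a 0%nat + Cseries (fun n => a (S n)).
Proof.
  intros Ha.
  assert (H := Cseries_correct a Ha).
  replace (Cseries (fun n => a (S n))) with (Cseries a - a 0%nat); [ring|].
  symmetry. apply Cseries_unique.
  apply (@is_series_incr_1 C_AbsRing C_NormedModule a).
  match goal with |- is_series _ ?x => assert (E : x = Cseries a) end.
  { unfold plus; simpl. change (@eq C (Cseries a - a 0%nat + a 0%nat) (Cseries a)); ring. }
  rewrite E. exact H.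
Qed.

Lemma is_series_finite (a : nat -> C) N :
  (forall n, (N < n)%nat -> a n = 0) -> @is_series C_AbsRing C_NormedModule a (Csum a N).
Proof.
  intros H. apply is_series_clim. intros eps He. exists N. intros n Hn.
  replace (Csum a n) with (Csum a N).
  - replace (Csum a N - Csum a N) with (RtoC 0) by ring. now rewrite Cmod_0.
  - induction Hn; auto. simpl. rewrite <- IHHn, H by lia. ring.
Qed.

Lemma Cseries_finite (a : nat -> C) N :
  (forall n, (N < n)%nat -> a n = 0) -> Cseries a = Csum a N.
Proof. intros H. apply Cseries_unique, is_series_finite, H. Qed.

Lemma csummable_finite (a : nat -> C) N : (forall n, (N < n)%nat -> a n = 0) -> csummable a.
Proof.
  intros H. unfold csummable. apply (ex_series_incr_n _ (S N)).
  apply ex_series_ext with (fun _ : nat => Cmod 0).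
  - intros n. rewrite H by lia. reflexivity.
  - exact csummable_0.
Qed.

Lemma Csum_single (a : nat -> C) k N :
  (forall n, n <> k -> a n = 0) -> (k <= N)%nat -> Csum a N = a k.
Proof.
  intros H. induction N; intros Hk.
  - assert (k = 0%nat) by lia. subst. reflexivity.
  - simpl. destruct (Nat.eq_dec k (S N)) as [->|Hne].
    + replace (Csum a N) with (RtoC 0); [ring|].
      symmetry. clear IHN Hk.
      assert (forall m, (m <= N)%nat -> Csum a m = 0) as E; [|apply E; lia].
      induction m; intros Hm; simpl; [apply H; lia|].
      rewrite IHm, H by lia. ring.
    + rewrite IHN by lia. rewrite (H (S N)) by lia. ring.
Qed.

Lemma Cseries_single (a : nat -> C) k : (forall n, n <> k -> a n = 0) -> Cseries a = a k.
Proof.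
  intros H. rewrite (Cseries_finite a k) by (intros; apply H; lia).
  apply Csum_single; auto.
Qed.

Lemma csummable_single (a : nat -> C) k : (forall n, n <> k -> a n = 0) -> csummable a.
Proof. intros H. apply csummable_finite with k. intros; apply H; lia. Qed.

Lemma Csum_RtoC (b : nat -> R) N : Csum (fun n => RtoC (b n)) N = RtoC (sum_n b N).
Proof.
  induction N; simpl; [now rewrite sum_O|].
  rewrite sum_Sn, IHN. unfold plus; simpl. now rewrite RtoC_plus.
Qed.

Lemma clim_RtoC (u : nat -> R) (l : R) : is_lim_seq u l -> clim (fun n => RtoC (u n)) (RtoC l).
Proof.
  intros H eps He. apply is_lim_seq_Reals in H.
  destruct (H eps He) as [N HN]. exists N. intros n Hn.
  rewrite <- RtoC_minus, Cmod_R. exact (HN n Hn).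
Qed.

Lemma Cseries_RtoC (b : nat -> R) : ex_series b -> Cseries (fun n => RtoC (b n)) = RtoC (Series b).
Proof.
  intros H. apply Cseries_unique, is_series_clim.
  apply clim_ext with (fun N => RtoC (sum_n b N)). { intros; symmetry; apply Csum_RtoC. }
  apply clim_RtoC. exact (Series_correct _ H).
Qed.

Lemma Cmod_Cmod x : Cmod (RtoC (Cmod x)) = Cmod x.
Proof. rewrite Cmod_R. apply Rabs_pos_eq, Cmod_ge_0. Qed.

Lemma Series_Cmod_single (a : nat -> C) k :
  (forall n, n <> k -> a n = 0) -> Series (fun n => Cmod (a n)) = Cmod (a k).
Proof.
  intros H.
  assert (E : RtoC (Series (fun n => Cmod (a n))) = RtoC (Cmod (a k))).
  2: now injection E.
  assert (Hs := csummable_single a k H).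
  rewrite <- (Cseries_single (fun n => RtoC (Cmod (a n))) k).
  2:{ intros n Hn. rewrite H, Cmod_0; auto. }
  symmetry. apply Cseries_RtoC, Hs.
Qed.

Lemma csummable_Series_bound a (M : R) :
  (forall N, (sum_n (fun n => Cmod (a n)) N <= M)%R) -> csummable a.
Proof.
  intros H. unfold csummable.
  assert (Hex : ex_finite_lim_seq (sum_n (fun n => Cmod (a n)))).
  { apply ex_finite_lim_seq_incr with M; auto.
    intros n. rewrite sum_Sn. unfold plus; simpl.
    assert (0 <= Cmod (a (S n)))%R by apply Cmod_ge_0. lra. }
  destruct Hex as [l Hl]. exists l. exact Hl.
Qed.

Lemma Series_clim (b : nat -> R) : ex_series b -> forall eps : R, (0 < eps)%R ->
  exists N, forall n, (N <= n)%nat -> (Rabs (sum_n b n - Series b) < eps)%R.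
Proof.
  intros H. exact (proj1 (is_lim_seq_Reals (sum_n b) (Series b)) (Series_correct b H)).
Qed.

(** Dominated convergence for series: past a suitable N the tails of all [a K] and of [l] are small
    with the tail of [b], and the first N + 1 terms converge one by one. The exchange of summations,
    the cotangent series and Cauchy's estimate all rest on it. *)
Lemma tannery (a : nat -> nat -> C) (l : nat -> C) (b : nat -> R) :
  (forall K m, (Cmod (a K m) <= b m)%R) -> ex_series b ->
  (forall m, clim (fun K => a K m) (l m)) ->
  clim (fun K => Cseries (a K)) (Cseries l).
Proof.
  intros Hab Hb Hl eps He.
  assert (Hlb : forall m, (Cmod (l m) <= b m)%R).
  { intros m. apply clim_Cmod_le with (fun K => a K m); auto. }
  destruct (Series_clim b Hb (eps / 4)%R ltac:(lra)) as [N HN].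
  specialize (HN N (le_n N)).
  (* Stated for any sequence below [b], so that it serves both [a K] and the limit [l]; the tail is
     written as a truncated series, to which [Cseries_le] applies. *)
  assert (Htail : forall c : nat -> C, (forall m, (Cmod (c m) <= b m)%R) ->
            (Cmod (Cseries c - Csum c N) <= eps / 4)%R).
  { intros c Hcb.
    assert (Hcs : csummable c) by (apply csummable_le with b; auto).
    assert (E : Cseries c - Csum c N =
                Cseries (fun m => if (m <=? N)%nat then 0 else c m)).
    { assert (F : Cseries (fun m => if (m <=? N)%nat then c m else 0) = Csum c N).
      { rewrite (Cseries_finite _ N).
        - apply Csum_ext_loc. intros n Hn. now rewrite (proj2 (Nat.leb_le n N) Hn).
        - intros n Hn. now rewrite (proj2 (Nat.leb_gt n N) Hn). }
      rewrite <- F, <- Cseries_minus; auto.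
      - apply Cseries_ext. intros n. destruct (n <=? N)%nat; ring.
      - apply csummable_finite with N. intros n Hn. now rewrite (proj2 (Nat.leb_gt n N) Hn). }
    rewrite E.
    assert (Hb0 : forall m, (0 <= b m)%R).
    { intros m. eapply Rle_trans. apply Cmod_ge_0. apply (Hcb m). }
    assert (ex_series (fun m => if (m <=? N)%nat then 0%R else b m)) as Hex.
    { apply (ex_series_incr_n _ (S N)).
      apply ex_series_ext with (fun n => b (S N + n)%nat).
      - intros n. now rewrite (proj2 (Nat.leb_gt _ _)) by lia.
      - apply (ex_series_incr_n b (S N)). exact Hb. }
    eapply Rle_trans.
    { apply Cseries_le with (b := fun m => if (m <=? N)%nat then 0%R else b m); auto.
      intros m. destruct (m <=? N)%nat; auto. rewrite Cmod_0. lra. }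
    apply Rle_trans with (Series b - sum_n b N)%R.
    2:{ apply Rabs_def2 in HN. destruct HN; lra. }
    right.
    rewrite (Series_incr_n (fun m => if (m <=? N)%nat then 0%R else b m) (S N)); auto; try lia.
    rewrite (Series_incr_n b (S N)); auto; try lia.
    simpl Init.Nat.pred.
    replace (sum_n b N) with (sum_f_R0 b N) by (symmetry; apply sum_n_Reals).
    replace (sum_f_R0 (fun m => if (m <=? N)%nat then 0%R else b m) N) with 0%R.
    2:{ rewrite (sum_eq _ (fun _ => 0%R)), sum_cte; [ring|].
        intros n Hn. now rewrite (proj2 (Nat.leb_le n N) Hn). }
    rewrite (Series_ext _ (fun k => b (S N + k)%nat)). ring.
    intros n. now rewrite (proj2 (Nat.leb_gt _ _)) by lia. }
  assert (Hfin : clim (fun K => Csum (a K) N) (Csum l N)).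
  { clear -Hl. induction N; simpl; [apply Hl|].
    apply (clim_plus _ _ _ _ IHN (Hl (S N))). }
  destruct (Hfin (eps / 4)%R ltac:(lra)) as [K0 HK0].
  exists K0. intros K HK.
  replace (Cseries (a K) - Cseries l) with
    ((Cseries (a K) - Csum (a K) N) + ((Csum (a K) N - Csum l N) + - (Cseries l - Csum l N))) by ring.
  eapply Rle_lt_trans. apply Cmod_triangle.
  assert (T1 := Htail (a K) (Hab K)). assert (T2 := Htail l Hlb).
  assert (T3 := HK0 K HK).
  assert (T4 := Cmod_triangle (Csum (a K) N - Csum l N) (- (Cseries l - Csum l N))).
  rewrite Cmod_opp in T4. lra.
Qed.

Lemma Cseries_Csum (A : nat -> nat -> C) K :
  (forall i, csummable (A i)) ->
  Cseries (fun j => Csum (fun i => A i j) K) = Csum (fun i => Cseries (A i)) K /\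
  csummable (fun j => Csum (fun i => A i j) K).
Proof.
  intros H. induction K; simpl; [split; [reflexivity|apply H]|].
  destruct IHK as [E S1]. split.
  - rewrite <- E. apply Cseries_plus; auto.
  - apply csummable_plus; auto.
Qed.

Lemma csummable_rows (A : nat -> nat -> C) :
  (forall i, csummable (A i)) ->
  ex_series (fun i => Series (fun j => Cmod (A i j))) ->
  csummable (fun i => Cseries (A i)).
Proof.
  intros H1 H2. apply csummable_le with (fun i => Series (fun j => Cmod (A i j))); auto.
  intros i. apply Cseries_le; [intros; lra|apply H1].
Qed.

Lemma csummable_col (A : nat -> nat -> C) j :
  (forall i, csummable (A i)) ->
  ex_series (fun i => Series (fun j => Cmod (A i j))) ->
  csummable (fun i => A i j).
Proof.
  intros H1 H2. apply csummable_le with (fun i => Series (fun j => Cmod (A i j))); auto.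
  intros i. apply (term_le_Series (fun j => Cmod (A i j))).
  intros; apply Cmod_ge_0. apply H1.
Qed.

(** The first K + 1 column sums add up to a series over the rows of partial row sums; the row norms
    dominate these, so [tannery] passes to the limit in K. *)
Lemma fubini (A : nat -> nat -> C) :
  (forall i, csummable (A i)) ->
  ex_series (fun i => Series (fun j => Cmod (A i j))) ->
  Cseries (fun i => Cseries (A i)) = Cseries (fun j => Cseries (fun i => A i j)).
Proof.
  intros H1 H2. symmetry. apply Cseries_unique, is_series_clim.
  apply clim_ext with (fun K => Cseries (fun i => Csum (A i) K)).
  { intros K. apply (Cseries_Csum (fun j i => A i j) K).
    intros j. apply csummable_col; auto. }
  apply tannery with (fun i => Series (fun j => Cmod (A i j))); auto.
  - intros K i. eapply Rle_trans.
    apply (Cmod_Csum_le _ (fun j => Cmod (A i j))). intros; lra.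
    apply sum_n_le_Series; auto. intros; apply Cmod_ge_0. apply H1.
  - intros i. apply Cseries_clim, H1.
Qed.

(** The moduli of finitely many column sums are compared with the family [B] of absolute values,
    where a finite sum over columns can be exchanged with the series over rows. *)
Lemma csummable_cols (A : nat -> nat -> C) :
  (forall i, csummable (A i)) ->
  ex_series (fun i => Series (fun j => Cmod (A i j))) ->
  csummable (fun j => Cseries (fun i => A i j)).
Proof.
  intros H1 H2.
  apply csummable_Series_bound with (Series (fun i => Series (fun j => Cmod (A i j)))).
  intros N.
  set (B := fun i j => RtoC (Cmod (A i j))).
  assert (HBr : forall i, csummable (B i)).
  { intros i. apply csummable_le with (fun j => Cmod (A i j)). 2: apply H1.
    intros n. unfold B. rewrite Cmod_Cmod. lra. }
  assert (HBc : forall j, csummable (fun i => B i j)).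
  { intros j. apply csummable_le with (fun i => Cmod (A i j)).
    intros n. unfold B. rewrite Cmod_Cmod. lra. apply csummable_col; auto. }
  assert (step : forall j, (Cmod (Cseries (fun i => A i j)) <= Re (Cseries (fun i => B i j)))%R).
  { intros j.
    assert (E : Cseries (fun i => B i j) = RtoC (Series (fun i => Cmod (A i j)))).
    { apply Cseries_RtoC. exact (csummable_col A j H1 H2). }
    rewrite E. simpl. apply Cseries_le. intros; lra. apply csummable_col; auto. }
  apply Rle_trans with (Re (Csum (fun j => Cseries (fun i => B i j)) N)).
  { clear -step. induction N; [rewrite sum_O; apply step|].
    rewrite sum_Sn. apply Rplus_le_compat; auto. }
  rewrite <- (proj1 (Cseries_Csum (fun j i => B i j) N HBc)).
  eapply Rle_trans. apply Rle_abs. eapply Rle_trans. apply re_le_Cmod.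
  apply Cseries_le; auto.
  intros i. eapply Rle_trans. apply (Cmod_Csum_le _ (fun j => Cmod (A i j))).
  intros j. unfold B. rewrite Cmod_Cmod. lra.
  apply sum_n_le_Series. intros; apply Cmod_ge_0. apply H1.
Qed.

Definition dsummable (A : nat -> nat -> C) : Prop :=
  (forall i, csummable (A i)) /\ ex_series (fun i => Series (fun j => Cmod (A i j))).

Lemma dsummable_le (A : nat -> nat -> C) (B : nat -> nat -> R) :
  (forall i j, (Cmod (A i j) <= B i j)%R) -> (forall i, ex_series (B i)) ->
  ex_series (fun i => Series (B i)) -> dsummable A.
Proof.
  intros H1 H2 H3. split.
  - intros i. apply csummable_le with (B i); auto.
  - apply (@ex_series_le R_AbsRing R_CompleteNormedModule) with (fun i => Series (B i)); auto.
    intros i. unfold norm; simpl. unfold abs; simpl. rewrite Rabs_pos_eq.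
    + apply Series_le; auto. intros n; split; auto using Cmod_ge_0.
    + apply Rle_trans with (sum_n (fun j => Cmod (A i j)) 0).
      rewrite sum_O. apply Cmod_ge_0.
      apply sum_n_le_Series. intros; apply Cmod_ge_0. apply csummable_le with (B i); auto.
Qed.

Lemma dsummable_prod (A : nat -> nat -> C) (s t : nat -> R) :
  (forall i j, (Cmod (A i j) <= s i * t j)%R) -> ex_series s -> ex_series t -> dsummable A.
Proof.
  intros H Hs Ht. apply dsummable_le with (fun i j => (s i * t j)%R); auto.
  - intros i. exact (ex_series_scal_l (s i) t Ht).
  - apply ex_series_ext with (fun i => scal (Series t) (s i)).
    + intros i. rewrite Series_scal_l. unfold scal; simpl. unfold mult; simpl. ring.
    + exact (ex_series_scal_l _ s Hs).
Qed.

Lemma dsummable_plus A B : dsummable A -> dsummable B -> dsummable (fun i j => A i j + B i j).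
Proof.
  intros [A1 A2] [B1 B2].
  apply dsummable_le with (fun i j => (Cmod (A i j) + Cmod (B i j))%R).
  - intros; apply Cmod_triangle.
  - intros i. exact (ex_series_plus _ _ (A1 i) (B1 i)).
  - apply ex_series_ext with (fun i => plus (Series (fun j => Cmod (A i j))) (Series (fun j => Cmod (B i j)))).
    + intros i. rewrite Series_plus; auto. apply A1. apply B1.
    + exact (ex_series_plus _ _ A2 B2).
Qed.

Lemma dsummable_scal c A : dsummable A -> dsummable (fun i j => c * A i j).
Proof.
  intros [A1 A2]. apply dsummable_le with (fun i j => (Cmod c * Cmod (A i j))%R).
  - intros. rewrite Cmod_mult. lra.
  - intros i. exact (ex_series_scal_l _ _ (A1 i)).
  - apply ex_series_ext with (fun i => scal (Cmod c) (Series (fun j => Cmod (A i j)))).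
    + intros i. rewrite Series_scal_l. reflexivity.
    + exact (ex_series_scal_l _ _ A2).
Qed.

Definition dseries (A : nat -> nat -> C) : C := Cseries (fun i => Cseries (A i)).

Lemma dseries_swap A : dsummable A -> dseries A = dseries (fun j i => A i j).
Proof. intros [H1 H2]. apply fubini; auto. Qed.

Lemma dseries_ext A B : (forall i j, A i j = B i j) -> dseries A = dseries B.
Proof. intros H. apply Cseries_ext. intros i. apply Cseries_ext. auto. Qed.

Lemma dsummable_ext A B : (forall i j, A i j = B i j) -> dsummable A -> dsummable B.
Proof.
  intros H [H1 H2]. apply dsummable_le with (fun i j => Cmod (A i j)); auto.
  intros. rewrite H. lra.
Qed.

Lemma dseries_plus A B : dsummable A -> dsummable B ->
  dseries (fun i j => A i j + B i j) = dseries A + dseries B.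
Proof.
  intros [A1 A2] [B1 B2]. unfold dseries.
  rewrite <- Cseries_plus; auto using csummable_rows.
  apply Cseries_ext. intros i. apply Cseries_plus; auto.
Qed.

Lemma dseries_scal c A : dsummable A -> dseries (fun i j => c * A i j) = c * dseries A.
Proof.
  intros [A1 A2]. unfold dseries. rewrite <- Cseries_scal; auto using csummable_rows.
  apply Cseries_ext. intros i. apply Cseries_scal; auto.
Qed.

Lemma dsummable_swap A : dsummable A -> dsummable (fun j i => A i j).
Proof.
  intros [A1 A2]. split.
  - intros j. apply csummable_col; auto.
  - set (B := fun i j => RtoC (Cmod (A i j))).
    assert (DB : dsummable B).
    { apply dsummable_le with (fun i j => Cmod (A i j)); auto.
      intros. unfold B. rewrite Cmod_Cmod. lra. }
    destruct DB as [B1 B2]. assert (H := csummable_cols B B1 B2).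
    apply ex_series_ext with (2 := H). intros j.
    assert (E : Cseries (fun i => B i j) = RtoC (Series (fun i => Cmod (A i j)))).
    { apply Cseries_RtoC. exact (csummable_col A j A1 A2). }
    rewrite E, Cmod_R. apply Rabs_pos_eq.
    apply Rle_trans with (sum_n (fun i => Cmod (A i j)) 0).
    rewrite sum_O. apply Cmod_ge_0.
    apply sum_n_le_Series. intros; apply Cmod_ge_0. apply csummable_col; auto.
Qed.

(** * Double series *)

Lemma Series_Cmod u : csummable u ->
  Cseries (fun n => RtoC (Cmod (u n))) = RtoC (Series (fun n => Cmod (u n))).
Proof. intros H. apply (Cseries_RtoC (fun n => Cmod (u n))). exact H. Qed.

Lemma csummable_Cmod u : csummable u -> csummable (fun n => RtoC (Cmod (u n))).
Proof.
  intros H. apply csummable_le with (fun n => Cmod (u n)); auto.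
  intros n. rewrite Cmod_Cmod. lra.
Qed.

(** The injection [phi] is encoded as the matrix whose row i holds [u i] in column [phi i] and 0
    elsewhere: its rows sum to [u], its columns to [v], and [fubini] equates the two totals. *)
Lemma reindex_aux (phi : nat -> nat) (u v : nat -> C) :
  (forall m n, phi m = phi n -> m = n) ->
  (forall n, v (phi n) = u n) -> (forall m, (forall n, phi n <> m) -> v m = 0) ->
  csummable u -> csummable v /\ Cseries v = Cseries u.
Proof.
  intros Hinj Hv H0 Hu.
  set (A := fun i j => if (j =? phi i)%nat then u i else 0).
  assert (Hne : forall i j, j <> phi i -> A i j = 0).
  { intros i j Hj. unfold A. now rewrite (proj2 (Nat.eqb_neq _ _) Hj). }
  assert (Heq : forall i, A i (phi i) = u i).
  { intros i. unfold A. now rewrite Nat.eqb_refl. }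
  assert (D1 : forall i, csummable (A i)).
  { intros i. apply csummable_single with (phi i). auto. }
  assert (D2 : ex_series (fun i => Series (fun j => Cmod (A i j)))).
  { apply ex_series_ext with (2 := Hu). intros i.
    rewrite (Series_Cmod_single _ (phi i)); auto. now rewrite Heq. }
  assert (Hcol : forall j, Cseries (fun i => A i j) = v j).
  { intros j.
    destruct (Classical_Prop.classic (exists n, phi n = j)) as [[n Hn]|Hno].
    - subst j. rewrite (Cseries_single _ n).
      + rewrite Heq. symmetry. apply Hv.
      + intros i Hi. apply Hne. intros E. apply Hi. symmetry. now apply Hinj.
    - rewrite (Cseries_single _ 0%nat).
      + rewrite H0. apply Hne. intros E. apply Hno. exists 0%nat. auto.
        intros n Hn. apply Hno. now exists n.
      + intros i _. apply Hne. intros E. apply Hno. exists i; auto. }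
  split.
  - apply csummable_ext with (fun j => Cseries (fun i => A i j)); auto.
    apply csummable_cols; auto.
  - transitivity (Cseries (fun j => Cseries (fun i => A i j))).
    + apply Cseries_ext. auto.
    + rewrite <- fubini; auto. apply Cseries_ext. intros i.
      rewrite (Cseries_single _ (phi i)); auto.
Qed.

Lemma reindex (phi : nat -> nat) (u v : nat -> C) :
  (forall m n, phi m = phi n -> m = n) ->
  (forall n, v (phi n) = u n) -> (forall m, (forall n, phi n <> m) -> v m = 0) ->
  csummable u -> csummable v /\ Cseries v = Cseries u /\
  Series (fun n => Cmod (v n)) = Series (fun n => Cmod (u n)).
Proof.
  intros Hinj Hv H0 Hu.
  destruct (reindex_aux phi u v Hinj Hv H0 Hu) as [S1 S2].
  repeat split; auto.
  assert (E : RtoC (Series (fun n => Cmod (v n))) = RtoC (Series (fun n => Cmod (u n)))).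
  2: now injection E.
  rewrite <- 2!Series_Cmod by auto.
  apply (reindex_aux phi); auto using csummable_Cmod.
  - intros n. cbv beta. now rewrite Hv.
  - intros m Hm. now rewrite H0, Cmod_0.
Qed.

(* Summation of a double family along the fibres of [(i, j) |-> phi i j], when row [i]
   contributes to the [n]-th fibre only for [i <= n]. *)
Lemma dseries_fibres (phi : nat -> nat -> nat) (F : nat -> nat -> C) (A : nat -> nat -> C) :
  (forall i m n, phi i m = phi i n -> m = n) ->
  (forall i n, A i (phi i n) = F i n) ->
  (forall i m, (forall n, phi i n <> m) -> A i m = 0) ->
  (forall i n, (i <= phi i n)%nat) ->
  dsummable F ->
  csummable (fun n => Csum (fun i => A i n) n) /\
  Cseries (fun n => Csum (fun i => A i n) n) = dseries F.
Proof.
  intros Hinj HA H0 Hle [F1 F2].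
  assert (R : forall i, csummable (A i) /\ Cseries (A i) = Cseries (F i) /\
            Series (fun n => Cmod (A i n)) = Series (fun n => Cmod (F i n))).
  { intros i. apply (reindex (phi i)); eauto. }
  assert (D1 : forall i, csummable (A i)) by (intros i; apply R).
  assert (D2 : ex_series (fun i => Series (fun j => Cmod (A i j)))).
  { apply ex_series_ext with (2 := F2). intros i. symmetry. apply R. }
  assert (Hcol : forall n, Cseries (fun i => A i n) = Csum (fun i => A i n) n).
  { intros n. apply Cseries_finite. intros i Hi. apply H0.
    intros k E. specialize (Hle i k). lia. }
  split.
  - apply csummable_ext with (1 := Hcol). apply csummable_cols; auto.
  - rewrite <- (Cseries_ext _ _ Hcol). rewrite <- fubini; auto.
    apply Cseries_ext. intros i. apply R.
Qed.

Lemma dseries_diag (F : nat -> nat -> C) : dsummable F ->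
  csummable (fun n => Csum (fun i => F i (n - i)%nat) n) /\
  Cseries (fun n => Csum (fun i => F i (n - i)%nat) n) = dseries F.
Proof.
  intros HF.
  destruct (dseries_fibres (fun i j => (i + j)%nat) F
     (fun i n => if (i <=? n)%nat then F i (n - i)%nat else 0)) as [H1 H2]; auto.
  - intros; lia.
  - intros i n. rewrite (proj2 (Nat.leb_le _ _)) by lia. f_equal. lia.
  - intros i m H. destruct (i <=? m)%nat eqn:E; auto.
    apply Nat.leb_le in E. exfalso. apply (H (m - i)%nat). lia.
  - intros; lia.
  - assert (E : forall n, Csum (fun i => if (i <=? n)%nat then F i (n - i)%nat else 0) n
                = Csum (fun i => F i (n - i)%nat) n).
    { intros n. apply Csum_ext_loc. intros i Hi. now rewrite (proj2 (Nat.leb_le _ _)). }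
    split.
    + apply csummable_ext with (1 := E). exact H1.
    + rewrite <- H2. apply Cseries_ext. intros n. now rewrite E.
Qed.

Lemma Cseries_mult a b : csummable a -> csummable b ->
  csummable (fun n => Csum (fun i => a i * b (n - i)%nat) n) /\
  Cseries (fun n => Csum (fun i => a i * b (n - i)%nat) n) = Cseries a * Cseries b.
Proof.
  intros Ha Hb.
  destruct (dseries_diag (fun i j => a i * b j)) as [H1 H2].
  { apply dsummable_prod with (fun i => Cmod (a i)) (fun j => Cmod (b j)); auto.
    intros. rewrite Cmod_mult. lra. }
  split; auto. rewrite H2. unfold dseries.
  rewrite (Cseries_ext _ (fun i => Cseries b * a i)).
  - rewrite Cseries_scal; auto. ring.
  - intros i. rewrite Cseries_scal; auto. ring.
Qed.

Lemma dseries_mult a b : csummable a -> csummable b ->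
  dseries (fun i j => a i * b j) = Cseries a * Cseries b.
Proof.
  intros Ha Hb. unfold dseries.
  rewrite (Cseries_ext _ (fun i => Cseries b * a i)).
  - rewrite Cseries_scal; auto. ring.
  - intros i. rewrite Cseries_scal; auto. ring.
Qed.

Lemma dsummable_mult a b : csummable a -> csummable b -> dsummable (fun i j => a i * b j).
Proof.
  intros Ha Hb. apply dsummable_prod with (fun i => Cmod (a i)) (fun j => Cmod (b j)); auto.
  intros. rewrite Cmod_mult. lra.
Qed.

(* Indices are shifted by one: [d] and [l] stand for the divisors [d + 1] and [l + 1]. *)
Lemma dseries_divisors (F : nat -> nat -> C) : dsummable F ->
  let c n := Csum (fun d => if (S n mod S d =? 0)%nat then F d (S n / S d - 1)%nat else 0) n in
  csummable c /\ Cseries c = dseries F.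
Proof.
  intros HF.
  apply (dseries_fibres (fun d l => (S d * S l - 1)%nat) F
     (fun d n => if (S n mod S d =? 0)%nat then F d (S n / S d - 1)%nat else 0)); auto.
  - intros; nia.
  - intros i n. replace (S (S i * S n - 1))%nat with (S n * S i)%nat by nia.
    rewrite Nat.Div0.mod_mul, Nat.eqb_refl, Nat.div_mul by lia. f_equal. lia.
  - intros i m H. destruct (S m mod S i =? 0)%nat eqn:E; auto.
    apply Nat.eqb_eq in E. exfalso.
    assert (D := Nat.div_mod_eq (S m) (S i)).
    apply (H (S m / S i - 1)%nat). rewrite E in D.
    destruct (S m / S i)%nat; nia.
  - intros; nia.
Qed.

(** The matrix of [reindex_aux] transposed: row j holds [a j] in the column that [phi] sends to j,
    if there is one, so the row norms are at most those of [a]. *)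
Lemma csummable_sub (phi : nat -> nat) (a : nat -> C) :
  (forall m n, phi m = phi n -> m = n) -> csummable a -> csummable (fun n => a (phi n)).
Proof.
  intros Hinj Ha.
  set (A := fun j i => if (j =? phi i)%nat then a j else 0).
  assert (Hne : forall i j, j <> phi i -> A j i = 0).
  { intros i j Hj. unfold A. now rewrite (proj2 (Nat.eqb_neq _ _) Hj). }
  assert (Heq : forall i, A (phi i) i = a (phi i)).
  { intros i. unfold A. now rewrite Nat.eqb_refl. }
  assert (Hrow : forall j, exists k, (forall i, i <> k -> A j i = 0)).
  { intros j. destruct (Classical_Prop.classic (exists n, phi n = j)) as [[n Hn]|Hno].
    - exists n. intros i Hi. apply Hne. intros E. apply Hi, Hinj. congruence.
    - exists 0%nat. intros i _. apply Hne. intros E. apply Hno. exists i; auto. }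
  apply csummable_ext with (fun i => Cseries (fun j => A j i)).
  { intros i. rewrite (Cseries_single _ (phi i)); auto. }
  apply csummable_cols.
  - intros j. destruct (Hrow j) as [k Hk]. apply csummable_single with k; auto.
  - apply (@ex_series_le R_AbsRing R_CompleteNormedModule) with (fun j => Cmod (a j)); auto.
    intros j. destruct (Hrow j) as [k Hk]. rewrite (Series_Cmod_single _ k); auto.
    unfold norm; simpl. unfold abs; simpl. rewrite Rabs_pos_eq by apply Cmod_ge_0.
    unfold A. destruct (j =? phi k)%nat; [lra|]. rewrite Cmod_0. apply Cmod_ge_0.
Qed.

Lemma Cseries_even_odd a : csummable a ->
  Cseries a = Cseries (fun n => a (2 * n)%nat) + Cseries (fun n => a (2 * n + 1)%nat).
Proof.
  intros Ha.
  assert (He : csummable (fun n => a (2 * n)%nat)) by (apply csummable_sub; auto; intros; lia).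
  assert (Ho : csummable (fun n => a (2 * n + 1)%nat)).
  { apply (csummable_sub (fun n => 2 * n + 1)%nat); auto; intros; lia. }
  destruct (reindex (fun n => 2 * n)%nat (fun n => a (2 * n)%nat)
              (fun m => if Nat.even m then a m else 0)) as [S1 [E1 _]]; auto.
  - intros; lia.
  - intros n. now rewrite Nat.even_even.
  - intros m H. destruct (Nat.even m) eqn:E; auto.
    apply Nat.even_spec in E. destruct E as [k Hk]. exfalso. now apply (H k).
  - destruct (reindex (fun n => 2 * n + 1)%nat (fun n => a (2 * n + 1)%nat)
              (fun m => if Nat.even m then 0 else a m)) as [S2 [E2 _]]; auto.
    + intros; lia.
    + intros n. now rewrite Nat.even_odd.
    + intros m H. destruct (Nat.even m) eqn:E; auto.
      exfalso. rewrite <- Nat.negb_odd, Bool.negb_false_iff in E.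
      apply Nat.odd_spec in E. destruct E as [k Hk]. now apply (H k).
    + rewrite <- E1, <- E2, <- Cseries_plus; auto.
      apply Cseries_ext. intros n. destruct (Nat.even n); ring.
Qed.

(** * The complex exponential *)

Lemma Cexp_plus z w : Cexp (z + w) = Cexp z * Cexp w.
Proof.
  unfold Cexp. destruct z as [x y], w as [u v]. simpl.
  rewrite exp_plus, cos_plus, sin_plus. unfold Cmult. simpl. f_equal; ring.
Qed.

Lemma Cexp_0 : Cexp 0 = 1.
Proof. unfold Cexp. simpl. rewrite exp_0, cos_0, sin_0. unfold RtoC. f_equal; ring. Qed.

Lemma Cmod_Cexp z : Cmod (Cexp z) = exp (Re z).
Proof.
  unfold Cexp, Cmod. simpl.
  replace (exp (Re z) * cos (Im z) * (exp (Re z) * cos (Im z) * 1) +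
    exp (Re z) * sin (Im z) * (exp (Re z) * sin (Im z) * 1))%R
    with (exp (Re z) ^ 2 * ((sin (Im z))² + (cos (Im z))²))%R by (unfold Rsqr; ring).
  rewrite sin2_cos2, Rmult_1_r, sqrt_pow2; auto. left. apply exp_pos.
Qed.

Lemma Cexp_neq_0 z : Cexp z <> 0.
Proof. apply Cmod_gt_0. rewrite Cmod_Cexp. apply exp_pos. Qed.

Lemma Cexp_opp z : Cexp (- z) = / Cexp z.
Proof.
  assert (H : Cexp z * Cexp (- z) = 1).
  { rewrite <- Cexp_plus, <- Cexp_0. f_equal. ring. }
  assert (N := Cexp_neq_0 z).
  replace (Cexp (- z)) with (/ Cexp z * (Cexp z * Cexp (- z))) by (field; auto).
  rewrite H. ring.
Qed.

Lemma Cexp_pow z n : Cpow (Cexp z) n = Cexp (INR n * z).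
Proof.
  induction n.
  - simpl. rewrite <- Cexp_0. f_equal. ring.
  - rewrite Cpow_S, IHn, <- Cexp_plus, S_INR, RtoC_plus. f_equal. ring.
Qed.

Lemma qpar_plus z w : qpar (z + w) = qpar z * qpar w.
Proof. unfold qpar. rewrite <- Cexp_plus. f_equal. ring. Qed.

Lemma qpar_pow z n : Cpow (qpar z) n = qpar (INR n * z).
Proof. unfold qpar. rewrite Cexp_pow. f_equal. ring. Qed.

Lemma qpar_neq_0 z : qpar z <> 0.
Proof. apply Cexp_neq_0. Qed.

Lemma qpar_0 : qpar 0 = 1.
Proof. unfold qpar. rewrite <- Cexp_0. f_equal. ring. Qed.

Lemma qpar_opp z : qpar (- z) = / qpar z.
Proof. unfold qpar. rewrite <- Cexp_opp. f_equal. ring. Qed.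

Lemma Cmod_qpar z : Cmod (qpar z) = exp (- (2 * PI * Im z)).
Proof.
  unfold qpar. rewrite Cmod_Cexp. f_equal. destruct z. simpl. ring.
Qed.

Lemma Cmod_qpar_lt_1 z : (0 < Im z)%R -> (Cmod (qpar z) < 1)%R.
Proof.
  intros H. rewrite Cmod_qpar, <- exp_0. apply exp_increasing.
  assert (0 < PI)%R by apply PI_RGT_0. nra.
Qed.

Lemma qpar_IZR n : qpar (IZR n) = 1.
Proof.
  assert (H1 : qpar 1 = 1).
  { unfold qpar. replace (2 * PI * Ci * 1) with ((0, 2 * PI)%R : C).
    - unfold Cexp. simpl. rewrite exp_0, cos_2PI, sin_2PI. unfold RtoC. f_equal; ring.
    - unfold Cmult, RtoC, Ci. simpl. f_equal; ring. }
  assert (Hn : forall k : nat, qpar (INR k) = 1).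
  { intros k. replace (RtoC (INR k)) with (INR k * 1) by ring.
    rewrite <- qpar_pow, H1. apply Cpow_1_l. }
  destruct (Z_le_gt_dec 0 n).
  - rewrite <- (Z2Nat.id n) by lia. rewrite <- INR_IZR_INZ. apply Hn.
  - replace n with (- Z.of_nat (Z.to_nat (- n)))%Z by lia.
    rewrite opp_IZR, <- INR_IZR_INZ, RtoC_opp, qpar_opp, Hn. field.
Qed.

Lemma qpar_plus_IZR z n : qpar (z + IZR n) = qpar z.
Proof. rewrite qpar_plus, qpar_IZR. ring. Qed.

(** From sin u >= u - u^3 / 6 and 1 - 2.4^2 / 6 = 1/25. The range 2.4 = 4 * 3/5 covers PI |Re w| in
    [qpar_lower], with PI <= 4. *)
Lemma sin_lower u : (0 <= u <= 2.4)%R -> (u / 25 <= sin u)%R.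
Proof.
  intros H.
  destruct (pre_sin_bound u 0 ltac:(lra) ltac:(lra)) as [H1 _].
  unfold sin_approx, sin_term in H1. simpl in H1.
  assert (u * u <= 5.76)%R by nra.
  assert (u * (u * u) <= 5.76 * u)%R by nra. lra.
Qed.

Lemma sin_upper u : (0 <= u <= 4)%R -> (sin u <= u)%R.
Proof.
  intros H. destruct (Req_dec u 0) as [->|]. rewrite sin_0; lra.
  left. apply sin_lt_x. lra.
Qed.

Lemma sin_cubic u : (0 <= u <= 4)%R -> (u - u ^ 3 / 6 <= sin u)%R.
Proof.
  intros H.
  destruct (pre_sin_bound u 0 ltac:(lra) ltac:(lra)) as [H1 _].
  unfold sin_approx, sin_term in H1. simpl in H1. lra.
Qed.

Lemma sin_abs_le y : (Rabs y <= 1)%R -> (Rabs (sin y) <= Rabs y)%R.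
Proof.
  assert (P : forall u, (0 <= u <= 1)%R -> (0 <= sin u <= u)%R).
  { intros u Hu. split; [|apply sin_upper; lra].
    assert (u / 25 <= sin u)%R by (apply sin_lower; lra). lra. }
  intros H. destruct (Rle_dec 0 y).
  - rewrite Rabs_pos_eq in H by lra. specialize (P y ltac:(lra)).
    rewrite 2!Rabs_pos_eq; lra.
  - rewrite (Rabs_left y) in * by lra. specialize (P (- y)%R ltac:(lra)).
    rewrite sin_neg in P. rewrite Rabs_left1; lra.
Qed.

Lemma sin_sub_abs y : (Rabs y <= 1)%R -> (Rabs (sin y - y) <= y ^ 2)%R.
Proof.
  assert (P : forall u, (0 <= u <= 1)%R -> (- u ^ 2 <= sin u - u <= 0)%R).
  { intros u Hu. split.
    - assert (u - u ^ 3 / 6 <= sin u)%R by (apply sin_cubic; lra). nra.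
    - assert (sin u <= u)%R by (apply sin_upper; lra). lra. }
  intros H. destruct (Rle_dec 0 y).
  - rewrite Rabs_pos_eq in H by lra. specialize (P y ltac:(lra)). apply Rabs_le. nra.
  - rewrite Rabs_left in H by lra. specialize (P (- y)%R ltac:(lra)).
    rewrite sin_neg in P. apply Rabs_le. nra.
Qed.

Lemma cos_sub_abs y : (Rabs y <= 1)%R -> (Rabs (cos y - 1) <= y ^ 2)%R.
Proof.
  intros H.
  replace y with (2 * (y / 2))%R at 1 by field.
  rewrite cos_2a_sin.
  assert (S : (Rabs (sin (y / 2)) <= Rabs (y / 2))%R).
  { apply sin_abs_le. unfold Rdiv. rewrite Rabs_mult, (Rabs_pos_eq (/ 2)) by lra. lra. }
  apply Rsqr_le_abs_1 in S. unfold Rsqr in S.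
  assert (0 <= sin (y / 2) * sin (y / 2))%R by nra.
  apply Rabs_le. nra.
Qed.

Lemma exp_sub_abs x : (Rabs x <= 1 / 2)%R -> (Rabs (exp x - 1 - x) <= 2 * x ^ 2)%R.
Proof.
  intros H. apply Rabs_le_between in H.
  assert (H1 := exp_ineq1_le x). assert (H2 := exp_ineq1_le (- x)).
  rewrite exp_Ropp in H2.
  assert (H3 : (exp x * (1 - x) <= 1)%R).
  { assert (P := exp_pos x).
    apply Rle_trans with (exp x * / exp x)%R.
    apply Rmult_le_compat_l; lra. right. field. lra. }
  apply Rabs_le. split; nra.
Qed.

Lemma Cmod_le_Rabs (z : C) : (Cmod z <= Rabs (Re z) + Rabs (Im z))%R.
Proof.
  destruct z as [x y]. simpl.
  replace (x, y) with (RtoC x + Ci * RtoC y).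
  - eapply Rle_trans. apply Cmod_triangle.
    rewrite Cmod_mult, Cmod_Ci, 2!Cmod_R. lra.
  - unfold Cplus, Cmult, RtoC, Ci. simpl. f_equal; ring.
Qed.

Lemma im_le_Cmod (z : C) : (Rabs (Im z) <= Cmod z)%R.
Proof. eapply Rle_trans; [|apply Rmax_Cmod]. apply Rmax_r. Qed.

(** The 9 is 4 for the real part plus 5 for the imaginary part; the quadratic order in h is what
    yields derivatives. *)
Lemma Cexp_sub_Cmod h : (Cmod h <= 1 / 2)%R -> (Cmod (Cexp h - 1 - h) <= 9 * Cmod h ^ 2)%R.
Proof.
  intros H.
  assert (Hx := re_le_Cmod h). assert (Hy := im_le_Cmod h).
  set (m := Cmod h) in *. destruct h as [x y]. simpl in Hx, Hy.
  eapply Rle_trans. apply Cmod_le_Rabs. unfold Cexp, Cminus, Cplus, Copp, RtoC. simpl.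
  assert (Ex := exp_sub_abs x ltac:(lra)).
  assert (Cy := cos_sub_abs y ltac:(lra)).
  assert (Sy := sin_sub_abs y ltac:(lra)).
  assert (Hx2 : (x ^ 2 <= m ^ 2)%R).
  { rewrite <- (pow2_abs x). apply pow_incr. split; [apply Rabs_pos|lra]. }
  assert (Hy2 : (y ^ 2 <= m ^ 2)%R).
  { rewrite <- (pow2_abs y). apply pow_incr. split; [apply Rabs_pos|lra]. }
  assert (Hxy : (Rabs x * Rabs y <= m ^ 2)%R).
  { replace (m ^ 2)%R with (m * m)%R by ring. apply Rmult_le_compat; auto using Rabs_pos. }
  assert (Ex2 : (exp x <= 2)%R).
  { apply Rabs_le_between in Ex. apply Rabs_le_between in Hx.
    assert (x ^ 2 <= 1 / 4)%R by nra. lra. }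
  assert (Px := exp_pos x).
  assert (T1 : (Rabs (exp x * cos y + - (1) + - x) <= 4 * m ^ 2)%R).
  { replace (exp x * cos y + - (1) + - x)%R with ((exp x - 1 - x) + exp x * (cos y - 1))%R by ring.
    eapply Rle_trans. apply Rabs_triang. rewrite Rabs_mult, (Rabs_pos_eq (exp x)) by lra.
    assert (exp x * Rabs (cos y - 1) <= 2 * y ^ 2)%R.
    { apply Rmult_le_compat; try lra. apply Rabs_pos. }
    lra. }
  assert (T2 : (Rabs (exp x * sin y + - 0 + - y) <= 5 * m ^ 2)%R).
  { replace (exp x * sin y + - 0 + - y)%R
      with (exp x * (sin y - y) + ((exp x - 1 - x) * y + x * y))%R by ring.
    eapply Rle_trans. apply Rabs_triang.
    eapply Rle_trans. apply Rplus_le_compat_l, Rabs_triang.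
    rewrite 3!Rabs_mult, (Rabs_pos_eq (exp x)) by lra.
    assert (exp x * Rabs (sin y - y) <= 2 * y ^ 2)%R.
    { apply Rmult_le_compat; try lra. apply Rabs_pos. }
    assert (Rabs (exp x - 1 - x) * Rabs y <= 2 * m ^ 2 * 1)%R.
    { apply Rmult_le_compat; auto using Rabs_pos; lra. }
    lra. }
  lra.
Qed.

Lemma sin_abs_lower u : (Rabs u <= 2.4)%R -> (Rabs u / 25 <= Rabs (sin u))%R.
Proof.
  intros H. destruct (Rle_dec 0 u).
  - rewrite Rabs_pos_eq in * by lra. eapply Rle_trans. apply sin_lower; lra. apply Rle_abs.
  - rewrite Rabs_left in * by lra. rewrite <- Rabs_Ropp, <- sin_neg.
    eapply Rle_trans. apply sin_lower; lra. apply Rle_abs.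
Qed.

(** Half-angle form: the first square is governed by y and the second by x, so that [qpar_lower] can
    bound them separately. *)
Lemma Cmod2_1_sub_qpar x y :
  (Cmod (1 - qpar (x, y)) ^ 2 =
   (1 - exp (- (2 * PI * y))) ^ 2 + 4 * exp (- (2 * PI * y)) * sin (PI * x) ^ 2)%R.
Proof.
  rewrite Cmod2_alt.
  assert (E : qpar (x, y) = (exp (- (2 * PI * y)) * cos (2 * (PI * x)),
                         exp (- (2 * PI * y)) * sin (2 * (PI * x)))%R).
  { unfold qpar, Cexp. simpl. f_equal; f_equal; f_equal; ring. }
  rewrite E. simpl. rewrite cos_2a_sin, sin_2a.
  set (e := exp (- (2 * PI * y))). assert (H := sin2_cos2 (PI * x)). unfold Rsqr in H.
  generalize dependent (cos (PI * x)). generalize (sin (PI * x)). intros s c H.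
  replace (1 + - (e * (1 - 2 * s * s)))%R with ((1 - e) + 2 * e * s * s)%R by ring.
  replace (0 + - (e * (2 * s * c)))%R with (- (2 * e * s * c))%R by ring.
  assert (Hc : (c * c = 1 - s * s)%R) by lra.
  replace (- (2 * e * s * c) * (- (2 * e * s * c) * 1))%R with (4 * e * e * s * s * (c * c))%R by ring.
  rewrite Hc. ring.
Qed.

Lemma exp_sub_lower t : (Rabs t * exp (- Rabs t) <= Rabs (1 - exp (- t)))%R.
Proof.
  assert (P : forall u, (0 <= u)%R -> (u * exp (- u) <= 1 - exp (- u))%R).
  { intros u Hu. assert (H := exp_ineq1_le u). assert (Q := exp_pos (- u)).
    assert (exp (- u) * exp u = 1)%R by (rewrite <- exp_plus, Rplus_opp_l; apply exp_0).
    nra. }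
  destruct (Rle_dec 0 t).
  - rewrite Rabs_pos_eq at 1 2 by lra. eapply Rle_trans. apply P; auto. apply Rle_abs.
  - rewrite (Rabs_left t) by lra. rewrite Ropp_involutive.
    assert (H := exp_ineq1_le (- t)).
    assert (exp t <= 1)%R. { rewrite <- exp_0. left; apply exp_increasing; lra. }
    apply Rle_trans with (- t * 1)%R. apply Rmult_le_compat_l; lra.
    rewrite Rabs_left1; lra.
Qed.

(** For |Im w| <= 1 and PI <= 4, [exp (- 8)] is a lower bound of exp (- 2 PI |Im w|); 1/25 is the
    slope in [sin_lower]. *)
Definition kq : R := (exp (- 8) / 25)%R.

Lemma kq_pos : (0 < kq)%R.
Proof. unfold kq. assert (H := exp_pos (- 8)). lra. Qed.

(** A uniform linear bound near the zero w = 0, used both to dominate the finite partial fractions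
    and to locate the zeros of 1 - [qpar]. The half-width 3/5, larger than 1/2, leaves room for Re z
    in (z + j) / (2 K + 1) with |j| <= K. *)
Lemma qpar_lower w : (Rabs (Re w) <= 3 / 5)%R -> (Rabs (Im w) <= 1)%R ->
  (kq * Cmod w <= Cmod (1 - qpar w))%R.
Proof.
  intros Hx Hy.
  assert (HPI : (3 < PI)%R) by (assert (Q := PI2_3_2); unfold PI2 in Q; lra).
  assert (HPI4 := PI_4).
  assert (H8 := exp_pos (- 8)).
  assert (H81 : (exp (- 8) <= 1)%R) by (rewrite <- exp_0; left; apply exp_increasing; lra).
  apply Rsqr_incr_0; try apply Cmod_ge_0.
  2:{ apply Rmult_le_pos; [left; apply kq_pos|apply Cmod_ge_0]. }
  rewrite 2!Rsqr_pow2, Rpow_mult_distr, Cmod2_alt.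
  destruct w as [x y]. simpl Re in *. simpl Im in *. rewrite Cmod2_1_sub_qpar.
  set (e := exp (- (2 * PI * y))).
  assert (Hay := Rabs_pos y). assert (Hax := Rabs_pos x).
  assert (He8 : (exp (- 8) <= e)%R).
  { unfold e. apply Rabs_le_between in Hy.
    destruct (Req_dec (- 8) (- (2 * PI * y))) as [->|]; [lra|].
    left. apply exp_increasing. nra. }
  assert (A : (kq * Rabs y <= Rabs (1 - e))%R).
  { eapply Rle_trans; [|apply exp_sub_lower].
    rewrite 2!Rabs_mult, (Rabs_pos_eq 2), (Rabs_pos_eq PI) by lra.
    assert (exp (- 8) <= exp (- (2 * PI * Rabs y)))%R.
    { destruct (Req_dec (- 8) (- (2 * PI * Rabs y))) as [->|]; [lra|].
      left. apply exp_increasing. nra. }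
    unfold kq. apply Rle_trans with (Rabs y * exp (- 8))%R.
    - assert (0 <= Rabs y * exp (-8))%R by nra. lra.
    - apply Rmult_le_compat; try nra. }
  assert (B : (exp (- 8) / 25 * Rabs x <= Rabs (sin (PI * x)))%R).
  { eapply Rle_trans; [|apply sin_abs_lower].
    - rewrite Rabs_mult, (Rabs_pos_eq PI) by lra. 
      assert (Rabs x <= PI * Rabs x)%R by nra. nra.
    - rewrite Rabs_mult, (Rabs_pos_eq PI) by lra. nra. }
  fold kq in B. assert (K := kq_pos).
  rewrite <- (pow2_abs (1 - e)), <- (pow2_abs (sin (PI * x))), <- (pow2_abs x), <- (pow2_abs y).
  assert (A2 : ((kq * Rabs y) ^ 2 <= Rabs (1 - e) ^ 2)%R) by (apply pow_incr; split; [nra|auto]).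
  assert (B2 : ((Rabs x / 25 * 3) ^ 2 <= Rabs (sin (PI * x)) ^ 2)%R).
  { apply pow_incr. split; [lra|].
    eapply Rle_trans; [|apply sin_abs_lower].
    - rewrite Rabs_mult, (Rabs_pos_eq PI) by lra. nra.
    - rewrite Rabs_mult, (Rabs_pos_eq PI) by lra. nra. }
  assert (C2 : ((kq * Rabs x) ^ 2 <= e * (Rabs x / 25 * 3) ^ 2)%R).
  { replace ((kq * Rabs x) ^ 2)%R with (exp (- 8) * exp (- 8) * (Rabs x / 25) ^ 2)%R
      by (unfold kq; field).
    replace (e * (Rabs x / 25 * 3) ^ 2)%R with (9 * e * (Rabs x / 25) ^ 2)%R by ring.
    apply Rmult_le_compat_r. apply pow2_ge_0. nra. }
  assert (D2 : (e * (Rabs x / 25 * 3) ^ 2 <= e * Rabs (sin (PI * x)) ^ 2)%R).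
  { apply Rmult_le_compat_l; auto. unfold e. left; apply exp_pos. }
  assert (0 <= e * Rabs (sin (PI * x)) ^ 2)%R.
  { apply Rmult_le_pos. left; apply exp_pos. apply pow2_ge_0. }
  lra.
Qed.

Lemma exists_shift (x : R) : exists n : Z, (Rabs (x + IZR n) <= 1 / 2)%R.
Proof.
  exists (- (up (x - 1 / 2)))%Z. rewrite opp_IZR.
  destruct (archimed (x - 1 / 2)) as [H1 H2]. apply Rabs_le. lra.
Qed.

(** The modulus forces Im z = 0; after a shift to |Re| <= 1/2 the bound [qpar_lower] leaves only
    0. *)
Lemma qpar_eq_1 z : qpar z = 1 -> exists n : Z, z = IZR n.
Proof.
  intros H.
  destruct (exists_shift (Re z)) as [n Hn].
  assert (Hi : Im z = 0%R).
  { assert (E := Cmod_qpar z). rewrite H, Cmod_1 in E.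
    rewrite <- exp_0 in E. apply exp_inv in E. assert (P := PI_RGT_0). nra. }
  assert (L := qpar_lower (z + IZR n)).
  rewrite qpar_plus_IZR, H in L.
  replace (1 - 1) with (RtoC 0) in L by ring. rewrite Cmod_0 in L.
  destruct z as [x y]. simpl in *. subst y.
  specialize (L ltac:(lra)). rewrite Rplus_0_r, Rabs_R0 in L.
  specialize (L ltac:(lra)).
  assert (K := kq_pos). assert (G := Cmod_ge_0 ((x, 0%R) + IZR n)).
  assert (E : Cmod ((x, 0%R) + IZR n) = 0%R) by nra.
  apply Cmod_eq_0 in E. exists (- n)%Z. rewrite opp_IZR, RtoC_opp.
  replace ((x, 0%R) : C) with ((x, 0%R) + IZR n + - IZR n) by ring.
  rewrite E. ring.
Qed.

Definition non_integer (z : C) : Prop := forall n : Z, z + IZR n <> 0.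

Lemma qpar_neq_1 z : non_integer z -> 1 - qpar z <> 0.
Proof.
  intros H E. destruct (qpar_eq_1 z) as [n Hn].
  - replace (qpar z) with (1 - (1 - qpar z)) by ring. rewrite E. ring.
  - apply (H (- n)%Z). rewrite Hn, opp_IZR, RtoC_opp. ring.
Qed.

(** * Partial fractions of the cotangent *)

Lemma Csum_S a N : Csum a (S N) = Csum a N + a (S N).
Proof. reflexivity. Qed.

Lemma Csum_plus a b N : Csum (fun n => a n + b n) N = Csum a N + Csum b N.
Proof. induction N; simpl; [reflexivity|]. rewrite IHN. ring. Qed.

Lemma Csum_scal c a N : Csum (fun n => c * a n) N = c * Csum a N.
Proof. induction N; simpl; [reflexivity|]. rewrite IHN. ring. Qed.

Lemma Csum_swap (f : nat -> nat -> C) M N :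
  Csum (fun i => Csum (f i) N) M = Csum (fun j => Csum (fun i => f i j) M) N.
Proof.
  induction M; simpl; [apply Csum_ext; reflexivity|].
  rewrite IHM, <- Csum_plus. reflexivity.
Qed.

Lemma Csum_const c N : Csum (fun _ => c) N = INR (S N) * c.
Proof.
  induction N; [simpl; ring|].
  simpl Csum. rewrite IHN, (S_INR (S N)), RtoC_plus. ring.
Qed.

(* Turns a sum over the integers into a series. *)
Definition bil (f : Z -> C) (n : nat) : C :=
  match n with 0%nat => f 0%Z | S _ => f (Z.of_nat n) + f (- Z.of_nat n)%Z end.

Lemma bil_ext f g n : (forall j, f j = g j) -> bil f n = bil g n.
Proof. intros H. destruct n; simpl; rewrite ?H; reflexivity. Qed.

Lemma bil_plus f g n : bil (fun j => f j + g j) n = bil f n + bil g n.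
Proof. destruct n; simpl; ring. Qed.

Lemma bil_scal c f n : bil (fun j => c * f j) n = c * bil f n.
Proof. destruct n; simpl; ring. Qed.

Lemma bil_opp f n : bil (fun j => f (- j)%Z) n = bil f n.
Proof.
  destruct n; [reflexivity|]. unfold bil. rewrite Z.opp_involutive. ring.
Qed.

Lemma bil_Csum (f : nat -> Z -> C) K n :
  bil (fun j => Csum (fun k => f k j) K) n = Csum (fun k => bil (f k) n) K.
Proof. destruct n; simpl; [reflexivity|]. symmetry. apply Csum_plus. Qed.

Lemma Csum_bil_Csum (f : nat -> Z -> C) K N :
  Csum (bil (fun j => Csum (fun k => f k j) K)) N = Csum (fun k => Csum (bil (f k)) N) K.
Proof.
  rewrite (Csum_ext _ (fun n => Csum (fun k => bil (f k) n) K)).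
  - apply (Csum_swap (fun n k => bil (f k) n)).
  - intros n. apply bil_Csum.
Qed.

Lemma bil_telescope (g : Z -> C) K :
  Csum (bil (fun j => g (j + 1)%Z - g j)) K = g (Z.of_nat K + 1)%Z - g (- Z.of_nat K)%Z.
Proof.
  induction K; [reflexivity|].
  change (Csum (bil (fun j => g (j + 1)%Z - g j)) (S K))
    with (Csum (bil (fun j => g (j + 1)%Z - g j)) K + bil (fun j => g (j + 1)%Z - g j) (S K)).
  rewrite IHK. unfold bil.
  replace (Z.of_nat K + 1)%Z with (Z.of_nat (S K)) by lia.
  replace (- Z.of_nat (S K) + 1)%Z with (- Z.of_nat K)%Z by lia. ring.
Qed.

Lemma clim_inv u l : clim u l -> l <> 0 -> clim (fun n => / u n) (/ l).
Proof.
  intros H Hl eps He. assert (Hp := proj1 (Cmod_gt_0 l) Hl).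
  set (m := Cmod l) in *.
  destruct (H (Rmin (m / 2) (eps * (m * m / 2)))) as [N HN].
  { apply Rmin_pos; [lra|]. apply Rmult_lt_0_compat; nra. }
  exists N. intros n Hn. specialize (HN n Hn).
  assert (H1 : (Cmod (u n - l) < m / 2)%R) by (eapply Rlt_le_trans; [apply HN|apply Rmin_l]).
  assert (H2 : (Cmod (u n - l) < eps * (m * m / 2))%R) by (eapply Rlt_le_trans; [apply HN|apply Rmin_r]).
  assert (Hu : (m / 2 < Cmod (u n))%R).
  { assert (T : (m <= Cmod (u n) + Cmod (u n - l))%R); [|lra].
    unfold m. replace l with (u n + - (u n - l)) at 1 by ring.
    eapply Rle_trans. apply Cmod_triangle. rewrite Cmod_opp. lra. }
  assert (Hun : u n <> 0) by (apply Cmod_gt_0; lra).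
  replace (/ u n - / l) with (- (u n - l) * (/ u n * / l)) by (field; auto).
  rewrite Cmod_mult, Cmod_opp, Cmod_mult, 2!Cmod_inv by auto. fold m.
  assert (0 < / Cmod (u n))%R by (apply Rinv_0_lt_compat; lra).
  assert (0 < / m)%R by (apply Rinv_0_lt_compat; lra).
  assert (L : (/ Cmod (u n) < / (m / 2))%R).
  { apply Rinv_lt_contravar; nra. }
  apply Rle_lt_trans with (Cmod (u n - l) * (/ (m / 2) * / m))%R.
  - apply Rmult_le_compat_l; [apply Cmod_ge_0|]. apply Rmult_le_compat_r; lra.
  - replace eps with (eps * (m * m / 2) * (/ (m / 2) * / m))%R at 1 by (field; lra).
    apply Rmult_lt_compat_r; auto.
    apply Rmult_lt_0_compat; auto. apply Rinv_0_lt_compat; lra.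
Qed.

(** The number of integers j with |j| <= K, so that exp (2 pi i j / (2 K + 1)) runs over all roots
    of unity of this order. *)
Definition oddn (K : nat) : R := INR (2 * K + 1).

Lemma oddn_pos K : (1 <= oddn K)%R.
Proof. unfold oddn. apply (le_INR 1). lia. Qed.

Lemma oddn_neq K : RtoC (oddn K) <> 0.
Proof. intros E. injection E. assert (H := oddn_pos K). lra. Qed.

Lemma oddn_RtoC K : RtoC (oddn K) = 2 * INR K + 1.
Proof. unfold oddn. rewrite plus_INR, mult_INR, RtoC_plus, RtoC_mult. reflexivity. Qed.

(** Orthogonality of characters modulo 2 K + 1; the range of k contains a single multiple of 2 K +
    1. For the other k, multiplication by x - 1 makes the sum telescope, and the arguments of [qpar]
    at its two ends differ by an integer. *)
Lemma char_sum K k : (0 < k < 2 * (2 * K + 1))%nat ->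
  Csum (bil (fun j => qpar (IZR j * (INR k / oddn K)))) K =
  if (k =? 2 * K + 1)%nat then oddn K else 0.
Proof.
  intros Hk. assert (HN := oddn_neq K).
  destruct (Nat.eqb_spec k (2 * K + 1)) as [->|Hne].
  - rewrite (Csum_ext _ (fun n => match n with 0%nat => 1 | S _ => 2 end)).
    + unfold oddn. clear. induction K; [simpl; f_equal; ring|].
      change (Csum (fun n : nat => match n with 0%nat => 1 | S _ => 2 end) (S K)) with
        (Csum (fun n : nat => match n with 0%nat => 1 | S _ => 2 end) K + 2).
      rewrite IHK. rewrite <- RtoC_plus. f_equal.
      replace (2 * S K + 1)%nat with (S (S (2 * K + 1))) by lia. rewrite 2!S_INR. ring.
    + intros n. fold (oddn K).
      assert (E : forall j, qpar (IZR j * (oddn K / oddn K)) = 1).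
      { intros j. rewrite <- (qpar_IZR j). f_equal. field. auto. }
      destruct n; unfold bil; rewrite ?E; auto. ring.
  - set (x := qpar (INR k / oddn K)).
    assert (Hx : 1 - x <> 0).
    { apply qpar_neq_1. intros n E.
      assert (E2 : INR k + IZR n * oddn K = 0).
      { replace (INR k + IZR n * oddn K) with ((INR k / oddn K + IZR n) * oddn K) by (field; auto).
        rewrite E. ring. }
      rewrite <- RtoC_mult, <- RtoC_plus in E2. injection E2 as E3.
      unfold oddn in E3. rewrite 2!INR_IZR_INZ, <- mult_IZR, <- plus_IZR in E3.
      apply eq_IZR in E3. destruct (Z.lt_trichotomy n (-1)) as [Hn|[Hn|Hn]]; [nia|subst n; lia|nia]. }
    assert (HT := bil_telescope (fun j => qpar (IZR j * (INR k / oddn K))) K).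
    rewrite (Csum_ext _ (fun n => (x - 1) * bil (fun j => qpar (IZR j * (INR k / oddn K))) n)) in HT.
    + rewrite Csum_scal in HT.
      assert (Z : qpar (IZR (Z.of_nat K + 1) * (INR k / oddn K)) -
                  qpar (IZR (- Z.of_nat K) * (INR k / oddn K)) = 0).
      { replace (IZR (Z.of_nat K + 1) * (INR k / oddn K))
          with (IZR (- Z.of_nat K) * (INR k / oddn K) + IZR (Z.of_nat k)).
        - rewrite qpar_plus_IZR. ring.
        - rewrite plus_IZR, opp_IZR, <- 2!INR_IZR_INZ, RtoC_plus, RtoC_opp.
          replace (RtoC (INR K)) with ((oddn K - 1) / 2) by (rewrite oddn_RtoC; field).
          field. auto. }
      rewrite Z in HT.
      replace (Csum _ K) with ((x - 1) * Csum (bil (fun j => qpar (IZR j * (INR k / oddn K)))) K / (x - 1)).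
      * rewrite HT. field. intros E. apply Hx. replace (1 - x) with (- (x - 1)) by ring. rewrite E. ring.
      * field. intros E. apply Hx. replace (1 - x) with (- (x - 1)) by ring. rewrite E. ring.
    + intros n. rewrite <- bil_scal. apply bil_ext. intros j.
      rewrite plus_IZR, RtoC_plus.
      replace ((IZR j + 1) * (INR k / oddn K)) with (IZR j * (INR k / oddn K) + INR k / oddn K) by (field; auto).
      rewrite qpar_plus. fold x. ring.
Qed.

Lemma geom_sum (a : C) N : (1 - a) * Csum (fun k => Cpow a k) N = 1 - Cpow a (S N).
Proof.
  induction N; [simpl; ring|].
  rewrite Csum_S, Cmult_plus_distr_l, IHN, (Cpow_S a (S N)). ring.
Qed.

Lemma geom_sum_inv (a : C) N : 1 - a <> 0 -> 1 - Cpow a (S N) <> 0 ->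
  / (1 - a) = / (1 - Cpow a (S N)) * Csum (fun k => Cpow a k) N.
Proof.
  intros H1 H2. rewrite <- geom_sum in H2 |- *. 
  assert (H3 : Csum (fun k => Cpow a k) N <> 0).
  { intros E. apply H2. rewrite E. ring. }
  field. auto.
Qed.

Lemma non_integer_div z K j : non_integer z -> non_integer ((z + IZR j) / oddn K).
Proof.
  intros H n E. assert (HN := oddn_neq K).
  apply (H (j + n * (2 * Z.of_nat K + 1))%Z).
  assert (F : oddn K = IZR (2 * Z.of_nat K + 1)).
  { unfold oddn. rewrite INR_IZR_INZ. f_equal. lia. }
  rewrite plus_IZR, mult_IZR, <- F, RtoC_plus, RtoC_mult.
  replace (z + (IZR j + IZR n * oddn K)) with (((z + IZR j) / oddn K + IZR n) * oddn K) by (field; auto).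
  rewrite E. ring.
Qed.

Lemma qpar_div_pow z K j : Cpow (qpar ((z + IZR j) / oddn K)) (S (2 * K)) = qpar z.
Proof.
  rewrite qpar_pow, <- (qpar_plus_IZR z j). f_equal.
  replace (INR (S (2 * K))) with (oddn K). field. apply oddn_neq.
  unfold oddn. f_equal. lia.
Qed.

Lemma qpar_div_split z K j :
  qpar ((z + IZR j) / oddn K) = qpar (IZR j * (1 / oddn K)) * qpar (z / oddn K).
Proof. rewrite <- qpar_plus. f_equal. field. apply oddn_neq. Qed.

(* The finite partial fraction expansion underlying the cotangent series. *)
Lemma finite_pf1 K z k : non_integer z -> (k < 2 * K + 1)%nat ->
  Csum (bil (fun j => qpar (IZR j * (INR (S k) / oddn K)) * / (1 - qpar ((z + IZR j) / oddn K)))) K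
  = oddn K * Cpow (qpar (z / oddn K)) (2 * K - k) * / (1 - qpar z).
Proof.
  intros Hz Hk. set (y := qpar (z / oddn K)).
  assert (Hq := qpar_neq_1 z Hz).
  rewrite (Csum_ext _ (bil (fun j => Csum (fun l => (/ (1 - qpar z) * Cpow y l) *
      qpar (IZR j * (INR (S k + l) / oddn K))) (2 * K)))).
  - rewrite (Csum_bil_Csum (fun l j => (/ (1 - qpar z) * Cpow y l) *
      qpar (IZR j * (INR (S k + l) / oddn K)))).
    rewrite (Csum_ext _ (fun l => (/ (1 - qpar z) * Cpow y l) *
        Csum (bil (fun j => qpar (IZR j * (INR (S k + l) / oddn K)))) K)).
    2:{ intros l. rewrite <- Csum_scal. apply Csum_ext. intros n. apply bil_scal. }
    rewrite (Csum_ext_loc _ (fun l => (/ (1 - qpar z) * Cpow y l) *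
        (if (S k + l =? 2 * K + 1)%nat then RtoC (oddn K) else 0))).
    2:{ intros l Hl. rewrite char_sum by lia. reflexivity. }
    rewrite (Csum_single _ (2 * K - k)%nat).
    + replace (S k + (2 * K - k))%nat with (2 * K + 1)%nat by lia.
      rewrite Nat.eqb_refl. ring.
    + intros n Hn. replace (S k + n =? 2 * K + 1)%nat with false. ring.
      symmetry. apply Nat.eqb_neq. lia.
    + lia.
  - intros n. apply bil_ext. intros j.
    rewrite (geom_sum_inv _ (2 * K)).
    2: apply qpar_neq_1, non_integer_div, Hz.
    2: rewrite qpar_div_pow; exact Hq.
    rewrite qpar_div_pow, <- Csum_scal, <- Csum_scal. apply Csum_ext. intros l.
    rewrite qpar_div_split, Cpow_mult_l. fold y. rewrite qpar_pow.
    replace (IZR j * (INR (S k + l) / oddn K)) with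
      (IZR j * (INR (S k) / oddn K) + INR l * (IZR j * (1 / oddn K))).
    + rewrite qpar_plus. ring.
    + rewrite plus_INR, RtoC_plus. field. apply oddn_neq.
Qed.

(** A geometric expansion of the factor in z1 reduces this to [finite_pf1]. The twist by
    [qpar (j / (2 K + 1))], which tends to 1, shifts the exponents into the range 1, ..., 2 K + 1
    that [finite_pf1] covers. *)
Lemma finite_pf2 K z1 z2 : non_integer z1 -> non_integer z2 ->
  Csum (bil (fun j => qpar (IZR j * (1 / oddn K)) *
     (/ (1 - qpar ((z1 + IZR j) / oddn K)) * / (1 - qpar ((z2 + IZR j) / oddn K))))) K
  = oddn K * / (1 - qpar z1) * / (1 - qpar z2) *
    Csum (fun k => Cpow (qpar (z1 / oddn K)) k * Cpow (qpar (z2 / oddn K)) (2 * K - k)) (2 * K).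
Proof.
  intros H1 H2. set (y := qpar (z1 / oddn K)).
  assert (Hq := qpar_neq_1 z1 H1).
  rewrite (Csum_ext _ (bil (fun j => Csum (fun l => (/ (1 - qpar z1) * Cpow y l) *
      (qpar (IZR j * (INR (S l) / oddn K)) * / (1 - qpar ((z2 + IZR j) / oddn K)))) (2 * K)))).
  - rewrite (Csum_bil_Csum (fun l j => (/ (1 - qpar z1) * Cpow y l) *
      (qpar (IZR j * (INR (S l) / oddn K)) * / (1 - qpar ((z2 + IZR j) / oddn K))))).
    rewrite <- Csum_scal. apply Csum_ext_loc. intros l Hl.
    rewrite (Csum_ext _ (fun n => (/ (1 - qpar z1) * Cpow y l) * 
       bil (fun j => qpar (IZR j * (INR (S l) / oddn K)) * / (1 - qpar ((z2 + IZR j) / oddn K))) n)).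
    2:{ intros n. apply bil_scal. }
    rewrite Csum_scal, finite_pf1 by (auto; lia). ring.
  - intros n. apply bil_ext. intros j.
    rewrite (geom_sum_inv (qpar ((z1 + IZR j) / oddn K)) (2 * K)).
    2: apply qpar_neq_1, non_integer_div, H1.
    2: rewrite qpar_div_pow; exact Hq.
    rewrite qpar_div_pow.
    replace (qpar (IZR j * (1 / oddn K)) *
      (/ (1 - qpar z1) * Csum (fun k => Cpow (qpar ((z1 + IZR j) / oddn K)) k) (2 * K) *
       / (1 - qpar ((z2 + IZR j) / oddn K)))) with
     ((qpar (IZR j * (1 / oddn K)) * / (1 - qpar z1) * / (1 - qpar ((z2 + IZR j) / oddn K))) *
       Csum (fun k => Cpow (qpar ((z1 + IZR j) / oddn K)) k) (2 * K)) by ring.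
    rewrite <- Csum_scal. apply Csum_ext. intros l.
    rewrite (qpar_div_split z1), Cpow_mult_l. fold y. rewrite qpar_pow.
    replace (IZR j * (INR (S l) / oddn K)) with
      (IZR j * (1 / oddn K) + INR l * (IZR j * (1 / oddn K))).
    + rewrite qpar_plus. ring.
    + rewrite S_INR, RtoC_plus. field. apply oddn_neq.
Qed.

Lemma finite_min (f : nat -> R) N : (forall n, (0 < f n)%R) ->
  exists d, (0 < d)%R /\ forall n, (n <= N)%nat -> (d <= f n)%R.
Proof.
  intros H. induction N.
  - exists (f 0%nat). split; auto. intros n Hn. replace n with 0%nat by lia. lra.
  - destruct IHN as [d [Hd HN]]. exists (Rmin d (f (S N))). split.
    + apply Rmin_pos; auto.
    + intros n Hn. destruct (Nat.eq_dec n (S N)) as [->|]; [apply Rmin_r|].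
      eapply Rle_trans. apply Rmin_l. apply HN. lia.
Qed.

Lemma exists_nat_ge (x : R) : exists n : nat, (x <= INR n)%R.
Proof.
  destruct (archimed x) as [H _]. exists (Z.to_nat (up x)).
  rewrite INR_IZR_INZ. destruct (Z_le_gt_dec 0 (up x)).
  - rewrite Z2Nat.id by lia. lra.
  - replace (Z.to_nat (up x)) with 0%nat by lia. simpl.
    apply Rle_trans with (IZR (up x)). lra. apply IZR_le. lia.
Qed.

(** For n beyond 2 |z| + 1 the triangle inequality gives the slope 1/4; the finitely many smaller n
    are covered by a minimum. Two such factors make a term of the cotangent series O(1 / n^2). *)
Lemma non_integer_lower z : non_integer z ->
  exists d, (0 < d)%R /\ forall n : nat,
    (d * (1 + INR n) <= Cmod (z + IZR (Z.of_nat n)))%R /\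
    (d * (1 + INR n) <= Cmod (z + IZR (- Z.of_nat n)))%R.
Proof.
  intros Hz.
  destruct (exists_nat_ge (2 * Cmod z + 1)) as [M HM].
  destruct (finite_min (fun n => Rmin (Cmod (z + IZR (Z.of_nat n))) (Cmod (z + IZR (- Z.of_nat n)))) M)
    as [d [Hd HdM]].
  { intros n. apply Rmin_pos; apply Cmod_gt_0, Hz. }
  assert (HM1 : (0 < 1 + INR M)%R) by (assert (Q := pos_INR M); lra).
  exists (Rmin (d / (1 + INR M)) (1 / 4)). split.
  { apply Rmin_pos; [apply Rdiv_lt_0_compat; auto|lra]. }
  assert (Hzc := Cmod_ge_0 z).
  intros n. assert (Hn := pos_INR n).
  destruct (le_lt_dec n M) as [Hle|Hlt].
  - specialize (HdM n Hle). 
    assert (A : (Rmin (d / (1 + INR M)) (1 / 4) * (1 + INR n) <= d)%R).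
    { apply Rle_trans with (d / (1 + INR M) * (1 + INR M))%R.
      - apply Rmult_le_compat; try lra.
        + left. apply Rmin_pos; [apply Rdiv_lt_0_compat; auto|lra].
        + apply Rmin_l.
        + apply Rplus_le_compat_l, le_INR, Hle.
      - right. field. lra. }
    split; (eapply Rle_trans; [apply A|]); (eapply Rle_trans; [apply HdM|]);
      [apply Rmin_l|apply Rmin_r].
  - assert (HMn : (INR M + 1 <= INR n)%R) by (rewrite <- S_INR; apply le_INR; lia).
    assert (A : (Rmin (d / (1 + INR M)) (1 / 4) * (1 + INR n) <= INR n - Cmod z)%R).
    { apply Rle_trans with (1 / 4 * (1 + INR n))%R.
      - apply Rmult_le_compat_r; [lra|apply Rmin_r].
      - lra. }
    split; (eapply Rle_trans; [apply A|]).
    + rewrite <- INR_IZR_INZ.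
      assert (T : (Cmod (INR n) <= Cmod (z + INR n) + Cmod (- z))%R).
      { replace (RtoC (INR n)) with ((z + INR n) + - z) at 1 by ring. apply Cmod_triangle. }
      rewrite Cmod_opp, Cmod_R, Rabs_pos_eq in T by lra. lra.
    + rewrite opp_IZR, <- INR_IZR_INZ.
      assert (T : (Cmod (INR n) <= Cmod (z + RtoC (- INR n)) + Cmod z)%R).
      { rewrite <- (Cmod_opp (z + _)).
        replace (RtoC (INR n)) with (- (z + RtoC (- INR n)) + z) at 1 by (rewrite RtoC_opp; ring).
        apply Cmod_triangle. }
      rewrite Cmod_R, Rabs_pos_eq in T by lra. lra.
Qed.

Definition invsq (n : nat) : R := (/ ((1 + INR n) * (1 + INR n)))%R.

Lemma invsq_pos n : (0 < invsq n)%R.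
Proof. unfold invsq. assert (H := pos_INR n). apply Rinv_0_lt_compat. nra. Qed.

Lemma ex_series_invsq : ex_series invsq.
Proof.
  assert (H : csummable (fun n => RtoC (invsq n))).
  { apply csummable_Series_bound with 2%R. intros N.
    apply Rle_trans with (2 - / (1 + INR N))%R.
    2:{ assert (0 < / (1 + INR N))%R; [|lra]. apply Rinv_0_lt_compat. assert (Q := pos_INR N). lra. }
    assert (E : forall n, Cmod (RtoC (invsq n)) = invsq n).
    { intros n. rewrite Cmod_R. apply Rabs_pos_eq. left; apply invsq_pos. }
    induction N.
    - rewrite sum_O, E. unfold invsq. simpl. lra.
    - rewrite sum_Sn, E. unfold plus; simpl AbelianMonoid.plus. unfold invsq.
      eapply Rle_trans. apply Rplus_le_compat_r, IHN.
      rewrite S_INR. assert (Q := pos_INR N).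
      apply Rminus_le. apply Rle_trans with (- (/ ((1 + INR N) * ((1 + (INR N + 1)) * (1 + (INR N + 1))))))%R.
      + right. field. lra.
      + assert (0 < / ((1 + INR N) * ((1 + (INR N + 1)) * (1 + (INR N + 1)))))%R; [|lra].
        apply Rinv_0_lt_compat. repeat apply Rmult_lt_0_compat; lra. }
  apply ex_series_ext with (2 := H). intros n. rewrite Cmod_R. apply Rabs_pos_eq. left; apply invsq_pos.
Qed.

Lemma clim_shift u l K0 : clim (fun K => u (K0 + K)%nat) l -> clim u l.
Proof.
  intros H eps He. destruct (H eps He) as [N HN]. exists (K0 + N)%nat. intros n Hn.
  replace n with (K0 + (n - K0))%nat by lia. apply HN. lia.
Qed.

Lemma clim_shift' u l K0 : clim u l -> clim (fun K => u (K0 + K)%nat) l.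
Proof.
  intros H eps He. destruct (H eps He) as [N HN]. exists N. intros n Hn. apply HN. lia.
Qed.

Lemma oddn_ge K : (INR K <= oddn K)%R.
Proof. unfold oddn. apply le_INR. lia. Qed.

Lemma clim_inv_oddn : clim (fun K => / oddn K) 0.
Proof.
  intros eps He. destruct (exists_nat_ge (2 / eps)) as [N HN].
  exists N. intros n Hn.
  assert (Ho := oddn_ge n). assert (Hn' := le_INR _ _ Hn). assert (Hp := oddn_pos n).
  replace (/ oddn n - 0) with (RtoC (/ oddn n)).
  2:{ rewrite RtoC_inv by lra. ring. }
  rewrite Cmod_R, Rabs_pos_eq by (left; apply Rinv_0_lt_compat; lra).
  assert (H2 : (2 / eps <= oddn n)%R) by lra.
  apply Rmult_lt_reg_r with (oddn n); [lra|]. rewrite Rinv_l by lra.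
  apply Rlt_le_trans with (eps * (2 / eps))%R.
  - replace (eps * (2 / eps))%R with 2%R by (field; lra). lra.
  - apply Rmult_le_compat_l; lra.
Qed.

Definition tpi : C := 2 * PI * Ci.

Lemma tpi_neq_0 : tpi <> 0.
Proof.
  unfold tpi. intros E. assert (H := PI_RGT_0).
  injection E. simpl. intros. lra.
Qed.

Lemma Copp_tpi_neq_0 : - tpi <> 0.
Proof.
  intros E. apply tpi_neq_0. replace tpi with (- - tpi) by ring. rewrite E. ring.
Qed.

Lemma qpar_tpi z : qpar z = Cexp (tpi * z).
Proof. reflexivity. Qed.

Lemma clim_0_bound (u : nat -> C) (v : nat -> C) N0 :
  (forall n, (N0 <= n)%nat -> (Cmod (u n) <= Cmod (v n))%R) -> clim v 0 -> clim u 0.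
Proof.
  intros H Hv eps He. destruct (Hv eps He) as [N HN]. exists (max N0 N). intros n Hn.
  specialize (HN n ltac:(lia)). specialize (H n ltac:(lia)).
  replace (u n - 0) with (u n) by ring. replace (v n - 0) with (v n) in HN by ring. lra.
Qed.

(** [- tpi] is the derivative of 1 - [qpar] at 0; the remainder [u] is O(1 / (2 K + 1)) by
    [Cexp_sub_Cmod]. *)
Lemma clim_qpar_scaled w : clim (fun K => oddn K * (1 - qpar (w / oddn K))) (- tpi * w).
Proof.
  set (u := fun K => oddn K * (1 - qpar (w / oddn K)) + tpi * w).
  assert (Hu : clim u 0).
  { destruct (exists_nat_ge (2 * Cmod (tpi * w))) as [N0 HN0].
    apply clim_0_bound with (fun K => (9 * (Cmod (tpi * w) ^ 2)%R) * / oddn K) N0.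
    - intros n Hn. assert (Ho := oddn_neq n). assert (Hp := oddn_pos n).
      assert (Hin := oddn_ge n). assert (Hn' := le_INR _ _ Hn).
      unfold u. rewrite qpar_tpi. set (h := tpi * (w / oddn n)).
      assert (Ho' : Cmod (oddn n) = oddn n) by (rewrite Cmod_R, Rabs_pos_eq; lra).
      assert (Hh : Cmod h = (Cmod (tpi * w) / oddn n)%R).
      { unfold h. replace (tpi * (w / oddn n)) with (tpi * w / oddn n) by (field; auto).
        rewrite Cmod_div by auto. now rewrite Ho'. }
      replace (oddn n * (1 - Cexp h) + tpi * w) with (- oddn n * (Cexp h - 1 - h)).
      2:{ unfold h. field. auto. }
      rewrite 3!Cmod_mult, Cmod_opp, Ho', Cmod_inv, Ho', 2!Cmod_R by auto.
      rewrite (Rabs_pos_eq 9), (Rabs_pos_eq (_ ^ 2)) by (try apply pow2_ge_0; lra).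
      eapply Rle_trans.
      + apply Rmult_le_compat_l; [lra|]. apply Cexp_sub_Cmod. rewrite Hh.
        apply Rmult_le_reg_r with (oddn n); [lra|].
        unfold Rdiv at 1. rewrite Rmult_assoc, Rinv_l by lra. lra.
      + rewrite Hh. right. field. lra.
    - replace (RtoC 0) with ((9 * (Cmod (tpi * w) ^ 2)%R) * 0) by ring.
      apply clim_scal, clim_inv_oddn. }
  apply clim_ext with (fun K => u K + - (tpi * w)).
  - intros n. unfold u. ring.
  - replace (- tpi * w) with (0 + - (tpi * w)) by ring.
    apply clim_plus; auto. apply clim_const.
Qed.

Lemma clim_qpar_1 w : clim (fun K => qpar (w / oddn K)) 1.
Proof.
  apply clim_ext with (fun K => 1 + - (1) * (/ oddn K * (oddn K * (1 - qpar (w / oddn K))))).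
  - intros n. assert (Ho := oddn_neq n). field. auto.
  - replace (RtoC 1) with (1 + - (1) * (0 * (- tpi * w))) at 1 by ring.
    apply clim_plus. apply clim_const. apply clim_scal.
    apply clim_mult. apply clim_inv_oddn. apply clim_qpar_scaled.
Qed.

(** Equal to 1/2 + (i/2) cot (pi z): differences of values of [cc] are differences of cotangents. *)
Definition cc (z : C) : C := / (1 - qpar z).

(** Each factor 1 - [qpar] tends to 0 with 1 / (2 K + 1); scaling both by 2 K + 1 gives the term a
    finite limit for fixed j. *)
Definition pf_term K z1 z2 (j : Z) : C :=
  qpar (IZR j * (1 / oddn K)) * (/ (oddn K * (1 - qpar ((z1 + IZR j) / oddn K))) *
   / (oddn K * (1 - qpar ((z2 + IZR j) / oddn K)))).

Lemma clim_pf_term z1 z2 j : non_integer z1 -> non_integer z2 ->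
  clim (fun K => pf_term K z1 z2 j) (/ (tpi * tpi) * / ((z1 + IZR j) * (z2 + IZR j))).
Proof.
  intros H1 H2. assert (T := tpi_neq_0). assert (N1 := H1 j). assert (N2 := H2 j).
  replace (/ (tpi * tpi) * / ((z1 + IZR j) * (z2 + IZR j))) with
    (1 * (/ (- tpi * (z1 + IZR j)) * / (- tpi * (z2 + IZR j)))) by (field; auto).
  unfold pf_term. apply clim_mult.
  - apply clim_ext with (fun K => qpar (IZR j / oddn K)).
    + intros n. f_equal. field. apply oddn_neq.
    + apply clim_qpar_1.
  - apply clim_mult; apply clim_inv; try apply clim_qpar_scaled;
      apply Cmult_neq_0; auto using Copp_tpi_neq_0.
Qed.

Lemma pf_factor_lower K z j d : (5 * (Rabs (Re z) + Rabs (Im z)) <= INR K)%R ->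
  (Z.abs j <= Z.of_nat K)%Z -> (0 < d)%R -> (d <= Cmod (z + IZR j))%R ->
  (Cmod (/ (oddn K * (1 - qpar ((z + IZR j) / oddn K)))) <= / (kq * d))%R.
Proof.
  intros HK Hj Hd0 Hd. assert (Hp := oddn_pos K). assert (Ho := oddn_neq K). assert (Q := kq_pos).
  assert (Hx := Rabs_pos (Re z)). assert (Hy := Rabs_pos (Im z)).
  assert (EK : oddn K = (2 * INR K + 1)%R).
  { unfold oddn. rewrite plus_INR, mult_INR. reflexivity. }
  assert (Hj' : (Rabs (IZR j) <= INR K)%R).
  { rewrite <- abs_IZR, INR_IZR_INZ. apply IZR_le, Hj. }
  assert (Ho' : Cmod (oddn K) = oddn K) by (rewrite Cmod_R, Rabs_pos_eq; lra).
  assert (Hw : (z + IZR j) / oddn K = ((Re z + IZR j) / oddn K, Im z / oddn K)%R).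
  { destruct z as [x y]. unfold Cdiv.
    rewrite <- RtoC_inv by lra. unfold Cmult, Cplus, RtoC. simpl. f_equal; field; lra. }
  assert (L : (kq * Cmod ((z + IZR j) / oddn K) <= Cmod (1 - qpar ((z + IZR j) / oddn K)))%R).
  { apply qpar_lower; rewrite Hw; simpl; unfold Rdiv;
      rewrite Rabs_mult, (Rabs_pos_eq (/ oddn K)) by (left; apply Rinv_0_lt_compat; lra);
      apply Rmult_le_reg_r with (oddn K); try lra; rewrite Rmult_assoc, Rinv_l by lra.
    - eapply Rle_trans. apply Rmult_le_compat_r; [lra|]. apply Rabs_triang. lra.
    - lra. }
  rewrite Cmod_div, Ho' in L by auto.
  assert (L2 : (kq * d <= Cmod (oddn K * (1 - qpar ((z + IZR j) / oddn K))))%R).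
  { rewrite Cmod_mult, Ho'. apply Rle_trans with (oddn K * (kq * (Cmod (z + IZR j) / oddn K)))%R.
    - apply Rle_trans with (kq * Cmod (z + IZR j))%R.
      + apply Rmult_le_compat_l; lra.
      + right. field. lra.
    - apply Rmult_le_compat_l; lra. }
  assert (P : (0 < kq * d)%R) by nra.
  rewrite Cmod_inv.
  - apply Rinv_le_contravar; auto.
  - apply Cmod_gt_0. lra.
Qed.

Lemma clim_pf_sum z1 z2 : non_integer z1 -> non_integer z2 ->
  csummable (bil (fun j => / ((z1 + IZR j) * (z2 + IZR j)))) /\
  clim (fun K => Csum (bil (pf_term K z1 z2)) K)
    (/ (tpi * tpi) * Cseries (bil (fun j => / ((z1 + IZR j) * (z2 + IZR j))))).
Proof.
  intros H1 H2.
  destruct (non_integer_lower z1 H1) as [d1 [Hd1 L1]].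
  destruct (non_integer_lower z2 H2) as [d2 [Hd2 L2]].
  assert (Q := kq_pos).
  assert (Hpos : forall n, (0 < 1 + INR n)%R) by (intros n; assert (P := pos_INR n); lra).
  assert (Hs : csummable (bil (fun j => / ((z1 + IZR j) * (z2 + IZR j))))).
  { apply csummable_le with (fun n => scal (2 * / (d1 * d2))%R (invsq n)).
    2: exact (ex_series_scal_l _ _ ex_series_invsq).
    assert (B : forall n j, j = Z.of_nat n \/ j = (- Z.of_nat n)%Z ->
      (Cmod (/ ((z1 + IZR j) * (z2 + IZR j))) <= / (d1 * d2) * invsq n)%R).
    { intros n j Hj. specialize (Hpos n).
      assert (A1 : (d1 * (1 + INR n) <= Cmod (z1 + IZR j))%R) by (destruct Hj; subst j; apply L1).
      assert (A2 : (d2 * (1 + INR n) <= Cmod (z2 + IZR j))%R) by (destruct Hj; subst j; apply L2).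
      rewrite Cmod_inv, Cmod_mult.
      2:{ apply Cmult_neq_0; auto. }
      unfold invsq. rewrite <- Rinv_mult. apply Rinv_le_contravar.
      - repeat apply Rmult_lt_0_compat; auto.
      - replace (d1 * d2 * ((1 + INR n) * (1 + INR n)))%R
          with ((d1 * (1 + INR n)) * (d2 * (1 + INR n)))%R by ring.
        apply Rmult_le_compat; auto; nra. }
    intros n. unfold scal; simpl. unfold mult; simpl.
    destruct n.
    - eapply Rle_trans. apply (B 0%nat); auto.
      assert (0 < / (d1 * d2))%R by (apply Rinv_0_lt_compat; nra).
      assert (P := invsq_pos 0). nra.
    - unfold bil. eapply Rle_trans. apply Cmod_triangle.
      assert (A1 := B (S n) (Z.of_nat (S n)) ltac:(auto)).
      assert (A2 := B (S n) (- Z.of_nat (S n))%Z ltac:(auto)). lra. }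
  split; auto.
  destruct (exists_nat_ge (5 * (Rabs (Re z1) + Rabs (Im z1)))) as [K1 HK1].
  destruct (exists_nat_ge (5 * (Rabs (Re z2) + Rabs (Im z2)))) as [K2 HK2].
  (* From K0 on, all arguments (z + j) / (2 K + 1) lie in the box of [qpar_lower], so one majorant
     serves for every K. Terms of index above K0 + K are set to 0, which turns the finite sums into
     series for [tannery]. *)
  set (K0 := (K1 + K2)%nat).
  apply clim_shift with K0.
  apply clim_ext with (fun K => Cseries (fun m => if (m <=? K0 + K)%nat then bil (pf_term (K0 + K) z1 z2) m else 0)).
  { intros K. rewrite (Cseries_finite _ (K0 + K)).
    - apply Csum_ext_loc. intros n Hn. now rewrite (proj2 (Nat.leb_le _ _) Hn).
    - intros n Hn. now rewrite (proj2 (Nat.leb_gt _ _) Hn). }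
  rewrite <- Cseries_scal by auto.
  apply tannery with (fun n => scal (2 * / (kq * d1) * / (kq * d2))%R (invsq n)).
  - intros K n. unfold scal; simpl. unfold mult; simpl.
    assert (P1 : (0 < / (kq * d1))%R) by (apply Rinv_0_lt_compat; nra).
    assert (P2 : (0 < / (kq * d2))%R) by (apply Rinv_0_lt_compat; nra).
    assert (P3 : (0 < / (kq * d1) * / (kq * d2))%R) by nra.
    assert (P := invsq_pos n).
    destruct (n <=? K0 + K)%nat eqn:E.
    2:{ rewrite Cmod_0. nra. }
    apply Nat.leb_le in E.
    assert (B : forall j, j = Z.of_nat n \/ j = (- Z.of_nat n)%Z ->
      (Cmod (pf_term (K0 + K) z1 z2 j) <= / (kq * d1) * / (kq * d2) * invsq n)%R).
    { intros j Hj. specialize (Hpos n).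
      assert (A1 : (d1 * (1 + INR n) <= Cmod (z1 + IZR j))%R) by (destruct Hj; subst j; apply L1).
      assert (A2 : (d2 * (1 + INR n) <= Cmod (z2 + IZR j))%R) by (destruct Hj; subst j; apply L2).
      assert (Hj' : (Z.abs j <= Z.of_nat (K0 + K))%Z) by (destruct Hj; subst j; lia).
      assert (I1 : (INR K1 <= INR (K0 + K))%R) by (apply le_INR; unfold K0; lia).
      assert (I2 : (INR K2 <= INR (K0 + K))%R) by (apply le_INR; unfold K0; lia).
      assert (F1 := pf_factor_lower (K0 + K) z1 j (d1 * (1 + INR n)) ltac:(lra) Hj' (Rmult_lt_0_compat _ _ Hd1 Hpos) A1).
      assert (F2 := pf_factor_lower (K0 + K) z2 j (d2 * (1 + INR n)) ltac:(lra) Hj' (Rmult_lt_0_compat _ _ Hd2 Hpos) A2).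
      unfold pf_term. rewrite 2!Cmod_mult, Cmod_qpar.
      replace (Im (IZR j * (1 / oddn (K0 + K)))) with 0%R.
      2:{ unfold Cdiv. rewrite <- RtoC_inv by (assert (O := oddn_pos (K0 + K)); lra).
          simpl. ring. }
      rewrite Rmult_0_r, Ropp_0, exp_0, Rmult_1_l.
      apply Rle_trans with (/ (kq * (d1 * (1 + INR n))) * / (kq * (d2 * (1 + INR n))))%R.
      - apply Rmult_le_compat; auto using Cmod_ge_0.
      - right. unfold invsq. field. repeat split; lra. }
    destruct n.
    + eapply Rle_trans. apply (B 0%Z); auto. nra.
    + unfold bil. eapply Rle_trans. apply Cmod_triangle.
      assert (A1 := B (Z.of_nat (S n)) ltac:(auto)).
      assert (A2 := B (- Z.of_nat (S n))%Z ltac:(auto)). lra.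
  - exact (ex_series_scal_l _ _ ex_series_invsq).
  - intros n.
    apply (clim_shift' (fun K => if (n <=? K)%nat then bil (pf_term K z1 z2) n else 0)).
    apply clim_ext_loc with (fun K => bil (pf_term K z1 z2) n) n.
    { intros K HK. now rewrite (proj2 (Nat.leb_le _ _) HK). }
    destruct n; unfold bil.
    + apply clim_pf_term; auto.
    + rewrite Cmult_plus_distr_l. apply clim_plus; apply clim_pf_term; auto.
Qed.

Lemma pf_term_sum K z1 z2 : non_integer z1 -> non_integer z2 ->
  Csum (bil (pf_term K z1 z2)) K = cc z1 * cc z2 *
    (/ oddn K * Csum (fun k => Cpow (qpar (z1 / oddn K)) k * Cpow (qpar (z2 / oddn K)) (2 * K - k)) (2 * K)).
Proof.
  intros H1 H2. assert (Ho := oddn_neq K).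
  assert (E := finite_pf2 K z1 z2 H1 H2).
  rewrite (Csum_ext _ (fun n => (/ oddn K * / oddn K) *
    bil (fun j => qpar (IZR j * (1 / oddn K)) *
     (/ (1 - qpar ((z1 + IZR j) / oddn K)) * / (1 - qpar ((z2 + IZR j) / oddn K)))) n)).
  - rewrite Csum_scal, E. unfold cc. field. repeat split; auto using qpar_neq_1.
  - intros n. rewrite <- bil_scal. apply bil_ext. intros j. unfold pf_term. field.
    repeat split; auto; apply qpar_neq_1, non_integer_div; auto.
Qed.

Lemma power_diff (a b : C) n :
  (a - b) * Csum (fun k => Cpow a k * Cpow b (n - k)) n = Cpow a (S n) - Cpow b (S n).
Proof.
  induction n; [simpl; ring|].
  rewrite Csum_S.
  rewrite (Csum_ext_loc _ (fun k => b * (Cpow a k * Cpow b (n - k)))).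
  2:{ intros k Hk. replace (S n - k)%nat with (S (n - k)) by lia. rewrite Cpow_S. ring. }
  rewrite Csum_scal, Nat.sub_diag.
  replace ((a - b) * (b * Csum (fun k => Cpow a k * Cpow b (n - k)) n + Cpow a (S n) * Cpow b 0))
    with (b * ((a - b) * Csum (fun k => Cpow a k * Cpow b (n - k)) n) + (a - b) * Cpow a (S n) * Cpow b 0) by ring.
  rewrite IHn, (Cpow_S a (S n)), (Cpow_S b (S n)). simpl (Cpow b 0). ring.
Qed.

Lemma qpar_div_pow0 z K : Cpow (qpar (z / oddn K)) (S (2 * K)) = qpar z.
Proof.
  rewrite <- (qpar_div_pow z K 0). f_equal. f_equal. f_equal. ring.
Qed.

(** The finite identity is multiplied by 2 K + 1 times the difference of [qpar (z1 / oddn K)] and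
    [qpar (z2 / oddn K)]. The sum of powers then collapses and the result is [cc z1 - cc z2] for
    every K, while the multiplier tends to [tpi * (z1 - z2)]. *)
Lemma pf_distinct z1 z2 : non_integer z1 -> non_integer z2 -> z1 <> z2 ->
  Cseries (bil (fun j => / ((z1 + IZR j) * (z2 + IZR j)))) = tpi * (cc z1 - cc z2) / (z1 - z2).
Proof.
  intros H1 H2 Hne. assert (T := tpi_neq_0).
  assert (Hd : z1 - z2 <> 0) by (intros E; apply Hne; replace z1 with (z1 - z2 + z2) by ring; rewrite E; ring).
  destruct (clim_pf_sum z1 z2 H1 H2) as [_ L].
  assert (L2 : clim (fun K => (oddn K * (1 - qpar (z2 / oddn K)) + - (1) * (oddn K * (1 - qpar (z1 / oddn K)))) *
                 Csum (bil (pf_term K z1 z2)) K)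
     ((- tpi * z2 + - (1) * (- tpi * z1)) * (/ (tpi * tpi) * Cseries (bil (fun j => / ((z1 + IZR j) * (z2 + IZR j))))))).
  { apply clim_mult; auto. apply clim_plus. apply clim_qpar_scaled.
    apply clim_scal, clim_qpar_scaled. }
  assert (E := clim_unique _ _ (cc z1 - cc z2) L2).
  replace (tpi * (cc z1 - cc z2) / (z1 - z2)) with ((cc z1 - cc z2) * (tpi / (z1 - z2))) by (field; auto).
  rewrite <- E.
  - field. auto.
  - apply clim_ext with (fun _ => cc z1 - cc z2). 2: apply clim_const.
    intros K. rewrite pf_term_sum by auto. assert (Ho := oddn_neq K).
    set (y1 := qpar (z1 / oddn K)). set (y2 := qpar (z2 / oddn K)).
    set (s := Csum _ _).
    assert (P : (y1 - y2) * s = qpar z1 - qpar z2).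
    { unfold s. rewrite power_diff. unfold y1, y2. now rewrite 2!qpar_div_pow0. }
    replace ((oddn K * (1 - y2) + - (1) * (oddn K * (1 - y1))) * (cc z1 * cc z2 * (/ oddn K * s)))
      with (cc z1 * cc z2 * ((y1 - y2) * s)) by (field; auto).
    rewrite P. unfold cc. field. split; apply qpar_neq_1; auto.
Qed.

(** The right side is pi^2 / sin^2 (pi z). For z1 = z2 the sum of powers degenerates to 2 K + 1
    equal terms. *)
Lemma pf_equal z : non_integer z ->
  Cseries (bil (fun j => / ((z + IZR j) * (z + IZR j)))) = tpi * tpi * (cc z * cc z * qpar z).
Proof.
  intros H. assert (T := tpi_neq_0).
  destruct (clim_pf_sum z z H H) as [_ L].
  assert (E := clim_unique _ _ (cc z * cc z * qpar z) L).
  rewrite <- E.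
  - field. auto.
  - apply clim_ext with (fun K => (cc z * cc z * qpar z) * / qpar (z / oddn K)).
    + intros K. rewrite pf_term_sum by auto. assert (Ho := oddn_neq K).
      set (y := qpar (z / oddn K)). assert (Hy : y <> 0) by apply qpar_neq_0.
      rewrite (Csum_ext_loc _ (fun _ => Cpow y (2 * K))).
      2:{ intros k Hk. rewrite <- Cpow_add_r. f_equal. lia. }
      rewrite Csum_const. replace (INR (S (2 * K))) with (oddn K) by (unfold oddn; f_equal; lia).
      rewrite <- (qpar_div_pow0 z K). fold y. rewrite Cpow_S. field. auto.
    + replace (cc z * cc z * qpar z) with (cc z * cc z * qpar z * / 1) at 1 by field.
      apply clim_scal. apply clim_inv. apply clim_qpar_1.
      intros F; injection F; lra.
Qed.

(** * Conditionally convergent lattice sums *)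

(** Symmetric summation. The summability that goes with it concerns the pairs f j + f (- j), and is
    weaker than absolute summability of f. *)
Definition Zsum (f : Z -> C) : C := Cseries (bil f).
Definition Zsummable (f : Z -> C) : Prop := csummable (bil f).

Lemma Zsum_ext f g : (forall j, f j = g j) -> Zsum f = Zsum g.
Proof. intros H. apply Cseries_ext. intros n. now apply bil_ext. Qed.

Lemma Zsummable_ext f g : (forall j, f j = g j) -> Zsummable f -> Zsummable g.
Proof. intros H. apply csummable_ext. intros n. now apply bil_ext. Qed.

Lemma Zsum_opp f : Zsum (fun j => f (- j)%Z) = Zsum f.
Proof. apply Cseries_ext. intros n. apply bil_opp. Qed.

Lemma Zsum_scal c f : Zsummable f -> Zsum (fun j => c * f j) = c * Zsum f.
Proof.
  intros H. unfold Zsum. rewrite <- Cseries_scal by auto.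
  apply Cseries_ext. intros n. apply bil_scal.
Qed.

Lemma Zsummable_scal c f : Zsummable f -> Zsummable (fun j => c * f j).
Proof.
  intros H. apply csummable_ext with (fun n => c * bil f n).
  intros n. now rewrite bil_scal. now apply csummable_scal.
Qed.

Lemma Zsum_plus f g : Zsummable f -> Zsummable g ->
  Zsum (fun j => f j + g j) = Zsum f + Zsum g.
Proof.
  intros Hf Hg. unfold Zsum. rewrite <- Cseries_plus by auto.
  apply Cseries_ext. intros n. apply bil_plus.
Qed.

Lemma Zsummable_plus f g : Zsummable f -> Zsummable g -> Zsummable (fun j => f j + g j).
Proof.
  intros Hf Hg. apply csummable_ext with (fun n => bil f n + bil g n).
  intros n. now rewrite bil_plus. now apply csummable_plus.
Qed.

Lemma Zsummable_minus f g : Zsummable f -> Zsummable g -> Zsummable (fun j => f j - g j).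
Proof.
  intros Hf Hg. apply Zsummable_ext with (fun j => f j + - (1) * g j). intros; ring.
  apply Zsummable_plus; auto. now apply Zsummable_scal.
Qed.

Lemma Zsum_minus f g : Zsummable f -> Zsummable g ->
  Zsum (fun j => f j - g j) = Zsum f - Zsum g.
Proof.
  intros Hf Hg. rewrite (Zsum_ext _ (fun j => f j + - (1) * g j)) by (intros; ring).
  rewrite Zsum_plus, Zsum_scal; auto. ring. now apply Zsummable_scal.
Qed.

Lemma Zsum_bil (f : Z -> Z -> C) i : (forall m, Zsummable (f m)) ->
  Cseries (fun k => bil (fun m => bil (f m) k) i) = bil (fun m => Zsum (f m)) i.
Proof.
  intros H. destruct i; unfold bil at 1 3; fold bil.
  - reflexivity.
  - apply Cseries_plus; apply H.
Qed.

Lemma bil_swap (f : Z -> Z -> C) i k :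
  bil (fun m => bil (f m) k) i = bil (fun n => bil (fun m => f m n) i) k.
Proof. destruct i, k; simpl; ring. Qed.

(** Each entry groups the points with coordinates +i or -i and +k or -k: four of them, fewer on the
    axes. *)
Definition Zdsummable (f : Z -> Z -> C) : Prop :=
  dsummable (fun i k => bil (fun m => bil (f m) k) i).

Lemma Zsum_swap (f : Z -> Z -> C) :
  (forall m, Zsummable (f m)) -> (forall n, Zsummable (fun m => f m n)) -> Zdsummable f ->
  Zsummable (fun m => Zsum (f m)) /\ Zsummable (fun n => Zsum (fun m => f m n)) /\
  Zsum (fun m => Zsum (f m)) = Zsum (fun n => Zsum (fun m => f m n)).
Proof.
  intros H1 H2 H3.
  assert (E1 : forall i, Cseries (fun k => bil (fun m => bil (f m) k) i) = bil (fun m => Zsum (f m)) i).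
  { intros i. now apply Zsum_bil. }
  assert (E2 : forall k, Cseries (fun i => bil (fun m => bil (f m) k) i) = bil (fun n => Zsum (fun m => f m n)) k).
  { intros k. rewrite (Cseries_ext _ (fun i => bil (fun n => bil (fun m => f m n) i) k)).
    apply (Zsum_bil (fun n m => f m n)); auto. intros i. apply bil_swap. }
  repeat split.
  - apply csummable_ext with (1 := E1). apply (csummable_rows (fun i k => bil (fun m => bil (f m) k) i)); apply H3.
  - apply csummable_ext with (1 := E2). apply (csummable_cols (fun i k => bil (fun m => bil (f m) k) i)); apply H3.
  - unfold Zsum at 1 3. rewrite <- (Cseries_ext _ _ E1), <- (Cseries_ext _ _ E2).
    apply (dseries_swap (fun i k => bil (fun m => bil (f m) k) i)). exact H3.
Qed.

Lemma finite_max (f : nat -> nat -> R) M :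
  exists c, (0 <= c)%R /\ forall i k, (i <= M)%nat -> (k <= M)%nat -> (f i k <= c)%R.
Proof.
  assert (P : forall (g : nat -> R) N, exists c, (0 <= c)%R /\ forall i, (i <= N)%nat -> (g i <= c)%R).
  { intros g N. induction N.
    - exists (Rmax 0 (g 0%nat)). split; [apply Rmax_l|]. intros i Hi.
      replace i with 0%nat by lia. apply Rmax_r.
    - destruct IHN as [c [Hc HN]]. exists (Rmax c (g (S N))). split.
      + eapply Rle_trans; [apply Hc|apply Rmax_l].
      + intros i Hi. destruct (Nat.eq_dec i (S N)) as [->|]; [apply Rmax_r|].
        eapply Rle_trans; [apply HN; lia|apply Rmax_l]. }
  assert (Q : forall N, exists c, (0 <= c)%R /\ forall i k, (i <= N)%nat -> (k <= M)%nat -> (f i k <= c)%R).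
  { intros N. induction N.
    - destruct (P (f 0%nat) M) as [c [Hc H]]. exists c. split; auto.
      intros i k Hi Hk. replace i with 0%nat by lia. auto.
    - destruct IHN as [c [Hc HN]]. destruct (P (f (S N)) M) as [c' [Hc' H']].
      exists (Rmax c c'). split.
      + eapply Rle_trans; [apply Hc|apply Rmax_l].
      + intros i k Hi Hk. destruct (Nat.eq_dec i (S N)) as [->|].
        * eapply Rle_trans; [apply H'; auto|apply Rmax_r].
        * eapply Rle_trans; [apply HN; lia|apply Rmax_l]. }
  apply Q.
Qed.

Lemma dsummable_eventually (A : nat -> nat -> C) (c : R) M :
  (forall i k, (M < i + k)%nat -> (Cmod (A i k) <= c * (invsq i * invsq k))%R) -> dsummable A.
Proof.
  intros H.
  destruct (finite_max (fun i k => Cmod (A i k) * / (invsq i * invsq k))%R M) as [c' [Hc' HM]].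
  assert (P : forall i k, (0 < invsq i * invsq k)%R).
  { intros. apply Rmult_lt_0_compat; apply invsq_pos. }
  apply dsummable_prod with (fun i => Rmax c c' * invsq i)%R invsq.
  - intros i k. specialize (P i k). rewrite Rmult_assoc.
    destruct (le_lt_dec (i + k) M).
    + apply Rle_trans with (c' * (invsq i * invsq k))%R.
      * specialize (HM i k ltac:(lia) ltac:(lia)).
        apply Rmult_le_reg_r with (/ (invsq i * invsq k))%R; [now apply Rinv_0_lt_compat|].
        rewrite (Rmult_assoc c'), Rinv_r by lra. lra.
      * apply Rmult_le_compat_r; [lra|apply Rmax_r].
    + eapply Rle_trans; [apply H; auto|]. apply Rmult_le_compat_r; [lra|apply Rmax_l].
  - exact (ex_series_scal_l _ _ ex_series_invsq).
  - exact ex_series_invsq.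
Qed.

(** * Lattice sums of 1 / (w^2 - t^2) *)

Lemma lattice_zero s (n : Z) (x : R) : (0 < Im s)%R -> IZR n * s + x = 0 -> n = 0%Z /\ x = 0%R.
Proof.
  intros Hs E. destruct s as [a b]. simpl in Hs.
  unfold Cplus, Cmult, RtoC in E. injection E. simpl. intros E2 E1.
  assert (Hn : IZR n = 0%R) by nra.
  split. now apply eq_IZR. rewrite Hn in E1. lra.
Qed.

(** Both coordinates are controlled by |w|: |n| Im s <= |w| and |m| <= |w| + |n| |s|. The constant
    is read off from these two bounds. *)
Lemma lattice_lower s : (0 < Im s)%R -> exists d, (0 < d)%R /\
  forall m n : Z, (d * (Rabs (IZR m) + Rabs (IZR n)) <= Cmod (IZR n * s + IZR m))%R.
Proof.
  intros Hs. assert (G := Cmod_ge_0 s).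
  assert (P : (0 < / Im s + 1 + Cmod s / Im s)%R).
  { assert (0 < / Im s)%R by now apply Rinv_0_lt_compat.
    assert (0 <= Cmod s / Im s)%R; [|lra]. unfold Rdiv. nra. }
  exists (/ (/ Im s + 1 + Cmod s / Im s))%R. split; [now apply Rinv_0_lt_compat|].
  intros m n. set (w := IZR n * s + IZR m).
  assert (H1 : (Rabs (IZR n) * Im s <= Cmod w)%R).
  { rewrite <- (Rabs_pos_eq (Im s)) by lra. rewrite <- Rabs_mult.
    replace (IZR n * Im s)%R with (Im w).
    - apply im_le_Cmod.
    - unfold w. destruct s. simpl. ring. }
  assert (H2 : (Rabs (IZR m) <= Cmod w + Rabs (IZR n) * Cmod s)%R).
  { rewrite <- 2!Cmod_R, <- Cmod_mult, <- (Cmod_opp (_ * s)).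
    replace (RtoC (IZR m)) with (w + - (IZR n * s)) by (unfold w; ring). apply Cmod_triangle. }
  apply Rmult_le_reg_l with (/ Im s + 1 + Cmod s / Im s)%R; auto.
  rewrite <- Rmult_assoc, Rinv_r, Rmult_1_l by lra.
  assert (H3 : (Rabs (IZR n) <= Cmod w / Im s)%R).
  { apply Rmult_le_reg_r with (Im s); auto. unfold Rdiv. rewrite Rmult_assoc, Rinv_l by lra. lra. }
  assert (H4 : (Rabs (IZR n) * Cmod s <= Cmod w / Im s * Cmod s)%R) by (apply Rmult_le_compat_r; auto).
  replace ((/ Im s + 1 + Cmod s / Im s) * Cmod w)%R with
    (Cmod w / Im s + (Cmod w + Cmod w / Im s * Cmod s))%R by (field; lra).
  lra.
Qed.

Lemma Cinv2_neq_0 : / RtoC 2 <> 0.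
Proof. rewrite <- RtoC_inv by lra. intros F; injection F; lra. Qed.

Definition lat (s t : C) (m n : Z) : C :=
  / ((IZR n * s + IZR m) * (IZR n * s + IZR m) - t * t).

Lemma Cinv_sub (p u v : C) : p - u <> 0 -> p - v <> 0 ->
  / (p - u) - / (p - v) = (u - v) * (/ (p - u) * / (p - v)).
Proof. intros H1 H2. field. auto. Qed.

(** One term decays only like |w|^(-2), but the difference of two terms with the same w decays like
    |w|^(-4), which is absolutely summable over the lattice. The value 1/2 is the one for which both
    iterated sums are known. *)
Lemma lat_diff_bound s t : (0 < Im s)%R -> exists c M, (0 <= c)%R /\ forall m n : Z,
  (INR M < Rabs (IZR m) + Rabs (IZR n))%R ->
  (Cmod (lat s t m n - lat s (/ 2) m n) <= c * (invsq (Z.abs_nat m) * invsq (Z.abs_nat n)))%R.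
Proof.
  intros Hs. destruct (lattice_lower s Hs) as [d [Hd HL]].
  assert (Ht := Cmod_ge_0 t).
  (* Beyond M one has |w| >= 2 |t| + 2, which makes both denominators at least (3/4) |w|^2. *)
  destruct (exists_nat_ge ((2 * Cmod t + 2) / d + 1)) as [M HM].
  assert (HdM : (2 * Cmod t + 2 <= d * (INR M - 1))%R).
  { apply Rle_trans with (d * ((2 * Cmod t + 2) / d))%R.
    - right. field. lra.
    - apply Rmult_le_compat_l; lra. }
  assert (Hk := Cmod_ge_0 (t * t - / 2 * / 2)).
  (* A factor 16 comes from (1 + |m|) (1 + |n|) <= 4 (|m| + |n|)^2, squared; the remaining 2 leaves
     1/2 to be compared with (3/4)^2. *)
  exists (Cmod (t * t - / 2 * / 2) * (32 / d ^ 4))%R, M. split.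
  { apply Rmult_le_pos; auto. apply Rmult_le_pos; [lra|]. left. apply Rinv_0_lt_compat. now apply pow_lt. }
  intros m n Hmn. specialize (HL m n). unfold lat.
  set (w := IZR n * s + IZR m) in *. set (x := Rabs (IZR m)) in *. set (y := Rabs (IZR n)) in *.
  assert (Hx : (0 <= x)%R) by apply Rabs_pos. assert (Hy : (0 <= y)%R) by apply Rabs_pos.
  assert (Hw : (2 * Cmod t + 2 <= Cmod w)%R) by nra.
  assert (Hxy1 : (1 <= x + y)%R).
  { assert (0 <= (2 * Cmod t + 2) / d)%R; [|lra]. apply Rmult_le_pos; [lra|]. left. now apply Rinv_0_lt_compat. }
  assert (Low : forall u, (2 * Cmod u <= Cmod w)%R -> (Cmod w * Cmod w * (3 / 4) <= Cmod (w * w - u * u))%R).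
  { intros u Hu. assert (Gu := Cmod_ge_0 u).
    assert (T : (Cmod (w * w) <= Cmod (w * w - u * u) + Cmod (u * u))%R).
    { replace (w * w) with ((w * w - u * u) + u * u) at 1 by ring. apply Cmod_triangle. }
    rewrite 2!Cmod_mult in T. nra. }
  assert (L1 := Low t ltac:(lra)).
  assert (L2 := Low (/ 2) ltac:(rewrite <- RtoC_inv, Cmod_R, Rabs_pos_eq; lra)).
  assert (Gw : (0 < Cmod w * Cmod w)%R) by nra.
  assert (N1 : w * w - t * t <> 0) by (apply Cmod_gt_0; lra).
  assert (N2 : w * w - / 2 * / 2 <> 0) by (apply Cmod_gt_0; lra).
  replace (/ (w * w - t * t) - / (w * w - / 2 * / 2)) with
    ((t * t - / 2 * / 2) * (/ (w * w - t * t) * / (w * w - / 2 * / 2))).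
  2:{ symmetry. now apply Cinv_sub. }
  rewrite Cmod_mult, Rmult_assoc. apply Rmult_le_compat_l; auto.
  rewrite Cmod_mult, 2!Cmod_inv by auto. rewrite <- Rinv_mult.
  assert (Ex : (1 + INR (Z.abs_nat m) = 1 + x)%R).
  { unfold x. rewrite INR_IZR_INZ, Zabs2Nat.id_abs, abs_IZR. reflexivity. }
  assert (Ey : (1 + INR (Z.abs_nat n) = 1 + y)%R).
  { unfold y. rewrite INR_IZR_INZ, Zabs2Nat.id_abs, abs_IZR. reflexivity. }
  unfold invsq. rewrite Ex, Ey.
  replace (32 / d ^ 4 * (/ ((1 + x) * (1 + x)) * / ((1 + y) * (1 + y))))%R with
    (/ (d ^ 4 / 32 * (((1 + x) * (1 + y)) ^ 2)))%R by (field; lra).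
  assert (Z1 : ((1 + x) * (1 + y) <= 4 * (x + y) ^ 2)%R) by nra.
  assert (P1 : (0 < (1 + x) * (1 + y))%R) by nra.
  assert (Z2 : (((1 + x) * (1 + y)) ^ 2 <= 16 * (x + y) ^ 4)%R).
  { replace (16 * (x + y) ^ 4)%R with ((4 * (x + y) ^ 2) ^ 2)%R by ring. apply pow_incr. lra. }
  apply Rinv_le_contravar.
  - apply Rmult_lt_0_compat. apply Rdiv_lt_0_compat; [now apply pow_lt|lra]. now apply pow_lt.
  - assert (D4 : (0 < d ^ 4)%R) by now apply pow_lt.
    apply Rle_trans with (d ^ 4 / 32 * (16 * (x + y) ^ 4))%R.
    { apply Rmult_le_compat_l; [lra|auto]. }
    replace (d ^ 4 / 32 * (16 * (x + y) ^ 4))%R with ((d * (x + y)) ^ 4 / 2)%R by field.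
    assert (Z3 : ((d * (x + y)) ^ 4 <= Cmod w ^ 4)%R).
    { apply pow_incr. split; [nra|auto]. }
    apply Rle_trans with ((Cmod w * Cmod w * (3 / 4)) * (Cmod w * Cmod w * (3 / 4)))%R.
    + replace (Cmod w ^ 4)%R with (Cmod w * Cmod w * (Cmod w * Cmod w))%R in Z3 by ring. nra.
    + apply Rmult_le_compat; lra.
Qed.

Lemma lat_diff_dsummable s t : (0 < Im s)%R ->
  Zdsummable (fun m n => lat s t m n - lat s (/ 2) m n).
Proof.
  intros Hs. destruct (lat_diff_bound s t Hs) as [c [M [Hc H]]].
  apply dsummable_eventually with (4 * c)%R M.
  intros i k Hik. set (D := fun m n => lat s t m n - lat s (/ 2) m n) in *.
  set (b := (c * (invsq i * invsq k))%R).
  assert (Hb : (0 <= b)%R).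
  { apply Rmult_le_pos; auto. left. apply Rmult_lt_0_compat; apply invsq_pos. }
  assert (HD : forall m n, Z.abs_nat m = i -> Z.abs_nat n = k -> (Cmod (D m n) <= b)%R).
  { intros m n <- <-. apply H. rewrite <- 2!abs_IZR, <- plus_IZR, INR_IZR_INZ.
    apply IZR_lt. lia. }
  replace (4 * c * (invsq i * invsq k))%R with (4 * b)%R by (unfold b; ring).
  assert (HB : forall m, Z.abs_nat m = i -> (Cmod (bil (D m) k) <= 2 * b)%R).
  { intros m Hm. destruct k; unfold bil.
    - specialize (HD m 0%Z Hm eq_refl). lra.
    - eapply Rle_trans. apply Cmod_triangle.
      assert (A1 := HD m (Z.of_nat (S k)) Hm ltac:(lia)).
      assert (A2 := HD m (- Z.of_nat (S k))%Z Hm ltac:(lia)). lra. }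
  destruct i.
  - specialize (HB 0%Z eq_refl). change (Cmod (bil (D 0%Z) k) <= 4 * b)%R. lra.
  - change (Cmod (bil (D (Z.of_nat (S i))) k + bil (D (- Z.of_nat (S i))%Z) k) <= 4 * b)%R.
    eapply Rle_trans. apply Cmod_triangle.
    assert (A1 := HB (Z.of_nat (S i)) ltac:(lia)).
    assert (A2 := HB (- Z.of_nat (S i))%Z ltac:(lia)). lra.
Qed.

Lemma half_non_integer s n : (0 < Im s)%R ->
  non_integer (IZR n * s + / 2) /\ non_integer (IZR n * s - / 2).
Proof.
  intros Hs.
  assert (P : forall x : R, (forall k : Z, x + IZR k <> 0)%R -> non_integer (IZR n * s + x)).
  { intros x Hx k E. destruct (lattice_zero s n (x + IZR k) Hs).
    - rewrite RtoC_plus. rewrite <- E. ring.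
    - now apply (Hx k). }
  assert (Hk : forall k : Z, (/ 2 + IZR k <> 0)%R).
  { intros k E. assert (F : IZR (1 + 2 * k) = 0%R) by (rewrite plus_IZR, mult_IZR; lra).
    apply eq_IZR in F. lia. }
  split.
  - rewrite <- RtoC_inv by lra. now apply P.
  - rewrite <- RtoC_inv by lra. unfold Cminus. rewrite <- RtoC_opp. apply P.
    intros k E. apply (Hk (- k)%Z). rewrite opp_IZR. lra.
Qed.

Lemma half_col_non_integer s m : (0 < Im s)%R ->
  non_integer ((IZR m + / 2) / s) /\ non_integer ((IZR m - / 2) / s).
Proof.
  intros Hs.
  assert (Ns : s <> 0) by (intros E; rewrite E in Hs; simpl in Hs; lra).
  assert (P : forall x : R, (x <> 0)%R -> non_integer (x / s)).
  { intros x Hx k E. destruct (lattice_zero s k x Hs); [|tauto].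
    replace (IZR k * s + x) with ((x / s + IZR k) * s) by (field; auto). rewrite E. ring. }
  assert (Hk : forall k : Z, (IZR k + / 2 <> 0)%R).
  { intros k E. assert (F : IZR (1 + 2 * k) = 0%R) by (rewrite plus_IZR, mult_IZR; lra).
    apply eq_IZR in F. lia. }
  split.
  - rewrite <- RtoC_inv, <- RtoC_plus by lra. apply P, Hk.
  - rewrite <- RtoC_inv, <- RtoC_minus by lra. apply P.
    intros E. apply (Hk (m - 1)%Z). rewrite minus_IZR. lra.
Qed.

Lemma cc_opp z : 1 - qpar z <> 0 -> cc (- z) = 1 - cc z.
Proof.
  intros H. unfold cc. rewrite qpar_opp. assert (N := qpar_neq_0 z).
  field. repeat split; auto.
  intros E. apply H. replace (1 - qpar z) with (- (qpar z - 1)) by ring. rewrite E. ring.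
Qed.

Lemma cc_plus_IZR z n : cc (z + IZR n) = cc z.
Proof. unfold cc. now rewrite qpar_plus_IZR. Qed.

Lemma lat_row (s t : C) n : non_integer (IZR n * s + t) -> non_integer (IZR n * s - t) -> t <> 0 ->
  Zsummable (fun m => lat s t m n) /\
  Zsum (fun m => lat s t m n) = tpi * (cc (IZR n * s + t) - cc (IZR n * s - t)) / (2 * t).
Proof.
  intros H1 H2 Ht.
  assert (E : forall m, / ((IZR n * s + t + IZR m) * (IZR n * s - t + IZR m)) = lat s t m n).
  { intros m. unfold lat. f_equal. ring. }
  split.
  - apply Zsummable_ext with (1 := E). apply (clim_pf_sum _ _ H1 H2).
  - rewrite <- (Zsum_ext _ _ E). unfold Zsum. rewrite pf_distinct; auto.
    + f_equal. ring.
    + intros F. apply Ht. replace t with (((IZR n * s + t) - (IZR n * s - t)) / 2) by field.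
      rewrite F. field.
Qed.

(** Dividing both factors of w^2 - t^2 by s makes the column a cotangent series in n. *)
Lemma lat_col (s t : C) m : s <> 0 -> non_integer ((IZR m + t) / s) -> non_integer ((IZR m - t) / s) -> t <> 0 ->
  Zsummable (fun n => lat s t m n) /\
  Zsum (fun n => lat s t m n) = tpi / s * (cc ((IZR m + t) / s) - cc ((IZR m - t) / s)) / (2 * t).
Proof.
  intros Hs H1 H2 Ht.
  assert (E : forall n, / (s * s) * / (((IZR m + t) / s + IZR n) * ((IZR m - t) / s + IZR n)) = lat s t m n).
  { intros n. unfold lat.
    replace ((IZR n * s + IZR m) * (IZR n * s + IZR m) - t * t) with
      ((s * s) * (((IZR m + t) / s + IZR n) * ((IZR m - t) / s + IZR n))) by (field; auto).
    field. repeat split; auto.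
    - specialize (H2 n). intros F. apply H2.
      replace ((IZR m - t) / s + IZR n) with ((IZR m - t + IZR n * s) / s) by (field; auto).
      rewrite F. field; auto.
    - specialize (H1 n). intros F. apply H1.
      replace ((IZR m + t) / s + IZR n) with ((IZR m + t + IZR n * s) / s) by (field; auto).
      rewrite F. field; auto. }
  assert (S0 := proj1 (clim_pf_sum _ _ H1 H2)).
  split.
  - apply Zsummable_ext with (1 := E). now apply Zsummable_scal.
  - etransitivity; [symmetry; exact (Zsum_ext _ _ E)|].
    rewrite Zsum_scal by exact S0. unfold Zsum. rewrite pf_distinct; auto.
    + field. repeat split; auto. 
      replace (IZR m + t - (IZR m - t)) with (2 * t) by ring. apply Cmult_neq_0; auto.
      intros F; injection F; lra.
    + intros F. apply Ht. replace t with (((IZR m + t) / s - (IZR m - t) / s) * s / 2) by (field; auto).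
      rewrite F. field. auto.
Qed.

(** Since Im s > 0, the imaginary part of the argument tends to - infinity, so that |[qpar]| grows
    without bound. *)
Lemma clim_cc_half s : (0 < Im s)%R -> clim (fun K => cc ((INR K + / 2) / s)) 0.
Proof.
  intros Hs.
  assert (Ns : s <> 0) by (intros E; rewrite E in Hs; simpl in Hs; lra).
  set (v := (Im s / Cmod s ^ 2)%R).
  assert (Gs : (0 < Cmod s)%R) by now apply Cmod_gt_0.
  assert (Hv : (0 < v)%R) by (apply Rdiv_lt_0_compat; auto; now apply pow_lt).
  assert (PP := PI_RGT_0).
  intros eps He. destruct (exists_nat_ge (/ (v * eps))) as [N HN].
  exists N. intros n Hn. assert (Hn' := le_INR _ _ Hn).
  assert (EI : Im ((INR n + / 2) / s) = (- ((INR n + / 2) * v))%R).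
  { rewrite <- RtoC_inv, <- RtoC_plus by lra. unfold v. rewrite Cmod2_alt. destruct s as [a b].
    unfold Cdiv, Cinv, Cmult, RtoC. simpl. simpl in Hs. field. nra. }
  assert (Hq : (1 + v * (INR n + / 2) <= Cmod (qpar ((INR n + / 2) / s)))%R).
  { rewrite Cmod_qpar, EI. eapply Rle_trans; [|apply exp_ineq1_le].
    assert (0 <= INR n)%R by apply pos_INR. assert (P3 : (3 < PI)%R) by (assert (Q := PI2_3_2); unfold PI2 in Q; lra).
    assert (0 < v * (INR n + / 2))%R by nra. nra. }
  set (q := qpar _) in *.
  assert (T : (Cmod q - 1 <= Cmod (1 - q))%R).
  { assert (T := Cmod_triangle (q - 1) 1). replace (q - 1 + 1) with q in T by ring.
    rewrite Cmod_1 in T. replace (1 - q) with (- (q - 1)) by ring. rewrite Cmod_opp. lra. }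
  assert (Hpos : (0 < v * (INR n + / 2))%R) by (assert (0 <= INR n)%R by apply pos_INR; nra).
  unfold cc. fold q. replace (/ (1 - q) - 0) with (/ (1 - q)) by ring.
  rewrite Cmod_inv by (apply Cmod_gt_0; lra).
  apply Rle_lt_trans with (/ (v * (INR n + / 2)))%R.
  { apply Rinv_le_contravar; lra. }
  assert (Hve : (0 < v * eps)%R) by nra.
  apply Rmult_lt_reg_r with (v * (INR n + / 2))%R; auto. rewrite Rinv_l by lra.
  apply Rle_lt_trans with (eps * v * / (v * eps))%R. right. field. lra.
  nra.
Qed.

(** For t = 1/2 the column sums are differences g (m + 1) - g m and telescope. The ends are [cc z]
    and [cc (- z) = 1 - cc z] with [cc z] tending to 0: the total is a boundary term that does not
    vanish, whereas all row sums do. *)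
Lemma lat_half_cols s : (0 < Im s)%R ->
  @is_series C_AbsRing C_NormedModule (bil (fun m => Zsum (fun n => lat s (/ 2) m n))) (- tpi / s).
Proof.
  intros Hs.
  assert (Ns : s <> 0) by (intros E; rewrite E in Hs; simpl in Hs; lra).
  set (g := fun j => tpi / s * cc ((IZR j - / 2) / s)).
  apply is_series_clim.
  apply clim_ext with (fun K => tpi / s * (2 * cc ((INR K + / 2) / s) + - (1))).
  - intros K. rewrite (Csum_ext _ (bil (fun j => g (j + 1)%Z - g j))).
    + rewrite bil_telescope. unfold g.
      replace ((IZR (Z.of_nat K + 1) - / 2) / s) with ((INR K + / 2) / s).
      2:{ rewrite plus_IZR, <- INR_IZR_INZ, RtoC_plus. field. auto. }
      replace ((IZR (- Z.of_nat K) - / 2) / s) with (- ((INR K + / 2) / s)).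
      2:{ rewrite opp_IZR, <- INR_IZR_INZ, RtoC_opp. field. auto. }
      rewrite cc_opp. ring.
      apply qpar_neq_1. destruct (half_col_non_integer s (Z.of_nat K) Hs) as [H _].
      now rewrite <- INR_IZR_INZ in H.
    + intros n. apply bil_ext. intros m.
      destruct (half_col_non_integer s m Hs) as [H1 H2].
      rewrite (proj2 (lat_col s (/ 2) m Ns H1 H2 Cinv2_neq_0)).
      unfold g. replace ((IZR (m + 1) - / 2) / s) with ((IZR m + / 2) / s).
      2:{ rewrite plus_IZR, RtoC_plus. field. auto. }
      field. auto.
  - replace (- tpi / s) with (tpi / s * (2 * 0 + - (1))) by (field; auto).
    apply clim_scal. apply clim_plus. apply clim_scal. now apply clim_cc_half. apply clim_const.
Qed.

(* The sum is only conditionally convergent; the defect [2 pi i / s] is read off from the case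
   [t = 1/2], in which both iterated sums telescope. *)
Lemma lat_swap s t : (0 < Im s)%R ->
  (forall n, Zsummable (fun m => lat s t m n)) -> (forall m, Zsummable (fun n => lat s t m n)) ->
  Zsum (fun m => Zsum (fun n => lat s t m n)) = Zsum (fun n => Zsum (fun m => lat s t m n)) - tpi / s.
Proof.
  intros Hs Hr Hc.
  assert (Ns : s <> 0) by (intros E; rewrite E in Hs; simpl in Hs; lra).
  assert (N2 := Cinv2_neq_0).
  set (D := fun m n => lat s t m n - lat s (/ 2) m n).
  assert (Rr : forall n, Zsummable (fun m => lat s (/ 2) m n) /\ Zsum (fun m => lat s (/ 2) m n) = 0).
  { intros n. destruct (half_non_integer s n Hs) as [H1 H2].
    destruct (lat_row s (/ 2) n H1 H2 N2) as [S1 S2]. split; auto. rewrite S2.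
    replace (cc (IZR n * s + / 2)) with (cc (IZR n * s - / 2)).
    - field.
    - rewrite <- (cc_plus_IZR _ 1). f_equal. field. }
  assert (Rc : forall m, Zsummable (fun n => lat s (/ 2) m n)).
  { intros m. destruct (half_col_non_integer s m Hs) as [H1 H2]. now apply lat_col. }
  destruct (Zsum_swap D) as [S1 [S2 E]].
  - intros m. apply Zsummable_minus; auto.
  - intros n. apply Zsummable_minus; auto. apply Rr.
  - now apply lat_diff_dsummable.
  - assert (E2 : Zsum (fun n => Zsum (fun m => lat s t m n)) = Zsum (fun n => Zsum (fun m => D m n))).
    { apply Zsum_ext. intros n. unfold D. rewrite Zsum_minus; auto; [|apply Rr].
      rewrite (proj2 (Rr n)). ring. }
    rewrite E2, <- E. unfold Zsum at 1. apply Cseries_unique.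
    apply is_series_clim.
    apply clim_ext with (fun K => Csum (bil (fun m => Zsum (D m))) K +
         Csum (bil (fun m => Zsum (fun n => lat s (/ 2) m n))) K).
    + intros K. rewrite <- Csum_plus. apply Csum_ext. intros n. rewrite <- bil_plus.
      apply bil_ext. intros m.
      assert (F : Zsum (D m) = Zsum (lat s t m) - Zsum (lat s (/ 2) m)).
      { apply (Zsum_minus (lat s t m)); auto. }
      rewrite F. change (fun n0 => lat s t m n0) with (lat s t m).
      change (fun n0 => lat s (/ 2) m n0) with (lat s (/ 2) m). ring.
    + replace (Zsum (fun m => Zsum (D m)) - tpi / s) with (Zsum (fun m => Zsum (D m)) + - tpi / s).
      2:{ field; auto. }
      apply clim_plus.
      * apply Cseries_clim. exact S1.
      * apply is_series_clim. now apply lat_half_cols.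
Qed.

(** * The quadratic character and divisor sums *)

Definition chi3 (n : nat) : Z :=
  match Nat.modulo n 3 with 1%nat => 1%Z | 2%nat => (-1)%Z | _ => 0%Z end.

Module Arithmetic.
Open Scope nat_scope.
From HB Require Import structures.
From mathcomp Require Import all_boot all_fingroup all_solvable all_algebra all_field ring.
Set Implicit Arguments.
Unset Strict Implicit.
Unset Printing Implicit Defensive.
Import GRing.Theory.

Lemma modnE_nat (m d : nat) : Nat.modulo m d = (m %% d)%N.
Proof.
case: d => [|d]; first by rewrite modn0.
have Hd : (m %% d.+1 < d.+1)%N by rewrite ltn_mod.
apply/esym/(Nat.mod_unique m d.+1 (m %/ d.+1)); first by apply/ltP.
rewrite {1}(divn_eq m d.+1) plusE multE mulnC //.
Qed.

Lemma chi3M m n : chi3 (m * n) = Z.mul (chi3 m) (chi3 n).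
Proof.
rewrite /chi3 !modnE_nat -modnMm.
have := ltn_pmod m (isT : (0 < 3)%N); have := ltn_pmod n (isT : (0 < 3)%N).
by move: (m %% 3)%N (n %% 3)%N => [|[|[|//]]] [|[|[|//]]].
Qed.

Lemma chi3X m k : chi3 (m ^ k) = Z.pow (chi3 m) (Z.of_nat k).
Proof.
elim: k => [//|k IH].
by rewrite expnS chi3M IH Nat2Z.inj_succ Z.pow_succ_r //; apply: Zle_0_nat.
Qed.

Lemma sqr_mod_p (p x : nat) : (0 < p)%N ->
  Z.eqb (Z.modulo (Z.sub (Z.mul (Z.of_nat x) (Z.of_nat x)) (Zneg 3)) (Z.of_nat p)) Z0 = (p %| x * x + 3)%N.
Proof.
move=> p0.
have -> : Z.sub (Z.mul (Z.of_nat x) (Z.of_nat x)) (Zneg 3) = Z.of_nat (x * x + 3)%N.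
  by rewrite Nat2Z.inj_add Nat2Z.inj_mul; lia.
rewrite -Nat2Z.inj_mod modnE_nat /dvdn.
by case: ((x * x + 3) %% p)%N.
Qed.

Local Open Scope ring_scope.

(** -3 is a square exactly when the field contains a primitive cube root of unity w, through w = (x
    - 1) / 2 and x = 2 w + 1. Given w, the relations w^p = w and w^3 = 1 exclude p = 2 modulo 3;
    conversely, if 3 divides p - 1, Cauchy's theorem finds an element of order 3 among the units. *)
Lemma sqrt_m3_mod3 (p : nat) : prime p -> (3 < p)%N ->
  (exists x : 'F_p, x ^+ 2 + 3%:R = 0) <-> (p %% 3 = 1)%N.
Proof.
move=> pp p3.
have cF : p \in [pchar 'F_p] by apply: pchar_Fp.
have n2 : 2%:R != 0 :> 'F_p.
  by rewrite -(dvdn_pcharf cF) gtnNdvd // (ltn_trans _ p3).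
have n3 : 3%:R != 0 :> 'F_p by rewrite -(dvdn_pcharf cF) gtnNdvd.
have pm0 : (p %% 3 != 0)%N.
  apply/negP => /eqP h; have /prime_nt_dvdP : (3 %| p)%N by rewrite /dvdn h.
  by move=> /(_ pp isT) h3; rewrite -h3 in p3.
split.
- case=> x hx.
  pose w : 'F_p := (x - 1) / 2%:R.
  have hw : w ^+ 2 + w + 1 = 0.
    have n4 : 4%:R != 0 :> 'F_p by rewrite (natrM _ 2 2) mulf_neq0.
    have xw : x = 2%:R * w + 1 by rewrite /w mulrC divfK // subrK.
    apply/eqP; rewrite -(mulrI_eq0 _ (mulfI n4)); apply/eqP.
    by rewrite -hx xw; ring.
  have w3 : w ^+ 3 = 1.
    have : (w - 1) * (w ^+ 2 + w + 1) = 0 by rewrite hw mulr0.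
    have -> : (w - 1) * (w ^+ 2 + w + 1) = w ^+ 3 - 1 by ring.
    by move/eqP; rewrite subr_eq0 => /eqP.
  have w1 : w != 1.
    apply/negP => /eqP h1; move: hw; rewrite h1 expr1n => h.
    by move: n3; rewrite !mulrS mulr0n addr0 addrA h eqxx.
  have wp : w ^+ p = w.
    have := expf_card w; by rewrite card_Fp.
  have hm a b : w ^+ (a * 3 + b) = w ^+ b by rewrite exprD mulnC exprM w3 expr1n mul1r.
  have := hm (p %/ 3)%N (p %% 3)%N; rewrite -divn_eq wp.
  have := ltn_pmod p (isT : (0 < 3)%N).
  case: (p %% 3)%N pm0 => [//|[//|[|//]]] _ _ w2.
  have wn0 : w != 0 by apply/negP => /eqP h0; move: w3; rewrite h0 expr0n /= => /eqP; rewrite eq_sym oner_eq0.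
  by move: w1; rewrite -(inj_eq (mulfI wn0)) mulr1 -expr2 -w2 eqxx.
- move=> h1.
  have d3 : (3 %| #|[set: {unit 'F_p}]|)%N.
    rewrite card_finField_unit card_Fp // (divn_eq p 3) h1 addn1 /=.
    by rewrite dvdn_mull.
  have [u _ ou] := Cauchy (isT : prime 3) d3.
  have u3 : (FinRing.uval u) ^+ 3 = 1.
    by rewrite -FinRing.val_unitX -ou expg_order.
  have u1 : FinRing.uval u != 1.
    apply/negP => /eqP h; have : u = 1%g by apply/val_inj.
    by move=> hu; move: ou; rewrite hu order1.
  move: u3 u1; move: (FinRing.uval u) => w w3 w1.
  have hw : w ^+ 2 + w + 1 = 0.
    have : (w - 1) * (w ^+ 2 + w + 1) = 0.
      have -> : (w - 1) * (w ^+ 2 + w + 1) = w ^+ 3 - 1 by ring.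
      by rewrite w3 subrr.
    by move/eqP; rewrite mulf_eq0 subr_eq0 (negbTE w1) /= => /eqP.
  exists (2%:R * w + 1).
  have -> : (2%:R * w + 1) ^+ 2 + 3%:R = 4%:R * (w ^+ 2 + w + 1) by ring.
  by rewrite hw mulr0.
Qed.

Lemma legendre_m3 (p : nat) : prime p -> (3 < p)%N -> legendre (Zneg 3) p = chi3 p.
Proof.
move=> pp p3; have p0 : (0 < p)%N by apply: prime_gt0.
have cF : p \in [pchar 'F_p] by apply: pchar_Fp.
have -> : legendre (Zneg 3) p = if [exists x : 'I_p, (p %| x * x + 3)%N] then Zpos 1 else Zneg 1.
  rewrite /legendre.
  have -> : Z.eqb (Z.modulo (Zneg 3) (Z.of_nat p)) Z0 = false.
    apply/negP => /Z.eqb_eq h.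
    have : Z.divide (Z.of_nat p) (Zpos 3).
      by apply/Z.divide_opp_r; apply/Z.mod_divide => //; lia.
    by move/Z.divide_pos_le => /(_ (Pos2Z.is_pos 3)); move/ltP: p3; lia.
  congr (if _ then _ else _); apply: eq_existsb => x; exact: sqr_mod_p.
have pm0 : (p %% 3 != 0)%N.
  apply/negP => /eqP h; have /prime_nt_dvdP : (3 %| p)%N by rewrite /dvdn h.
  by move=> /(_ pp isT) h3; rewrite -h3 in p3.
have hx : [exists x : 'I_p, (p %| x * x + 3)%N] = (p %% 3 == 1)%N.
  apply/existsP/eqP.
  - case=> x hx; apply/(sqrt_m3_mod3 pp p3); exists (x%:R).
    by apply/eqP; rewrite -natrX -natrD -(dvdn_pcharf cF) expnS expn1.
  - move/(sqrt_m3_mod3 pp p3) => [x hx].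
    have hxp : (x < p)%N by have := ltn_ord x; rewrite {2}Fp_cast.
    exists (Ordinal hxp); rewrite (dvdn_pcharf cF) /= natrD natrM.
    have -> : (x : nat)%:R = x :> 'F_p by rewrite natr_Zp.
    by rewrite -expr2 hx.
rewrite hx /chi3 modnE_nat.
have := ltn_pmod p (isT : (0 < 3)%N).
by case: (p %% 3)%N pm0 => [//|[//|[//|//]]].
Qed.

(** [chi3] is completely multiplicative, so the two are compared on prime factors: 2 and 3 by
    computation, the others by [legendre_m3]. *)
Lemma kronecker_m3 (n : nat) : (0 < n)%N -> kronecker (Zneg 3) n = chi3 n.
Proof.
move=> n0; rewrite /kronecker {2}(prod_prime_decomp n0).
rewrite (big_morph chi3 chi3M (erefl : chi3 1 = Zpos 1)).
rewrite big_seq [RHS]big_seq; apply: eq_bigr => f.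
case: f => p e /mem_prime_decomp /= [pp _ _].
rewrite chi3X; congr (Z.pow _ _).
case: eqP => [->//|/eqP pn2].
have p2 := prime_gt1 pp.
case: (ltngtP p 3) => h.
- by move: p2 pn2 h; case: p {pp} => [|[|[|]]].
- exact: legendre_m3.
- by rewrite h.
Qed.

Local Close Scope ring_scope.

HB.instance Definition _ := Monoid.isComLaw.Build C (RtoC (IZR Z0)) Cplus Cplus_assoc Cplus_comm Cplus_0_l.

Lemma sum_divisors (F : nat -> C) n :
  \big[Cplus/RtoC (IZR Z0)]_(d <- divisors n.+1) F d =
  Csum (fun d => if Nat.eqb (Nat.modulo (S n) (S d)) 0 then F (S d) else RtoC (IZR Z0)) n.
Proof.
have hp : perm_eq (divisors n.+1) [seq d <- iota 1 n.+1 | dvdn d n.+1].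
  apply: uniq_perm; first exact: divisors_uniq.
    by rewrite filter_uniq // iota_uniq.
  move=> d; rewrite -dvdn_divisors // mem_filter mem_iota.
  case hd: (dvdn d n.+1) => //=; apply/esym.
  by rewrite add1n ltnS (dvdn_leq _ hd) // andbT; case: d hd.
rewrite (perm_big _ hp) big_filter big_mkcond.
have -> : iota 1 n.+1 = index_iota 1 n.+2 by rewrite /index_iota subn1.
have H k : \big[Cplus/RtoC (IZR Z0)]_(1 <= i < k.+2) (if dvdn i n.+1 then F i else RtoC (IZR Z0)) =
    Csum (fun d => if Nat.eqb (Nat.modulo (S n) (S d)) 0 then F (S d) else RtoC (IZR Z0)) k.
  elim: k => [|k IH].
    by rewrite big_nat1 /Csum modnE_nat /dvdn; case: (_ %% _).
  have CS a : Csum a k.+1 = Cplus (Csum a k) (a k.+1) by [].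
  rewrite big_nat_recr // IH CS; congr (Cplus _ _).
  by rewrite modnE_nat /dvdn; case: (_ %% _).
exact: H.
Qed.

Lemma chi_sum_Csum n : RtoC (IZR (chi_sum n.+1)) =
  Csum (fun d => if Nat.eqb (Nat.modulo (S n) (S d)) 0 then RtoC (IZR (chi3 (S d))) else RtoC (IZR Z0)) n.
Proof.
rewrite -(sum_divisors (fun d => RtoC (IZR (chi3 d)))) /chi_sum.
rewrite (big_morph (fun z => RtoC (IZR z)) (id1 := RtoC (IZR Z0)) (op1 := Cplus)) //; last first.
  by move=> x y; rewrite plus_IZR RtoC_plus.
rewrite big_seq [RHS]big_seq; apply: eq_bigr => d hd.
rewrite kronecker_m3 //; move: hd; rewrite -dvdn_divisors //.
by case: d => [|d] //; rewrite dvd0n.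
Qed.

Lemma divisor_sigma_Csum k n : RtoC (INR (divisor_sigma k n.+1)) =
  Csum (fun d => if Nat.eqb (Nat.modulo (S n) (S d)) 0 then Cpow (RtoC (INR (S d))) k else RtoC (IZR Z0)) n.
Proof.
rewrite -(sum_divisors (fun d => Cpow (RtoC (INR d)) k)) /divisor_sigma.
rewrite (big_morph (fun z => RtoC (INR z)) (id1 := RtoC (IZR Z0)) (op1 := Cplus)) //; last first.
  by move=> x y; rewrite plus_INR RtoC_plus.
apply: eq_bigr => d _.
elim: k => [//|k IH].
by rewrite expnS mult_INR RtoC_mult IH Cpow_S.
Qed.
End Arithmetic.

(** * Lambert series *)

(** Radius of convergence at least 1. The property is stable under products, Dirichlet convolution
    and multiplication by n, so the q-expansions below all have it. *)
Definition rapid (a : nat -> C) : Prop :=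
  forall x : C, (Cmod x < 1)%R -> csummable (fun n => a n * Cpow x n).

Lemma csummable_geom x : (Cmod x < 1)%R -> csummable (fun n => Cpow x n).
Proof.
  intros H. unfold csummable. apply ex_series_ext with (fun n => (Cmod x ^ n)%R).
  - intros n. now rewrite Cmod_pow.
  - apply ex_series_geom. rewrite Rabs_pos_eq; auto. apply Cmod_ge_0.
Qed.

Lemma one_sub_neq_0 x : (Cmod x < 1)%R -> 1 - x <> 0.
Proof.
  intros H E. replace x with (1 - (1 - x)) in H by ring. rewrite E in H.
  replace (1 - 0) with (RtoC 1) in H by ring. rewrite Cmod_1 in H. lra.
Qed.

Lemma Cseries_geom x : (Cmod x < 1)%R -> Cseries (fun n => Cpow x n) = / (1 - x).
Proof.
  intros H. assert (S0 := csummable_geom x H). assert (N := one_sub_neq_0 x H).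
  assert (E := Cseries_incr_1 _ S0). cbv beta in E.
  rewrite (Cseries_ext (fun n => Cpow x (S n)) (fun n => x * Cpow x n)) in E by reflexivity.
  rewrite Cseries_scal in E by auto. simpl (Cpow x 0) in E.
  set (s := Cseries _) in *.
  replace s with ((1 - x) * s / (1 - x)) by (field; auto).
  replace ((1 - x) * s) with (RtoC 1). field; auto.
  replace ((1 - x) * s) with (s - x * s) by ring. rewrite E at 1. ring.
Qed.

Lemma rapid_1 : rapid (fun _ => 1).
Proof.
  intros x H. apply csummable_ext with (fun n => Cpow x n). intros; ring.
  now apply csummable_geom.
Qed.

(** 1 - t^(n+1) is 1 - t times a sum of n + 1 powers of t, each at least t^n. *)
Lemma linear_geom_bound (t : R) : (0 <= t < 1)%R ->
  exists c, forall n, (INR (S n) * t ^ n <= c)%R.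
Proof.
  intros [H0 H1]. exists (/ (1 - t))%R. intros n.
  assert (P : (0 < 1 - t)%R) by lra.
  apply Rmult_le_reg_l with (1 - t)%R; auto. rewrite Rinv_r by lra.
  apply Rle_trans with (1 - t ^ S n)%R.
  2:{ assert (0 <= t ^ S n)%R; [|lra]. now apply pow_le. }
  induction n.
  - simpl. lra.
  - assert (Q : (t ^ S (S n) = t * t ^ S n)%R) by reflexivity. rewrite Q.
    assert (Q2 : (t ^ S n = t * t ^ n)%R) by reflexivity. rewrite Q2 in *.
    rewrite (S_INR (S n)).
    assert (0 <= t ^ n)%R by now apply pow_le.
    set (y := (t ^ n)%R) in *. set (k := INR (S n)) in *.
    assert (A1 : (t * ((1 - t) * (k * y)) <= t * (1 - t * y))%R) by (apply Rmult_le_compat_l; lra).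
    assert (Hy : (y <= 1)%R).
    { unfold y. rewrite <- (pow1 n). apply pow_incr. lra. }
    assert (A2 : (t * y <= 1)%R) by nra.
    assert (A3 : ((1 - t) * (t * y) <= (1 - t) * 1)%R) by (apply Rmult_le_compat_l; lra).
    lra.
Qed.

Lemma rapid_le a b : (forall n, (Cmod (a n) <= Cmod (b n))%R) -> rapid b -> rapid a.
Proof.
  intros H Hb x Hx. apply csummable_le with (fun n => Cmod (b n * Cpow x n)).
  - intros n. rewrite 2!Cmod_mult. apply Rmult_le_compat_r; auto. apply Cmod_ge_0.
  - exact (Hb x Hx).
Qed.

Lemma rapid_ext a b : (forall n, a n = b n) -> rapid a -> rapid b.
Proof. intros H. apply rapid_le. intros n. rewrite H. lra. Qed.

Lemma rapid_scal c a : rapid a -> rapid (fun n => c * a n).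
Proof.
  intros H x Hx. apply csummable_ext with (fun n => c * (a n * Cpow x n)). intros; ring.
  apply csummable_scal; auto.
Qed.

Lemma rapid_plus a b : rapid a -> rapid b -> rapid (fun n => a n + b n).
Proof.
  intros Ha Hb x Hx. apply csummable_ext with (fun n => a n * Cpow x n + b n * Cpow x n).
  intros; ring. apply csummable_plus; auto.
Qed.

Lemma rapid_linear a : rapid a -> rapid (fun n => INR (S n) * a n).
Proof.
  intros Ha x Hx. assert (G := Cmod_ge_0 x).
  set (r := ((1 + Cmod x) / 2)%R).
  assert (Hr : (0 < r < 1)%R) by (unfold r; lra).
  assert (Ht : (0 <= Cmod x / r < 1)%R).
  { split. unfold Rdiv. apply Rmult_le_pos; auto. left. apply Rinv_0_lt_compat. lra.
    apply Rmult_lt_reg_r with r; [lra|]. unfold Rdiv. rewrite Rmult_assoc, Rinv_l by lra.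
    unfold r. lra. }
  destruct (linear_geom_bound _ Ht) as [c Hc].
  apply csummable_le with (fun n => scal c (Cmod (a n * Cpow r n))).
  - intros n. change (scal c (Cmod (a n * Cpow r n))) with (c * Cmod (a n * Cpow r n))%R.
    rewrite 3!Cmod_mult, 2!Cmod_pow, 2!Cmod_R, (Rabs_pos_eq r), (Rabs_pos_eq (INR _)) by (try apply pos_INR; lra).
    replace (Cmod x ^ n)%R with ((Cmod x / r) ^ n * r ^ n)%R.
    2:{ rewrite <- Rpow_mult_distr. f_equal. field. lra. }
    specialize (Hc n).
    apply Rle_trans with ((INR (S n) * (Cmod x / r) ^ n) * (Cmod (a n) * r ^ n))%R; [right; ring|].
    apply Rmult_le_compat_r; auto.
    apply Rmult_le_pos. apply Cmod_ge_0. apply pow_le. lra.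
  - apply (ex_series_scal_l c (fun n => Cmod (a n * Cpow r n))). apply (Ha r).
    rewrite Cmod_R, Rabs_pos_eq; lra.
Qed.

Lemma Cpow_le_1 x n : (Cmod x < 1)%R -> (Cmod x ^ n <= 1)%R.
Proof.
  intros H. rewrite <- (pow1 n). apply pow_incr. split. apply Cmod_ge_0. lra.
Qed.

(** (d + 1) (l + 1) = d + l + (d l + 1), so the power of x is at most |x|^d |x|^l in modulus and the
    family is dominated by a product. *)
Lemma dsummable_lambert a b x : rapid a -> rapid b -> (Cmod x < 1)%R ->
  dsummable (fun d l => a d * b l * Cpow x (S d * S l)).
Proof.
  intros Ha Hb Hx. apply dsummable_prod with (fun d => Cmod (a d * Cpow x d)) (fun l => Cmod (b l * Cpow x l)).
  - intros d l. rewrite 4!Cmod_mult, 3!Cmod_pow.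
    replace (S d * S l)%nat with (d + l + S (d * l))%nat by lia.
    rewrite 2!pow_add. assert (Q := Cpow_le_1 x (S (d * l)) Hx).
    assert (Q0 : (0 <= Cmod x ^ d)%R) by apply pow_le, Cmod_ge_0.
    assert (Q1 : (0 <= Cmod x ^ l)%R) by apply pow_le, Cmod_ge_0.
    assert (Q2 := Cmod_ge_0 (a d)). assert (Q3 := Cmod_ge_0 (b l)).
    assert (Q4 : (0 <= Cmod (a d) * Cmod (b l) * (Cmod x ^ d * Cmod x ^ l))%R) by (repeat apply Rmult_le_pos; auto).
    nra.
  - exact (Ha x Hx).
  - exact (Hb x Hx).
Qed.

(** Dirichlet convolution, the index n standing for the integer n + 1. *)
Definition conv (a b : nat -> C) (n : nat) : C :=
  Csum (fun d => if (S n mod S d =? 0)%nat then a d * b (S n / S d - 1)%nat else 0) n.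

Lemma lambert a b x : rapid a -> rapid b -> (Cmod x < 1)%R ->
  csummable (fun n => conv a b n * Cpow x (S n)) /\
  Cseries (fun n => conv a b n * Cpow x (S n)) = dseries (fun d l => a d * b l * Cpow x (S d * S l)).
Proof.
  intros Ha Hb Hx.
  destruct (dseries_divisors _ (dsummable_lambert a b x Ha Hb Hx)) as [H1 H2].
  assert (E : forall n, Csum (fun d => if (S n mod S d =? 0)%nat
     then a d * b (S n / S d - 1)%nat * Cpow x (S d * S (S n / S d - 1)) else 0) n = conv a b n * Cpow x (S n)).
  { intros n. unfold conv. rewrite Cmult_comm, <- Csum_scal. apply Csum_ext. intros d.
    destruct (Nat.eqb_spec (S n mod S d) 0) as [E|]; [|ring].
    assert (D := Nat.div_mod_eq (S n) (S d)).
    replace (S d * S (S n / S d - 1))%nat with (S n). ring.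
    rewrite E in D. destruct (S n / S d)%nat; lia. }
  split.
  - apply csummable_ext with (1 := E). exact H1.
  - rewrite <- H2. apply Cseries_ext. intros n. now rewrite <- E.
Qed.

Lemma rapid_shift a : (forall x, (Cmod x < 1)%R -> csummable (fun n => a n * Cpow x (S n))) -> rapid a.
Proof.
  intros H x Hx. destruct (Ceq_dec x 0) as [->|Hx0].
  - apply csummable_finite with 0%nat. intros n Hn. destruct n; [lia|]. rewrite Cpow_S. ring.
  - apply csummable_ext with (fun n => / x * (a n * Cpow x (S n))).
    + intros n. rewrite Cpow_S. field. auto.
    + apply csummable_scal; auto.
Qed.

Lemma rapid_conv a b : rapid a -> rapid b -> rapid (conv a b).
Proof. intros Ha Hb. apply rapid_shift. intros x Hx. now apply lambert. Qed.

Definition chiC (d : nat) : C := IZR (chi3 (S d)).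

Lemma chi3_cases n : chi3 n = 0%Z \/ chi3 n = 1%Z \/ chi3 n = (-1)%Z.
Proof.
  unfold chi3. generalize (n mod 3)%nat. intros k.
  destruct k as [ | k]; auto. destruct k as [ | k]; auto. destruct k; auto.
Qed.

Lemma rapid_chi : rapid chiC.
Proof.
  apply rapid_le with (2 := rapid_1). intros n. unfold chiC. rewrite 2!Cmod_R.
  destruct (chi3_cases (S n)) as [-> | [-> | ->]]; rewrite ?Rabs_R0, ?Rabs_R1; try lra.
  rewrite Rabs_left; lra.
Qed.

Lemma chi3_plus3 n : chi3 (3 + n) = chi3 n.
Proof. unfold chi3. replace (3 + n)%nat with (n + 1 * 3)%nat by lia. now rewrite Nat.Div0.mod_add. Qed.

(** The character has period 3, so the sum s satisfies s = y - y^2 + y^3 s. *)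
Lemma chi_geom y : (Cmod y < 1)%R ->
  csummable (fun d => chiC d * Cpow y (S d)) /\
  Cseries (fun d => chiC d * Cpow y (S d)) = y / (1 + y + y * y).
Proof.
  intros Hy. assert (N1 := one_sub_neq_0 y Hy).
  assert (N3 : 1 - y * (y * y) <> 0).
  { apply one_sub_neq_0. rewrite 2!Cmod_mult. assert (G := Cmod_ge_0 y). nra. }
  assert (N2 : 1 + y + y * y <> 0).
  { intros E. apply N3. replace (1 - y * (y * y)) with ((1 - y) * (1 + y + y * y)) by ring. rewrite E. ring. }
  assert (S0 : csummable (fun d => chiC d * Cpow y (S d))).
  { apply csummable_ext with (fun d => y * (chiC d * Cpow y d)). intros; rewrite Cpow_S; ring.
    apply csummable_scal, rapid_chi, Hy. }
  split; auto.
  assert (S1 := proj1 (csummable_incr_1 _) S0).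
  assert (S2 := proj1 (csummable_incr_1 _) S1).
  assert (E := Cseries_incr_1 _ S0). assert (E1 := Cseries_incr_1 _ S1).
  assert (E2 := Cseries_incr_1 _ S2). cbv beta in E, E1, E2. rewrite E1, E2 in E. clear E1 E2.
  rewrite (Cseries_ext (fun n => chiC (S (S (S n))) * Cpow y (S (S (S (S n)))))
     (fun n => y * (y * y) * (chiC n * Cpow y (S n)))) in E.
  2:{ intros n. unfold chiC. change (S (S (S (S n)))) with (3 + S n)%nat.
      rewrite chi3_plus3, Cpow_add_r. simpl (Cpow y 3). ring. }
  rewrite Cseries_scal in E by auto.
  replace (chiC 0) with (RtoC 1) in E by reflexivity.
  replace (chiC 1) with (- RtoC 1) in E by (rewrite <- RtoC_opp; reflexivity).
  replace (chiC 2) with (RtoC 0) in E by reflexivity.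
  simpl (Cpow y _) in E.
  set (s := Cseries _) in *.
  replace s with ((1 - y * (y * y)) * s / (1 - y * (y * y))) by (field; auto).
  replace ((1 - y * (y * y)) * s) with (y - y * y).
  - replace (1 - y * (y * y)) with ((1 - y) * (1 + y + y * y)) by ring. field. auto.
  - replace ((1 - y * (y * y)) * s) with (s - y * (y * y) * s) by ring. rewrite E at 1. ring.
Qed.

(** For x = [qpar z] with |x| < 1 this is, by [hh_eq] and [chi_geom], the generating function of
    [chi3] at x times the Gauss sum [sqrtm3]. *)
Definition hh (z : C) : C := cc (z + 1 / 3) - cc (z - 1 / 3).

Definition om : C := ((- (1 / 2))%R, (sqrt 3 / 2)%R).

Lemma sqrt3_sq : (sqrt 3 * sqrt 3 = 3)%R.
Proof. apply sqrt_sqrt. lra. Qed.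

Lemma sqrtm3_sq : sqrtm3 * sqrtm3 = - (3).
Proof.
  unfold sqrtm3. replace (Ci * sqrt 3 * (Ci * sqrt 3)) with (Ci * Ci * (sqrt 3 * sqrt 3)) by ring.
  rewrite <- RtoC_mult, sqrt3_sq. unfold Ci, Cmult, RtoC, Copp. simpl. f_equal; ring.
Qed.

Lemma sqrtm3_neq_0 : sqrtm3 <> 0.
Proof.
  intros E. assert (H := sqrtm3_sq). rewrite E in H. 
  assert (F : RtoC 3 = 0). { replace (RtoC 3) with (- (- (3))) by ring. rewrite <- H. ring. }
  injection F. lra.
Qed.

Lemma om_eq : om = (- (1) + sqrtm3) / 2.
Proof.
  unfold om, sqrtm3, Cdiv. rewrite <- RtoC_inv by lra.
  unfold Cplus, Cmult, Copp, RtoC, Ci. simpl. f_equal; field.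
Qed.

Lemma om_rel : om * om = - om - 1.
Proof.
  rewrite om_eq. replace ((- (1) + sqrtm3) / 2 * ((- (1) + sqrtm3) / 2)) with
   ((1 - 2 * sqrtm3 + sqrtm3 * sqrtm3) / 4) by field.
  rewrite sqrtm3_sq. field.
Qed.

Lemma qpar_third : qpar (1 / 3) = om.
Proof.
  unfold qpar, om. replace (2 * PI * Ci * (1 / 3)) with ((0, 2 * (PI / 3))%R : C).
  - unfold Cexp. simpl. rewrite exp_0, cos_2PI3, sin_2PI3. f_equal; field.
  - unfold Cdiv. rewrite <- RtoC_inv by lra. unfold Cmult, RtoC, Ci. simpl. f_equal; field.
Qed.

Lemma qpar_third_opp : qpar (- (1 / 3)) = - om - 1.
Proof.
  rewrite <- om_rel, <- qpar_third, <- qpar_plus, <- (qpar_plus_IZR (- (1 / 3)) 1).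
  f_equal. field.
Qed.

Lemma hh_eq x z : qpar z = x -> 1 - x * x * x <> 0 -> hh z = sqrtm3 * (x / (1 + x + x * x)).
Proof.
  intros Hx N3. unfold hh, cc.
  replace (z - 1 / 3) with (z + - (1 / 3)) by ring. rewrite 2!qpar_plus, qpar_third, qpar_third_opp, Hx.
  assert (F : (1 - x) * ((1 - x * om) * (1 - x * (- om - 1))) = 1 - x * x * x).
  { replace ((1 - x * om) * (1 - x * (- om - 1))) with (1 + x + x * x * (om * (- om - 1))) by ring.
    rewrite <- om_rel. replace (om * (om * om)) with (om * om * om) by ring. rewrite om_rel.
    replace ((- om - 1) * om) with (- (om * om) - om) by ring. rewrite om_rel. ring. }
  assert (F2 : (1 - x * om) * (1 - x * (- om - 1)) = 1 + x + x * x).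
  { replace ((1 - x * om) * (1 - x * (- om - 1))) with (1 + x + x * x * (om * (- om - 1))) by ring.
    rewrite <- om_rel. replace (om * (om * om)) with (om * om * om) by ring. rewrite om_rel.
    replace ((- om - 1) * om) with (- (om * om) - om) by ring. rewrite om_rel. ring. }
  assert (N12 : (1 - x * om) * (1 - x * (- om - 1)) <> 0).
  { intros E. apply N3. rewrite <- F, E. ring. }
  assert (Na : 1 - x * om <> 0) by (intros E; apply N12; rewrite E; ring).
  assert (Nb : 1 - x * (- om - 1) <> 0) by (intros E; apply N12; rewrite E; ring).
  replace (/ (1 - x * om) - / (1 - x * (- om - 1))) with
    ((2 * om + 1) * x / ((1 - x * om) * (1 - x * (- om - 1)))) by (field; auto).
  rewrite F2. rewrite F2 in N12. replace (2 * om + 1) with sqrtm3.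
  - field. auto.
  - rewrite om_eq. field.
Qed.

(** This is twice the constant [sqrtm3 / 6] of [E1m3_hh]: in [E1m3_fricke] the column m = 0 supplies
    the constant term. *)
Lemma hh_0 : hh 0 = sqrtm3 / 3.
Proof.
  unfold hh, cc. replace (0 - 1 / 3) with (0 + - (1 / 3)) by ring. rewrite 2!qpar_plus, qpar_third, qpar_third_opp, qpar_0.
  assert (O := om_eq). assert (Q := sqrtm3_sq).
  replace (1 - 1 * om) with ((3 - sqrtm3) / 2) by (rewrite O; field).
  replace (1 - 1 * (- om - 1)) with ((3 + sqrtm3) / 2) by (rewrite O; field).
  assert (P : (3 - sqrtm3) * (3 + sqrtm3) = 12).
  { replace ((3 - sqrtm3) * (3 + sqrtm3)) with (9 - sqrtm3 * sqrtm3) by ring. rewrite Q. ring. }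
  assert (N12 : RtoC 12 <> 0) by (intros E; injection E; lra).
  assert (Na : 3 - sqrtm3 <> 0) by (intros E; apply N12; rewrite <- P, E; ring).
  assert (Nb : 3 + sqrtm3 <> 0) by (intros E; apply N12; rewrite <- P, E; ring).
  replace (/ ((3 - sqrtm3) / 2) - / ((3 + sqrtm3) / 2)) with (4 * sqrtm3 / ((3 - sqrtm3) * (3 + sqrtm3))).
  rewrite P. field. field. auto.
Qed.

(** * Inversion of the weight one Eisenstein series *)

Lemma E1m3_double tau : (0 < Im tau)%R ->
  E1m3 tau = 1 / 6 + dseries (fun d l => chiC d * 1 * Cpow (qpar tau) (S d * S l)).
Proof.
  intros H. unfold E1m3. f_equal.
  rewrite <- (proj2 (lambert chiC (fun _ => 1) _ rapid_chi rapid_1 (Cmod_qpar_lt_1 _ H))).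
  apply Cseries_ext. intros n. rewrite Arithmetic.chi_sum_Csum. f_equal.
  unfold conv. apply Csum_ext. intros d. destruct (_ =? _)%nat; auto. unfold chiC. ring.
Qed.

Definition uu (x : C) (k : nat) : C := Cpow x k / (1 - Cpow x k).

Lemma Cmod_pow_lt_1 x k : (Cmod x < 1)%R -> (Cmod (Cpow x (S k)) < 1)%R.
Proof.
  intros H. rewrite Cmod_pow. assert (G := Cmod_ge_0 x). assert (P := Cpow_le_1 x k H).
  assert (Q : (0 <= Cmod x ^ k)%R) by now apply pow_le. simpl. nra.
Qed.

Lemma Cseries_uu x d : (Cmod x < 1)%R ->
  csummable (fun l => Cpow x (S d * S l)) /\ Cseries (fun l => Cpow x (S d * S l)) = uu x (S d).
Proof.
  intros H. assert (H' := Cmod_pow_lt_1 x d H).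
  assert (E : forall l, Cpow x (S d) * Cpow (Cpow x (S d)) l = Cpow x (S d * S l)).
  { intros l. rewrite <- Cpow_S, <- Cpow_mult_r. reflexivity. }
  split.
  - apply csummable_ext with (1 := E). apply csummable_scal, csummable_geom, H'.
  - rewrite <- (Cseries_ext _ _ E), Cseries_scal, Cseries_geom; auto using csummable_geom.
Qed.

Lemma dseries_uu a x : rapid a -> (Cmod x < 1)%R ->
  csummable (fun d => a d * uu x (S d)) /\
  dseries (fun d l => a d * 1 * Cpow x (S d * S l)) = Cseries (fun d => a d * uu x (S d)).
Proof.
  intros Ha Hx. assert (HD := dsummable_lambert a (fun _ => 1) x Ha rapid_1 Hx).
  assert (E : forall d, Cseries (fun l => a d * 1 * Cpow x (S d * S l)) = a d * uu x (S d)).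
  { intros d. destruct (Cseries_uu x d Hx) as [S0 E0].
    rewrite Cseries_scal by auto. rewrite E0. ring. }
  split.
  - apply csummable_ext with (1 := E). apply (csummable_rows _ (proj1 HD) (proj2 HD)).
  - apply Cseries_ext. exact E.
Qed.

Lemma E1m3_uu tau : (0 < Im tau)%R ->
  E1m3 tau = 1 / 6 + Cseries (fun d => chiC d * uu (qpar tau) (S d)).
Proof.
  intros H. rewrite E1m3_double by auto. f_equal.
  apply dseries_uu. apply rapid_chi. now apply Cmod_qpar_lt_1.
Qed.

Lemma one_sub_cube_neq_0 x : (Cmod x < 1)%R -> 1 - x * x * x <> 0.
Proof.
  intros H. apply one_sub_neq_0. rewrite 2!Cmod_mult. assert (G := Cmod_ge_0 x). nra.
Qed.

Lemma E1m3_hh tau : (0 < Im tau)%R ->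
  csummable (fun m => hh (INR (S m) * tau)) /\
  sqrtm3 * E1m3 tau = sqrtm3 / 6 + Cseries (fun m => hh (INR (S m) * tau)).
Proof.
  intros H. set (x := qpar tau). assert (Hx : (Cmod x < 1)%R) by now apply Cmod_qpar_lt_1.
  assert (HD := dsummable_lambert chiC (fun _ => 1) x rapid_chi rapid_1 Hx).
  assert (E : forall m, sqrtm3 * Cseries (fun d => chiC d * 1 * Cpow x (S d * S m)) = hh (INR (S m) * tau)).
  { intros m. assert (Hm := Cmod_pow_lt_1 x m Hx).
    rewrite (hh_eq (Cpow x (S m))).
    - rewrite <- (proj2 (chi_geom _ Hm)). f_equal. apply Cseries_ext. intros d.
      rewrite <- Cpow_mult_r. replace (S m * S d)%nat with (S d * S m)%nat by lia. ring.
    - unfold x. now rewrite qpar_pow.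
    - now apply one_sub_cube_neq_0. }
  assert (HS : csummable (fun m => Cseries (fun d => chiC d * 1 * Cpow x (S d * S m)))).
  { apply (csummable_cols _ (proj1 HD) (proj2 HD)). }
  split.
  - apply csummable_ext with (1 := E). now apply csummable_scal.
  - rewrite E1m3_double by auto. fold x. rewrite dseries_swap by auto. unfold dseries.
    rewrite <- (Cseries_ext _ _ E), Cseries_scal by auto. field.
Qed.

Lemma Csum_3 a K : Csum (fun k => a (3 * k)%nat + a (3 * k + 1)%nat + a (3 * k + 2)%nat) K = Csum a (3 * K + 2).
Proof.
  induction K; [simpl; ring|].
  rewrite Csum_S, IHK. replace (3 * S K + 2)%nat with (S (S (S (3 * K + 2)))) by lia.
  rewrite 3!Csum_S. replace (S (3 * K + 2)) with (3 * S K)%nat by lia.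
  replace (S (3 * S K)) with (3 * S K + 1)%nat by lia.
  replace (S (3 * S K + 1)) with (3 * S K + 2)%nat by lia. ring.
Qed.

Lemma Cseries_3 a : csummable a ->
  Cseries (fun k => a (3 * k)%nat + a (3 * k + 1)%nat + a (3 * k + 2)%nat) = Cseries a.
Proof.
  intros Ha. apply Cseries_unique, is_series_clim. intros eps He.
  destruct (Cseries_clim a Ha eps He) as [N HN]. exists N. intros n Hn.
  rewrite Csum_3. apply HN. lia.
Qed.

Lemma Im_pos_neq_0 s : (0 < Im s)%R -> s <> 0.
Proof. intros Hs E. rewrite E in Hs; simpl in Hs; lra. Qed.

Lemma non_integer_lattice s (n : Z) : (0 < Im s)%R -> n <> 0%Z -> non_integer (IZR n * s).
Proof.
  intros Hs Hn k E. destruct (lattice_zero s n (IZR k) Hs); auto.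
Qed.

Lemma non_integer_third s (m : Z) : (0 < Im s)%R ->
  non_integer (IZR m / (3 * s) + 1 / 3) /\ non_integer (IZR m / (3 * s) - 1 / 3).
Proof.
  intros Hs. assert (N := Im_pos_neq_0 s Hs).
  split; intros k E.
  - destruct (lattice_zero s (3 * k + 1) (IZR m) Hs).
    + rewrite plus_IZR, mult_IZR, RtoC_plus, RtoC_mult.
      replace ((3 * IZR k + 1) * s + IZR m) with ((IZR m / (3 * s) + 1 / 3 + IZR k) * (3 * s)) by (field; auto).
      rewrite E. ring.
    + lia.
  - destruct (lattice_zero s (3 * k - 1) (IZR m) Hs).
    + rewrite minus_IZR, mult_IZR, RtoC_minus, RtoC_mult.
      replace ((3 * IZR k - 1) * s + IZR m) with ((IZR m / (3 * s) - 1 / 3 + IZR k) * (3 * s)) by (field; auto).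
      rewrite E. ring.
    + lia.
Qed.

Lemma cc_uu x z : qpar z = x -> 1 - x <> 0 -> cc z = 1 + x / (1 - x).
Proof. intros E H. unfold cc. rewrite E. field. auto. Qed.

(** The numbers 3 n + 1 and 3 n - 1 run over the integers prime to 3, and the signs of the two terms
    are the values of the character. The reflection [cc (- z) = 1 - cc z] leaves a constant 1 from n
    = 0, and 1 = 2/3 + 2 (1/6). *)
Lemma Zsum_cc_rows tau : (0 < Im tau)%R ->
  Zsummable (fun n => cc (IZR n * (3 * tau) + tau) - cc (IZR n * (3 * tau) - tau)) /\
  Zsum (fun n => cc (IZR n * (3 * tau) + tau) - cc (IZR n * (3 * tau) - tau)) = 2 / 3 + 2 * E1m3 tau.
Proof.
  intros H. set (x := qpar tau). assert (Hx : (Cmod x < 1)%R) by now apply Cmod_qpar_lt_1.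
  set (f := fun n : Z => cc (IZR n * (3 * tau) + tau) - cc (IZR n * (3 * tau) - tau)).
  assert (Hcc : forall k, cc (INR (S k) * tau) = 1 + uu x (S k)).
  { intros k. unfold uu. apply cc_uu. unfold x. now rewrite qpar_pow.
    now apply one_sub_neq_0, Cmod_pow_lt_1. }
  assert (Hcn : forall k, cc (- (INR (S k) * tau)) = - uu x (S k)).
  { intros k. rewrite cc_opp, Hcc. ring.
    apply qpar_neq_1. rewrite INR_IZR_INZ. apply non_integer_lattice; auto. lia. }
  destruct (dseries_uu chiC x rapid_chi Hx) as [S0 _].
  set (g := fun d => chiC d * uu x (S d)) in *.
  assert (S1 := proj1 (csummable_incr_1 _) S0).
  assert (Hchi : forall k, chiC (3 * k) = 1 /\ chiC (3 * k + 1) = - (1) /\ chiC (3 * k + 2) = 0).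
  { intros k. assert (P : forall j, chiC (3 * k + j) = chiC j).
    { intros j. unfold chiC. f_equal. f_equal. induction k; [reflexivity|].
      replace (S (3 * S k + j)) with (3 + S (3 * k + j))%nat by lia. now rewrite chi3_plus3. }
    repeat split; rewrite ?P; try reflexivity.
    - rewrite <- (Nat.add_0_r (3 * k)), P. reflexivity.
    - rewrite <- RtoC_opp. reflexivity. }
  assert (Ef : forall n, bil f (S n) = 2 * (g (S (3 * n)) + g (S (3 * n + 1)) + g (S (3 * n + 2)))).
  { intros n. unfold bil, f, g.
    assert (c1 := proj1 (proj2 (Hchi n))). assert (c2 := proj2 (proj2 (Hchi n))).
    assert (c3 := proj1 (Hchi (S n))).
    replace (3 * n + 1)%nat with (S (3 * n)) in c1 by lia.
    replace (3 * n + 2)%nat with (S (3 * n + 1)) in c2 by lia.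
    replace (3 * S n)%nat with (S (3 * n + 2)) in c3 by lia.
    rewrite c1, c2, c3. replace (S (S (3 * n + 2))) with (S (3 * S n)) by lia.
    replace (S (S (3 * n))) with (S (3 * n + 1)) by lia.
    rewrite opp_IZR, <- INR_IZR_INZ.
    replace (INR (S n) * (3 * tau) + tau) with (INR (S (3 * S n)) * tau).
    2:{ rewrite (S_INR (3 * S n)), mult_INR, RtoC_plus, RtoC_mult. replace (RtoC (INR 3)) with (RtoC 3) by (f_equal; simpl; ring). ring. }
    assert (E3 : INR (S n) * (3 * tau) - tau = INR (S (3 * n + 1)) * tau).
    { rewrite (S_INR (3 * n + 1)), plus_INR, mult_INR, (S_INR n), 3!RtoC_plus, RtoC_mult. replace (RtoC (INR 3)) with (RtoC 3) by (f_equal; simpl; ring). simpl (INR 1). ring. }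
    rewrite E3.
    replace (RtoC (- INR (S n)) * (3 * tau) + tau) with (- (INR (S (3 * n + 1)) * tau)).
    2:{ rewrite <- E3, RtoC_opp. ring. }
    replace (RtoC (- INR (S n)) * (3 * tau) - tau) with (- (INR (S (3 * S n)) * tau)).
    2:{ rewrite (S_INR (3 * S n)), mult_INR, RtoC_plus, RtoC_mult, RtoC_opp. replace (RtoC (INR 3)) with (RtoC 3) by (f_equal; simpl; ring). ring. }
    rewrite 2!Hcc, 2!Hcn. ring. }
  assert (SB : csummable (fun n => g (S (3 * n)) + g (S (3 * n + 1)) + g (S (3 * n + 2)))).
  { repeat apply csummable_plus.
    - apply (csummable_sub (fun n => S (3 * n))); auto. intros; lia.
    - apply (csummable_sub (fun n => S (3 * n + 1))); auto. intros; lia.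
    - apply (csummable_sub (fun n => S (3 * n + 2))); auto. intros; lia. }
  assert (Sf : csummable (bil f)).
  { apply csummable_incr_1. apply csummable_ext with (fun n => 2 * (g (S (3 * n)) + g (S (3 * n + 1)) + g (S (3 * n + 2)))).
    intros n. now rewrite Ef. now apply csummable_scal. }
  split; auto.
  unfold Zsum. rewrite Cseries_incr_1 by auto. rewrite (Cseries_ext _ _ Ef), Cseries_scal by auto.
  rewrite (Cseries_3 (fun d => g (S d))) by auto.
  rewrite E1m3_uu by auto. fold x g. rewrite (Cseries_incr_1 g) by auto.
  unfold bil, f. replace (IZR 0 * (3 * tau) + tau) with (INR 1 * tau) by (simpl; ring).
  replace (IZR 0 * (3 * tau) - tau) with (- (INR 1 * tau)) by (simpl; ring).
  rewrite Hcc, Hcn. unfold g at 2. replace (chiC 0) with (RtoC 1) by reflexivity. field.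
Qed.

Lemma Im_fricke tau : (0 < Im tau)%R -> (0 < Im (- (1) / (3 * tau)))%R.
Proof.
  intros H. assert (N := Im_pos_neq_0 tau H). destruct tau as [x y]. simpl in H.
  unfold Cdiv, Cinv, Cmult, Copp, RtoC. simpl.
  match goal with |- (0 < ?e)%R => replace e with (y / (3 * (x * x + y * y)))%R end.
  - apply Rdiv_lt_0_compat; nra.
  - field. nra.
Qed.

Lemma hh_opp z : non_integer (z + 1 / 3) -> non_integer (z - 1 / 3) -> hh (- z) = hh z.
Proof.
  intros H1 H2. unfold hh.
  replace (- z + 1 / 3) with (- (z - 1 / 3)) by ring.
  replace (- z - 1 / 3) with (- (z + 1 / 3)) by ring.
  rewrite 2!cc_opp by (now apply qpar_neq_1). ring.
Qed.

(* Both iterated sums of [1 / (w^2 - tau^2)] over the lattice [Z (3 tau) + Z] are values of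
   [E1m3]: the inner sums are differences of cotangents. *)
Theorem E1m3_fricke tau : (0 < Im tau)%R ->
  E1m3 (- (1) / (3 * tau)) = - sqrtm3 * tau * E1m3 tau.
Proof.
  intros H. assert (N := Im_pos_neq_0 tau H). assert (T := tpi_neq_0).
  assert (Q := sqrtm3_neq_0). assert (Q2 := sqrtm3_sq).
  set (W := - (1) / (3 * tau)). assert (HW : (0 < Im W)%R) by now apply Im_fricke.
  set (s := 3 * tau).
  assert (Hs : (0 < Im s)%R) by (unfold s; destruct tau; simpl in *; lra).
  assert (Ns := Im_pos_neq_0 s Hs).
  assert (Hrow : forall n : Z, non_integer (IZR n * s + tau) /\ non_integer (IZR n * s - tau)).
  { intros n. split.
    - replace (IZR n * s + tau) with (IZR (3 * n + 1) * tau).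
      apply non_integer_lattice; auto; lia.
      unfold s. rewrite plus_IZR, mult_IZR, RtoC_plus, RtoC_mult. ring.
    - replace (IZR n * s - tau) with (IZR (3 * n - 1) * tau).
      apply non_integer_lattice; auto; lia.
      unfold s. rewrite minus_IZR, mult_IZR, RtoC_minus, RtoC_mult. ring. }
  assert (Hth := fun m => non_integer_third tau m H).
  assert (E3 : forall m : Z, (IZR m + tau) / s = IZR m / (3 * tau) + 1 / 3) by (intros; unfold s; field; auto).
  assert (E4 : forall m : Z, (IZR m - tau) / s = IZR m / (3 * tau) - 1 / 3) by (intros; unfold s; field; auto).
  assert (Hcol : forall m : Z, non_integer ((IZR m + tau) / s) /\ non_integer ((IZR m - tau) / s)).
  { intros m. rewrite E3, E4. apply Hth. }
  assert (Rr := fun n => lat_row s tau n (proj1 (Hrow n)) (proj2 (Hrow n)) N).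
  assert (Rc := fun m => lat_col s tau m Ns (proj1 (Hcol m)) (proj2 (Hcol m)) N).
  assert (SW := lat_swap s tau Hs (fun n => proj1 (Rr n)) (fun m => proj1 (Rc m))).
  destruct (Zsum_cc_rows tau H) as [Z1 Z2].
  assert (R1 : Zsum (fun n => Zsum (fun m => lat s tau m n)) = tpi / (2 * tau) * (2 / 3 + 2 * E1m3 tau)).
  { rewrite <- Z2, <- Zsum_scal by auto. apply Zsum_ext. intros n. rewrite (proj2 (Rr n)). fold s. field. auto. }
  destruct (E1m3_hh W HW) as [Y1 Y2].
  assert (Hhh : forall m : Z, hh (IZR m / (3 * tau)) = hh (IZR m * W)).
  { intros m. rewrite <- hh_opp by apply Hth. f_equal. unfold W. field. auto. }
  assert (Eb : forall n, bil (fun m => hh (IZR m * W)) (S n) = 2 * hh (INR (S n) * W)).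
  { intros n. unfold bil. rewrite opp_IZR, <- INR_IZR_INZ.
    assert (F := Hhh (Z.of_nat (S n))). rewrite <- INR_IZR_INZ in F.
    rewrite <- F. replace (RtoC (- INR (S n)) * W) with (INR (S n) / (3 * tau)).
    ring. unfold W. rewrite RtoC_opp. field. auto. }
  assert (SS : Zsummable (fun m => hh (IZR m * W))).
  { apply csummable_incr_1. apply csummable_ext with (fun n => 2 * hh (INR (S n) * W)).
    intros n. now rewrite Eb. now apply csummable_scal. }
  assert (C1 : Zsum (fun m => Zsum (fun n => lat s tau m n)) = tpi / (6 * tau * tau) * (2 * (sqrtm3 * E1m3 W))).
  { rewrite Y2. transitivity (tpi / (6 * tau * tau) * Zsum (fun m => hh (IZR m * W))).
    - rewrite <- Zsum_scal by auto. apply Zsum_ext. intros m.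
      transitivity (tpi / s * (cc ((IZR m + tau) / s) - cc ((IZR m - tau) / s)) / (2 * tau)).
      exact (proj2 (Rc m)).
      rewrite <- Hhh. unfold hh. rewrite <- E3, <- E4. unfold s at 1. field. auto.
    - f_equal. unfold Zsum. rewrite Cseries_incr_1 by exact SS.
      rewrite (Cseries_ext _ _ Eb), Cseries_scal by auto.
      replace (bil (fun m => hh (IZR m * W)) 0) with (hh 0) by (unfold bil; f_equal; ring).
      rewrite hh_0. field. }
  (* The defect [tpi / s] of [lat_swap] cancels exactly the contribution of the constant 2/3 of
     [Zsum_cc_rows]. *)
  rewrite R1, C1 in SW. unfold s in SW.
  assert (K : sqrtm3 * E1m3 W = 3 * tau * E1m3 tau).
  { replace (sqrtm3 * E1m3 W) with (tpi / (6 * tau * tau) * (2 * (sqrtm3 * E1m3 W)) * (3 * tau * tau / tpi)) by (field; auto).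
    rewrite SW. field. auto. }
  replace (E1m3 W) with (sqrtm3 * sqrtm3 * E1m3 W / - (3)) by (rewrite Q2; field).
  replace (sqrtm3 * sqrtm3 * E1m3 W) with (sqrtm3 * (sqrtm3 * E1m3 W)) by ring.
  rewrite K. field.
Qed.

(** * Inversion of [E2] *)

Definition idx (n : nat) : C := INR (S n).

Lemma rapid_idx : rapid idx.
Proof.
  apply rapid_ext with (fun n => INR (S n) * 1). intros; unfold idx; ring.
  apply rapid_linear, rapid_1.
Qed.

Definition sigma_series (k : nat) (x : C) : C :=
  Cseries (fun n => INR (divisor_sigma k (S n)) * Cpow x (S n)).

Lemma divisor_sigma_conv k n :
  RtoC (INR (divisor_sigma k (S n))) = conv (fun d => Cpow (idx d) k) (fun _ => 1) n.
Proof.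
  rewrite Arithmetic.divisor_sigma_Csum. apply Csum_ext. intros d.
  destruct (_ =? _)%nat; auto. unfold idx. ring.
Qed.

Lemma rapid_idx_pow k : rapid (fun d => Cpow (idx d) k).
Proof.
  induction k. apply rapid_1.
  apply rapid_ext with (fun d => INR (S d) * Cpow (idx d) k). reflexivity.
  apply rapid_linear, IHk.
Qed.

Lemma sigma_series_double k x : (Cmod x < 1)%R ->
  csummable (fun n => INR (divisor_sigma k (S n)) * Cpow x (S n)) /\
  sigma_series k x = dseries (fun d l => Cpow (idx d) k * 1 * Cpow x (S d * S l)).
Proof.
  intros Hx. destruct (lambert _ (fun _ => 1) x (rapid_idx_pow k) rapid_1 Hx) as [S0 E0].
  assert (E : forall n, conv (fun d => Cpow (idx d) k) (fun _ => 1) n * Cpow x (S n) =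
     INR (divisor_sigma k (S n)) * Cpow x (S n)).
  { intros n. now rewrite divisor_sigma_conv. }
  split. apply csummable_ext with (1 := E). exact S0.
  rewrite <- E0. unfold sigma_series. symmetry. apply Cseries_ext. exact E.
Qed.

Lemma idx_geom y : (Cmod y < 1)%R ->
  csummable (fun d => idx d * Cpow y (S d)) /\
  Cseries (fun d => idx d * Cpow y (S d)) = y / ((1 - y) * (1 - y)).
Proof.
  intros Hy. assert (N := one_sub_neq_0 y Hy).
  assert (S0 := rapid_idx y Hy). assert (G0 := csummable_geom y Hy).
  assert (E := Cseries_incr_1 _ S0). cbv beta in E.
  rewrite (Cseries_ext (fun n => idx (S n) * Cpow y (S n)) (fun n => y * (idx n * Cpow y n) + y * Cpow y n)) in E.
  2:{ intros n. unfold idx. rewrite (S_INR (S n)), RtoC_plus, Cpow_S. ring. }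
  rewrite Cseries_plus, 2!Cseries_scal, Cseries_geom in E; auto using csummable_scal.
  replace (idx 0) with (RtoC 1) in E by reflexivity. simpl (Cpow y 0) in E.
  set (s := Cseries (fun n => idx n * Cpow y n)) in *.
  assert (F : (1 - y) * s = / (1 - y)).
  { replace ((1 - y) * s) with (s - y * s) by ring. rewrite E at 1. field. auto. }
  assert (Ex : forall n, y * (idx n * Cpow y n) = idx n * Cpow y (S n)) by (intros; rewrite Cpow_S; ring).
  split.
  - apply csummable_ext with (1 := Ex). now apply csummable_scal.
  - rewrite <- (Cseries_ext _ _ Ex), Cseries_scal by auto. fold s.
    replace s with ((1 - y) * s / (1 - y)) by (field; auto). rewrite F. field. auto.
Qed.

Lemma lat_0_row (s : C) (k : nat) : (0 < Im s)%R ->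
  let x := Cpow (qpar s) (S k) in
  Zsummable (fun m => lat s 0 m (Z.of_nat (S k))) /\
  Zsum (fun m => lat s 0 m (Z.of_nat (S k))) = tpi * tpi * (x / ((1 - x) * (1 - x))).
Proof.
  intros Hs x. set (z := IZR (Z.of_nat (S k)) * s).
  assert (Hz : non_integer z) by (apply non_integer_lattice; auto; lia).
  assert (E : forall m, / ((z + IZR m) * (z + IZR m)) = lat s 0 m (Z.of_nat (S k))).
  { intros m. unfold lat. fold z. f_equal. ring. }
  split.
  - apply Zsummable_ext with (1 := E). now apply clim_pf_sum.
  - rewrite <- (Zsum_ext _ _ E). unfold Zsum. rewrite pf_equal by auto.
    assert (Ex : qpar z = x) by (unfold z, x; now rewrite qpar_pow, INR_IZR_INZ).
    unfold cc. rewrite Ex. field. rewrite <- Ex. now apply qpar_neq_1.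
Qed.

Lemma lat_0_opp s m n : lat s 0 m (- n) = lat s 0 (- m) n.
Proof. unfold lat. rewrite 2!opp_IZR, 2!RtoC_opp. f_equal. ring. Qed.

Lemma csummable_invsq : csummable (fun n => RtoC (invsq n)).
Proof.
  apply csummable_le with invsq. 2: exact ex_series_invsq.
  intros n. rewrite Cmod_R, Rabs_pos_eq. lra. left; apply invsq_pos.
Qed.

Lemma invsq_C n : RtoC (invsq n) = / (idx n * idx n).
Proof.
  unfold invsq, idx. assert (P := pos_INR n). rewrite RtoC_inv by nra.
  rewrite S_INR, RtoC_mult. f_equal. rewrite !RtoC_plus. ring.
Qed.

Lemma idx_neq_0 n : idx n <> 0.
Proof. unfold idx. intros E. injection E as E'. apply (not_0_INR (S n)); [lia|exact E']. Qed.

Lemma idx_Z n : idx n = IZR (Z.of_nat (S n)).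
Proof. unfold idx. now rewrite INR_IZR_INZ. Qed.

(* From the expansion of [pi^2 / sin^2] at [1/2]. *)
Lemma zeta_2 : Cseries (fun n => RtoC (invsq n)) = - (tpi * tpi) / 24.
Proof.
  assert (Hn : non_integer (/ 2)).
  { intros k E. destruct (lattice_zero Ci 0 (/ 2 + IZR k)).
    - simpl. lra.
    - rewrite RtoC_plus, RtoC_inv by lra. rewrite E. ring.
    - assert (F : IZR (1 + 2 * k) = 0%R) by (rewrite plus_IZR, mult_IZR; lra).
      apply eq_IZR in F. lia. }
  assert (Hq : qpar (/ 2) = - (1)).
  { unfold qpar. replace (2 * PI * Ci * / 2) with ((0, PI)%R : C).
    - unfold Cexp. simpl. rewrite exp_0, cos_PI, sin_PI. unfold RtoC, Copp. simpl. f_equal; ring.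
    - rewrite <- RtoC_inv by lra. unfold Cmult, RtoC, Ci. simpl. f_equal; field. }
  assert (E := pf_equal (/ 2) Hn). unfold cc in E. rewrite Hq in E.
  destruct (clim_pf_sum _ _ Hn Hn) as [S0 _].
  set (f := fun j : Z => / ((/ 2 + IZR j) * (/ 2 + IZR j))) in *.
  set (s := Cseries (fun n => RtoC (invsq n))).
  assert (S1 := csummable_invsq).
  assert (So : csummable (fun n => RtoC (invsq (2 * n)))).
  { apply (csummable_sub (fun n => 2 * n)%nat (fun n => RtoC (invsq n))); auto. intros; lia. }
  assert (So' := proj1 (csummable_incr_1 _) So).
  (* Because of the shift in [invsq], the even indices 2 n carry the odd integers 2 n + 1, and the
     odd indices the even integers 2 (n + 1). *)
  assert (Hs : s = Cseries (fun n => RtoC (invsq (2 * n))) + / 4 * s).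
  { unfold s at 1. rewrite (Cseries_even_odd _ S1). f_equal. unfold s.
    rewrite <- Cseries_scal by auto. apply Cseries_ext. intros n.
    rewrite 2!invsq_C. assert (N := idx_neq_0 n).
    replace (idx (2 * n + 1)) with (2 * idx n). field; auto.
    unfold idx. rewrite !S_INR, plus_INR, mult_INR. simpl (INR 2). simpl (INR 1).
    rewrite !RtoC_plus, RtoC_mult, RtoC_plus. ring. }
  assert (H2n : forall n, RtoC 2 * INR n + 1 <> 0).
  { intros n F. rewrite <- RtoC_mult, <- RtoC_plus in F. injection F. assert (P := pos_INR n). lra. }
  assert (Ei : forall n, RtoC (invsq (2 * n)) = / ((2 * INR n + 1) * (2 * INR n + 1))).
  { intros n. rewrite invsq_C. unfold idx.
    replace (RtoC (INR (S (2 * n)))) with (2 * INR n + 1); auto.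
    rewrite S_INR, mult_INR, RtoC_plus, RtoC_mult. reflexivity. }
  (* (j + 1/2)^(-2) is 4 / (2 j + 1)^2, and each odd square arises from two values of j. *)
  assert (Ef : Cseries (bil f) = 8 * Cseries (fun n => RtoC (invsq (2 * n)))).
  { rewrite Cseries_incr_1 by auto.
    rewrite (Cseries_ext (fun n => bil f (S n)) (fun n => 4 * RtoC (invsq (2 * S n)) + 4 * RtoC (invsq (2 * n)))).
    - rewrite Cseries_plus, 2!Cseries_scal; auto using csummable_scal.
      assert (I1 := Cseries_incr_1 _ So). cbv beta in I1.
      replace (Cseries (fun n => RtoC (invsq (2 * S n)))) with
        (Cseries (fun n => RtoC (invsq (2 * n))) - RtoC (invsq (2 * 0))) by (rewrite I1; ring).
      replace (bil f 0) with (RtoC 4) by (unfold bil, f; field).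
      rewrite Ei. simpl (INR 0). field.
    - intros n. unfold bil, f. rewrite opp_IZR, <- INR_IZR_INZ, 2!Ei, S_INR, RtoC_opp, RtoC_plus.
      assert (A1 := H2n n). assert (A2 := H2n (S n)). rewrite S_INR, RtoC_plus in A2.
      field. repeat split; auto.
      intros F. apply A1.
      match type of F with ?e = _ => replace (2 * INR n + 1) with (- e) by ring end.
      rewrite F. ring. }
  rewrite Ef in E. set (o := Cseries (fun n => RtoC (invsq (2 * n)))) in *.
  assert (Ho : o = - (tpi * tpi) / 32).
  { replace o with (8 * o / 8) by field. rewrite E. field. }
  replace s with ((s - / 4 * s) * 4 / 3) by field. rewrite Hs at 1. rewrite Ho. field.
Qed.

Lemma lat_0_row_0 s :
  Zsummable (fun m => lat s 0 m 0) /\ Zsum (fun m => lat s 0 m 0) = - (tpi * tpi) / 12.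
Proof.
  assert (Eb : forall n, bil (fun m => lat s 0 m 0) (S n) = 2 * RtoC (invsq n)).
  { intros n. unfold bil, lat. rewrite invsq_C, idx_Z, opp_IZR, RtoC_opp.
    assert (N := idx_neq_0 n). rewrite idx_Z in N. field. auto. }
  assert (S0 : Zsummable (fun m => lat s 0 m 0)).
  { apply csummable_incr_1. apply csummable_ext with (fun n => 2 * RtoC (invsq n)).
    intros; now rewrite Eb. apply csummable_scal, csummable_invsq. }
  split; auto.
  unfold Zsum. rewrite Cseries_incr_1 by exact S0.
  rewrite (Cseries_ext _ _ Eb), Cseries_scal, zeta_2 by apply csummable_invsq.
  (* The origin w = 0 contributes nothing, because [/ 0] is 0. *)
  replace (bil (fun m => lat s 0 m 0) 0) with (RtoC 0). field.
  unfold bil, lat. replace ((IZR 0 * s + IZR 0) * (IZR 0 * s + IZR 0) - 0 * 0) with (RtoC 0) by ring.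
  unfold Cinv, RtoC. simpl. f_equal; unfold Rdiv; ring.
Qed.

Lemma lat_0_rows s n : (0 < Im s)%R -> Zsummable (fun m => lat s 0 m n).
Proof.
  intros Hs. destruct (Z.lt_trichotomy n 0) as [Hn | [-> | Hn]].
  - apply Zsummable_ext with (fun m => lat s 0 (- m) (- n)).
    { intros m. rewrite <- lat_0_opp, Z.opp_involutive. reflexivity. }
    assert (E : (- n)%Z = Z.of_nat (S (Z.to_nat (- n - 1)))) by lia. rewrite E.
    apply csummable_ext with (bil (fun m => lat s 0 m (Z.of_nat (S (Z.to_nat (- n - 1)))))).
    intros k. symmetry. apply (bil_opp (fun m => lat s 0 m _)). now apply lat_0_row.
  - apply lat_0_row_0.
  - assert (E : n = Z.of_nat (S (Z.to_nat (n - 1)))) by lia. rewrite E. now apply lat_0_row.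
Qed.

(** Eisenstein's order of summation, with the sum over m inside. The row n = 0 gives 2 zeta(2),
    which is - tpi^2 / 12, and the rows n and - n together give the Lambert series of sigma_1. *)
Lemma E2_lattice s : (0 < Im s)%R ->
  Zsummable (fun n => Zsum (fun m => lat s 0 m n)) /\
  Zsum (fun n => Zsum (fun m => lat s 0 m n)) = - (tpi * tpi) / 12 * E2 s.
Proof.
  intros Hs. set (x := qpar s). assert (Hx : (Cmod x < 1)%R) by now apply Cmod_qpar_lt_1.
  set (f := fun n => Zsum (fun m => lat s 0 m n)).
  set (v := fun k => Cpow x (S k) / ((1 - Cpow x (S k)) * (1 - Cpow x (S k)))).
  assert (Eb : forall k, bil f (S k) = 2 * (tpi * tpi) * v k).
  { intros k. unfold bil, f.
    rewrite (Zsum_ext (fun m => lat s 0 m (- Z.of_nat (S k))) (fun m => lat s 0 (- m) (Z.of_nat (S k)))).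
    - rewrite (Zsum_opp (fun m => lat s 0 m (Z.of_nat (S k)))).
      rewrite (proj2 (lat_0_row s k Hs)). fold x. fold (v k). ring.
    - intros m. apply lat_0_opp. }
  assert (HD := dsummable_lambert _ _ x (rapid_idx_pow 1) rapid_1 Hx).
  assert (Ev : forall l, Cseries (fun d => Cpow (idx d) 1 * 1 * Cpow x (S d * S l)) = v l).
  { intros l. unfold v. rewrite <- (proj2 (idx_geom _ (Cmod_pow_lt_1 x l Hx))).
    apply Cseries_ext. intros d. rewrite <- Cpow_mult_r, Nat.mul_comm. simpl (Cpow (idx d) 1). ring. }
  assert (Sv : csummable v).
  { apply csummable_ext with (1 := Ev). apply (csummable_cols _ (proj1 HD) (proj2 HD)). }
  assert (Sf : csummable (bil f)).
  { apply csummable_incr_1. apply csummable_ext with (fun k => 2 * (tpi * tpi) * v k).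
    intros; now rewrite Eb. now apply csummable_scal. }
  split. exact Sf.
  unfold Zsum at 1. rewrite Cseries_incr_1 by exact Sf.
  rewrite (Cseries_ext _ _ Eb), Cseries_scal by auto.
  change (bil f 0) with (Zsum (fun m => lat s 0 m 0)). rewrite (proj2 (lat_0_row_0 s)).
  unfold E2. fold x. fold (sigma_series 1 x). rewrite (proj2 (sigma_series_double 1 x Hx)).
  rewrite dseries_swap by exact HD. unfold dseries. rewrite (Cseries_ext _ _ Ev). field.
Qed.

Lemma Im_inv tau : (0 < Im tau)%R -> (0 < Im (- (1) / tau))%R.
Proof.
  intros H. destruct tau as [x y]. simpl in H.
  unfold Cdiv, Cinv, Cmult, Copp, RtoC. simpl.
  match goal with |- (0 < ?e)%R => replace e with (y / (x * x + y * y))%R end.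
  - apply Rdiv_lt_0_compat; nra.
  - field. nra.
Qed.

(** Multiplication by tau maps the lattice of -1 / tau onto that of tau and exchanges rows with
    columns, so [lat_swap] at t = 0 compares the two values of [E2]; its defect becomes the
    non-modular term. *)
Theorem E2_inversion tau : (0 < Im tau)%R ->
  E2 (- (1) / tau) = tau * tau * E2 tau + 12 * tau / tpi.
Proof.
  intros H. assert (N := Im_pos_neq_0 tau H). assert (T := tpi_neq_0).
  set (W := - (1) / tau). assert (HW : (0 < Im W)%R) by now apply Im_inv.
  assert (El : forall m n, lat tau 0 m n = / (tau * tau) * lat W 0 n (- m)).
  { intros m n. unfold lat. rewrite opp_IZR, RtoC_opp.
    assert (E : IZR n * tau + IZR m = tau * (- IZR m * W + IZR n)) by (unfold W; field; auto).
    rewrite E. set (w := - IZR m * W + IZR n).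
    destruct (Ceq_dec w 0) as [-> | Hw].
    (* At the origin both sides are 0 by the convention [/ 0 = 0], so the origin drops out of both
       lattice sums. *)
    - assert (Z : / RtoC 0 = 0) by (unfold Cinv, RtoC; simpl; f_equal; unfold Rdiv; ring).
      replace (tau * 0 * (tau * 0) - 0 * 0) with (RtoC 0) by ring.
      replace (0 * 0 - 0 * 0) with (RtoC 0) by ring. rewrite Z. ring.
    - field. auto. }
  assert (Hcol : forall m, Zsummable (fun n => lat tau 0 m n) /\
     Zsum (fun n => lat tau 0 m n) = / (tau * tau) * Zsum (fun n => lat W 0 n (- m))).
  { intros m. assert (S0 := lat_0_rows W (- m) HW). split.
    - apply Zsummable_ext with (fun n => / (tau * tau) * lat W 0 n (- m)).
      intros n; now rewrite El. now apply Zsummable_scal.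
    - rewrite <- Zsum_scal by auto. apply Zsum_ext. intros n. apply El. }
  assert (SW := lat_swap tau 0 H (fun n => lat_0_rows tau n H) (fun m => proj1 (Hcol m))).
  rewrite (proj2 (E2_lattice tau H)) in SW.
  destruct (E2_lattice W HW) as [SW1 SW2].
  assert (E : Zsum (fun m => Zsum (fun n => lat tau 0 m n)) = / (tau * tau) * (- (tpi * tpi) / 12 * E2 W)).
  { rewrite <- SW2, <- (Zsum_opp (fun n => Zsum (fun m => lat W 0 m n))).
    rewrite <- Zsum_scal.
    - apply Zsum_ext. intros m. apply Hcol.
    - apply csummable_ext with (bil (fun n => Zsum (fun m => lat W 0 m n))).
      intros n. symmetry. apply (bil_opp (fun n => Zsum (fun m => lat W 0 m n))). exact SW1. }
  rewrite E in SW.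
  replace (E2 W) with (/ (tau * tau) * (- (tpi * tpi) / 12 * E2 W) * (- (12) * tau * tau / (tpi * tpi))) by (field; auto).
  rewrite SW. field. auto.
Qed.

(** * Complex derivatives and power series *)

Definition cder (f : C -> C) (z l : C) : Prop :=
  forall eps : R, (0 < eps)%R -> exists d : R, (0 < d)%R /\
  forall h, (Cmod h < d)%R -> (Cmod (f (z + h) - f z - l * h)%C <= eps * Cmod h)%R.

Lemma cder_ext_loc f g z l r : (0 < r)%R ->
  (forall h, (Cmod h < r)%R -> f (z + h) = g (z + h)) -> cder f z l -> cder g z l.
Proof.
  intros Hr H Hf eps He. destruct (Hf eps He) as [d [Hd Hb]].
  exists (Rmin d r). split. now apply Rmin_pos. intros h Hh.
  rewrite <- H. 2:{ eapply Rlt_le_trans; [apply Hh|apply Rmin_r]. }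
  replace (g z) with (f z).
  - apply Hb. eapply Rlt_le_trans; [apply Hh|apply Rmin_l].
  - assert (E := H 0). rewrite Cplus_0_r in E. apply E. now rewrite Cmod_0.
Qed.

Lemma cder_ext f g z l : (forall w, f w = g w) -> cder f z l -> cder g z l.
Proof. intros H. apply (cder_ext_loc f g z l 1). lra. intros; apply H. Qed.

Lemma cder_const c z : cder (fun _ => c) z 0.
Proof.
  intros eps He. exists 1%R. split; [lra|]. intros h _.
  replace (c - c - 0 * h) with (RtoC 0) by ring. rewrite Cmod_0.
  apply Rmult_le_pos; [lra|apply Cmod_ge_0].
Qed.

Lemma cder_id z : cder (fun w => w) z 1.
Proof.
  intros eps He. exists 1%R. split; [lra|]. intros h _.
  replace (z + h - z - 1 * h) with (RtoC 0) by ring. rewrite Cmod_0.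
  apply Rmult_le_pos; [lra|apply Cmod_ge_0].
Qed.

Lemma cder_plus f g z l m : cder f z l -> cder g z m -> cder (fun w => f w + g w) z (l + m).
Proof.
  intros Hf Hg eps He.
  destruct (Hf (eps / 2)%R ltac:(lra)) as [d1 [Hd1 H1]].
  destruct (Hg (eps / 2)%R ltac:(lra)) as [d2 [Hd2 H2]].
  exists (Rmin d1 d2). split. now apply Rmin_pos. intros h Hh.
  assert (A1 := H1 h ltac:(eapply Rlt_le_trans; [apply Hh|apply Rmin_l])).
  assert (A2 := H2 h ltac:(eapply Rlt_le_trans; [apply Hh|apply Rmin_r])).
  replace (f (z + h) + g (z + h) - (f z + g z) - (l + m) * h) with
    ((f (z + h) - f z - l * h) + (g (z + h) - g z - m * h)) by ring.
  eapply Rle_trans. apply Cmod_triangle. lra.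
Qed.

Lemma cder_lipschitz f z l : cder f z l -> exists d, (0 < d)%R /\
  forall h, (Cmod h < d)%R -> (Cmod (f (z + h) - f z)%C <= (Cmod l + 1) * Cmod h)%R.
Proof.
  intros Hf. destruct (Hf 1%R ltac:(lra)) as [d [Hd H]].
  exists d. split; auto. intros h Hh. specialize (H h Hh).
  replace (f (z + h) - f z) with ((f (z + h) - f z - l * h) + l * h) by ring.
  eapply Rle_trans. apply Cmod_triangle. rewrite Cmod_mult. lra.
Qed.

Lemma cder_mult f g z l m : cder f z l -> cder g z m ->
  cder (fun w => f w * g w) z (l * g z + f z * m).
Proof.
  intros Hf Hg eps He.
  assert (Ga := Cmod_ge_0 (f z)). assert (Gb := Cmod_ge_0 (g z)).
  assert (Gl := Cmod_ge_0 l). assert (Gm := Cmod_ge_0 m).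
  destruct (cder_lipschitz g z m Hg) as [d0 [Hd0 L]].
  set (e1 := (eps / (3 * (Cmod (g z) + 1)))%R).
  set (e2 := (eps / (3 * (Cmod (f z) + 1)))%R).
  set (d3 := (eps / (3 * ((Cmod l + 1) * (Cmod m + 1))))%R).
  assert (He1 : (0 < e1)%R) by (apply Rdiv_lt_0_compat; lra).
  assert (He2 : (0 < e2)%R) by (apply Rdiv_lt_0_compat; lra).
  assert (Hd3 : (0 < d3)%R) by (apply Rdiv_lt_0_compat; nra).
  destruct (Hf e1 He1) as [d1 [Hd1 H1]].
  destruct (Hg e2 He2) as [d2 [Hd2 H2]].
  destruct (cder_lipschitz f z l Hf) as [d4 [Hd4 L4]].
  exists (Rmin (Rmin d0 d4) (Rmin (Rmin d1 d2) d3)). split.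
  { repeat apply Rmin_pos; auto. }
  intros h Hh.
  assert (h0 : (Cmod h < d0)%R) by (eapply Rlt_le_trans; [apply Hh|]; eapply Rle_trans; [apply Rmin_l|apply Rmin_l]).
  assert (h4 : (Cmod h < d4)%R) by (eapply Rlt_le_trans; [apply Hh|]; eapply Rle_trans; [apply Rmin_l|apply Rmin_r]).
  assert (h1 : (Cmod h < d1)%R) by (eapply Rlt_le_trans; [apply Hh|]; eapply Rle_trans; [apply Rmin_r|]; eapply Rle_trans; [apply Rmin_l|apply Rmin_l]).
  assert (h2 : (Cmod h < d2)%R) by (eapply Rlt_le_trans; [apply Hh|]; eapply Rle_trans; [apply Rmin_r|]; eapply Rle_trans; [apply Rmin_l|apply Rmin_r]).
  assert (h3 : (Cmod h < d3)%R) by (eapply Rlt_le_trans; [apply Hh|]; eapply Rle_trans; [apply Rmin_r|apply Rmin_r]).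
  specialize (H1 h h1). specialize (H2 h h2). specialize (L h h0). specialize (L4 h h4).
  replace (f (z + h) * g (z + h) - f z * g z - (l * g z + f z * m) * h) with
    ((f (z + h) - f z - l * h) * g z + (f z * (g (z + h) - g z - m * h) +
     (f (z + h) - f z) * (g (z + h) - g z))) by ring.
  assert (Gh := Cmod_ge_0 h).
  eapply Rle_trans. apply Cmod_triangle.
  eapply Rle_trans. apply Rplus_le_compat_l, Cmod_triangle.
  rewrite 3!Cmod_mult.
  assert (B1 : (Cmod (f (z + h) - f z - l * h)%C * Cmod (g z) <= eps / 3 * Cmod h)%R).
  { apply Rle_trans with (e1 * Cmod h * (Cmod (g z) + 1))%R.
    - apply Rmult_le_compat; auto using Cmod_ge_0; lra.
    - right. unfold e1. field. lra. }
  assert (B2 : (Cmod (f z) * Cmod (g (z + h) - g z - m * h)%C <= eps / 3 * Cmod h)%R).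
  { apply Rle_trans with ((Cmod (f z) + 1) * (e2 * Cmod h))%R.
    - apply Rmult_le_compat; auto using Cmod_ge_0; lra.
    - right. unfold e2. field. lra. }
  assert (B3 : (Cmod (f (z + h) - f z)%C * Cmod (g (z + h) - g z)%C <= eps / 3 * Cmod h)%R).
  { apply Rle_trans with (((Cmod l + 1) * Cmod h) * ((Cmod m + 1) * Cmod h))%R.
    - apply Rmult_le_compat; auto using Cmod_ge_0.
    - apply Rle_trans with (((Cmod l + 1) * (Cmod m + 1)) * d3 * Cmod h)%R.
      + replace ((Cmod l + 1) * Cmod h * ((Cmod m + 1) * Cmod h))%R with
          ((Cmod l + 1) * (Cmod m + 1) * Cmod h * Cmod h)%R by ring.
        apply Rmult_le_compat_r; auto. apply Rmult_le_compat_l; nra.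
      + right. unfold d3. field. lra. }
  lra.
Qed.

Lemma cder_scal c f z l : cder f z l -> cder (fun w => c * f w) z (c * l).
Proof.
  intros H. replace (c * l) with (0 * f z + c * l) by ring.
  apply (cder_mult (fun _ => c)); auto. apply cder_const.
Qed.

Lemma cder_linear c z : cder (fun w => c * w) z c.
Proof. assert (H := cder_scal c _ z 1 (cder_id z)). now rewrite Cmult_1_r in H. Qed.

Lemma cder_comp f g z l m : cder f (g z) l -> cder g z m -> cder (fun w => f (g w)) z (l * m).
Proof.
  intros Hf Hg eps He.
  assert (Gl := Cmod_ge_0 l). assert (Gm := Cmod_ge_0 m).
  destruct (cder_lipschitz g z m Hg) as [d0 [Hd0 L]].
  destruct (Hf (eps / (2 * (Cmod m + 1)))%R) as [d1 [Hd1 H1]]. { apply Rdiv_lt_0_compat; lra. }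
  destruct (Hg (eps / (2 * (Cmod l + 1)))%R) as [d2 [Hd2 H2]]. { apply Rdiv_lt_0_compat; lra. }
  assert (Hd3 : (0 < d1 / (Cmod m + 1))%R) by (apply Rdiv_lt_0_compat; lra).
  exists (Rmin (Rmin d0 d2) (d1 / (Cmod m + 1))). split. { repeat apply Rmin_pos; auto. }
  intros h Hh. assert (Gh := Cmod_ge_0 h).
  assert (h0 : (Cmod h < d0)%R) by (eapply Rlt_le_trans; [apply Hh|]; eapply Rle_trans; [apply Rmin_l|apply Rmin_l]).
  assert (h2 : (Cmod h < d2)%R) by (eapply Rlt_le_trans; [apply Hh|]; eapply Rle_trans; [apply Rmin_l|apply Rmin_r]).
  assert (h3 : (Cmod h < d1 / (Cmod m + 1))%R) by (eapply Rlt_le_trans; [apply Hh|apply Rmin_r]).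
  specialize (L h h0). specialize (H2 h h2). set (k := g (z + h) - g z) in *.
  assert (Hk : (Cmod k < d1)%R).
  { eapply Rle_lt_trans. apply L.
    apply Rlt_le_trans with ((Cmod m + 1) * (d1 / (Cmod m + 1)))%R.
    - apply Rmult_lt_compat_l; lra.
    - right. field. lra. }
  specialize (H1 k Hk).
  replace (g z + k) with (g (z + h)) in H1 by (unfold k; ring).
  replace (f (g (z + h)) - f (g z) - l * m * h) with
    ((f (g (z + h)) - f (g z) - l * k) + l * (k - m * h)) by ring.
  eapply Rle_trans. apply Cmod_triangle. rewrite Cmod_mult.
  assert (B1 : (Cmod (f (g (z + h)) - f (g z) - l * k)%C <= eps / 2 * Cmod h)%R).
  { eapply Rle_trans. apply H1.
    apply Rle_trans with (eps / (2 * (Cmod m + 1)) * ((Cmod m + 1) * Cmod h))%R.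
    - apply Rmult_le_compat_l; auto. left. apply Rdiv_lt_0_compat; lra.
    - right. field. lra. }
  assert (B2 : (Cmod l * Cmod (k - m * h) <= eps / 2 * Cmod h)%R).
  { apply Rle_trans with ((Cmod l + 1) * (eps / (2 * (Cmod l + 1)) * Cmod h))%R.
    - apply Rmult_le_compat; auto using Cmod_ge_0; lra.
    - right. field. lra. }
  lra.
Qed.

Lemma cder_inv (z : C) : z <> 0 -> cder (fun w => / w) z (- / (z * z)).
Proof.
  intros Hz eps He. assert (P := proj1 (Cmod_gt_0 z) Hz). set (m := Cmod z) in *.
  assert (Q : (0 < m * m * m)%R) by (repeat apply Rmult_lt_0_compat; auto).
  exists (Rmin (m / 2) (eps * (m * m * m / 2))). split.
  { apply Rmin_pos; nra. }
  intros h Hh.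
  assert (h1 : (Cmod h < m / 2)%R) by (eapply Rlt_le_trans; [apply Hh|apply Rmin_l]).
  assert (h2 : (Cmod h < eps * (m * m * m / 2))%R) by (eapply Rlt_le_trans; [apply Hh|apply Rmin_r]).
  assert (Gh := Cmod_ge_0 h).
  assert (Hw : (m / 2 < Cmod (z + h))%R).
  { assert (T : (m <= Cmod (z + h) + Cmod (- h))%R).
    { unfold m. replace z with (z + h + - h) at 1 by ring. apply Cmod_triangle. }
    rewrite Cmod_opp in T. lra. }
  assert (Nw : z + h <> 0) by (apply Cmod_gt_0; lra).
  replace (/ (z + h) - / z - - / (z * z) * h) with (h * (h * (/ (z + h) * / (z * z)))) by (field; auto).
  rewrite Cmod_mult, Rmult_comm. apply Rmult_le_compat_r; auto.
  rewrite 2!Cmod_mult, 2!Cmod_inv, Cmod_mult by auto using Cmult_neq_0. fold m.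
  assert (I1 : (/ Cmod (z + h) <= / (m / 2))%R) by (apply Rinv_le_contravar; lra).
  assert (I2 : (0 < / (m * m))%R) by (apply Rinv_0_lt_compat; nra).
  apply Rle_trans with (eps * (m * m * m / 2) * (/ (m / 2) * / (m * m)))%R.
  - apply Rmult_le_compat; try lra.
    + apply Rmult_le_pos; [left; apply Rinv_0_lt_compat; lra|lra].
    + apply Rmult_le_compat_r; lra.
  - right. field. lra.
Qed.

Lemma cder_unique f z l m : cder f z l -> cder f z m -> l = m.
Proof.
  intros Hl Hm. destruct (Ceq_dec l m) as [|Hne]; auto. exfalso.
  assert (P : (0 < Cmod (l - m))%R).
  { apply Cmod_gt_0. intros E. apply Hne. replace l with (l - m + m) by ring. rewrite E. ring. }
  set (e := (Cmod (l - m) / 4)%R).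
  destruct (Hl e ltac:(unfold e; lra)) as [d1 [Hd1 H1]].
  destruct (Hm e ltac:(unfold e; lra)) as [d2 [Hd2 H2]].
  set (h := (Rmin d1 d2 / 2)%R).
  assert (Hh : (0 < h)%R) by (unfold h; assert (Q := Rmin_pos d1 d2 Hd1 Hd2); lra).
  assert (Ch : Cmod (RtoC h) = h) by (rewrite Cmod_R, Rabs_pos_eq; lra).
  assert (L1 := Rmin_l d1 d2). assert (L2 := Rmin_r d1 d2).
  specialize (H1 (RtoC h) ltac:(rewrite Ch; unfold h in *; lra)).
  specialize (H2 (RtoC h) ltac:(rewrite Ch; unfold h in *; lra)).
  rewrite Ch in *.
  assert (T : (Cmod ((l - m) * RtoC h) <= e * h + e * h)%R).
  { replace ((l - m) * RtoC h) with (- (f (z + RtoC h) - f z - l * RtoC h) + (f (z + RtoC h) - f z - m * RtoC h)) by ring.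
    eapply Rle_trans. apply Cmod_triangle. rewrite Cmod_opp. lra. }
  rewrite Cmod_mult, Ch in T. unfold e in T. nra.
Qed.

Definition pser (a : nat -> C) (x : C) : C := Cseries (fun n => a n * Cpow x n).

Lemma rapid_tail a : rapid a -> rapid (fun n => a (S n)).
Proof.
  intros H. apply rapid_shift. intros x Hx.
  apply (proj1 (csummable_incr_1 (fun n => a n * Cpow x n))). apply H, Hx.
Qed.

Lemma rapid_INR a : rapid a -> rapid (fun n => INR n * a n).
Proof.
  intros H. apply rapid_le with (2 := rapid_linear a H).
  intros n. rewrite 2!Cmod_mult, 2!Cmod_R, 2!Rabs_pos_eq by apply pos_INR.
  apply Rmult_le_compat_r. apply Cmod_ge_0. apply le_INR. lia.
Qed.

(** Induction through (x + h)^(n+1) = (x + h) (x + h)^n. The factor r^2 on the left stands for the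
    exponent n - 2 on the right, and n^2 is a crude form of n (n - 1) / 2. *)
Lemma power_remainder (x h : C) (r : R) n : (Cmod x <= r)%R -> (Cmod (x + h) <= r)%R ->
  (r * r * Cmod (Cpow (x + h) n - Cpow x n - INR n * Cpow x (Init.Nat.pred n) * h) <=
   INR n * INR n * (Cmod h * Cmod h) * r ^ n)%R.
Proof.
  intros Hx Hxh. assert (Gx := Cmod_ge_0 x). assert (Gh := Cmod_ge_0 h).
  assert (Hr : (0 <= r)%R) by lra.
  induction n.
  - simpl. replace (1 - 1 - 0 * 1 * h) with (RtoC 0) by ring. rewrite Cmod_0. lra.
  - set (E := Cpow (x + h) n - Cpow x n - INR n * Cpow x (Init.Nat.pred n) * h) in *.
    assert (Es : Cpow (x + h) (S n) - Cpow x (S n) - INR (S n) * Cpow x (Init.Nat.pred (S n)) * h =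
      (x + h) * E + INR n * (h * h) * Cpow x (Init.Nat.pred n)).
    { unfold E. rewrite S_INR, RtoC_plus, 2!Cpow_S. simpl Init.Nat.pred.
      destruct n; [simpl; ring|]. simpl Init.Nat.pred. rewrite (Cpow_S x n). ring. }
    rewrite Es.
    assert (Hn := pos_INR n).
    assert (Hp : (r * (Cmod (Cpow x (Init.Nat.pred n)) * INR n) <= r ^ n * INR n)%R).
    { destruct n; [simpl; lra|]. simpl Init.Nat.pred. rewrite Cmod_pow.
      rewrite <- Rmult_assoc. apply Rmult_le_compat_r; auto. simpl.
      apply Rmult_le_compat_l; auto. apply pow_incr. lra. }
    apply Rle_trans with (r * r * (r * Cmod E + INR n * (Cmod h * Cmod h) * Cmod (Cpow x (Init.Nat.pred n))))%R.
    { apply Rmult_le_compat_l; [nra|]. eapply Rle_trans. apply Cmod_triangle.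
      rewrite 4!Cmod_mult, Cmod_R, Rabs_pos_eq by auto.
      apply Rplus_le_compat_r. apply Rmult_le_compat_r; auto. apply Cmod_ge_0. }
    replace (r * r * (r * Cmod E + INR n * (Cmod h * Cmod h) * Cmod (Cpow x (Init.Nat.pred n))))%R with
      (r * (r * r * Cmod E) + r * (Cmod h * Cmod h) * (r * (Cmod (Cpow x (Init.Nat.pred n)) * INR n)))%R by ring.
    apply Rle_trans with (r * (INR n * INR n * (Cmod h * Cmod h) * r ^ n) + r * (Cmod h * Cmod h) * (r ^ n * INR n))%R.
    { apply Rplus_le_compat; apply Rmult_le_compat_l; auto. repeat apply Rmult_le_pos; auto. }
    rewrite S_INR. simpl (r ^ S n)%R.
    assert (0 <= Cmod h * Cmod h * (r * r ^ n))%R by (repeat apply Rmult_le_pos; auto; now apply pow_le).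
    nra.
Qed.

(** Termwise differentiation: the second order remainders are dominated by n^2 |a_n| r^n, with r the
    midpoint between |x| and 1, where this series still converges. *)
Lemma cder_pser a x : rapid a -> (Cmod x < 1)%R ->
  cder (pser a) x (pser (fun n => INR (S n) * a (S n)) x).
Proof.
  intros Ha Hx.
  set (d := fun n => INR n * a n * Cpow x (Init.Nat.pred n)).
  assert (Sd : csummable d).
  { apply csummable_incr_1.
    apply csummable_ext with (fun n => INR (S n) * a (S n) * Cpow x n). reflexivity.
    apply (rapid_linear _ (rapid_tail a Ha) x Hx). }
  replace (pser (fun n => INR (S n) * a (S n)) x) with (Cseries d).
  2:{ rewrite Cseries_incr_1 by auto. unfold d at 1. simpl (INR 0). rewrite !Cmult_0_l, Cplus_0_l. reflexivity. }
  assert (G := Cmod_ge_0 x).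
  set (r := ((1 + Cmod x) / 2)%R). assert (Hr : (0 < r < 1)%R) by (unfold r; lra).
  set (b := fun n => (Cmod (INR n * (INR n * a n) * Cpow r n))%R).
  assert (Sb : ex_series b).
  { apply (rapid_INR _ (rapid_INR a Ha) r). rewrite Cmod_R, Rabs_pos_eq; lra. }
  set (M := (Series b / (r * r))%R).
  assert (HM : (0 <= M)%R).
  { unfold M. apply Rmult_le_pos. 2: left; apply Rinv_0_lt_compat; nra.
    apply Rle_trans with (b 0%nat). apply Cmod_ge_0. apply term_le_Series; auto. intros; apply Cmod_ge_0. }
  intros eps He.
  exists (Rmin (r - Cmod x) (eps / (M + 1))). split.
  { apply Rmin_pos. unfold r; lra. apply Rdiv_lt_0_compat; lra. }
  intros h Hh. assert (Gh := Cmod_ge_0 h).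
  assert (h1 : (Cmod h < r - Cmod x)%R) by (eapply Rlt_le_trans; [apply Hh|apply Rmin_l]).
  assert (h2 : (Cmod h < eps / (M + 1))%R) by (eapply Rlt_le_trans; [apply Hh|apply Rmin_r]).
  assert (Hxh : (Cmod (x + h) <= r)%R) by (eapply Rle_trans; [apply Cmod_triangle|lra]).
  assert (S1 : csummable (fun n => a n * Cpow (x + h) n)) by (apply Ha; lra).
  assert (S2 : csummable (fun n => a n * Cpow x n)) by (apply Ha; lra).
  assert (E : pser a (x + h) - pser a x - Cseries d * h =
    Cseries (fun n => a n * Cpow (x + h) n - a n * Cpow x n - h * d n)).
  { unfold pser. rewrite 2!Cseries_minus, Cseries_scal; auto using csummable_minus, csummable_scal. ring. }
  rewrite E.
  apply Rle_trans with (M * (Cmod h * Cmod h))%R.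
  - assert (L : (r * r * Cmod (Cseries (fun n => a n * Cpow (x + h) n - a n * Cpow x n - h * d n))%C <= Series b * (Cmod h * Cmod h))%R).
    { replace (r * r)%R with (Cmod (RtoC (r * r))) by (rewrite Cmod_R, Rabs_pos_eq; nra).
      rewrite <- Cmod_mult, <- Cseries_scal.
      - rewrite <- Series_scal_r. apply Cseries_le.
        + intros n. rewrite Cmod_mult, Cmod_R, Rabs_pos_eq by nra.
          replace (a n * Cpow (x + h) n - a n * Cpow x n - h * d n) with
            (a n * (Cpow (x + h) n - Cpow x n - INR n * Cpow x (Init.Nat.pred n) * h)) by (unfold d; ring).
          rewrite Cmod_mult. assert (PR := power_remainder x h r n ltac:(unfold r; lra) Hxh).
          unfold b. rewrite 3!Cmod_mult, Cmod_pow, 2!Cmod_R, (Rabs_pos_eq (INR n)), (Rabs_pos_eq r) by (try apply pos_INR; lra).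
          assert (Ga := Cmod_ge_0 (a n)).
          apply (Rmult_le_compat_l (Cmod (a n))) in PR; auto. lra.
        + exact (ex_series_scal_r (Cmod h * Cmod h)%R b Sb).
      - auto using csummable_minus, csummable_scal. }
    unfold M. apply Rmult_le_reg_l with (r * r)%R. nra.
    eapply Rle_trans. apply L. right. field. lra.
  - replace (M * (Cmod h * Cmod h))%R with (M * Cmod h * Cmod h)%R by ring.
    apply Rmult_le_compat_r; auto.
    apply Rle_trans with ((M + 1) * (eps / (M + 1)))%R.
    + apply Rmult_le_compat; lra.
    + right. field. lra.
Qed.

Lemma pser_theta a x : rapid a -> (Cmod x < 1)%R ->
  x * pser (fun n => INR (S n) * a (S n)) x = pser (fun n => INR n * a n) x.
Proof.
  intros Ha Hx. unfold pser. rewrite <- Cseries_scal by apply (rapid_linear _ (rapid_tail a Ha) x Hx).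
  rewrite (Cseries_incr_1 (fun n => INR n * a n * Cpow x n)) by now apply (rapid_INR a Ha).
  cbv beta. simpl (INR 0). rewrite !Cmult_0_l, Cplus_0_l. apply Cseries_ext. intros n. rewrite Cpow_S. ring.
Qed.

Lemma cder_Cexp z : cder Cexp z (Cexp z).
Proof.
  assert (P := proj1 (Cmod_gt_0 _) (Cexp_neq_0 z)). set (m := Cmod (Cexp z)) in *.
  intros eps He. exists (Rmin (1 / 2) (eps / (9 * m))). split.
  { apply Rmin_pos. lra. apply Rdiv_lt_0_compat; lra. }
  intros h Hh. assert (Gh := Cmod_ge_0 h).
  assert (h1 : (Cmod h < 1 / 2)%R) by (eapply Rlt_le_trans; [apply Hh|apply Rmin_l]).
  assert (h2 : (Cmod h < eps / (9 * m))%R) by (eapply Rlt_le_trans; [apply Hh|apply Rmin_r]).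
  rewrite Cexp_plus. replace (Cexp z * Cexp h - Cexp z - Cexp z * h) with (Cexp z * (Cexp h - 1 - h)) by ring.
  rewrite Cmod_mult. fold m.
  apply Rle_trans with (m * (9 * Cmod h ^ 2))%R.
  - apply Rmult_le_compat_l; [lra|]. apply Cexp_sub_Cmod. lra.
  - replace (m * (9 * Cmod h ^ 2))%R with (9 * m * Cmod h * Cmod h)%R by ring.
    apply Rmult_le_compat_r; auto.
    apply Rle_trans with (9 * m * (eps / (9 * m)))%R.
    + apply Rmult_le_compat_l; lra.
    + right. field. lra.
Qed.

(** * Expansions in the local parameter q^(1/2) *)

Definition ph (tau : C) : C := qpar (tau / 2).

Lemma Im_half tau : Im (tau / 2) = (Im tau / 2)%R.
Proof. unfold Cdiv. rewrite <- RtoC_inv by lra. destruct tau. simpl. field. Qed.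

Lemma Cmod_ph tau : (0 < Im tau)%R -> (Cmod (ph tau) < 1)%R.
Proof. intros H. apply Cmod_qpar_lt_1. rewrite Im_half. lra. Qed.

Lemma cder_ph z : cder ph z (tpi / 2 * ph z).
Proof.
  apply cder_ext with (fun w => Cexp (tpi / 2 * w)).
  - intros w. unfold ph. rewrite qpar_tpi. f_equal. field.
  - replace (ph z) with (Cexp (tpi / 2 * z)) by (unfold ph; rewrite qpar_tpi; f_equal; field).
    rewrite Cmult_comm. apply (cder_comp Cexp (fun w => tpi / 2 * w)). apply cder_Cexp.
    apply cder_linear.
Qed.

Definition qs (a : nat -> C) (g : C -> C) : Prop :=
  rapid a /\ forall tau, (0 < Im tau)%R -> g tau = pser a (ph tau).

Lemma half_plane_ball z : (0 < Im z)%R -> forall h, (Cmod h < Im z)%R -> (0 < Im (z + h))%R.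
Proof.
  intros Hz h Hh. assert (L := im_le_Cmod h). assert (Q := Rle_abs (- Im h)).
  rewrite Rabs_Ropp in Q. destruct z, h. simpl in *. lra.
Qed.

Definition half_D (a : nat -> C) (n : nat) : C := / 2 * (INR n * a n).

(* The operator [q d/dq] on series in [q^(1/2)]. *)
Definition Dq (a : nat -> C) (tau : C) : C := pser (half_D a) (ph tau).

Lemma rapid_half_D a : rapid a -> rapid (half_D a).
Proof. intros H. apply rapid_scal, rapid_INR, H. Qed.

Lemma qs_D a g : qs a g -> qs (half_D a) (Dq a).
Proof. intros [Ha _]. split. now apply rapid_half_D. reflexivity. Qed.

Lemma qs_cder a g tau : qs a g -> (0 < Im tau)%R -> cder g tau (tpi * Dq a tau).
Proof.
  intros [Ha Hg] Ht. assert (Hp := Cmod_ph tau Ht).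
  assert (Hl := cder_pser a (ph tau) Ha Hp). assert (El := pser_theta a (ph tau) Ha Hp).
  set (l := pser (fun n => INR (S n) * a (S n)) (ph tau)) in *.
  assert (E : tpi * Dq a tau = l * (tpi / 2 * ph tau)).
  { replace (l * (tpi / 2 * ph tau)) with (tpi * (/ 2 * (ph tau * l))) by field.
    rewrite El. unfold Dq, pser, half_D.
    rewrite <- (Cseries_scal (/ 2)) by apply (rapid_INR a Ha _ Hp).
    f_equal. apply Cseries_ext. intros n. ring. }
  rewrite E.
  apply cder_ext_loc with (fun w => pser a (ph w)) (Im tau); auto.
  - intros h Hh. rewrite Hg; auto. now apply half_plane_ball.
  - apply cder_comp; auto. apply cder_ph.
Qed.

Lemma qs_ext a g1 g2 : (forall tau, (0 < Im tau)%R -> g1 tau = g2 tau) -> qs a g1 -> qs a g2.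
Proof. intros H [Ha Hg]. split; auto. intros tau Ht. rewrite <- H; auto. Qed.

Definition cst (c : C) (n : nat) : C := match n with 0%nat => c | _ => 0 end.

Lemma qs_const c : qs (cst c) (fun _ => c).
Proof.
  assert (H : forall x n, (0 < n)%nat -> cst c n * Cpow x n = 0).
  { intros x n Hn. destruct n; [lia|]. simpl. ring. }
  split.
  - intros x _. apply csummable_finite with 0%nat. auto.
  - intros tau _. unfold pser. rewrite (Cseries_finite _ 0); auto. simpl. ring.
Qed.

Lemma qs_plus a b f g : qs a f -> qs b g -> qs (fun n => a n + b n) (fun t => f t + g t).
Proof.
  intros [Ha Hf] [Hb Hg]. split. now apply rapid_plus.
  intros tau Ht. rewrite Hf, Hg by auto. unfold pser. assert (Hp := Cmod_ph tau Ht).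
  rewrite <- Cseries_plus by auto. apply Cseries_ext. intros n. ring.
Qed.

Lemma qs_scal c a f : qs a f -> qs (fun n => c * a n) (fun t => c * f t).
Proof.
  intros [Ha Hf]. split. now apply rapid_scal.
  intros tau Ht. rewrite Hf by auto. unfold pser. assert (Hp := Cmod_ph tau Ht).
  rewrite <- Cseries_scal by auto. apply Cseries_ext. intros n. ring.
Qed.

Lemma qs_minus a b f g : qs a f -> qs b g -> qs (fun n => a n - b n) (fun t => f t - g t).
Proof.
  intros Hf Hg. assert (H := qs_plus _ _ _ _ Hf (qs_scal (- (1)) _ _ Hg)).
  destruct H as [H1 H2]. split.
  - apply rapid_ext with (2 := H1). intros; ring.
  - intros tau Ht. transitivity (f tau + - (1) * g tau). ring.
    rewrite H2 by auto. apply Cseries_ext. intros; ring.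
Qed.

Definition cmul (a b : nat -> C) (n : nat) : C := Csum (fun i => a i * b (n - i)%nat) n.

Lemma cmul_pow a b x n :
  Csum (fun i => a i * Cpow x i * (b (n - i)%nat * Cpow x (n - i))) n = cmul a b n * Cpow x n.
Proof.
  unfold cmul. rewrite Cmult_comm, <- Csum_scal. apply Csum_ext_loc. intros i Hi.
  replace (Cpow x n) with (Cpow x i * Cpow x (n - i)). ring.
  rewrite <- Cpow_add_r. f_equal. lia.
Qed.

Lemma rapid_cmul a b : rapid a -> rapid b -> rapid (cmul a b).
Proof.
  intros Ha Hb x Hx.
  apply csummable_ext with (1 := cmul_pow a b x).
  apply (Cseries_mult (fun i => a i * Cpow x i) (fun i => b i * Cpow x i)); auto.
Qed.

Lemma pser_cmul a b x : rapid a -> rapid b -> (Cmod x < 1)%R ->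
  pser (cmul a b) x = pser a x * pser b x.
Proof.
  intros Ha Hb Hx. unfold pser.
  rewrite <- (proj2 (Cseries_mult (fun i => a i * Cpow x i) (fun i => b i * Cpow x i) (Ha x Hx) (Hb x Hx))).
  apply Cseries_ext. intros n. symmetry. apply cmul_pow.
Qed.

Lemma qs_mult a b f g : qs a f -> qs b g -> qs (cmul a b) (fun t => f t * g t).
Proof.
  intros [Ha Hf] [Hb Hg]. split. now apply rapid_cmul.
  intros tau Ht. rewrite Hf, Hg by auto. rewrite pser_cmul; auto. now apply Cmod_ph.
Qed.

(** * Infinite products *)

Lemma cder_clim f z l u : cder f z l -> clim u z -> clim (fun n => f (u n)) (f z).
Proof.
  intros Hf Hu eps He. destruct (cder_lipschitz f z l Hf) as [d [Hd H]].
  assert (G := Cmod_ge_0 l). set (M := (Cmod l + 1)%R) in *.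
  destruct (Hu (Rmin d (eps / M))) as [N HN].
  { apply Rmin_pos; auto. apply Rdiv_lt_0_compat; unfold M; lra. }
  exists N. intros n Hn. specialize (HN n Hn).
  assert (h1 : (Cmod (u n - z) < d)%R) by (eapply Rlt_le_trans; [apply HN|apply Rmin_l]).
  assert (h2 : (Cmod (u n - z) < eps / M)%R) by (eapply Rlt_le_trans; [apply HN|apply Rmin_r]).
  specialize (H _ h1). replace (z + (u n - z)) with (u n) in H by ring.
  eapply Rle_lt_trans. apply H. replace eps with (M * (eps / M))%R by (field; unfold M; lra).
  apply Rmult_lt_compat_l; auto. unfold M; lra.
Qed.

Lemma Ciota_filterlim {T} (F : (T -> Prop) -> Prop) {FF : ProperFilter' F} (f : T -> C) (l : C) :
  filterlim f F (@locally C_UniformSpace l) ->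
  Ciota (fun l => filterlim f F (@locally C_UniformSpace l)) = l.
Proof.
  intros H. unfold Ciota. exact (iota_filterlim_locally f l H).
Qed.

Module Products.
From HB Require Import structures.
From mathcomp Require Import all_boot.
HB.instance Definition _ := Monoid.isComLaw.Build C (RtoC (IZR (Zpos xH))) Cmult Cmult_assoc Cmult_comm Cmult_1_l.

Lemma prod_Cexp (f g : nat -> C) N : (forall n, f n = Cexp (g n)) ->
  \big[Cmult/RtoC (IZR (Zpos xH))]_(0 <= n < N.+1) f n = Cexp (Csum g N).
Proof.
move=> H; elim: N => [|N IH]; first by rewrite big_nat1 H.
by rewrite big_nat_recr //= IH H -Cexp_plus.
Qed.

Lemma Cinfprod_Cexp (f g : nat -> C) : (forall n, f n = Cexp (g n)) -> csummable g ->
  Cinfprod f = Cexp (Cseries g).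
Proof.
move=> H Hg; apply: (@Ciota_filterlim nat _ (@Proper_StrongProper nat eventually eventually_filter)); apply/clim_filterlim.
(* A product over n < N has N factors, whereas [Csum g N] has N + 1 terms. *)
apply: (clim_shift _ _ 1); apply: (clim_ext (fun N => Cexp (Csum g N))).
  by move=> N; rewrite -(prod_Cexp _ _ _ H).
by apply: cder_clim; [apply: cder_Cexp|apply: Cseries_clim].
Qed.
End Products.

(** * Forms vanishing at the cusp *)

Lemma bil_sum_bound (f : Z -> C) (M : R) K : (forall j, (Cmod (f j) <= M)%R) ->
  (Cmod (Csum (bil f) K) <= oddn K * M)%R.
Proof.
  intros H. unfold oddn. induction K.
  - simpl. specialize (H 0%Z). lra.
  - rewrite Csum_S. eapply Rle_trans. apply Cmod_triangle.
    replace (2 * S K + 1)%nat with (S (S (2 * K + 1))) by lia. rewrite 2!S_INR.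
    assert (A : (Cmod (bil f (S K)) <= M + M)%R).
    { unfold bil. eapply Rle_trans. apply Cmod_triangle. apply Rplus_le_compat; auto. }
    lra.
Qed.

Lemma bil_sum_const K : Csum (bil (fun _ => 1)) K = oddn K.
Proof.
  unfold oddn. induction K; [reflexivity|].
  rewrite Csum_S, IHK. unfold bil.
  replace (2 * S K + 1)%nat with (S (S (2 * K + 1))) by lia. rewrite 2!S_INR, !RtoC_plus. ring.
Qed.

Lemma char_sum_diff K m n : (m < 2 * K + 1)%nat -> (n < 2 * K + 1)%nat -> m <> n ->
  Csum (bil (fun j => qpar (IZR j * ((INR m - INR n) / oddn K)))) K = 0.
Proof.
  intros Hm Hn Hne. assert (Ho := oddn_neq K).
  destruct (le_lt_dec m n) as [Hle|Hlt].
  - rewrite (Csum_ext _ (bil (fun j => qpar (IZR j * (INR (n - m) / oddn K))))).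
    + rewrite char_sum by lia. replace (n - m =? 2 * K + 1)%nat with false; auto.
      symmetry. apply Nat.eqb_neq. lia.
    + intros k. rewrite <- bil_opp. apply bil_ext. intros j. f_equal.
      rewrite opp_IZR, minus_INR, RtoC_minus, RtoC_opp by lia. field. auto.
  - rewrite (Csum_ext _ (bil (fun j => qpar (IZR j * (INR (m - n) / oddn K))))).
    + rewrite char_sum by lia. replace (m - n =? 2 * K + 1)%nat with false; auto.
      symmetry. apply Nat.eqb_neq. lia.
    + intros k. apply bil_ext. intros j. f_equal. rewrite minus_INR, RtoC_minus by lia. reflexivity.
Qed.

Lemma Cmod_qpar_real (x : R) : Cmod (qpar x) = 1%R.
Proof. rewrite Cmod_qpar. simpl. rewrite Rmult_0_r, Ropp_0. apply exp_0. Qed.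

Lemma real_div_oddn (y : C) K : Im y = 0%R -> exists x : R, y / oddn K = x.
Proof.
  intros H. exists (Re y / oddn K)%R. destruct y as [a b]. simpl in *. subst b.
  unfold Cdiv, Rdiv. assert (Ho := oddn_pos K).
  rewrite RtoC_mult, RtoC_inv by lra. reflexivity.
Qed.

(* By averaging over roots of unity. *)
Lemma cauchy_estimate a (r M : R) n : rapid a -> (0 < r < 1)%R ->
  (forall x : R, (Cmod (pser a (r * qpar x)) <= M)%R) -> (Cmod (a n) * r ^ n <= M)%R.
Proof.
  intros Ha Hr HM.
  assert (Cr : Cmod (RtoC r) = r) by (rewrite Cmod_R, Rabs_pos_eq; lra).
  set (w := fun K m => / oddn K * Csum (bil (fun j => qpar (IZR j * ((INR m - INR n) / oddn K)))) K).
  set (avg := fun K => / oddn K * Csum (bil (fun j =>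
       qpar (IZR j * (- INR n / oddn K)) * pser a (r * qpar (IZR j * (1 / oddn K))))) K).
  assert (Hreal : forall K (j : Z) (y : C), Im y = 0%R -> exists x : R, IZR j * (y / oddn K) = x).
  { intros K j y Hy. destruct (real_div_oddn y K Hy) as [x Hx]. exists (IZR j * x)%R.
    now rewrite Hx, RtoC_mult. }
  assert (Hw1 : forall K m, (Cmod (w K m) <= 1)%R).
  { intros K m. unfold w. assert (Ho := oddn_pos K).
    rewrite Cmod_mult, Cmod_inv, Cmod_R, Rabs_pos_eq by (auto using oddn_neq; lra).
    apply Rmult_le_reg_l with (oddn K); [lra|]. rewrite <- Rmult_assoc, Rinv_r, Rmult_1_l by lra.
    apply bil_sum_bound. intros j.
    destruct (Hreal K j (INR m - INR n)) as [x ->]. { simpl. ring. } rewrite Cmod_qpar_real. lra. }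
  assert (Eavg : forall K, avg K = Cseries (fun m => a m * Cpow r m * w K m)).
  { intros K. unfold avg, w.
    set (F := fun j m => qpar (IZR j * (- INR n / oddn K)) * (a m * Cpow (r * qpar (IZR j * (1 / oddn K))) m)).
    assert (SF : forall j, csummable (F j)).
    { intros j. apply csummable_scal, Ha. rewrite Cmod_mult, Cr.
      destruct (Hreal K j 1 eq_refl) as [x ->]. rewrite Cmod_qpar_real. lra. }
    assert (G : forall N, Csum (bil (fun j => Cseries (F j))) N = Cseries (fun m => Csum (bil (fun j => F j m)) N) /\
        csummable (fun m => Csum (bil (fun j => F j m)) N)).
    { intros N.
      assert (SB : forall i, csummable (fun m => bil (fun j => F j m) i) /\
                   Cseries (fun m => bil (fun j => F j m) i) = bil (fun j => Cseries (F j)) i).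
      { intros i. destruct i; unfold bil.
        - split; [apply SF|reflexivity].
        - split; [apply csummable_plus; apply SF|apply Cseries_plus; apply SF]. }
      destruct (Cseries_Csum (fun i m => bil (fun j => F j m) i) N (fun i => proj1 (SB i))) as [E1 E2].
      split; [|exact E2].
      transitivity (Csum (fun i => Cseries (fun m => bil (fun j => F j m) i)) N).
      apply Csum_ext. intros i. symmetry. apply SB. symmetry. exact E1. }
    destruct (G K) as [G1 G2].
    rewrite (Csum_ext _ (bil (fun j => Cseries (F j)))).
    - rewrite G1, <- Cseries_scal by auto. apply Cseries_ext. intros m.
      replace (a m * Cpow r m * (/ oddn K * Csum (bil (fun j => qpar (IZR j * ((INR m - INR n) / oddn K)))) K))
        with (/ oddn K * ((a m * Cpow r m) * Csum (bil (fun j => qpar (IZR j * ((INR m - INR n) / oddn K)))) K)) by ring.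
      f_equal. rewrite <- Csum_scal. apply Csum_ext. intros i. rewrite <- bil_scal. apply bil_ext. intros j.
      unfold F. rewrite Cpow_mult_l, qpar_pow.
      replace (IZR j * ((INR m - INR n) / oddn K)) with (IZR j * (- INR n / oddn K) + INR m * (IZR j * (1 / oddn K))).
      + rewrite qpar_plus. ring.
      + field. apply oddn_neq.
    - intros i. apply bil_ext. intros j. unfold F, pser. rewrite Cseries_scal; auto.
      apply Ha. rewrite Cmod_mult, Cr.
      destruct (Hreal K j 1 eq_refl) as [x ->]. rewrite Cmod_qpar_real. lra. }
  (* The averages [w K m] are at most 1 in modulus and, once K >= m + n, equal 1 for m = n and 0
     otherwise; [tannery] then isolates the n-th term. *)
  assert (Lim : clim avg (a n * Cpow r n)).
  { apply clim_ext with (fun K => Cseries (fun m => a m * Cpow r m * w K m)). { intros; now rewrite Eavg. }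
    replace (a n * Cpow r n) with (Cseries (fun m => if (m =? n)%nat then a m * Cpow r m else 0)).
    2:{ rewrite (Cseries_single _ n). now rewrite Nat.eqb_refl.
        intros m Hm. now rewrite (proj2 (Nat.eqb_neq _ _) Hm). }
    apply tannery with (fun m => Cmod (a m * Cpow r m)).
    - intros K m. rewrite Cmod_mult. rewrite <- (Rmult_1_r (Cmod (a m * _))) at 2.
      apply Rmult_le_compat_l; auto. apply Cmod_ge_0.
    - apply Ha. lra.
    - intros m. apply clim_ext_loc with (fun _ => if (m =? n)%nat then a m * Cpow r m else 0) (m + n)%nat.
      2: apply clim_const.
      intros K HK. destruct (Nat.eqb_spec m n) as [->|Hne].
      + unfold w. rewrite (Csum_ext _ (bil (fun _ => 1))).
        * rewrite bil_sum_const. assert (Ho := oddn_neq K). field. auto.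
        * intros i. apply bil_ext. intros j. rewrite <- qpar_0. f_equal. field. apply oddn_neq.
      + unfold w. rewrite char_sum_diff by lia. ring. }
  assert (E : (Cmod (a n) * r ^ n)%R = Cmod (a n * Cpow r n)) by (rewrite Cmod_mult, Cmod_pow, Cr; auto).
  rewrite E. apply clim_Cmod_le with avg; auto.
  intros K. unfold avg. assert (Ho := oddn_pos K).
  rewrite Cmod_mult, Cmod_inv, Cmod_R, Rabs_pos_eq by (auto using oddn_neq; lra).
  apply Rmult_le_reg_l with (oddn K); [lra|]. rewrite <- Rmult_assoc, Rinv_r, Rmult_1_l by lra.
  apply bil_sum_bound. intros j. rewrite Cmod_mult.
  destruct (Hreal K j (- INR n)) as [x ->]. { simpl. ring. } rewrite Cmod_qpar_real, Rmult_1_l.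
  destruct (Hreal K j 1 eq_refl) as [y ->]. apply HM.
Qed.

Fixpoint cpw (a : nat -> C) (N : nat) : nat -> C :=
  match N with 0%nat => cst 1 | S N' => cmul a (cpw a N') end.

Lemma cpw_spec a N : rapid a -> rapid (cpw a N) /\
  forall x, (Cmod x < 1)%R -> pser (cpw a N) x = Cpow (pser a x) N.
Proof.
  intros Ha. induction N as [|N [IH1 IH2]].
  - split. apply (qs_const 1). intros x Hx. simpl. unfold pser.
    rewrite (Cseries_finite _ 0). simpl; ring. intros n Hn. destruct n; [lia|]. simpl. ring.
  - split. now apply rapid_cmul. intros x Hx. simpl cpw. rewrite pser_cmul, IH2 by auto. reflexivity.
Qed.

(** If A > M > 0, Bernoulli's inequality makes (A / M)^N exceed any constant. This removes a
    multiplicative constant from a bound valid for all powers. *)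
Lemma le_of_pow_le (A M c : R) : (0 <= A)%R -> (0 <= M)%R ->
  (forall N : nat, (A ^ N <= c * M ^ N)%R) -> (A <= M)%R.
Proof.
  intros HA HM H. apply Rnot_lt_le. intros Hlt.
  destruct (Req_dec M 0) as [->|HM0].
  - specialize (H 1%nat). simpl in H. lra.
  - set (t := (A / M - 1)%R).
    assert (Ht : (0 < t)%R).
    { unfold t. assert (1 < A / M)%R; [|lra]. apply Rmult_lt_reg_r with M; [lra|].
      unfold Rdiv. rewrite Rmult_assoc, Rinv_l by lra. lra. }
    destruct (exists_nat_ge (c / t)) as [N HN].
    specialize (H N).
    assert (B : (1 + INR N * t <= (A / M) ^ N)%R).
    { replace (A / M)%R with (1 + t)%R by (unfold t; ring). apply poly. exact Ht. }
    assert (P : (0 < M ^ N)%R) by (apply pow_lt; lra).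
    assert (E : (A ^ N = (A / M) ^ N * M ^ N)%R).
    { rewrite <- Rpow_mult_distr. f_equal. field. auto. }
    rewrite E in H. apply Rmult_le_reg_r in H; auto.
    assert (c <= INR N * t)%R.
    { apply Rmult_le_reg_r with (/ t)%R. now apply Rinv_0_lt_compat.
      rewrite Rmult_assoc, Rinv_r by lra. rewrite Rmult_1_r. exact HN. }
    lra.
Qed.

(* Cauchy's estimate applied to powers of the series. *)
Lemma max_modulus a (r M : R) x : rapid a -> (0 < r < 1)%R ->
  (forall t : R, (Cmod (pser a (r * qpar t)) <= M)%R) -> (Cmod x < r)%R -> (Cmod (pser a x) <= M)%R.
Proof.
  intros Ha Hr HM Hx. assert (Gx := Cmod_ge_0 x).
  assert (HM0 : (0 <= M)%R) by (eapply Rle_trans; [apply Cmod_ge_0|apply (HM 0%R)]).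
  set (u := (Cmod x / r)%R).
  assert (Hu : (0 <= u < 1)%R).
  { unfold u. split. apply Rmult_le_pos; auto. left. apply Rinv_0_lt_compat. lra.
    apply Rmult_lt_reg_r with r; [lra|]. unfold Rdiv. rewrite Rmult_assoc, Rinv_l by lra. lra. }
  (* The coefficients of the N-th power are at most M^N / r^n, so a geometric series in [u] bounds
     the N-th power at x by M^N / (1 - u); the factor independent of N then disappears. *)
  apply le_of_pow_le with (/ (1 - u))%R; auto. apply Cmod_ge_0.
  intros N. destruct (cpw_spec a N Ha) as [P1 P2].
  rewrite <- Cmod_pow, <- P2 by lra.
  assert (HC : forall n, (Cmod (cpw a N n) * r ^ n <= M ^ N)%R).
  { intros n. apply cauchy_estimate; auto. intros t. rewrite P2.
    - rewrite Cmod_pow. apply pow_incr. split. apply Cmod_ge_0. apply HM.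
    - rewrite Cmod_mult, Cmod_qpar_real, Cmod_R, Rabs_pos_eq; lra. }
  assert (Hg : ex_series (fun n => (u ^ n)%R)) by (apply ex_series_geom; rewrite Rabs_pos_eq; lra).
  rewrite Rmult_comm. rewrite <- (Series_geom u) by (rewrite Rabs_pos_eq; lra).
  rewrite <- Series_scal_l. apply Cseries_le.
  - intros n. rewrite Cmod_mult, Cmod_pow. specialize (HC n).
    replace (Cmod x ^ n)%R with (r ^ n * u ^ n)%R.
    2:{ rewrite <- Rpow_mult_distr. f_equal. unfold u. field. lra. }
    rewrite <- Rmult_assoc. apply Rmult_le_compat_r; auto. apply pow_le. lra.
  - exact (ex_series_scal_l _ _ Hg).
Qed.

(** * The Fricke group and reduction to large imaginary part *)

Definition fricke (tau : C) : C := - (1) / (3 * tau).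

Lemma Im_fricke_eq tau : (0 < Im tau)%R -> Im (fricke tau) = (Im tau / (3 * Cmod tau ^ 2))%R.
Proof.
  intros H. rewrite Cmod2_alt. destruct tau as [x y]. simpl in H.
  unfold fricke, Cdiv, Cinv, Cmult, Copp, RtoC. simpl. field. nra.
Qed.

Definition T_invariant (g : C -> C) : Prop :=
  forall tau, (0 < Im tau)%R -> Cmod (g (tau + 1)) = Cmod (g tau).

(** Weight k under the Fricke involution, in absolute value: multipliers of modulus 1 disappear, and
    [sqrt 3] normalizes the factor so that its values at tau and at W tau are inverse to each
    other. *)
Definition W_invariant (g : C -> C) (k : nat) : Prop := forall tau, (0 < Im tau)%R ->
  Cmod (g (fricke tau)) = ((sqrt 3 * Cmod tau) ^ k * Cmod (g tau))%R.

(* [|g|^2 y^k], invariant under translations and under the Fricke involution when [g] has weight [k]. *)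
Definition height (g : C -> C) (k : nat) (tau : C) : R := (Cmod (g tau) ^ 2 * Im tau ^ k)%R.

Lemma height_T g k tau (n : Z) : T_invariant g -> (0 < Im tau)%R ->
  height g k (tau + IZR n) = height g k tau.
Proof.
  intros HT.
  assert (I : forall z (m : Z), Im (z + IZR m) = Im z) by (intros z m; destruct z; simpl; ring).
  assert (P : forall m z, (0 < Im z)%R -> Cmod (g (z + INR m)%C) = Cmod (g z)).
  { intros m z Hz. induction m. simpl. now rewrite Cplus_0_r.
    rewrite S_INR, RtoC_plus, Cplus_assoc, HT, IHm; auto.
    rewrite INR_IZR_INZ, I. exact Hz. }
  intros Ht. unfold height. rewrite I. f_equal. f_equal.
  destruct (Z_le_gt_dec 0 n).
  - rewrite <- (Z2Nat.id n) by lia. rewrite <- INR_IZR_INZ. now apply P.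
  - rewrite <- (P (Z.to_nat (- n)) (tau + IZR n)) by now rewrite I.
    f_equal. f_equal. rewrite INR_IZR_INZ, Z2Nat.id, opp_IZR, RtoC_opp by lia. ring.
Qed.

Lemma height_W g k tau : W_invariant g k -> (0 < Im tau)%R ->
  height g k (fricke tau) = height g k tau.
Proof.
  intros HW H. assert (P := proj1 (Cmod_gt_0 tau) (Im_pos_neq_0 tau H)).
  unfold height. rewrite HW, Im_fricke_eq by auto.
  assert (E : ((sqrt 3 * Cmod tau) ^ 2 = 3 * Cmod tau ^ 2)%R).
  { rewrite Rpow_mult_distr. f_equal. simpl. rewrite Rmult_1_r. apply sqrt3_sq. }
  rewrite Rpow_mult_distr, <- pow_mult, (Nat.mul_comm k 2), pow_mult, E.
  unfold Rdiv. rewrite (Rpow_mult_distr (Im tau)), pow_inv.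
  assert (Q : (0 < (3 * Cmod tau ^ 2) ^ k)%R).
  { apply pow_lt. apply Rmult_lt_0_compat; [lra|]. now apply pow_lt. }
  field. lra.
Qed.

(** After a translation to |Re| <= 1/2, a point with Im < c has |tau|^2 <= 1/4 + c^2, so W
    multiplies its imaginary part by 1 / (3 |tau|^2) >= [lam]. The condition 12 c^2 < 1 says that
    [lam] > 1, so finitely many steps reach c. *)
Lemma height_reduction g k (c : R) : T_invariant g -> W_invariant g k ->
  (0 < c)%R -> (12 * c ^ 2 < 1)%R ->
  forall tau, (0 < Im tau)%R -> exists tau', (c <= Im tau')%R /\ height g k tau' = height g k tau.
Proof.
  intros HT HW Hc Hc12. set (lam := (/ (3 / 4 + 3 * c ^ 2))%R).
  assert (Hl : (1 < lam)%R).
  { unfold lam. rewrite <- Rinv_1. apply Rinv_lt_contravar; nra. }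
  assert (P : forall n tau, (0 < Im tau)%R -> (c <= Im tau * lam ^ n)%R ->
             exists tau', (c <= Im tau')%R /\ height g k tau' = height g k tau).
  { induction n; intros tau Ht Hn.
    - exists tau. split; auto. simpl in Hn. lra.
    - destruct (Rle_dec c (Im tau)) as [Hle|Hgt]; [exists tau; auto|].
      destruct (exists_shift (Re tau)) as [m Hm].
      set (t1 := tau + IZR m).
      assert (I1 : Im t1 = Im tau) by (unfold t1; destruct tau; simpl; ring).
      assert (R1 : Re t1 = (Re tau + IZR m)%R) by (unfold t1; destruct tau; simpl; ring).
      assert (H1 : (0 < Im t1)%R) by lra.
      assert (Hmod : (Cmod t1 ^ 2 <= 1 / 4 + c ^ 2)%R).
      { rewrite Cmod2_alt, I1, R1. apply Rabs_le_between in Hm.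
        assert ((Re tau + IZR m) ^ 2 <= 1 / 4)%R by nra.
        assert (Im tau ^ 2 <= c ^ 2)%R by nra. lra. }
      assert (Hpos := proj1 (Cmod_gt_0 t1) (Im_pos_neq_0 t1 H1)).
      assert (Hp2 : (0 < Cmod t1 ^ 2)%R) by now apply pow_lt.
      assert (I2 : (Im tau * lam <= Im (fricke t1))%R).
      { rewrite Im_fricke_eq, I1 by auto. unfold Rdiv. apply Rmult_le_compat_l; [lra|].
        unfold lam. apply Rinv_le_contravar; lra. }
      destruct (IHn (fricke t1)) as [t2 [A1 A2]].
      + nra.
      + apply Rle_trans with (Im tau * lam * lam ^ n)%R.
        * simpl in Hn. lra.
        * apply Rmult_le_compat_r; auto. apply pow_le. lra.
      + exists t2. split; auto. rewrite A2, height_W by auto. unfold t1. now apply height_T. }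
  intros tau Ht.
  destruct (exists_nat_ge (c / Im tau / (lam - 1))) as [n Hn].
  apply (P n); auto.
  assert (B : (1 + INR n * (lam - 1) <= lam ^ n)%R).
  { replace lam with (1 + (lam - 1))%R at 2 by ring. apply poly. lra. }
  assert (Hn2 : (c / Im tau <= INR n * (lam - 1))%R).
  { apply Rmult_le_reg_r with (/ (lam - 1))%R. apply Rinv_0_lt_compat; lra.
    rewrite Rmult_assoc, Rinv_r by lra. rewrite Rmult_1_r. exact Hn. }
  replace c with (Im tau * (c / Im tau))%R at 1 by (field; lra).
  apply Rmult_le_compat_l; lra.
Qed.
Lemma pser_factor a nu : rapid a -> (forall n, (n < nu)%nat -> a n = 0) ->
  rapid (fun n => a (nu + n)%nat) /\
  forall x, (Cmod x < 1)%R -> pser a x = Cpow x nu * pser (fun n => a (nu + n)%nat) x.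
Proof.
  intros Ha H0. induction nu as [|nu IH].
  - split; auto. intros x Hx. simpl. change (fun n => a n) with a. ring.
  - destruct IH as [R1 E1]. { intros; apply H0; lia. }
    assert (Ex : forall n, a (nu + S n)%nat = a (S nu + n)%nat) by (intros; f_equal; lia).
    split.
    + apply rapid_ext with (1 := Ex). now apply (rapid_tail (fun n => a (nu + n)%nat)).
    + intros x Hx. rewrite E1 by auto. unfold pser at 1. rewrite Cseries_incr_1 by (apply R1; auto).
      rewrite Nat.add_0_r, H0 by lia. rewrite Cpow_S.
      replace (x * Cpow x nu * pser (fun n => a (S nu + n)%nat) x) with
        (Cpow x nu * (x * pser (fun n => a (S nu + n)%nat) x)) by ring.
      f_equal. rewrite Cmult_0_l, Cplus_0_l. unfold pser. rewrite <- Cseries_scal.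
      * apply Cseries_ext. intros n. rewrite Ex, Cpow_S. ring.
      * apply (rapid_ext _ _ Ex); auto. now apply (rapid_tail (fun n => a (nu + n)%nat)).
Qed.

(** The logarithmic derivative k / y - b of the left side is at most k / y0 - b for y >= y0, and y -
    y0 >= c - y0. The inequality y / y0 <= exp (y / y0 - 1) does the work of the logarithm. *)
Lemma power_exp_decay (k : nat) (b y0 y c : R) : (0 < y0)%R -> (y0 < c)%R -> (c <= y)%R ->
  (INR k / y0 < b)%R ->
  (y ^ k * exp (- (b * y)) <= exp (- ((b - INR k / y0) * (c - y0))) * (y0 ^ k * exp (- (b * y0))))%R.
Proof.
  intros H0 Hc Hy Hb.
  assert (P : (y ^ k <= y0 ^ k * exp (INR k / y0 * (y - y0)))%R).
  { apply Rle_trans with (y0 ^ k * exp (y / y0 - 1) ^ k)%R.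
    - rewrite <- Rpow_mult_distr. apply pow_incr. split; [lra|].
      assert (E := exp_ineq1_le (y / y0 - 1)).
      apply Rle_trans with (y0 * (y / y0))%R. right; field; lra.
      apply Rmult_le_compat_l; lra.
    - right. f_equal. clear -H0. induction k.
      + simpl. unfold Rdiv. rewrite !Rmult_0_l, exp_0. reflexivity.
      + simpl pow. rewrite IHk, <- exp_plus. f_equal. rewrite S_INR. field. lra. }
  apply Rle_trans with (y0 ^ k * exp (INR k / y0 * (y - y0)) * exp (- (b * y)))%R.
  - apply Rmult_le_compat_r; auto. left; apply exp_pos.
  - rewrite Rmult_assoc, <- exp_plus.
    replace (exp (- ((b - INR k / y0) * (c - y0))) * (y0 ^ k * exp (- (b * y0))))%R with
      (y0 ^ k * (exp (- ((b - INR k / y0) * (c - y0))) * exp (- (b * y0))))%R by ring.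
    rewrite <- exp_plus. apply Rmult_le_compat_l. apply pow_le; lra.
    assert (Q : (INR k / y0 * (y - y0) + - (b * y) <= - ((b - INR k / y0) * (c - y0)) + - (b * y0))%R) by nra.
    destruct Q as [Q|Q]; [left; now apply exp_increasing|rewrite Q; lra].
Qed.

Lemma Cmod_ph_exp tau : Cmod (ph tau) = exp (- (PI * Im tau)).
Proof. unfold ph. rewrite Cmod_qpar, Im_half. f_equal. field. Qed.

Lemma exp_pow (x : R) n : (exp x ^ n = exp (INR n * x))%R.
Proof.
  induction n. simpl. now rewrite Rmult_0_l, exp_0.
  simpl pow. rewrite IHn, <- exp_plus, S_INR. f_equal. ring.
Qed.

(* The maximum modulus principle makes a bound of the height on the half-plane improve by a
   fixed factor. *)
Theorem modular_vanishing a g k nu : qs a g -> (forall n, (n < nu)%nat -> a n = 0) ->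
  T_invariant g -> W_invariant g k -> (INR k * sqrt 3 < PI * INR nu)%R ->
  forall tau, (0 < Im tau)%R -> g tau = 0.
Proof.
  intros [Ha Hg] H0 HT HW Hk.
  destruct (pser_factor a nu Ha H0) as [Rb Eb].
  set (b := fun n => a (nu + n)%nat) in *.
  assert (PP := PI_RGT_0). assert (Hkp := pos_INR k).
  assert (S3 : (0 < sqrt 3)%R) by (apply sqrt_lt_R0; lra). assert (S32 := sqrt3_sq).
  assert (Hnu : (0 < INR nu)%R) by nra.
  set (be := (2 * PI * INR nu)%R). assert (Hbe : (0 < be)%R) by (unfold be; nra).
  (* The function y^k exp (- be y) is largest at y = [k0], and the hypothesis on k and nu is [k0] <
     sqrt 3 / 6. *)
  set (k0 := (INR k / be)%R).
  assert (Hk0 : (0 <= k0)%R) by (unfold k0, Rdiv; apply Rmult_le_pos; auto; left; now apply Rinv_0_lt_compat).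
  assert (Hk1 : (k0 < sqrt 3 / 6)%R).
  { unfold k0. apply Rmult_lt_reg_r with be; auto. unfold Rdiv at 1. rewrite Rmult_assoc, Rinv_l by lra.
    unfold be. apply Rmult_lt_reg_r with (sqrt 3); auto. 
    replace (sqrt 3 / 6 * (2 * PI * INR nu) * sqrt 3)%R with (PI * INR nu * (sqrt 3 * sqrt 3) / 3)%R by field.
    rewrite S32. lra. }
  (* The points at one third and two thirds of the way from [k0] to sqrt 3 / 6: every orbit reaches
     Im >= [c], and from [c] on y^k exp (- be y) is at most [rho] times its value [psi0] at [y0]. *)
  set (y0 := (k0 + (sqrt 3 / 6 - k0) / 3)%R). set (c := (k0 + 2 * (sqrt 3 / 6 - k0) / 3)%R).
  assert (Hy0 : (0 < y0)%R) by (unfold y0; lra).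
  assert (Hy0c : (y0 < c)%R) by (unfold y0, c; lra).
  assert (Hc6 : (c < sqrt 3 / 6)%R) by (unfold c; lra).
  assert (Hc12 : (12 * c ^ 2 < 1)%R) by nra.
  assert (Hby0 : (INR k / y0 < be)%R).
  { apply Rmult_lt_reg_r with y0; auto. unfold Rdiv at 1. rewrite Rmult_assoc, Rinv_l by lra.
    replace (INR k * 1)%R with (be * k0)%R by (unfold k0; field; lra).
    apply Rmult_lt_compat_l; auto. unfold y0. lra. }
  set (rho := exp (- ((be - INR k / y0) * (c - y0)))).
  set (psi0 := (y0 ^ k * exp (- (be * y0)))%R).
  assert (Hpsi : (0 < psi0)%R) by (apply Rmult_lt_0_compat; [now apply pow_lt|apply exp_pos]).
  assert (Hrho : (0 < rho < 1)%R).
  { split. apply exp_pos. unfold rho. rewrite <- exp_0. apply exp_increasing. nra. }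
  assert (Hdec : forall y, (c <= y)%R -> (y ^ k * exp (- (be * y)) <= rho * psi0)%R).
  { intros y Hy. now apply power_exp_decay. }
  assert (Hred : forall tau, (0 < Im tau)%R -> exists tau', (c <= Im tau')%R /\ height g k tau' = height g k tau).
  { apply height_reduction; auto. lra. }
  assert (Hgh : forall tau, (0 < Im tau)%R ->
    height g k tau = (Cmod (pser b (ph tau)) ^ 2 * (Im tau ^ k * exp (- (be * Im tau))))%R).
  { intros tau Ht. unfold height. rewrite Hg, Eb, Cmod_mult, Cmod_pow, Cmod_ph_exp by (auto; now apply Cmod_ph).
    rewrite Rpow_mult_distr, <- pow_mult, exp_pow.
    replace (INR (nu * 2) * - (PI * Im tau))%R with (- (be * Im tau))%R.
    ring. unfold be. rewrite mult_INR. simpl (INR 2). ring. }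
  (* A first bound, to be improved: for Im >= [c], the quotient g / q^(nu/2) is bounded by its
     absolutely convergent series at q^(1/2) = [r1]. *)
  assert (Init : exists M0, (0 <= M0)%R /\ forall tau, (0 < Im tau)%R -> (height g k tau <= M0)%R).
  { set (r1 := exp (- (PI * c))).
    assert (Hr1 : (0 < r1 < 1)%R).
    { split. apply exp_pos. unfold r1. rewrite <- exp_0. apply exp_increasing. nra. }
    assert (Sb := Rb (RtoC r1) ltac:(rewrite Cmod_R, Rabs_pos_eq; lra)).
    set (B := Series (fun n => Cmod (b n * Cpow (RtoC r1) n))).
    assert (HB : (0 <= B)%R).
    { eapply Rle_trans. 2: apply (term_le_Series (fun n => Cmod (b n * Cpow (RtoC r1) n)) 0); auto.
      apply Cmod_ge_0. intros; apply Cmod_ge_0. }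
    exists (B ^ 2 * psi0)%R. split. { apply Rmult_le_pos. apply pow2_ge_0. lra. }
    intros tau Ht. destruct (Hred tau Ht) as [t1 [H1 <-]]. rewrite Hgh by lra.
    apply Rmult_le_compat.
    - apply pow2_ge_0.
    - apply Rmult_le_pos. apply pow_le; lra. left; apply exp_pos.
    - apply pow_incr. split. apply Cmod_ge_0. apply Cseries_le; auto.
      intros n. rewrite 2!Cmod_mult, 2!Cmod_pow, Cmod_R, (Rabs_pos_eq r1) by lra.
      apply Rmult_le_compat_l. apply Cmod_ge_0. apply pow_incr. split. apply Cmod_ge_0.
      rewrite Cmod_ph_exp. unfold r1.
      assert (Q : (- (PI * Im t1) <= - (PI * c))%R) by nra.
      destruct Q as [Q|Q]; [left; now apply exp_increasing|rewrite Q; lra].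
    - eapply Rle_trans. apply Hdec; auto. nra. }
  (* At Im = [y0], a circle in q^(1/2), the bound M on the height reads |g / q^(nu/2)|^2 <= M /
     psi0. The maximum modulus carries it to the points with Im >= [c], where the other factor of
     the height is at most rho psi0. *)
  assert (Step : forall M, (0 <= M)%R -> (forall tau, (0 < Im tau)%R -> (height g k tau <= M)%R) ->
     forall tau, (0 < Im tau)%R -> (height g k tau <= rho * M)%R).
  { intros M HM HMt tau Ht. destruct (Hred tau Ht) as [t1 [H1 <-]].
    set (r := exp (- (PI * y0))).
    assert (Hr : (0 < r < 1)%R).
    { split. apply exp_pos. unfold r. rewrite <- exp_0. apply exp_increasing. nra. }
    assert (HMf : (Cmod (pser b (ph t1)) <= sqrt (M / psi0))%R).
    { apply max_modulus with r; auto.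
      - intros t. set (t2 := RtoC 2 * t + Ci * y0).
        assert (I2 : Im t2 = y0) by (unfold t2; simpl; ring).
        assert (E2 : ph t2 = r * qpar t).
        { unfold ph, t2. replace ((2 * t + Ci * y0) / 2) with (Ci * y0 / 2 + t) by field.
          rewrite qpar_plus. f_equal. unfold qpar.
          replace (2 * PI * Ci * (Ci * y0 / 2)) with (RtoC (- (PI * y0))).
          - unfold Cexp, r. simpl. rewrite cos_0, sin_0. unfold RtoC. f_equal; ring.
          - replace (2 * PI * Ci * (Ci * y0 / 2)) with ((Ci * Ci) * (PI * y0)) by field.
            rewrite <- RtoC_mult. unfold Ci, Cmult, RtoC. simpl. f_equal; ring. }
        rewrite <- E2. specialize (HMt t2 ltac:(lra)). rewrite Hgh, I2 in HMt by lra.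
        fold psi0 in HMt. rewrite <- (sqrt_pow2 (Cmod _)) by apply Cmod_ge_0.
        apply sqrt_le_1_alt. apply Rmult_le_reg_r with psi0; auto.
        unfold Rdiv. rewrite Rmult_assoc, Rinv_l by lra. lra.
      - rewrite Cmod_ph_exp. apply exp_increasing. nra. }
    rewrite Hgh by lra.
    apply Rle_trans with (M / psi0 * (rho * psi0))%R.
    - apply Rmult_le_compat; auto.
      + apply pow2_ge_0.
      + apply Rmult_le_pos. apply pow_le; lra. left; apply exp_pos.
      + rewrite <- (pow2_sqrt (M / psi0)).
        * apply pow_incr. split; auto. apply Cmod_ge_0.
        * apply Rmult_le_pos; auto. left. now apply Rinv_0_lt_compat.
    - right. field. lra. }
  destruct Init as [M0 [HM0 HI]].
  assert (Iter : forall n tau, (0 < Im tau)%R -> (height g k tau <= rho ^ n * M0)%R).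
  { induction n; intros tau Ht. simpl. rewrite Rmult_1_l. now apply HI.
    simpl pow. rewrite Rmult_assoc. apply Step; auto.
    apply Rmult_le_pos; auto. apply pow_le. lra. }
  intros tau Ht. destruct (Ceq_dec (g tau) 0) as [|Hne]; auto. exfalso.
  assert (P := proj1 (Cmod_gt_0 _) Hne).
  assert (Hh : (0 < height g k tau)%R) by (apply Rmult_lt_0_compat; apply pow_lt; auto).
  destruct (pow_lt_1_zero rho ltac:(rewrite Rabs_pos_eq; lra) (height g k tau / (M0 + 1))) as [N HN].
  { apply Rdiv_lt_0_compat; lra. }
  specialize (HN N (le_n N)). rewrite Rabs_pos_eq in HN by (apply pow_le; lra).
  specialize (Iter N tau Ht).
  assert (Q : (rho ^ N * M0 < height g k tau)%R); [|lra].
  apply Rle_lt_trans with (rho ^ N * (M0 + 1))%R.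
  { apply Rmult_le_compat_l. apply pow_le; lra. lra. }
  replace (height g k tau) with (height g k tau / (M0 + 1) * (M0 + 1))%R by (field; lra).
  apply Rmult_lt_compat_r; lra.
Qed.

(** * Ramanujan's differential equation for [E2] *)

Lemma uu_mult x m n : 1 - Cpow x m <> 0 -> 1 - Cpow x n <> 0 -> 1 - Cpow x (m + n) <> 0 ->
  uu x m * uu x n = uu x (m + n) * (1 + uu x m + uu x n).
Proof.
  unfold uu. rewrite Cpow_add_r. intros H1 H2 H3. field. auto.
Qed.

Lemma sum_squares n : Csum (fun d => idx d * idx d) n = idx n * (idx n + 1) * (2 * idx n + 1) / 6.
Proof.
  induction n.
  - simpl. unfold idx. simpl. field.
  - rewrite Csum_S, IHn. unfold idx. rewrite (S_INR (S n)), RtoC_plus. field.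
Qed.

Section Convolution.
Variable x : C.
Hypothesis Hx : (Cmod x < 1)%R.

Let v (i : nat) : C := uu x (S i).

Lemma pow_neq_1 n : 1 - Cpow x (S n) <> 0.
Proof. now apply one_sub_neq_0, Cmod_pow_lt_1. Qed.

Lemma v_bound i : (Cmod (v i) <= / (1 - Cmod x) * Cmod x ^ S i)%R.
Proof.
  unfold v, uu. rewrite Cmod_div, Cmod_pow by apply pow_neq_1.
  assert (G := Cmod_ge_0 x).
  assert (T : (1 - Cmod x <= Cmod (1 - Cpow x (S i)))%R).
  { assert (T := Cmod_triangle (1 - Cpow x (S i)) (Cpow x (S i))).
    replace (1 - Cpow x (S i) + Cpow x (S i)) with (RtoC 1) in T by ring.
    rewrite Cmod_1, Cmod_pow in T. assert (P := Cpow_le_1 x i Hx).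
    assert (Q : (Cmod x ^ S i <= Cmod x * 1)%R) by (simpl; apply Rmult_le_compat_l; auto). lra. }
  unfold Rdiv. rewrite Rmult_comm. apply Rmult_le_compat_r. now apply pow_le.
  apply Rinv_le_contravar; lra.
Qed.

Lemma v_bound1 i : (Cmod (v i) <= / (1 - Cmod x))%R.
Proof.
  eapply Rle_trans. apply v_bound. assert (G := Cmod_ge_0 x).
  rewrite <- (Rmult_1_r (/ (1 - Cmod x))) at 2. apply Rmult_le_compat_l.
  left. apply Rinv_0_lt_compat. lra. now apply Cpow_le_1.
Qed.

Lemma csummable_v a : rapid a -> csummable (fun i => a i * v i).
Proof. intros Ha. now apply (dseries_uu a x). Qed.

Lemma csummable_v0 : csummable v.
Proof. apply csummable_ext with (fun i => 1 * v i). intros; ring. apply csummable_v, rapid_1. Qed.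

Lemma rapid_bounded a b (c : R) : (forall n, (Cmod (b n) <= c)%R) -> rapid a -> rapid (fun n => a n * b n).
Proof.
  intros H Ha. apply rapid_le with (fun n => c * a n).
  - intros n. rewrite 2!Cmod_mult, Cmod_R, Rmult_comm. apply Rmult_le_compat_r. apply Cmod_ge_0.
    eapply Rle_trans. apply H. apply Rle_abs.
  - now apply rapid_scal.
Qed.

Lemma rapid_idx2 : rapid (fun i => idx i * idx i).
Proof. apply rapid_ext with (fun i => Cpow (idx i) 2). intros; simpl; ring. apply rapid_idx_pow. Qed.

Lemma V_bound : exists c, forall n, (Cmod (Csum v n) <= c)%R.
Proof.
  exists (Series (fun n => Cmod (v n))). intros n.
  eapply Rle_trans. apply (Cmod_Csum_le _ (fun n => Cmod (v n))). intros; lra.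
  apply sum_n_le_Series. intros; apply Cmod_ge_0. apply csummable_v0.
Qed.

Let T1 : C := Cseries (fun i => idx i * v i).

Lemma csummable_v_shift k : csummable (fun i => v (k + i)%nat).
Proof. apply (csummable_sub (fun i => k + i)%nat). intros; lia. apply csummable_v0. Qed.

Lemma Cseries_v_shift d : Cseries (fun i => v i) - Cseries (fun i => v (S d + i)%nat) = Csum v d.
Proof.
  induction d.
  - rewrite Cseries_incr_1 by apply csummable_v0. simpl. ring.
  - rewrite Csum_S, <- IHd.
    rewrite (Cseries_incr_1 (fun i => v (S d + i)%nat)) by apply csummable_v_shift.
    rewrite (Cseries_ext (fun n => v (S d + S n)%nat) (fun i => v (S (S d) + i)%nat)).
    rewrite Nat.add_0_r. ring. intros n. f_equal. lia.
Qed.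

(** Write u_m for [uu x m]. Along m + n = N, [uu_mult] sums u_m u_n to u_N (N - 1 + 2 (u_1 + ... +
    u_{N-1})), and the weight (m + n)^2 is constant there. The index i stands for N = i + 1. *)
Lemma sum_part :
  dsummable (fun i j => (idx i + idx j) * (idx i + idx j) * (v i * v j)) /\
  csummable (fun i => idx i * idx i * v i * (INR i + 2 * Csum v i - 2 * v i)) /\
  dseries (fun i j => (idx i + idx j) * (idx i + idx j) * (v i * v j)) =
  Cseries (fun i => idx i * idx i * v i * (INR i + 2 * Csum v i - 2 * v i)).
Proof.
  assert (D : dsummable (fun i j => (idx i + idx j) * (idx i + idx j) * (v i * v j))).
  { apply dsummable_ext with (fun i j => (idx i * idx i * v i) * v j +
       (2 * ((idx i * v i) * (idx j * v j)) + v i * (idx j * idx j * v j))).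
    { intros i j. ring. }
    assert (S0 := csummable_v0). assert (S1 := csummable_v _ rapid_idx). assert (S2 := csummable_v _ rapid_idx2).
    apply dsummable_plus; [|apply dsummable_plus; [apply dsummable_scal|]]; now apply dsummable_mult. }
  destruct (dseries_diag _ D) as [D1 D2].
  set (A := fun i => idx i * idx i * v i * (INR i + 2 * Csum v i - 2 * v i)).
  assert (EA : forall k, Csum (fun i => (idx i + idx (k - i)) * (idx i + idx (k - i)) * (v i * v (k - i)%nat)) k = A (S k)).
  { intros k.
    rewrite (Csum_ext_loc _ (fun i => (idx (S k) * idx (S k) * v (S k)) * (1 + v i + v (k - i)%nat))).
    - rewrite Csum_scal, 2!Csum_plus.
      assert (Rv : Csum (fun n => v (k - n)%nat) k = Csum v k).
      { clear. assert (H : forall (f : nat -> C) n, Csum (fun i => f (n - i)%nat) n = Csum f n).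
        { intros f n. revert f. induction n; intros f; [reflexivity|].
          assert (Hs : forall (g : nat -> C) m, Csum g (S m) = g 0%nat + Csum (fun i => g (S i)) m).
          { intros g m. induction m; [reflexivity|]. rewrite Csum_S, IHm, (Csum_S (fun i => g (S i))). ring. }
          rewrite Hs. cbv beta. rewrite (Csum_S f), <- (IHn f).
          rewrite (Csum_ext (fun i => f (S n - S i)%nat) (fun i => f (n - i)%nat)) by (intros; f_equal; lia).
          replace (S n - 0)%nat with (S n) by lia. ring. }
        apply H. }
      rewrite Rv, Csum_const. unfold A. rewrite Csum_S. ring.
    - intros i Hi. unfold v.
      rewrite uu_mult by apply pow_neq_1.
      replace (S i + S (k - i))%nat with (S (S k)) by lia.
      replace (idx i + idx (k - i)) with (idx (S k)). ring.
      unfold idx. rewrite <- RtoC_plus, <- plus_INR. f_equal. f_equal. lia. }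
  assert (SA : csummable A).
  { apply csummable_incr_1. apply csummable_ext with (1 := EA). exact D1. }
  split; [exact D|split; [exact SA|]].
  rewrite <- D2, (Cseries_ext _ _ EA). rewrite (Cseries_incr_1 A) by auto.
  unfold A at 2. simpl. ring.
Qed.

(** The family is symmetric and vanishes on the diagonal, so its sum is twice the part with i < j,
    which is parametrized by i and the difference j - i = d + 1. *)
Lemma dsummable_upper : dsummable (fun i d => idx d * idx d * (v i * v (S (i + d)))) /\
  dsummable (fun i j => (idx i - idx j) * (idx i - idx j) * (v i * v j)) /\
  dseries (fun i j => (idx i - idx j) * (idx i - idx j) * (v i * v j)) =
  2 * dseries (fun i d => idx d * idx d * (v i * v (S (i + d)))).
Proof.
  set (F := fun i j => (idx i - idx j) * (idx i - idx j) * (v i * v j)).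
  assert (D : dsummable F).
  { apply dsummable_ext with (fun i j => (idx i * idx i * v i) * v j +
       ((- (2)) * ((idx i * v i) * (idx j * v j)) + v i * (idx j * idx j * v j))).
    { intros i j. unfold F. ring. }
    assert (S0 := csummable_v0). assert (S1 := csummable_v _ rapid_idx). assert (S2 := csummable_v _ rapid_idx2).
    apply dsummable_plus; [|apply dsummable_plus; [apply dsummable_scal|]]; now apply dsummable_mult. }
  set (U := fun i j => if (i <? j)%nat then F i j else 0).
  assert (DU : dsummable U).
  { destruct D as [D1 D2]. apply dsummable_le with (fun i j => Cmod (F i j)); auto.
    intros i j. unfold U. destruct (i <? j)%nat; [lra|]. rewrite Cmod_0. apply Cmod_ge_0. }
  set (W := fun i d => idx d * idx d * (v i * v (S (i + d)))).
  assert (R : forall i, csummable (W i) /\ csummable (U i) /\ Cseries (U i) = Cseries (W i) /\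
     Series (fun n => Cmod (U i n)) = Series (fun n => Cmod (W i n))).
  { intros i.
    assert (EW : forall d, W i d = U i (S (i + d))).
    { intros d. unfold W, U, F. rewrite (proj2 (Nat.ltb_lt i (S (i + d)))) by lia.
      replace (idx (S (i + d))) with (idx i + idx d).
      ring. unfold idx. rewrite <- RtoC_plus, <- plus_INR. f_equal. f_equal. lia. }
    assert (SW : csummable (W i)).
    { apply csummable_ext with (fun d => U i (S (i + d))). intros; now rewrite EW.
      apply (csummable_sub (fun d => S (i + d))). intros; lia. apply DU. }
    split; auto. apply (reindex (fun d => S (i + d))); auto.
    - intros; lia.
    - intros m Hm. unfold U. destruct (i <? m)%nat eqn:E; auto.
      apply Nat.ltb_lt in E. exfalso. apply (Hm (m - S i)%nat). lia. }
  assert (DW : dsummable W).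
  { split. intros i; apply R. apply ex_series_ext with (2 := proj2 DU). intros i. apply R. }
  split; auto. split; auto.
  rewrite (dseries_ext F (fun i j => U i j + U j i)).
  - rewrite dseries_plus; auto using dsummable_swap.
    rewrite <- (dseries_swap U) by auto.
    replace (dseries U) with (dseries W). ring.
    apply Cseries_ext. intros i. symmetry. apply R.
  - intros i j. unfold U, F.
    destruct (lt_eq_lt_dec i j) as [[H|H]|H].
    + rewrite (proj2 (Nat.ltb_lt i j) H), (proj2 (Nat.ltb_ge j i)) by lia. ring.
    + subst. rewrite Nat.ltb_irrefl. ring.
    + rewrite (proj2 (Nat.ltb_lt j i) H), (proj2 (Nat.ltb_ge i j)) by lia. ring.
Qed.

(** [uu_mult] in the form u_m u_{m+d} = u_d (u_m - u_{m+d}) - u_{m+d}. Summed over m, the first part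
    telescopes to u_d (u_1 + ... + u_d); in the second, u_N collects the squares d^2 with d < N,
    that is (N - 1) N (2 N - 1) / 6. *)
Lemma difference_part :
  csummable (fun i => idx i * idx i * v i * Csum v i) /\
  csummable (fun i => INR i * (INR i + 1) * (2 * INR i + 1) / 6 * v i) /\
  dseries (fun i d => idx d * idx d * (v i * v (S (i + d)))) =
  Cseries (fun i => idx i * idx i * v i * Csum v i) - Cseries (fun i => INR i * (INR i + 1) * (2 * INR i + 1) / 6 * v i).
Proof.
  destruct dsummable_upper as [D [_ _]]. destruct V_bound as [c Hc].
  assert (S1 : csummable (fun i => idx i * idx i * v i * Csum v i)).
  { apply csummable_ext with (fun i => (idx i * idx i * Csum v i) * v i). intros; ring.
    apply csummable_v, rapid_bounded with c; auto. apply rapid_idx2. }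
  set (F := fun d i => idx d * idx d * v (S (d + i))).
  assert (DF : dsummable F).
  { apply dsummable_prod with (fun d => (/ (1 - Cmod x) * Cmod (idx d * idx d * Cpow x d))%R) (fun i => Cmod (Cpow x i)).
    - intros d i. unfold F. rewrite Cmod_mult. rewrite (Cmod_mult (idx d * idx d)), 2!Cmod_pow.
      assert (B := v_bound (S (d + i))). assert (G := Cmod_ge_0 x).
      assert (P : (0 <= / (1 - Cmod x))%R) by (left; apply Rinv_0_lt_compat; lra).
      apply Rle_trans with (Cmod (idx d * idx d) * (/ (1 - Cmod x) * Cmod x ^ (d + i)))%R.
      + apply Rmult_le_compat_l. apply Cmod_ge_0. eapply Rle_trans. apply B.
        apply Rmult_le_compat_l; auto. replace (S (S (d + i))) with (d + i + 2)%nat by lia.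
        rewrite (pow_add _ (d + i)). rewrite <- (Rmult_1_r (Cmod x ^ (d + i))) at 2.
        apply Rmult_le_compat_l. now apply pow_le. now apply Cpow_le_1.
      + rewrite pow_add. right. ring.
    - apply (ex_series_scal_l (/ (1 - Cmod x))%R (fun d => Cmod (idx d * idx d * Cpow x d))). apply rapid_idx2, Hx.
    - now apply csummable_geom. }
  destruct (dseries_diag F DF) as [F1 F2].
  set (Q := fun i => INR i * (INR i + 1) * (2 * INR i + 1) / 6 * v i).
  assert (EQ : forall k, Csum (fun d => F d (k - d)%nat) k = Q (S k)).
  { intros k. rewrite (Csum_ext_loc _ (fun d => v (S k) * (idx d * idx d))).
    - rewrite Csum_scal, sum_squares. unfold Q. fold (idx k). ring.
    - intros d Hd. unfold F. replace (d + (k - d))%nat with k by lia. ring. }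
  assert (SQ : csummable Q).
  { apply csummable_incr_1. apply csummable_ext with (1 := EQ). exact F1. }
  split; [exact S1|split; [exact SQ|]].
  assert (ES : dseries F = Cseries Q).
  { rewrite <- F2, (Cseries_ext _ _ EQ), (Cseries_incr_1 Q) by auto. unfold Q at 2. simpl. field. }
  rewrite dseries_swap by auto. rewrite <- ES. unfold dseries.
  rewrite <- Cseries_minus; auto.
  2:{ apply (csummable_rows F (proj1 DF) (proj2 DF)). }
  apply Cseries_ext. intros d.
  rewrite (Cseries_ext _ (fun i => (idx d * idx d * v d) * (v i - v (S d + i)%nat) - F d i)).
  - rewrite Cseries_minus.
    + rewrite Cseries_scal, Cseries_minus; auto using csummable_v0, csummable_v_shift, csummable_minus.
      f_equal. f_equal. apply Cseries_v_shift.
    + apply csummable_scal, csummable_minus. apply csummable_v0. apply csummable_v_shift.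
    + apply DF.
  - intros i. unfold F. replace (S (i + d)) with (S (d + i)) by lia.
    replace (S d + i)%nat with (S (d + i)) by lia. unfold v.
    assert (E := uu_mult x (S i) (S d) (pow_neq_1 i) (pow_neq_1 d)).
    replace (S i + S d)%nat with (S (S (d + i))) in E by lia. specialize (E (pow_neq_1 _)).
    replace (idx d * idx d * uu x (S d) * (uu x (S i) - uu x (S (S (d + i)))) - idx d * idx d * uu x (S (S (d + i))))
      with (idx d * idx d * (uu x (S i) * uu x (S d) - uu x (S d) * uu x (S (S (d + i))) - uu x (S (S (d + i))))) by ring.
    rewrite E. ring.
Qed.

(* Glaisher: use [4 m n = (m + n)^2 - (m - n)^2] and the two expansions of [u_m u_n], where
   [u_m = x^m / (1 - x^m)]. *)
Lemma glaisher :
  12 * (T1 * T1) = 5 * Cseries (fun i => idx i * idx i * idx i * v i) + T1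
    - 6 * Cseries (fun i => idx i * idx i * (v i * (1 + v i))).
Proof.
  destruct sum_part as [D1 [S1 E1]]. destruct dsummable_upper as [_ [D2 E2]].
  destruct difference_part as [S2 [S3 E3]]. rewrite E3 in E2.
  assert (SV := csummable_v _ rapid_idx).
  assert (R3 : rapid (fun i => idx i * idx i * idx i)).
  { apply rapid_ext with (fun i => Cpow (idx i) 3). intros; simpl; ring. apply rapid_idx_pow. }
  assert (S5 : csummable (fun i => idx i * idx i * (v i * (1 + v i)))).
  { apply csummable_ext with (fun i => idx i * idx i * v i + (idx i * idx i * v i) * v i). intros; ring.
    apply csummable_plus. apply csummable_v, rapid_idx2.
    apply csummable_v, rapid_bounded with (/ (1 - Cmod x))%R. apply v_bound1. apply rapid_idx2. }
  assert (E4 : 4 * (T1 * T1) = dseries (fun i j => (idx i + idx j) * (idx i + idx j) * (v i * v j)) -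
      dseries (fun i j => (idx i - idx j) * (idx i - idx j) * (v i * v j))).
  { unfold T1. rewrite <- dseries_mult, <- dseries_scal by (auto; now apply dsummable_mult).
    unfold Cminus at 1.
    replace (- dseries (fun i j => (idx i - idx j) * (idx i - idx j) * (v i * v j))) with
      (- (1) * dseries (fun i j => (idx i - idx j) * (idx i - idx j) * (v i * v j))) by ring.
    rewrite <- (dseries_scal (- (1))), <- dseries_plus by auto using dsummable_scal.
    apply dseries_ext. intros i j. ring. }
  rewrite E1, E2 in E4.
  replace (12 * (T1 * T1)) with (3 * (4 * (T1 * T1))) by ring. rewrite E4. unfold T1.
  rewrite <- !Cseries_scal by (auto using csummable_v).
  rewrite <- Cseries_plus by (auto using csummable_scal, csummable_v).
  rewrite <- !Cseries_minus by (auto using csummable_scal, csummable_v, csummable_plus, csummable_minus).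
  replace (2 * (Cseries (fun i => idx i * idx i * v i * Csum v i - INR i * (INR i + 1) * (2 * INR i + 1) / 6 * v i)))
    with (Cseries (fun i => 2 * (idx i * idx i * v i * Csum v i - INR i * (INR i + 1) * (2 * INR i + 1) / 6 * v i)))
    by (apply Cseries_scal; auto using csummable_minus).
  rewrite <- Cseries_minus by (auto using csummable_scal, csummable_minus).
  rewrite <- Cseries_scal by (auto 6 using csummable_scal, csummable_minus).
  apply Cseries_ext. intros i.
  replace (RtoC (INR i)) with (idx i - 1) by (unfold idx; rewrite S_INR, RtoC_plus; ring).
  field.
Qed.
End Convolution.

(** * Expansions and transformation laws *)

Lemma rapid_cons a : rapid (fun n => a (S n)) -> rapid a.
Proof.
  intros H x Hx. apply csummable_incr_1.
  apply csummable_ext with (fun n => x * (a (S n) * Cpow x n)). intros; rewrite Cpow_S; ring.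
  now apply csummable_scal, H.
Qed.

Definition ccons (c : C) (a : nat -> C) (n : nat) : C := match n with 0%nat => c | S m => a m end.

Lemma rapid_ccons c a : rapid a -> rapid (ccons c a).
Proof. intros H. apply rapid_cons. exact H. Qed.

Lemma pser_ccons c a x : rapid a -> (Cmod x < 1)%R ->
  pser (ccons c a) x = c + Cseries (fun n => a n * Cpow x (S n)).
Proof.
  intros Ha Hx. unfold pser. rewrite Cseries_incr_1 by (now apply rapid_ccons). simpl. ring.
Qed.

Definition sigC (k n : nat) : C := INR (divisor_sigma k (S n)).
Definition chisC (n : nat) : C := IZR (chi_sum (S n)).

Lemma rapid_sig k : rapid (sigC k).
Proof.
  apply rapid_ext with (conv (fun d => Cpow (idx d) k) (fun _ => 1)).
  intros n. symmetry. apply divisor_sigma_conv. apply rapid_conv. apply rapid_idx_pow. apply rapid_1.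
Qed.

Lemma chis_conv n : chisC n = conv chiC (fun _ => 1) n.
Proof.
  unfold chisC. rewrite Arithmetic.chi_sum_Csum. apply Csum_ext. intros d.
  destruct (_ =? _)%nat; auto. unfold chiC. ring.
Qed.

Lemma rapid_chis : rapid chisC.
Proof.
  apply rapid_ext with (conv chiC (fun _ => 1)). intros n. symmetry. apply chis_conv.
  apply rapid_conv. apply rapid_chi. apply rapid_1.
Qed.

Definition cE1 : nat -> C := ccons (1 / 6) chisC.
Definition cE2 : nat -> C := ccons 1 (fun n => - (24) * sigC 1 n).
Definition cE4 : nat -> C := ccons 1 (fun n => 240 * sigC 3 n).

Lemma rapid_cE1 : rapid cE1.
Proof. apply rapid_ccons, rapid_chis. Qed.
Lemma rapid_cE2 : rapid cE2.
Proof. apply rapid_ccons, rapid_scal, rapid_sig. Qed.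
Lemma sig_summable k x : (Cmod x < 1)%R -> csummable (fun n => sigC k n * Cpow x (S n)).
Proof. intros Hx. now apply sigma_series_double. Qed.

Lemma E1m3_pser tau : (0 < Im tau)%R -> E1m3 tau = pser cE1 (qpar tau).
Proof. intros H. unfold cE1. rewrite pser_ccons; auto using rapid_chis, Cmod_qpar_lt_1. Qed.

Lemma E2_pser tau : (0 < Im tau)%R -> E2 tau = pser cE2 (qpar tau).
Proof.
  intros H. assert (Hx := Cmod_qpar_lt_1 tau H).
  unfold cE2. rewrite pser_ccons by (auto using rapid_scal, rapid_sig).
  rewrite (Cseries_ext _ (fun n => - (24) * (sigC 1 n * Cpow (qpar tau) (S n)))) by (intros; ring).
  rewrite Cseries_scal by now apply sig_summable. unfold E2. fold (sigC 1). 
  change (fun n => RtoC (INR (divisor_sigma 1 (S n))) * Cpow (qpar tau) (S n)) with (fun n => sigC 1 n * Cpow (qpar tau) (S n)).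
  ring.
Qed.

Lemma E4_pser tau : (0 < Im tau)%R -> E4 tau = pser cE4 (qpar tau).
Proof.
  intros H. assert (Hx := Cmod_qpar_lt_1 tau H).
  unfold cE4. rewrite pser_ccons by (auto using rapid_scal, rapid_sig).
  rewrite (Cseries_ext _ (fun n => 240 * (sigC 3 n * Cpow (qpar tau) (S n)))) by (intros; ring).
  rewrite Cseries_scal by now apply sig_summable. reflexivity.
Qed.

Definition theta (a : nat -> C) (n : nat) : C := INR n * a n.

(** n sigma_1(n) is the sum of d^2 (n / d) over the divisors d of n, the Dirichlet convolution of
    the squares with the identity; the inner sum is y / (1 - y)^2 = u (1 + u) for u = y / (1 -
    y). *)
Lemma lambert_idx2 x : (Cmod x < 1)%R ->
  Cseries (fun n => idx n * sigC 1 n * Cpow x (S n)) = Cseries (fun i => idx i * idx i * (uu x (S i) * (1 + uu x (S i)))).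
Proof.
  intros Hx.
  destruct (lambert _ _ x rapid_idx2 rapid_idx Hx) as [_ E].
  assert (Ec : forall n, conv (fun i => idx i * idx i) idx n = idx n * sigC 1 n).
  { intros n. unfold sigC. rewrite divisor_sigma_conv. unfold conv. rewrite <- Csum_scal.
    apply Csum_ext. intros d. destruct (Nat.eqb_spec (S n mod S d) 0) as [Ed|]; [|ring].
    assert (Dm := Nat.div_mod_eq (S n) (S d)). rewrite Ed in Dm.
    assert (Ei : idx d * idx (S n / S d - 1) = idx n).
    { unfold idx. rewrite <- RtoC_mult, <- mult_INR. f_equal. f_equal.
      destruct (S n / S d)%nat; lia. }
    rewrite <- Ei. simpl (Cpow (idx d) 1). ring. }
  rewrite (Cseries_ext _ (fun n => conv (fun i => idx i * idx i) idx n * Cpow x (S n))).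
  2:{ intros n. now rewrite Ec. }
  rewrite E. apply Cseries_ext. intros d.
  assert (Hd := Cmod_pow_lt_1 x d Hx). destruct (idx_geom _ Hd) as [G1 G2].
  rewrite (Cseries_ext _ (fun l => idx d * idx d * (idx l * Cpow (Cpow x (S d)) (S l)))).
  - rewrite Cseries_scal by auto. rewrite G2. unfold uu. field. now apply one_sub_neq_0.
  - intros l. rewrite <- Cpow_mult_r. ring.
Qed.

Theorem ramanujan x : (Cmod x < 1)%R ->
  12 * pser (theta cE2) x = pser cE2 x * pser cE2 x - pser cE4 x.
Proof.
  intros Hx.
  assert (L : forall k, Cseries (fun n => sigC k n * Cpow x (S n)) = Cseries (fun i => Cpow (idx i) k * uu x (S i))).
  { intros k. destruct (sigma_series_double k x Hx) as [_ E].
    change (Cseries (fun n => sigC k n * Cpow x (S n))) with (sigma_series k x). rewrite E.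
    apply (dseries_uu _ x (rapid_idx_pow k) Hx). }
  assert (L1 : Cseries (fun n => sigC 1 n * Cpow x (S n)) = Cseries (fun i => idx i * uu x (S i))).
  { rewrite L. apply Cseries_ext. intros; simpl; ring. }
  assert (L3 : Cseries (fun n => sigC 3 n * Cpow x (S n)) = Cseries (fun i => idx i * idx i * idx i * uu x (S i))).
  { rewrite L. apply Cseries_ext. intros; simpl; ring. }
  assert (G := glaisher x Hx). cbv beta zeta in G. rewrite <- L1, <- L3, <- (lambert_idx2 x Hx) in G.
  set (t1 := Cseries (fun n => sigC 1 n * Cpow x (S n))) in *.
  set (t3 := Cseries (fun n => sigC 3 n * Cpow x (S n))) in *.
  set (d1 := Cseries (fun n => idx n * sigC 1 n * Cpow x (S n))) in *.
  assert (E2' : pser cE2 x = 1 - 24 * t1).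
  { unfold cE2. rewrite pser_ccons by (auto using rapid_scal, rapid_sig).
    rewrite (Cseries_ext _ (fun n => - (24) * (sigC 1 n * Cpow x (S n)))) by (intros; ring).
    rewrite Cseries_scal by now apply sig_summable. fold t1. ring. }
  assert (E4' : pser cE4 x = 1 + 240 * t3).
  { unfold cE4. rewrite pser_ccons by (auto using rapid_scal, rapid_sig).
    rewrite (Cseries_ext _ (fun n => 240 * (sigC 3 n * Cpow x (S n)))) by (intros; ring).
    rewrite Cseries_scal by now apply sig_summable. fold t3. ring. }
  assert (ED : pser (theta cE2) x = - (24) * d1).
  { assert (S0 : csummable (fun n => theta cE2 n * Cpow x n)) by (apply (rapid_INR cE2 rapid_cE2 x Hx)).
    unfold pser. rewrite Cseries_incr_1 by auto. unfold theta at 1. simpl (INR 0).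
    unfold d1. rewrite <- Cseries_scal.
    - rewrite !Cmult_0_l, Cplus_0_l. apply Cseries_ext. intros n. unfold theta, cE2, ccons. fold (idx n). ring.
    - apply csummable_ext with (fun n => (- / 24) * (theta cE2 (S n) * Cpow x (S n))).
      + intros n. unfold theta, cE2, ccons. fold (idx n). field.
      + apply csummable_scal. now apply (csummable_incr_1 (fun n => theta cE2 n * Cpow x n)). }
  rewrite E2', E4', ED.
  replace (12 * (- (24) * d1)) with (48 * (- (6) * d1)) by ring.
  replace (- (6) * d1) with (12 * (t1 * t1) - 5 * t3 - t1) by (rewrite G; ring). ring.
Qed.

(** Coefficients of the series [c] evaluated at x^k. In the variable q^(1/2), expansions in q, q^2
    and q^3 become [sp 2], [sp 4] and [sp 6]. *)
Definition sp (k : nat) (c : nat -> C) (n : nat) : C :=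
  if (n mod k =? 0)%nat then c (n / k)%nat else 0.

Lemma sp_series k c (w : nat -> C) : (0 < k)%nat -> csummable (fun n => c n * w (k * n)%nat) ->
  csummable (fun n => sp k c n * w n) /\ Cseries (fun n => sp k c n * w n) = Cseries (fun n => c n * w (k * n)%nat).
Proof.
  intros Hk Hs.
  destruct (reindex (fun n => k * n)%nat (fun n => c n * w (k * n)%nat) (fun n => sp k c n * w n)) as [R1 [R2 _]]; auto.
  - intros; nia.
  - intros n. unfold sp. rewrite Nat.mul_comm, Nat.Div0.mod_mul, Nat.div_mul by lia. reflexivity.
  - intros m Hm. unfold sp. destruct (Nat.eqb_spec (m mod k) 0) as [E|]; [|ring].
    exfalso. apply (Hm (m / k)%nat). assert (Dm := Nat.div_mod_eq m k). lia.
Qed.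

Lemma Cmod_pow_lt_1' x k : (0 < k)%nat -> (Cmod x < 1)%R -> (Cmod (Cpow x k) < 1)%R.
Proof. intros Hk Hx. destruct k; [lia|]. now apply Cmod_pow_lt_1. Qed.

Lemma qs_sp k c : (0 < k)%nat -> rapid c -> qs (sp k c) (fun tau => pser c (Cpow (ph tau) k)).
Proof.
  intros Hk Hc.
  assert (H : forall x, (Cmod x < 1)%R -> csummable (fun n => c n * Cpow x (k * n))).
  { intros x Hx. apply csummable_ext with (fun n => c n * Cpow (Cpow x k) n).
    intros n. now rewrite Cpow_mult_r. apply Hc. now apply Cmod_pow_lt_1'. }
  split.
  - intros x Hx. apply (sp_series k c (Cpow x) Hk). auto.
  - intros tau Ht. unfold pser. rewrite (proj2 (sp_series k c (Cpow (ph tau)) Hk (H _ (Cmod_ph tau Ht)))).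
    apply Cseries_ext. intros n. now rewrite Cpow_mult_r.
Qed.

Lemma Dq_sp k c tau : (0 < k)%nat -> rapid c -> (0 < Im tau)%R ->
  Dq (sp k c) tau = INR k / 2 * pser (theta c) (Cpow (ph tau) k).
Proof.
  intros Hk Hc Ht. assert (Hp := Cmod_ph tau Ht). assert (Hpk := Cmod_pow_lt_1' _ k Hk Hp).
  assert (S0 := rapid_INR c Hc _ Hpk).
  assert (Ew : forall n, INR k / 2 * (theta c n * Cpow (Cpow (ph tau) k) n) = c n * (/ 2 * INR (k * n) * Cpow (ph tau) (k * n))).
  { intros n. unfold theta. rewrite mult_INR, RtoC_mult, Cpow_mult_r. field. }
  unfold Dq, pser. rewrite <- Cseries_scal by exact S0.
  rewrite (Cseries_ext _ _ Ew).
  rewrite <- (proj2 (sp_series k c (fun n => / 2 * INR n * Cpow (ph tau) n) Hk (csummable_ext _ _ Ew (csummable_scal _ _ S0)))).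
  apply Cseries_ext. intros n. unfold half_D. ring.
Qed.

Lemma ph_pow2 tau : Cpow (ph tau) 2 = qpar tau.
Proof. unfold ph. rewrite qpar_pow. f_equal. simpl (INR 2). rewrite RtoC_plus. field. Qed.

Lemma ph_pow6 tau : Cpow (ph tau) 6 = qpar (3 * tau).
Proof. replace 6%nat with (2 * 3)%nat by lia. rewrite Cpow_mult_r, ph_pow2, qpar_pow. f_equal. f_equal. f_equal. simpl. ring. Qed.

Lemma ph_pow4 tau : Cpow (ph tau) 4 = qpar (2 * tau).
Proof. replace 4%nat with (2 * 2)%nat by lia. rewrite Cpow_mult_r, ph_pow2, qpar_pow. f_equal. Qed.

Lemma qpar_half : qpar (1 / 2) = - (1).
Proof.
  unfold qpar. replace (2 * PI * Ci * (1 / 2)) with ((0, PI)%R : C).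
  - unfold Cexp. simpl. rewrite exp_0, cos_PI, sin_PI. unfold RtoC, Copp. simpl. f_equal; ring.
  - unfold Cdiv. rewrite <- RtoC_inv by lra. unfold Cmult, RtoC, Ci. simpl. f_equal; field.
Qed.

Lemma ph_plus_1 tau : ph (tau + 1) = - ph tau.
Proof.
  unfold ph. replace ((tau + 1) / 2) with (tau / 2 + 1 / 2) by field.
  rewrite qpar_plus, qpar_half. ring.
Qed.

Lemma Im_scale (r : R) tau : Im (r * tau) = (r * Im tau)%R.
Proof. destruct tau; simpl; ring. Qed.

Lemma Im_plus_1 tau : Im (tau + 1) = Im tau.
Proof. destruct tau; simpl; ring. Qed.

(** * The forms L and f_s under translation and the Fricke involution *)

Definition L (tau : C) : C := 6 * E1m3 tau.
Definition cL (n : nat) : C := 6 * sp 2 cE1 n.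

Lemma qs_L : qs cL L.
Proof.
  apply qs_scal. apply qs_ext with (2 := qs_sp 2 cE1 ltac:(lia) rapid_cE1).
  intros tau Ht. rewrite ph_pow2. symmetry. now apply E1m3_pser.
Qed.

(** The function [f3 j] with a free sign s in place of (-1)^j, so that passing from j to j + 1 is
    passing from s to - s. *)
Definition ff (s tau : C) : C :=
  6 * E1m3 (2 * tau) + s * sqrtm3 * (E1m3 (tau / 2) - E1m3 ((tau + 1) / 2)).

(** Coefficients after q^(1/2) -> - q^(1/2), which is the effect of the translation by 1. *)
Definition calt (a : nat -> C) (n : nat) : C := Cpow (- (1)) n * a n.

Lemma pser_calt a x : pser (calt a) x = pser a (- x).
Proof.
  apply Cseries_ext. intros n. unfold calt.
  replace (- x) with (- (1) * x) by ring. rewrite Cpow_mult_l. ring.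
Qed.

Lemma rapid_calt a : rapid a -> rapid (calt a).
Proof.
  apply rapid_le. intros n. unfold calt. rewrite Cmod_mult, Cmod_pow, Cmod_m1, pow1. lra.
Qed.

Definition cff (s : C) (n : nat) : C := 6 * sp 4 cE1 n + s * sqrtm3 * (cE1 n - calt cE1 n).

Lemma qs_ff s : qs (cff s) (ff s).
Proof.
  apply (qs_plus _ _ (fun tau => 6 * E1m3 (2 * tau)) (fun tau => s * sqrtm3 * (E1m3 (tau / 2) - E1m3 ((tau + 1) / 2)))).
  - apply qs_scal. apply qs_ext with (2 := qs_sp 4 cE1 ltac:(lia) rapid_cE1).
    intros tau Ht. rewrite ph_pow4. symmetry. apply E1m3_pser. rewrite Im_scale. lra.
  - apply (qs_scal _ _ (fun tau => E1m3 (tau / 2) - E1m3 ((tau + 1) / 2))).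
    apply (qs_minus _ _ (fun tau => E1m3 (tau / 2)) (fun tau => E1m3 ((tau + 1) / 2))).
    + split. apply rapid_cE1. intros tau Ht. apply E1m3_pser. rewrite Im_half. lra.
    + split. apply rapid_calt, rapid_cE1. intros tau Ht. rewrite pser_calt, <- ph_plus_1.
      apply E1m3_pser. rewrite Im_half, Im_plus_1. lra.
Qed.

Lemma E1m3_T tau (n : Z) : E1m3 (tau + IZR n) = E1m3 tau.
Proof. unfold E1m3. now rewrite qpar_plus_IZR. Qed.

Lemma E2_T tau (n : Z) : E2 (tau + IZR n) = E2 tau.
Proof. unfold E2. now rewrite qpar_plus_IZR. Qed.

Lemma ff_T s tau : ff s (tau + 1) = ff (- s) tau.
Proof.
  unfold ff. replace (2 * (tau + 1)) with (2 * tau + 2) by ring.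
  rewrite (E1m3_T (2 * tau) 2). replace ((tau + 1 + 1) / 2) with (tau / 2 + 1) by field.
  rewrite (E1m3_T (tau / 2) 1). ring.
Qed.

Lemma chi_even k : chiC (2 * k + 1) = - chiC k.
Proof.
  unfold chiC. replace (S (2 * k + 1)) with (2 * S k)%nat by lia.
  assert (E := Arithmetic.chi3M 2 (S k)). change (chi3 (2 * S k) = Z.mul (chi3 2) (chi3 (S k))) in E.
  rewrite E. change (chi3 2) with (-1)%Z. rewrite mult_IZR, RtoC_mult.
  change (RtoC (IZR (-1))) with (RtoC (- (1))). rewrite RtoC_opp. ring.
Qed.

(** The Hecke operator T_2 kills [E1m3], its eigenvalue being 1 + chi(2) = 0. Concretely, the
    Lambert series is split by the parity of the divisor d: for odd d the terms at x and - x add up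
    to twice the term at x^2, and even d bring in the sign chi(2) = -1. *)
Lemma even_part x : (Cmod x < 1)%R ->
  pser cE1 x + pser cE1 (- x) = 2 * pser cE1 (Cpow x 4).
Proof.
  intros Hx.
  set (Su := fun y => Cseries (fun d => chiC d * uu y (S d))).
  assert (E : forall y, (Cmod y < 1)%R -> pser cE1 y = 1 / 6 + Su y).
  { intros y Hy. unfold cE1. rewrite pser_ccons by (auto using rapid_chis). f_equal.
    rewrite (Cseries_ext _ (fun n => conv chiC (fun _ => 1) n * Cpow y (S n))).
    - rewrite (proj2 (lambert _ _ y rapid_chi rapid_1 Hy)). apply (dseries_uu chiC y rapid_chi Hy).
    - intros n. now rewrite chis_conv. }
  assert (Hm : (Cmod (- x) < 1)%R) by now rewrite Cmod_opp.
  assert (H2 : (Cmod (Cpow x 2) < 1)%R) by (apply Cmod_pow_lt_1'; [lia|auto]).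
  assert (H4 : (Cmod (Cpow x 4) < 1)%R) by (apply Cmod_pow_lt_1'; [lia|auto]).
  rewrite !E by auto.
  assert (Ss : forall y, (Cmod y < 1)%R -> csummable (fun d => chiC d * uu y (S d))).
  { intros y Hy. apply (dseries_uu chiC y rapid_chi Hy). }
  assert (Eo : forall (a : nat -> C), csummable a ->
     csummable (fun n => a (2 * n)%nat) /\ csummable (fun n => a (2 * n + 1)%nat)).
  { intros a Ha. split; [apply (csummable_sub (fun n => 2 * n)%nat)|apply (csummable_sub (fun n => 2 * n + 1)%nat)]; auto; intros; lia. }
  assert (S2 := Cseries_even_odd _ (Ss _ H2)).
  assert (Sw := Cseries_even_odd _ (csummable_plus _ _ (Ss _ Hx) (Ss _ Hm))). cbv beta in S2, Sw.
  rewrite Cseries_plus in Sw by auto. fold (Su x) (Su (- x)) in Sw. fold (Su (Cpow x 2)) in S2.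
  assert (X1 : Cseries (fun n => chiC (2 * n) * uu x (S (2 * n)) + chiC (2 * n) * uu (- x) (S (2 * n))) =
     2 * Cseries (fun n => chiC (2 * n) * uu (Cpow x 2) (S (2 * n)))).
  { rewrite <- Cseries_scal by apply (Eo _ (Ss _ H2)). apply Cseries_ext. intros n.
    assert (N := one_sub_neq_0 _ (Cmod_pow_lt_1 x (2 * n) Hx)).
    assert (N' := one_sub_neq_0 _ (Cmod_pow_lt_1 (- x) (2 * n) Hm)).
    assert (Ep : Cpow (- x) (S (2 * n)) = - Cpow x (S (2 * n))).
    { rewrite !Cpow_S, !Cpow_mult_r. replace (Cpow (- x) 2) with (Cpow x 2) by (simpl; ring). ring. }
    assert (E2x : Cpow (Cpow x 2) (S (2 * n)) = Cpow x (S (2 * n)) * Cpow x (S (2 * n))).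
    { rewrite <- Cpow_mult_r, <- Cpow_add_r. f_equal. lia. }
    unfold uu. rewrite E2x. rewrite Ep in *. set (y := Cpow x (S (2 * n))) in *.
    assert (N2 : 1 - y * y <> 0).
    { replace (1 - y * y) with ((1 - y) * (1 - - y)) by ring. now apply Cmult_neq_0. }
    field; repeat split; auto. }
  assert (X2 : Cseries (fun n => chiC (2 * n + 1) * uu x (S (2 * n + 1)) + chiC (2 * n + 1) * uu (- x) (S (2 * n + 1))) =
     - (2) * Su (Cpow x 2)).
  { unfold Su. rewrite <- Cseries_scal by auto. apply Cseries_ext. intros n. rewrite chi_even.
    replace (S (2 * n + 1)) with (2 * S n)%nat by lia. unfold uu. rewrite !Cpow_mult_r.
    replace (Cpow (- x) 2) with (Cpow x 2) by (simpl; ring). ring. }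
  assert (X3 : Cseries (fun n => chiC (2 * n + 1) * uu (Cpow x 2) (S (2 * n + 1))) = - (1) * Su (Cpow x 4)).
  { unfold Su. rewrite <- Cseries_scal by auto. apply Cseries_ext. intros n. rewrite chi_even.
    replace (S (2 * n + 1)) with (2 * S n)%nat by lia. unfold uu. rewrite <- !Cpow_mult_r.
    replace (2 * (2 * S n))%nat with (4 * S n)%nat by lia. ring. }
  rewrite X1, X2 in Sw. rewrite X3 in S2.
  set (o := Cseries (fun n => chiC (2 * n) * uu (Cpow x 2) (S (2 * n)))) in *.
  replace (1 / 6 + Su x + (1 / 6 + Su (- x))) with (1 / 3 + (Su x + Su (- x))) by field.
  rewrite Sw, S2. field.
Qed.

Lemma E1m3_even_part tau : (0 < Im tau)%R ->
  E1m3 (tau / 2) + E1m3 ((tau + 1) / 2) = 2 * E1m3 (2 * tau).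
Proof.
  intros H. rewrite !E1m3_pser.
  - rewrite <- ph_pow4. fold (ph tau). fold (ph (tau + 1)). rewrite ph_plus_1. apply even_part. now apply Cmod_ph.
  - rewrite Im_scale. lra.
  - rewrite Im_half, Im_plus_1. lra.
  - rewrite Im_half. lra.
Qed.

(* [(W tau + 1) / 2] is reached from [(tau + 1) / 2] by the chain W, T, W, T, W, T. *)
Lemma E1m3_fricke_half tau : (0 < Im tau)%R ->
  E1m3 ((fricke tau + 1) / 2) = sqrtm3 * tau * E1m3 ((tau + 1) / 2).
Proof.
  intros H. set (w := (tau + 1) / 2).
  assert (Hw : (0 < Im w)%R) by (unfold w; rewrite Im_half, Im_plus_1; lra).
  set (w2 := fricke w + 1).
  assert (Hw2 : (0 < Im w2)%R) by (unfold w2; rewrite Im_plus_1; now apply Im_fricke).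
  set (w4 := fricke w2 + 1).
  assert (Hw4 : (0 < Im w4)%R) by (unfold w4; rewrite Im_plus_1; now apply Im_fricke).
  assert (N0 := Im_pos_neq_0 _ H).
  assert (N1 : tau + 1 <> 0) by (apply Im_pos_neq_0; now rewrite Im_plus_1).
  assert (N3 : 3 * tau + 1 <> 0) by (apply Im_pos_neq_0; rewrite Im_plus_1, Im_scale; lra).
  assert (E2' : w2 = (3 * tau + 1) / (3 * (tau + 1))) by (unfold w2, w, fricke; field; auto).
  assert (E4' : w4 = 2 * tau / (3 * tau + 1)) by (unfold w4, fricke; rewrite E2'; field; auto).
  assert (M5 : (fricke tau + 1) / 2 = fricke w4 + 1) by (unfold fricke; rewrite E4'; field; auto).
  assert (T := fun z => E1m3_T z 1).
  rewrite M5, T. unfold fricke. rewrite E1m3_fricke by auto.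
  unfold w4. rewrite T. unfold fricke. rewrite E1m3_fricke by auto.
  unfold w2. rewrite T. unfold fricke. rewrite E1m3_fricke by auto.
  fold (fricke w). fold w2. fold (fricke w2). fold w4.
  replace (- sqrtm3 * w4 * (- sqrtm3 * w2 * (- sqrtm3 * w * E1m3 w))) with
    (- (sqrtm3 * sqrtm3) * sqrtm3 * (w4 * w2 * w) * E1m3 w) by ring.
  rewrite sqrtm3_sq. replace (w4 * w2 * w) with (tau / 3). field.
  rewrite E2', E4'. unfold w. field. auto.
Qed.

Lemma L_fricke tau : (0 < Im tau)%R -> L (fricke tau) = - sqrtm3 * tau * L tau.
Proof. intros H. unfold L, fricke. rewrite E1m3_fricke by auto. ring. Qed.

(** The value of [E1m3] at 2 tau is exchanged with that at tau / 2, and the one at (tau + 1) / 2 is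
    sent to itself. [E1m3_even_part] eliminates the latter; what remains is linear in two values,
    whose coefficients match because s^2 = 1. *)
Lemma ff_fricke s tau : s * s = 1 -> (0 < Im tau)%R ->
  ff s (fricke tau) = (s * 3 - sqrtm3) / 2 * tau * ff (- s) tau.
Proof.
  intros Hs H. assert (N0 := Im_pos_neq_0 _ H). assert (Q := sqrtm3_sq).
  unfold ff. rewrite E1m3_fricke_half by auto.
  replace (2 * fricke tau) with (fricke (tau / 2)) by (unfold fricke; field; auto).
  replace (fricke tau / 2) with (fricke (2 * tau)) by (unfold fricke; field; auto).
  unfold fricke. rewrite 2!E1m3_fricke by (rewrite ?Im_half, ?Im_scale; lra).
  assert (Ev := E1m3_even_part tau H).
  set (A := E1m3 (2 * tau)) in *. set (B := E1m3 (tau / 2)) in *. set (D := E1m3 ((tau + 1) / 2)) in *.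
  assert (ED : D = 2 * A - B) by (rewrite <- Ev; ring). rewrite ED.
  replace (6 * (- sqrtm3 * (tau / 2) * B) + s * sqrtm3 * (- sqrtm3 * (2 * tau) * A - sqrtm3 * tau * (2 * A - B)))
    with (- (3) * sqrtm3 * tau * B - s * (sqrtm3 * sqrtm3) * tau * (4 * A - B)) by field.
  replace ((s * 3 - sqrtm3) / 2 * tau * (6 * A + - s * sqrtm3 * (B - (2 * A - B)))) with
    (tau * (9 * s * A - 3 * sqrtm3 * A + (s * s) * 3 * sqrtm3 * (A - B) - s * (sqrtm3 * sqrtm3) * (A - B)
      )) by field.
  rewrite Hs, Q. ring.
Qed.

(** * Identities between forms on the Fricke group *)

Lemma Cmod_sqrtm3 : Cmod sqrtm3 = sqrt 3.
Proof. unfold sqrtm3. rewrite Cmod_mult, Cmod_Ci, Cmod_R, Rabs_pos_eq by apply sqrt_pos. ring. Qed.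

Lemma W_invariant_intro g k : (forall tau, (0 < Im tau)%R ->
  g (fricke tau) = Cpow (sqrtm3 * tau) k * g tau) -> W_invariant g k.
Proof.
  intros H tau Ht. rewrite H by auto. now rewrite Cmod_mult, Cmod_pow, Cmod_mult, Cmod_sqrtm3.
Qed.

Lemma T_invariant_even g : (forall tau, (0 < Im tau)%R -> g (tau + 1) = g tau) -> T_invariant g.
Proof. intros H tau Ht. now rewrite H. Qed.

Lemma T_invariant_odd g : (forall tau, (0 < Im tau)%R -> g (tau + 1) = - g tau) -> T_invariant g.
Proof. intros H tau Ht. now rewrite H, Cmod_opp by auto. Qed.

Lemma ph_surj_circle (r t : R) : (0 < r < 1)%R -> exists tau, (0 < Im tau)%R /\ ph tau = r * qpar t.
Proof.
  intros Hr. assert (PP := PI_RGT_0).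
  assert (Hl : (ln r < 0)%R) by (rewrite <- ln_1; apply ln_increasing; lra).
  exists (2 * t + Ci * (- ln r / PI)%R). split.
  - simpl. unfold Rdiv. assert (0 < / PI)%R by now apply Rinv_0_lt_compat. nra.
  - unfold ph. replace ((2 * t + Ci * (- ln r / PI)%R) / 2) with (Ci * (- ln r / PI)%R / 2 + t) by field.
    rewrite qpar_plus. f_equal. unfold qpar.
    replace (2 * PI * Ci * (Ci * (- ln r / PI)%R / 2)) with (RtoC (ln r)).
    + unfold Cexp. simpl. rewrite cos_0, sin_0, exp_ln by lra. unfold RtoC. f_equal; ring.
    + replace (2 * PI * Ci * (Ci * (- ln r / PI)%R / 2)) with ((Ci * Ci) * (PI * (- ln r / PI)%R)) by field.
      rewrite <- RtoC_mult. replace (PI * (- ln r / PI))%R with (- ln r)%R by (field; lra).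
      unfold Ci, Cmult, RtoC. simpl. f_equal; ring.
Qed.

Lemma qs_zero a g : qs a g -> (forall tau, (0 < Im tau)%R -> g tau = 0) -> forall n, a n = 0.
Proof.
  intros [Ha Hg] H n.
  assert (B : (Cmod (a n) * (/ 2) ^ n <= 0)%R).
  { apply cauchy_estimate; auto. lra. intros t.
    destruct (ph_surj_circle (/ 2) t ltac:(lra)) as [tau [Ht <-]].
    rewrite <- Hg, H, Cmod_0 by auto. lra. }
  assert (P : (0 < (/ 2) ^ n)%R) by (apply pow_lt; lra).
  assert (G := Cmod_ge_0 (a n)). apply Cmod_eq_0. nra.
Qed.

Lemma qs_T a g : qs a g -> qs (calt a) (fun tau => g (tau + 1)).
Proof.
  intros [Ha Hg]. split. now apply rapid_calt.
  intros tau Ht. rewrite pser_calt, <- ph_plus_1. apply Hg. now rewrite Im_plus_1.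
Qed.

(** Uniqueness of the expansion, applied to g (tau + 1) - e g (tau). For e = 1 or -1 it makes the
    coefficients of one parity vanish without computing them. *)
Lemma qs_parity a g (e : C) : qs a g -> (forall tau, (0 < Im tau)%R -> g (tau + 1) = e * g tau) ->
  forall n, Cpow (- (1)) n * a n = e * a n.
Proof.
  intros H HT n.
  assert (Z := qs_zero _ _ (qs_minus _ _ _ _ (qs_T a g H) (qs_scal e _ _ H))). cbv beta in Z.
  specialize (Z ltac:(intros; rewrite HT by auto; ring) n). unfold calt in Z.
  replace (e * a n) with (Cpow (- (1)) n * a n - (Cpow (- (1)) n * a n - e * a n)) by ring.
  rewrite Z. ring.
Qed.

Lemma eq_opp_0 (z : C) : - z = z -> z = 0.
Proof.
  intros E. replace z with ((z - - z) / 2) by field. rewrite E. field.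
Qed.

Lemma qs_even_1 a g : qs a g -> (forall tau, (0 < Im tau)%R -> g (tau + 1) = g tau) -> a 1%nat = 0.
Proof.
  intros H HT. assert (P := qs_parity a g 1 H ltac:(intros; rewrite HT by auto; ring) 1).
  simpl in P. apply eq_opp_0. transitivity (- (1) * 1 * a 1%nat). ring. rewrite P. ring.
Qed.

Lemma qs_odd_0_2 a g : qs a g -> (forall tau, (0 < Im tau)%R -> g (tau + 1) = - g tau) -> a 0%nat = 0 /\ a 2%nat = 0.
Proof.
  intros H HT. assert (P := qs_parity a g (- (1)) H ltac:(intros; rewrite HT by auto; ring)).
  split; apply eq_opp_0.
  - transitivity (- (1) * a 0%nat). ring. rewrite <- P. simpl. ring.
  - transitivity (- (1) * a 2%nat). ring. rewrite <- P. simpl. ring.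
Qed.

Lemma cder_fricke (tau : C) : tau <> 0 -> cder fricke tau (/ (3 * tau * tau)).
Proof.
  intros N. apply cder_ext with (fun w => - (1) / 3 * / w).
  - intros w. unfold fricke, Cdiv. destruct (Ceq_dec w 0) as [-> | Hw].
    + assert (Z : / RtoC 0 = 0) by (unfold Cinv, RtoC; simpl; f_equal; unfold Rdiv; ring).
      replace (3 * 0) with (RtoC 0) by ring. rewrite Z. ring.
    + field. auto.
  - replace (/ (3 * tau * tau)) with (- (1) / 3 * (- / (tau * tau))) by (field; auto).
    apply cder_scal, cder_inv, N.
Qed.

(** Both sides of the functional equation are differentiated; [fricke] has derivative 1 / (3 tau^2).
    The term in [dm] is the failure of modularity of a derivative, which P has to compensate. *)
Lemma Dq_fricke a b g h (m : C -> C) (dm : C) tau : qs a g -> qs b h ->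
  (forall t, (0 < Im t)%R -> g (fricke t) = m t * h t) -> (0 < Im tau)%R -> cder m tau dm ->
  Dq a (fricke tau) = 3 * tau * tau * (m tau * Dq b tau + dm * h tau / tpi).
Proof.
  intros Hg Hh HT Ht Hm. assert (N := Im_pos_neq_0 _ Ht). assert (T := tpi_neq_0).
  assert (D1 : cder (fun w => g (fricke w)) tau (tpi * Dq a (fricke tau) * / (3 * tau * tau))).
  { apply cder_comp. apply (qs_cder a g); auto. now apply Im_fricke. now apply cder_fricke. }
  assert (D2 : cder (fun w => g (fricke w)) tau (dm * h tau + m tau * (tpi * Dq b tau))).
  { apply cder_ext_loc with (fun w => m w * h w) (Im tau); auto.
    - intros k Hk. symmetry. apply HT. now apply half_plane_ball.
    - apply cder_mult; auto. now apply (qs_cder b h). }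
  assert (E := cder_unique _ _ _ _ D1 D2).
  replace (Dq a (fricke tau)) with (tpi * Dq a (fricke tau) * / (3 * tau * tau) * (3 * tau * tau / tpi)) by (field; auto).
  rewrite E. field. auto.
Qed.

Lemma Dq_T a b g h tau : qs a g -> qs b h -> (forall t, g (t + 1) = h t) -> (0 < Im tau)%R ->
  Dq a (tau + 1) = Dq b tau.
Proof.
  intros Hg Hh HT Ht. assert (T := tpi_neq_0).
  assert (D1 : cder (fun w => g (w + 1)) tau (tpi * Dq a (tau + 1) * 1)).
  { apply (cder_comp g (fun w => w + 1)). apply (qs_cder a g); auto. now rewrite Im_plus_1.
    assert (D := cder_plus (fun w => w) (fun _ => RtoC 1) _ _ _ (cder_id tau) (cder_const 1 tau)).
    now rewrite Cplus_0_r in D. }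
  assert (D2 : cder (fun w => g (w + 1)) tau (tpi * Dq b tau)).
  { apply cder_ext with h. intros; now rewrite HT. now apply (qs_cder b h). }
  assert (E := cder_unique _ _ _ _ D1 D2).
  replace (Dq a (tau + 1)) with (tpi * Dq a (tau + 1) * 1 / tpi) by (field; auto).
  rewrite E. field. auto.
Qed.

Definition P (tau : C) : C := (3 * E2 (3 * tau) + E2 tau) / 2.
Definition cP (n : nat) : C := / 2 * (3 * sp 6 cE2 n + sp 2 cE2 n).
Definition cE32 (n : nat) : C := / 2 * (3 * sp 6 cE2 n - sp 2 cE2 n).

Lemma qs_E2 : qs (sp 2 cE2) E2.
Proof.
  apply qs_ext with (2 := qs_sp 2 cE2 ltac:(lia) rapid_cE2).
  intros tau Ht. rewrite ph_pow2. symmetry. now apply E2_pser.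
Qed.

Lemma qs_E2_3 : qs (sp 6 cE2) (fun tau => E2 (3 * tau)).
Proof.
  apply qs_ext with (2 := qs_sp 6 cE2 ltac:(lia) rapid_cE2).
  intros tau Ht. rewrite ph_pow6. symmetry. apply E2_pser. rewrite Im_scale. lra.
Qed.

Lemma qs_P : qs cP P.
Proof.
  apply qs_ext with (fun tau => / 2 * (3 * E2 (3 * tau) + E2 tau)).
  intros; unfold P; field.
  apply (qs_scal _ _ (fun tau => 3 * E2 (3 * tau) + E2 tau)).
  apply (qs_plus _ _ (fun tau => 3 * E2 (3 * tau))); [apply (qs_scal _ _ (fun tau => E2 (3 * tau)))|]; auto using qs_E2, qs_E2_3.
Qed.

Lemma qs_E32 : qs cE32 E32.
Proof.
  apply qs_ext with (fun tau => / 2 * (3 * E2 (3 * tau) - E2 tau)).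
  intros; unfold E32; field.
  apply (qs_scal _ _ (fun tau => 3 * E2 (3 * tau) - E2 tau)).
  apply (qs_minus _ _ (fun tau => 3 * E2 (3 * tau))); [apply (qs_scal _ _ (fun tau => E2 (3 * tau)))|]; auto using qs_E2, qs_E2_3.
Qed.

Lemma L_T tau : L (tau + 1) = L tau.
Proof. unfold L. now rewrite (E1m3_T tau 1). Qed.

Lemma P_T tau : P (tau + 1) = P tau.
Proof.
  unfold P. replace (3 * (tau + 1)) with (3 * tau + 3) by ring.
  now rewrite (E2_T (3 * tau) 3), (E2_T tau 1).
Qed.

Lemma E32_T tau : E32 (tau + 1) = E32 tau.
Proof.
  unfold E32. replace (3 * (tau + 1)) with (3 * tau + 3) by ring.
  now rewrite (E2_T (3 * tau) 3), (E2_T tau 1).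
Qed.

Lemma E2_fricke tau : (0 < Im tau)%R ->
  E2 (fricke tau) = 9 * tau * tau * E2 (3 * tau) + 36 * tau / tpi /\
  E2 (3 * fricke tau) = tau * tau * E2 tau + 12 * tau / tpi.
Proof.
  intros H. assert (N := Im_pos_neq_0 _ H). assert (T := tpi_neq_0). split.
  - unfold fricke. rewrite E2_inversion by (rewrite Im_scale; lra). field. auto.
  - replace (3 * fricke tau) with (- (1) / tau) by (unfold fricke; field; auto).
    now apply E2_inversion.
Qed.

Lemma P_fricke tau : (0 < Im tau)%R -> P (fricke tau) = 3 * tau * tau * P tau + 36 * tau / tpi.
Proof.
  intros H. assert (T := tpi_neq_0). destruct (E2_fricke tau H) as [H1 H2].
  unfold P. rewrite H1, H2. field. auto.
Qed.

Lemma E32_fricke tau : (0 < Im tau)%R -> E32 (fricke tau) = - (3) * tau * tau * E32 tau.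
Proof.
  intros H. assert (T := tpi_neq_0). destruct (E2_fricke tau H) as [H1 H2].
  unfold E32. rewrite H1, H2. field. auto.
Qed.

Lemma sqrtm3_pow3 : sqrtm3 * sqrtm3 * sqrtm3 = - (3) * sqrtm3.
Proof. now rewrite sqrtm3_sq. Qed.

Lemma cmul_0 a b : cmul a b 0 = a 0%nat * b 0%nat.
Proof. reflexivity. Qed.

Lemma cmul_1 a b : cmul a b 1 = a 0%nat * b 1%nat + a 1%nat * b 0%nat.
Proof. reflexivity. Qed.

Lemma cE1_0 : cE1 0 = 1 / 6. Proof. reflexivity. Qed.
Lemma cE2_0 : cE2 0 = 1. Proof. reflexivity. Qed.
Lemma sp_0 k c : sp k c 0 = c 0%nat.
Proof. unfold sp. rewrite Nat.Div0.mod_0_l, Nat.Div0.div_0_l. reflexivity. Qed.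
Lemma cL_0 : cL 0 = 1.
Proof. unfold cL. rewrite sp_0, cE1_0. field. Qed.
Lemma cff_0 s : cff s 0 = 1.
Proof. unfold cff, calt. rewrite sp_0, cE1_0. simpl. field. Qed.
Lemma cP_0 : cP 0 = 2.
Proof. unfold cP. rewrite !sp_0, cE2_0. field. Qed.
Lemma cE32_0 : cE32 0 = 1.
Proof. unfold cE32. rewrite !sp_0, cE2_0. field. Qed.

(** Together with pi > 3 this is just enough for the tightest case, weight 5 and order 3: 5 (7/4) <
    9. *)
Lemma sqrt3_bound : (sqrt 3 < 7 / 4)%R.
Proof. assert (Q := sqrt3_sq). assert (0 <= sqrt 3)%R by apply sqrt_pos. nra. Qed.

Lemma PI_gt_3 : (3 < PI)%R.
Proof. assert (Q := PI2_3_2). unfold PI2 in Q. lra. Qed.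

Lemma small_cases (nu : nat) (a : nat -> C) :
  (nu <= 3)%nat -> a 0%nat = 0 -> a 1%nat = 0 -> (nu = 3%nat -> a 2%nat = 0) -> forall n, (n < nu)%nat -> a n = 0.
Proof.
  intros Hnu H0 H1 H2 n Hn. destruct n; auto. destruct n; auto. assert (n = 0%nat) by lia. subst.
  apply H2. lia.
Qed.

Theorem L_sq tau : (0 < Im tau)%R -> L tau * L tau = E32 tau.
Proof.
  intros Ht.
  set (g := fun t => E32 t - L t * L t).
  assert (Hg : qs (fun n => cE32 n - cmul cL cL n) g).
  { apply qs_minus. apply qs_E32. apply qs_mult; apply qs_L. }
  assert (HT : forall t, (0 < Im t)%R -> g (t + 1) = g t) by (intros; unfold g; now rewrite L_T, E32_T).
  assert (E : g tau = 0).
  { apply (modular_vanishing _ g 2 2 Hg); auto.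
    - apply small_cases; auto; try lia.
      + rewrite cmul_0, cE32_0, cL_0. ring.
      + exact (qs_even_1 _ _ Hg HT).
    - now apply T_invariant_even.
    - apply W_invariant_intro. intros t H. unfold g. rewrite L_fricke, E32_fricke by auto.
      replace (Cpow (sqrtm3 * t) 2) with ((sqrtm3 * sqrtm3) * t * t) by (simpl; ring).
      replace (- sqrtm3 * t * L t * (- sqrtm3 * t * L t)) with ((sqrtm3 * sqrtm3) * t * t * (L t * L t)) by ring.
      rewrite sqrtm3_sq. ring.
    - assert (B := sqrt3_bound). assert (Q := PI_gt_3). simpl. lra. }
  unfold g in E. replace (L tau * L tau) with (E32 tau - (E32 tau - L tau * L tau)) by ring.
  rewrite E. ring.
Qed.

Lemma ff_fricke_1 tau : (0 < Im tau)%R -> ff 1 (fricke tau) = (3 - sqrtm3) / 2 * tau * ff (- (1)) tau.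
Proof. intros H. rewrite ff_fricke by (auto; ring). field. Qed.

Lemma ff_fricke_m1 tau : (0 < Im tau)%R -> ff (- (1)) (fricke tau) = (- (3) - sqrtm3) / 2 * tau * ff 1 tau.
Proof.
  intros H. rewrite ff_fricke by (auto; ring). replace (- - RtoC 1) with (RtoC 1) by ring. field.
Qed.

Lemma ff_T_1 tau : ff 1 (tau + 1) = ff (- (1)) tau.
Proof. apply ff_T. Qed.

Lemma ff_T_m1 tau : ff (- (1)) (tau + 1) = ff 1 tau.
Proof. rewrite ff_T. f_equal. ring. Qed.

(** The two multipliers of f_1 and f_{-1} under W have the product ([sqrtm3]^2 - 9) / 4 = - 3 =
    [sqrtm3]^2, which is the multiplier of L^2. *)
Theorem ff_prod tau : (0 < Im tau)%R -> ff 1 tau * ff (- (1)) tau = L tau * L tau.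
Proof.
  intros Ht.
  set (g := fun t => ff 1 t * ff (- (1)) t - L t * L t).
  assert (Hg : qs (fun n => cmul (cff 1) (cff (- (1))) n - cmul cL cL n) g).
  { apply qs_minus; apply qs_mult; auto using qs_ff, qs_L. }
  assert (HT : forall t, (0 < Im t)%R -> g (t + 1) = g t).
  { intros; unfold g. rewrite L_T, ff_T_1, ff_T_m1. ring. }
  assert (E : g tau = 0).
  { apply (modular_vanishing _ g 2 2 Hg); auto.
    - apply small_cases; auto; try lia.
      + rewrite !cmul_0, !cff_0, cL_0. ring.
      + exact (qs_even_1 _ _ Hg HT).
    - now apply T_invariant_even.
    - apply W_invariant_intro. intros t H. unfold g. rewrite L_fricke, ff_fricke_1, ff_fricke_m1 by auto.
      replace (Cpow (sqrtm3 * t) 2) with ((sqrtm3 * sqrtm3) * t * t) by (simpl; ring).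
      replace (- sqrtm3 * t * L t * (- sqrtm3 * t * L t)) with ((sqrtm3 * sqrtm3) * t * t * (L t * L t)) by ring.
      replace ((3 - sqrtm3) / 2 * t * ff (- (1)) t * ((- (3) - sqrtm3) / 2 * t * ff 1 t)) with
        ((sqrtm3 * sqrtm3 - 9) / 4 * t * t * (ff 1 t * ff (- (1)) t)) by field.
      rewrite sqrtm3_sq. field.
    - assert (B := sqrt3_bound). assert (Q := PI_gt_3). simpl. lra. }
  unfold g in E. replace (L tau * L tau) with (ff 1 tau * ff (- (1)) tau - (ff 1 tau * ff (- (1)) tau - L tau * L tau)) by ring.
  rewrite E. ring.
Qed.

(** * Cubes of f_s and Serre derivatives *)

Definition cube (z : C) : C := z * (z * z).
Definition ccube (a : nat -> C) : nat -> C := cmul a (cmul a a).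

Lemma qs_cube a g : qs a g -> qs (ccube a) (fun t => cube (g t)).
Proof. intros H. apply qs_mult; auto. apply (qs_mult a a g g); auto. Qed.

(** The multipliers of f_1 and f_{-1} differ by a cube root of unity, so their cubes coincide, see
    [cube_cm1]. Hence W exchanges the two cubes with one common factor, and their sum and difference
    are eigenfunctions. *)
Lemma cube_c1 : cube ((3 - sqrtm3) / 2) = - (3) * sqrtm3.
Proof.
  unfold cube. replace ((3 - sqrtm3) / 2 * ((3 - sqrtm3) / 2 * ((3 - sqrtm3) / 2))) with
    ((27 - 27 * sqrtm3 + 9 * (sqrtm3 * sqrtm3) - sqrtm3 * sqrtm3 * sqrtm3) / 8) by field.
  rewrite sqrtm3_pow3, sqrtm3_sq. field.
Qed.

Lemma cube_cm1 : cube ((- (3) - sqrtm3) / 2) = - (3) * sqrtm3.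
Proof.
  unfold cube. replace ((- (3) - sqrtm3) / 2 * ((- (3) - sqrtm3) / 2 * ((- (3) - sqrtm3) / 2))) with
    ((- (27) - 27 * sqrtm3 - 9 * (sqrtm3 * sqrtm3) - sqrtm3 * sqrtm3 * sqrtm3) / 8) by field.
  rewrite sqrtm3_pow3, sqrtm3_sq. field.
Qed.

Lemma cube_ff_fricke tau : (0 < Im tau)%R ->
  cube (ff 1 (fricke tau)) = - (3) * sqrtm3 * (tau * tau * tau) * cube (ff (- (1)) tau) /\
  cube (ff (- (1)) (fricke tau)) = - (3) * sqrtm3 * (tau * tau * tau) * cube (ff 1 tau).
Proof.
  intros H. rewrite ff_fricke_1, ff_fricke_m1 by auto. rewrite <- cube_c1 at 1. rewrite <- cube_cm1.
  unfold cube. split; ring.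
Qed.

Definition DL : C -> C := Dq cL.
(** This is - 6 times the Serre derivative DL - L P / 12 of the weight one form L; the non-modular
    terms of DL and of P cancel in it. *)
Definition GG (tau : C) : C := L tau * P tau / 2 - 6 * DL tau.
Definition XX (tau : C) : C := cube (ff 1 tau) - cube (ff (- (1)) tau).
Definition cX (n : nat) : C := ccube (cff 1) n - ccube (cff (- (1))) n.

Lemma qs_X : qs cX XX.
Proof. apply (qs_minus _ _ (fun t => cube (ff 1 t)) (fun t => cube (ff (- (1)) t))); apply qs_cube, qs_ff. Qed.

Lemma X_T tau : XX (tau + 1) = - XX tau.
Proof. unfold XX. rewrite ff_T_1, ff_T_m1. ring. Qed.

Lemma X_fricke tau : (0 < Im tau)%R -> XX (fricke tau) = 3 * sqrtm3 * (tau * tau * tau) * XX tau.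
Proof. intros H. destruct (cube_ff_fricke tau H) as [H1 H2]. unfold XX. rewrite H1, H2. ring. Qed.

Lemma DL_T tau : (0 < Im tau)%R -> DL (tau + 1) = DL tau.
Proof. apply (Dq_T cL cL L L); auto using qs_L. apply L_T. Qed.

Lemma DL_fricke tau : (0 < Im tau)%R ->
  DL (fricke tau) = 3 * tau * tau * (- sqrtm3 * tau * DL tau + - sqrtm3 * L tau / tpi).
Proof.
  intros H. apply (Dq_fricke cL cL L L (fun t => - sqrtm3 * t)); auto using qs_L.
  intros; now apply L_fricke. apply cder_linear.
Qed.

Lemma G_fricke tau : (0 < Im tau)%R -> GG (fricke tau) = - (3) * sqrtm3 * (tau * tau * tau) * GG tau.
Proof.
  intros H. assert (T := tpi_neq_0). unfold GG. rewrite L_fricke, P_fricke, DL_fricke by auto. field. auto.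
Qed.

Definition DX : C -> C := Dq cX.

Lemma DX_fricke tau : (0 < Im tau)%R ->
  DX (fricke tau) = 3 * tau * tau * (3 * sqrtm3 * (tau * tau * tau) * DX tau + 9 * sqrtm3 * (tau * tau) * XX tau / tpi).
Proof.
  intros H. apply (Dq_fricke cX cX XX XX (fun t => 3 * sqrtm3 * (t * t * t))); auto using qs_X.
  intros; now apply X_fricke.
  replace (9 * sqrtm3 * (tau * tau)) with (3 * sqrtm3 * ((1 * tau + tau * 1) * tau + tau * tau * 1)) by ring.
  apply cder_scal. apply (cder_mult (fun t => t * t) (fun t => t)). apply cder_mult; apply cder_id. apply cder_id.
Qed.

Lemma DX_T tau : (0 < Im tau)%R -> DX (tau + 1) = - DX tau.
Proof.
  intros H. unfold DX. rewrite (Dq_T cX (fun n => - (1) * cX n) XX (fun t => - (1) * XX t)); auto using qs_X, qs_scal.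
  - unfold Dq, pser. rewrite (Cseries_ext _ (fun n => - (1) * (half_D cX n * Cpow (ph tau) n))).
    rewrite Cseries_scal. ring. apply (rapid_half_D _ (proj1 qs_X)). now apply Cmod_ph.
    intros; unfold half_D; ring.
  - intros; rewrite X_T; ring.
Qed.

Definition cG (n : nat) : C := / 2 * cmul cL cP n - 6 * half_D cL n.

Lemma qs_G : qs cG GG.
Proof.
  apply qs_ext with (fun t => / 2 * (L t * P t) - 6 * DL t).
  intros; unfold GG; field.
  apply (qs_minus _ _ (fun t => / 2 * (L t * P t)) (fun t => 6 * DL t)).
  - apply (qs_scal _ _ (fun t => L t * P t)). apply qs_mult; auto using qs_L, qs_P.
  - apply qs_scal. apply (qs_D cL L), qs_L.
Qed.

Lemma G_T tau : (0 < Im tau)%R -> GG (tau + 1) = GG tau.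
Proof. intros H. unfold GG. now rewrite L_T, P_T, DL_T. Qed.

Theorem G_eq tau : (0 < Im tau)%R -> 2 * GG tau = cube (ff 1 tau) + cube (ff (- (1)) tau).
Proof.
  intros Ht.
  set (g := fun t => 2 * GG t - (cube (ff 1 t) + cube (ff (- (1)) t))).
  assert (Hg : qs (fun n => 2 * cG n - (ccube (cff 1) n + ccube (cff (- (1))) n)) g).
  { apply (qs_minus _ _ (fun t => 2 * GG t)). apply qs_scal, qs_G.
    apply (qs_plus _ _ (fun t => cube (ff 1 t)) (fun t => cube (ff (- (1)) t))); apply qs_cube, qs_ff. }
  assert (HT : forall t, (0 < Im t)%R -> g (t + 1) = g t).
  { intros; unfold g. rewrite G_T, ff_T_1, ff_T_m1 by auto. ring. }
  assert (E : g tau = 0).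
  { apply (modular_vanishing _ g 3 2 Hg); auto.
    - apply small_cases; auto; try lia.
      + unfold cG, ccube, half_D. rewrite !cmul_0, !cff_0, cL_0, cP_0. simpl. field.
      + exact (qs_even_1 _ _ Hg HT).
    - now apply T_invariant_even.
    - apply W_invariant_intro. intros t H. unfold g. destruct (cube_ff_fricke t H) as [H1 H2].
      rewrite H1, H2, G_fricke by auto.
      replace (Cpow (sqrtm3 * t) 3) with ((sqrtm3 * sqrtm3 * sqrtm3) * (t * t * t)) by (simpl; ring).
      rewrite sqrtm3_pow3. ring.
    - assert (B := sqrt3_bound). assert (Q := PI_gt_3). simpl. lra. }
  unfold g in E. set (u := cube (ff 1 tau) + cube (ff (- (1)) tau)) in *.
  replace u with (2 * GG tau - (2 * GG tau - u)) by ring. rewrite E. ring.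
Qed.

Theorem X_ode tau : (0 < Im tau)%R -> 4 * DX tau = P tau * XX tau.
Proof.
  intros Ht.
  set (g := fun t => 4 * DX t - P t * XX t).
  assert (Hg : qs (fun n => 4 * half_D cX n - cmul cP cX n) g).
  { apply (qs_minus _ _ (fun t => 4 * DX t)). apply qs_scal. apply (qs_D cX XX), qs_X.
    apply qs_mult; auto using qs_P, qs_X. }
  assert (HT : forall t, (0 < Im t)%R -> g (t + 1) = - g t).
  { intros; unfold g. rewrite DX_T, X_T, P_T by auto. ring. }
  assert (C0 : cX 0 = 0) by (unfold cX, ccube; rewrite !cmul_0, !cff_0; ring).
  assert (E : g tau = 0).
  { apply (modular_vanishing _ g 5 3 Hg); auto.
    - apply small_cases; auto; try lia.
      + exact (proj1 (qs_odd_0_2 _ _ Hg HT)).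
      (* The coefficient of q^(1/2): 4 times the exponent 1/2 equals the constant term 2 of P. *)
      + unfold half_D. rewrite cmul_1, cP_0, C0. simpl. field.
      + intros _. exact (proj2 (qs_odd_0_2 _ _ Hg HT)).
    - now apply T_invariant_odd.
    - apply W_invariant_intro. intros t H. assert (T := tpi_neq_0). unfold g.
      rewrite DX_fricke, P_fricke, X_fricke by auto.
      replace (Cpow (sqrtm3 * t) 5) with ((sqrtm3 * sqrtm3) * (sqrtm3 * sqrtm3 * sqrtm3) * (t * t * t * t * t)) by (simpl; ring).
      rewrite sqrtm3_pow3, sqrtm3_sq. field. auto.
    - assert (B := sqrt3_bound). assert (Q := PI_gt_3). simpl. lra. }
  unfold g in E. set (u := P tau * XX tau) in *.
  replace u with (4 * DX tau - (4 * DX tau - u)) by ring. rewrite E. ring.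
Qed.

Lemma Dq_E2 tau : (0 < Im tau)%R ->
  12 * Dq (sp 2 cE2) tau = E2 tau * E2 tau - E4 tau /\
  4 * Dq (sp 6 cE2) tau = E2 (3 * tau) * E2 (3 * tau) - E4 (3 * tau).
Proof.
  intros H. assert (H3 : (0 < Im (3 * tau))%R) by (rewrite Im_scale; lra).
  rewrite !Dq_sp by (auto using rapid_cE2; lia). rewrite ph_pow2, ph_pow6.
  rewrite !E2_pser, !E4_pser by auto.
  rewrite <- !ramanujan by now apply Cmod_qpar_lt_1.
  split; simpl (INR _); rewrite ?RtoC_plus; field.
Qed.

Lemma D_E32 tau : (0 < Im tau)%R -> 4 * L tau * DL tau = 3 * Dq (sp 6 cE2) tau - Dq (sp 2 cE2) tau.
Proof.
  intros H. assert (T := tpi_neq_0).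
  assert (D1 : cder (fun t => L t * L t) tau (tpi * DL tau * L tau + L tau * (tpi * DL tau))).
  { apply cder_mult; apply (qs_cder cL L); auto using qs_L. }
  assert (D2 : cder (fun t => / 2 * (3 * E2 (3 * t) + - (1) * E2 t)) tau
    (/ 2 * (3 * (tpi * Dq (sp 6 cE2) tau) + - (1) * (tpi * Dq (sp 2 cE2) tau)))).
  { apply cder_scal. apply (cder_plus (fun t => 3 * E2 (3 * t)) (fun t => - (1) * E2 t)).
    - apply (cder_scal 3 (fun t => E2 (3 * t))). apply (qs_cder _ (fun t => E2 (3 * t)) tau); auto using qs_E2_3.
    - apply cder_scal. apply qs_cder; auto using qs_E2. }
  assert (D3 : cder (fun t => L t * L t) tau (/ 2 * (3 * (tpi * Dq (sp 6 cE2) tau) + - (1) * (tpi * Dq (sp 2 cE2) tau)))).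
  { apply cder_ext_loc with (1 := H) (3 := D2). intros k Hk.
    rewrite L_sq by now apply half_plane_ball. unfold E32. field. }
  assert (E := cder_unique _ _ _ _ D1 D3).
  replace (4 * L tau * DL tau) with ((tpi * DL tau * L tau + L tau * (tpi * DL tau)) * (2 / tpi)) by (field; auto).
  rewrite E. field. auto.
Qed.

(** With Ramanujan's equation for both values of [E4], the squares of [E2] combine to E32 P / 2 =
    L^2 P / 2 and the derivatives to - 6 L DL. *)
Theorem E34_eq tau : (0 < Im tau)%R -> E34 tau = L tau * GG tau.
Proof.
  intros H. destruct (Dq_E2 tau H) as [H1 H2]. assert (H3 := D_E32 tau H). assert (H4 := L_sq tau H).
  unfold E34.
  replace (E4 (3 * tau)) with (E2 (3 * tau) * E2 (3 * tau) - 4 * Dq (sp 6 cE2) tau) by (rewrite H2; ring).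
  replace (E4 tau) with (E2 tau * E2 tau - 12 * Dq (sp 2 cE2) tau) by (rewrite H1; ring).
  replace (L tau * GG tau) with (L tau * L tau * P tau / 2 - (6 / 4) * (4 * L tau * DL tau)) by (unfold GG; field).
  rewrite H3, H4. unfold E32, P. field.
Qed.

(** * The eta product *)

(** Here p stands for the real or the imaginary part: the mean value theorem is one for real
    functions, so constancy is proved one coordinate at a time. *)
Lemma cder_line (p : C -> R) f z (d : C) (t : R) :
  (forall a b, p (a - b) = (p a - p b)%R) -> (forall a, (Rabs (p a) <= Cmod a)%R) ->
  cder f (z + t * d) 0 -> is_derive (fun s : R => p (f (z + s * d))) t 0%R.
Proof.
  intros Hp Hb Hf. apply is_derive_Reals. intros eps He.
  assert (G := Cmod_ge_0 d). set (M := (Cmod d + 1)%R). assert (HM : (0 < M)%R) by (unfold M; lra).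
  destruct (Hf (eps / (2 * M))%R) as [r [Hr H]]. apply Rdiv_lt_0_compat; lra.
  assert (Hd : (0 < r / M)%R) by now apply Rdiv_lt_0_compat.
  exists (mkposreal _ Hd). intros h Hh Hlt. simpl in Hlt.
  assert (P : (0 < Rabs h)%R) by now apply Rabs_pos_lt.
  assert (Lt : (Cmod (h * d)%C < r)%R).
  { rewrite Cmod_mult, Cmod_R. apply Rle_lt_trans with (Rabs h * M)%R.
    apply Rmult_le_compat_l; unfold M; lra.
    apply Rmult_lt_reg_r with (/ M)%R. now apply Rinv_0_lt_compat.
    replace (Rabs h * M * / M)%R with (Rabs h) by (field; lra). exact Hlt. }
  specialize (H _ Lt).
  replace (z + t * d + h * d) with (z + (t + h)%R * d) in H by (rewrite RtoC_plus; ring).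
  set (u := f (z + (t + h)%R * d)) in *. set (v := f (z + t * d)) in *.
  replace (u - v - 0 * (h * d)) with (u - v) in H by ring.
  rewrite Cmod_mult, Cmod_R in H.
  rewrite <- Hp, Rminus_0_r, Rabs_div by auto.
  apply Rmult_lt_reg_r with (Rabs h); auto.
  replace (Rabs (p (u - v)%C) / Rabs h * Rabs h)%R with (Rabs (p (u - v)%C)) by (field; lra).
  eapply Rle_lt_trans. apply Hb. eapply Rle_lt_trans. apply H.
  replace (eps / (2 * M) * (Rabs h * Cmod d))%R with (eps * Rabs h * (Cmod d / (2 * M)))%R by (field; lra).
  rewrite <- (Rmult_1_r (eps * Rabs h)) at 2.
  apply Rmult_lt_compat_l. now apply Rmult_lt_0_compat.
  apply Rmult_lt_reg_r with (2 * M)%R. lra.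
  replace (Cmod d / (2 * M) * (2 * M))%R with (Cmod d) by (field; lra). unfold M; lra.
Qed.

Lemma cder_0_const f (z0 z1 : C) :
  (forall t : R, (0 <= t <= 1)%R -> cder f (z0 + t * (z1 - z0)) 0) -> f z0 = f z1.
Proof.
  intros H.
  assert (K : forall p : C -> R, (forall a b, p (a - b) = (p a - p b)%R) ->
    (forall a, (Rabs (p a) <= Cmod a)%R) -> p (f z0) = p (f z1)).
  { intros p Hp Hb.
    assert (E := eq_is_derive (fun s : R => p (f (z0 + s * (z1 - z0)))) 0 1
      ltac:(intros t Ht; apply (cder_line p f z0 (z1 - z0) t Hp Hb), H, Ht) ltac:(lra)).
    cbv beta in E. replace (z0 + 0%R * (z1 - z0)) with z0 in E by ring.
    now replace (z0 + 1%R * (z1 - z0)) with z1 in E by ring. }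
  rewrite (surjective_pairing (f z0)), (surjective_pairing (f z1)).
  f_equal; apply K.
  - reflexivity.
  - intros a. eapply Rle_trans. 2: apply Rmax_Cmod. apply Rmax_l.
  - reflexivity.
  - intros a. eapply Rle_trans. 2: apply Rmax_Cmod. apply Rmax_r.
Qed.

Lemma pser_0 a : pser a 0 = a 0%nat.
Proof.
  unfold pser. rewrite (Cseries_single _ 0). simpl; ring.
  intros n Hn. destruct n; [lia|]. rewrite Cpow_S. ring.
Qed.

Lemma rapid_inv_idx : rapid (fun l => / idx l).
Proof.
  apply rapid_le with (2 := rapid_1). intros n. rewrite Cmod_inv by apply idx_neq_0.
  unfold idx. rewrite 2!Cmod_R, (Rabs_pos_eq (INR (S n))), Rabs_R1 by apply pos_INR.
  assert (P := pos_INR n). rewrite S_INR. rewrite <- Rinv_1. apply Rinv_le_contravar; lra.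
Qed.

Definition clog : nat -> C := ccons 0 (fun l => / idx l).

Lemma rapid_clog : rapid clog.
Proof. apply rapid_ccons, rapid_inv_idx. Qed.

(* [pser clog y] is the branch of [-log (1 - y)] vanishing at 0. *)
Lemma Cexp_clog y : (Cmod y < 1)%R -> Cexp (- pser clog y) = 1 - y.
Proof.
  intros Hy.
  (* [h] has derivative 0, because the derivative of [pser clog] is the geometric series 1 / (1 -
     z); its value at 0 is 1. *)
  set (h := fun z => (1 + - (1) * z) * Cexp (pser clog z)).
  assert (E : h 0 = h y).
  { apply cder_0_const. intros t Ht.
    replace (0 + t * (y - 0)) with (t * y) by ring. set (z := t * y).
    assert (Hz : (Cmod z < 1)%R).
    { unfold z. rewrite Cmod_mult, Cmod_R, Rabs_pos_eq by lra. assert (G := Cmod_ge_0 y). nra. }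
    assert (N := one_sub_neq_0 z Hz).
    assert (D1 := cder_comp Cexp (pser clog) z _ _ (cder_Cexp _) (cder_pser clog z rapid_clog Hz)).
    assert (E1 : pser (fun n => INR (S n) * clog (S n)) z = / (1 - z)).
    { rewrite <- Cseries_geom by auto. apply Cseries_ext. intros n. simpl clog. fold (idx n).
      field. apply idx_neq_0. }
    rewrite E1 in D1.
    assert (D2 := cder_plus (fun _ => 1) _ z _ _ (cder_const 1 z) (cder_linear (- (1)) z)).
    assert (D3 := cder_mult _ _ z _ _ D2 D1). cbv beta in D3.
    replace (RtoC 0) with ((0 + - (1)) * Cexp (pser clog z) + (1 + - (1) * z) * (Cexp (pser clog z) * / (1 - z))).
    exact D3. field. auto. }
  unfold h in E. rewrite pser_0 in E. simpl clog in E. rewrite Cexp_0 in E.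
  rewrite Cexp_opp. assert (N := Cexp_neq_0 (pser clog y)).
  replace (1 - y) with ((1 + - (1) * y) * Cexp (pser clog y) * / Cexp (pser clog y)) by (field; auto).
  rewrite <- E. ring.
Qed.

(** The coefficients are the sums of 1 / l over the divisors l of n: the expansion of minus the
    logarithm of Euler's product. *)
Definition cell : nat -> C := ccons 0 (conv (fun _ => 1) (fun l => / idx l)).

Lemma rapid_cell : rapid cell.
Proof. apply rapid_ccons, rapid_conv. apply rapid_1. apply rapid_inv_idx. Qed.

Lemma euler_product x : (Cmod x < 1)%R -> Cinfprod (fun n => 1 - Cpow x (S n)) = Cexp (- pser cell x).
Proof.
  intros Hx.
  destruct (lambert (fun _ => 1) _ x rapid_1 rapid_inv_idx Hx) as [_ E].
  assert (DS := dsummable_lambert _ _ x rapid_1 rapid_inv_idx Hx).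
  assert (Ec : forall n, Cseries (fun l => 1 * / idx l * Cpow x (S n * S l)) = pser clog (Cpow x (S n))).
  { intros n. unfold clog. rewrite pser_ccons, Cplus_0_l by (auto using rapid_inv_idx, Cmod_pow_lt_1).
    apply Cseries_ext. intros l. rewrite Cpow_mult_r. ring. }
  assert (SS : csummable (fun n => pser clog (Cpow x (S n)))).
  { apply csummable_ext with (1 := Ec). destruct DS. now apply csummable_rows. }
  rewrite (Products.Cinfprod_Cexp _ (fun n => - pser clog (Cpow x (S n)))).
  - f_equal. rewrite (Cseries_ext _ (fun n => - (1) * pser clog (Cpow x (S n)))) by (intros; ring).
    rewrite Cseries_scal by auto.
    unfold cell. rewrite pser_ccons, E by (auto using rapid_conv, rapid_1, rapid_inv_idx).
    unfold dseries. rewrite (Cseries_ext _ _ Ec). ring.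
  - intros n. symmetry. apply Cexp_clog. now apply Cmod_pow_lt_1.
  - now apply csummable_opp.
Qed.

(** n times the sum of the 1 / l over the divisors l of n is sigma_1(n). This is how the logarithmic
    derivative of the eta product becomes an [E2]. *)
Lemma theta_cell n : theta cell (S n) = sigC 1 n.
Proof.
  unfold theta, cell, ccons, sigC. rewrite divisor_sigma_conv. unfold conv.
  rewrite <- Csum_scal. apply Csum_ext. intros d.
  destruct (Nat.eqb_spec (S n mod S d) 0) as [E0|]; [|ring].
  assert (D := Nat.div_mod_eq (S n) (S d)). rewrite E0 in D.
  assert (Q : (0 < S n / S d)%nat) by (destruct (S n / S d)%nat; lia).
  set (q := (S n / S d)%nat) in *. fold (idx n).
  assert (E1 : idx n = idx d * idx (q - 1)).
  { unfold idx. rewrite <- RtoC_mult, <- mult_INR. do 2 f_equal.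
    replace (S (q - 1)) with q by lia. lia. }
  rewrite E1. simpl. field. apply idx_neq_0.
Qed.

Lemma pser_theta_cell x : (Cmod x < 1)%R -> 24 * pser (theta cell) x = 1 - pser cE2 x.
Proof.
  intros Hx. unfold cE2. rewrite pser_ccons by (auto using rapid_scal, rapid_sig).
  rewrite (Cseries_ext _ (fun n => - (24) * (sigC 1 n * Cpow x (S n)))) by (intros; ring).
  rewrite Cseries_scal by now apply sig_summable.
  unfold pser. rewrite Cseries_incr_1 by (apply (rapid_INR _ rapid_cell x Hx)). cbv beta.
  rewrite (Cseries_ext _ (fun n => sigC 1 n * Cpow x (S n))) by (intros; now rewrite theta_cell).
  unfold theta, cell, ccons. ring.
Qed.

(** Minus the logarithm of eta3^3 / q^(1/2), see [eta3_cube]: the two Euler products, each cubed. *)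
Definition lam (tau : C) : C := 3 * pser cell (qpar tau) + 3 * pser cell (qpar (3 * tau)).
Definition clam (n : nat) : C := 3 * sp 2 cell n + 3 * sp 6 cell n.

Lemma qs_cell_1 : qs (sp 2 cell) (fun tau => pser cell (qpar tau)).
Proof.
  apply qs_ext with (2 := qs_sp 2 cell ltac:(lia) rapid_cell). intros. now rewrite ph_pow2.
Qed.

Lemma qs_cell_3 : qs (sp 6 cell) (fun tau => pser cell (qpar (3 * tau))).
Proof.
  apply qs_ext with (2 := qs_sp 6 cell ltac:(lia) rapid_cell). intros. now rewrite ph_pow6.
Qed.

Lemma qs_lam : qs clam lam.
Proof.
  apply (qs_plus _ _ (fun tau => 3 * pser cell (qpar tau)) (fun tau => 3 * pser cell (qpar (3 * tau)))).
  - apply (qs_scal _ _ (fun tau => pser cell (qpar tau))), qs_cell_1.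
  - apply (qs_scal _ _ (fun tau => pser cell (qpar (3 * tau)))), qs_cell_3.
Qed.

Lemma eta_Cexp tau : (0 < Im tau)%R -> eta tau = Cexp (tpi / 24 * tau - pser cell (qpar tau)).
Proof.
  intros H. unfold eta. rewrite euler_product by now apply Cmod_qpar_lt_1.
  rewrite <- Cexp_plus. f_equal. unfold tpi. field.
Qed.

Lemma eta3_cube tau : (0 < Im tau)%R -> Cpow (eta3 tau) 3 = Cexp (tpi / 2 * tau - lam tau).
Proof.
  intros H. unfold eta3. rewrite !eta_Cexp by (auto; rewrite Im_scale; lra).
  rewrite <- Cexp_plus, Cexp_pow. f_equal. unfold lam. simpl (INR 3). rewrite !RtoC_plus. field.
Qed.

Lemma cder_lam tau : (0 < Im tau)%R -> cder lam tau (tpi * (1 / 2 - P tau / 4)).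
Proof.
  intros H. assert (H3 : (0 < Im (3 * tau))%R) by (rewrite Im_scale; lra).
  assert (D := cder_plus _ _ tau _ _
    (cder_scal 3 _ tau _ (qs_cder _ _ tau qs_cell_1 H)) (cder_scal 3 _ tau _ (qs_cder _ _ tau qs_cell_3 H))).
  rewrite !Dq_sp in D by (auto using rapid_cell; lia). rewrite ph_pow2, ph_pow6 in D.
  assert (E1 := pser_theta_cell _ (Cmod_qpar_lt_1 _ H)).
  assert (E3 := pser_theta_cell _ (Cmod_qpar_lt_1 _ H3)).
  rewrite <- E2_pser in E1, E3 by auto.
  replace (tpi * (1 / 2 - P tau / 4)) with
    (3 * (tpi * (INR 2 / 2 * pser (theta cell) (qpar tau))) + 3 * (tpi * (INR 6 / 2 * pser (theta cell) (qpar (3 * tau))))).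
  exact D.
  replace (P tau) with (2 - (3 * (1 - E2 (3 * tau)) + (1 - E2 tau)) / 2) by (unfold P; field).
  rewrite <- E1, <- E3. simpl (INR _). rewrite ?RtoC_plus. field.
Qed.

Lemma cder_X_over_eta tau : (0 < Im tau)%R -> cder (fun t => XX t * Cexp (lam t + - (tpi / 2) * t)) tau 0.
Proof.
  intros H.
  assert (D1 := qs_cder cX XX tau qs_X H). fold DX in D1. fold (DX tau) in D1.
  assert (D2 := cder_plus _ _ tau _ _ (cder_lam tau H) (cder_linear (- (tpi / 2)) tau)).
  assert (D3 := cder_comp Cexp _ tau _ _ (cder_Cexp _) D2).
  assert (D4 := cder_mult _ _ tau _ _ D1 D3). cbv beta in D4.
  match type of D4 with cder _ _ ?l => replace (RtoC 0) with l end.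
  exact D4.
  replace (DX tau) with (4 * DX tau / 4) by field. rewrite X_ode by auto. field.
Qed.

Lemma chi_sum_1 : chi_sum 1 = 1%Z.
Proof.
  apply eq_IZR. apply RtoC_inj. rewrite Arithmetic.chi_sum_Csum. reflexivity.
Qed.

Lemma cff_1 s : cff s 1 = 2 * s * sqrtm3.
Proof.
  unfold cff, calt. change (cE1 1) with (RtoC (IZR (chi_sum 1))). rewrite chi_sum_1.
  unfold sp. simpl. ring.
Qed.

Lemma cX_0 : cX 0 = 0.
Proof. unfold cX, ccube. rewrite !cmul_0, !cff_0. ring. Qed.

Lemma cX_1 : cX 1 = 12 * sqrtm3.
Proof. unfold cX, ccube. rewrite !cmul_1, !cmul_0, !cff_0, !cff_1. ring. Qed.

Lemma clam_0 : clam 0 = 0.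
Proof. unfold clam. rewrite !sp_0. simpl. ring. Qed.

Lemma cder_0_ray (F : C -> C) (l c : C) : F 0 = 0 -> cder F 0 l -> (forall r : R, (0 < r < 1)%R -> F r = c * r) -> c = l.
Proof.
  intros F0 D H. destruct (Ceq_dec c l) as [|Hne]; auto. exfalso.
  assert (P : (0 < Cmod (c - l))%R).
  { apply Cmod_gt_0. intros E. apply Hne. replace c with (c - l + l) by ring. rewrite E. ring. }
  destruct (D (Cmod (c - l) / 2)%R ltac:(lra)) as [d [Hd B]].
  set (r := (Rmin d 1 / 2)%R).
  assert (Hr : (0 < r < 1)%R /\ (r < d)%R).
  { unfold r. assert (G := Rmin_l d 1). assert (G' := Rmin_r d 1).
    assert (0 < Rmin d 1)%R by (apply Rmin_pos; lra). lra. }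
  assert (Er : Cmod r = r) by (rewrite Cmod_R, Rabs_pos_eq; lra).
  specialize (B r ltac:(rewrite Er; apply Hr)).
  rewrite Cplus_0_l, F0, H in B by apply Hr.
  replace (c * r - 0 - l * r) with ((c - l) * r) in B by ring.
  rewrite Cmod_mult, Er in B. nra.
Qed.

Lemma Im_segment (z w : C) (s : R) : Im (z + s * (w - z)) = ((1 - s) * Im z + s * Im w)%R.
Proof. destruct z, w. simpl. ring. Qed.

Theorem X_eta3 tau : (0 < Im tau)%R -> XX tau = 12 * sqrtm3 * Cpow (eta3 tau) 3.
Proof.
  intros Ht. set (c := XX tau * Cexp (lam tau + - (tpi / 2) * tau)).
  assert (HC : forall t, (0 < Im t)%R -> XX t = c * Cexp (tpi / 2 * t - lam t)).
  { intros t H.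
    assert (E : XX t * Cexp (lam t + - (tpi / 2) * t) = c).
    { apply (cder_0_const (fun t => XX t * Cexp (lam t + - (tpi / 2) * t))).
      intros s Hs. apply cder_X_over_eta.
      (* The half-plane is convex, so the segment from t to tau stays inside it. *)
      replace (Im (t + s * (tau - t))) with ((1 - s) * Im t + s * Im tau)%R by (symmetry; apply Im_segment).
      destruct (Req_dec s 0) as [-> | N]. lra.
      apply Rplus_le_lt_0_compat. apply Rmult_le_pos; lra. apply Rmult_lt_0_compat; lra. }
    rewrite <- E, <- Cmult_assoc, <- Cexp_plus.
    replace (lam t + - (tpi / 2) * t + (tpi / 2 * t - lam t)) with (RtoC 0) by ring.
    rewrite Cexp_0. ring. }
  (* In the variable x = q^(1/2) the relation reads [pser cX x * Cexp (pser clam x)] = c x for 0 < x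
     < 1, so c is the derivative of the left side at 0, which is [cX 1]. *)
  assert (Ec : c = 12 * sqrtm3).
  { rewrite <- cX_1.
    apply (cder_0_ray (fun x => pser cX x * Cexp (pser clam x))).
    - rewrite pser_0, cX_0. ring.
    - assert (Z : (Cmod 0 < 1)%R) by (rewrite Cmod_0; lra).
      assert (D := cder_mult _ _ 0 _ _ (cder_pser cX 0 (proj1 qs_X) Z)
        (cder_comp Cexp _ 0 _ _ (cder_Cexp _) (cder_pser clam 0 (proj1 qs_lam) Z))).
      cbv beta in D. rewrite !pser_0, cX_0, clam_0, Cexp_0 in D. simpl (INR 1) in D.
      rewrite Cmult_1_l, Cmult_1_r, Cmult_0_l, Cplus_0_r in D. exact D.
    - intros r Hr. destruct (ph_surj_circle r 0 Hr) as [t [Hi Hp]].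
      rewrite qpar_0, Cmult_1_r in Hp. rewrite <- Hp.
      rewrite <- (proj2 qs_X t Hi), <- (proj2 qs_lam t Hi), HC by auto.
      rewrite <- Cmult_assoc, <- Cexp_plus. f_equal.
      unfold ph. rewrite qpar_tpi. f_equal. field. }
  rewrite eta3_cube, HC, Ec by auto. reflexivity.
Qed.

Lemma X_neq_0 tau : (0 < Im tau)%R -> XX tau <> 0.
Proof.
  intros H. rewrite X_eta3, eta3_cube by auto. apply Cmult_neq_0. apply Cmult_neq_0.
  - intros E. apply RtoC_inj in E. lra.
  - apply sqrtm3_neq_0.
  - apply Cexp_neq_0.
Qed.

(** * Removable singularities and the theorem *)

Lemma sgn_succ j : sgn (j + 1) = - sgn j.
Proof.
  unfold sgn. rewrite powerRZ_add by lra. replace (powerRZ (-1) 1) with (-1)%R by (simpl; ring).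
  rewrite RtoC_mult. ring.
Qed.

Lemma sgn_cases j : sgn j = 1 \/ sgn j = - (1).
Proof.
  unfold sgn. assert (E : (powerRZ (-1) j * powerRZ (-1) j = 1)%R).
  { rewrite <- powerRZ_mult by (right; lra).
    replace (-1 * -1)%R with 1%R by ring. apply powerRZ_R1. }
  assert (H : (powerRZ (-1) j = 1 \/ powerRZ (-1) j = - (1))%R).
  { destruct (Rmult_integral (powerRZ (-1) j - 1) (powerRZ (-1) j + 1)). lra. left; lra. right; lra. }
  destruct H as [-> | ->]; [left | right]. reflexivity. now rewrite RtoC_opp.
Qed.

Lemma locally'_C_intro (z : C) (Q : C -> Prop) (d : R) : (0 < d)%R ->
  (forall h : C, h <> 0 -> (Cmod h < d)%R -> Q (z + h)) -> @locally' C_UniformSpace z Q.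
Proof.
  intros Hd H. apply (@locally_le_locally_norm C_AbsRing C_NormedModule z).
  assert (A : forall y : C, z + (y - z) = y) by (intros; ring).
  exists (mkposreal d Hd). intros y Hy Hne. rewrite <- (A y). apply H.
  - intros E. apply Hne. rewrite <- (A y), E. exact (Cplus_0_r z).
  - exact Hy.
Qed.

Lemma locally'_C_proper (z : C) : ProperFilter' (@locally' C_UniformSpace z).
Proof.
  split. 2: apply locally'_filter.
  intros H. destruct (@locally_norm_le_locally C_AbsRing C_NormedModule z _ H) as [d B].
  assert (Hd := cond_pos d).
  apply (B (z + (d / 2)%R)).
  - change (Cmod (z + (d / 2)%R - z) < d)%R. replace (z + (d / 2)%R - z) with (RtoC (d / 2)) by ring.
    rewrite Cmod_R, Rabs_pos_eq; lra.
  - intros E. assert (E' : RtoC (d / 2) = 0).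
    { replace (RtoC (d / 2)) with (z + (d / 2)%R - z) by ring. rewrite E. ring. }
    apply RtoC_inj in E'. lra.
Qed.

Lemma Clim_removable f g (z l : C) (d : R) : (0 < d)%R ->
  (forall h : C, h <> 0 -> (Cmod h < d)%R -> f (z + h) = g (z + h)) -> cder g z l -> Clim f z = g z.
Proof.
  intros Hd H D. unfold Clim. apply (@Ciota_filterlim C _ (locally'_C_proper z)).
  apply (@filterlim_locally_ball_norm C_AbsRing C C_NormedModule _ (@locally'_filter C_UniformSpace z) f (g z)).
  intros eps. destruct (cder_lipschitz g z l D) as [d1 [Hd1 L1]].
  assert (G := Cmod_ge_0 l). set (M := (Cmod l + 1)%R) in *.
  assert (He := cond_pos eps).
  apply locally'_C_intro with (Rmin d (Rmin d1 (eps / M))).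
  { repeat apply Rmin_pos; auto. apply Rdiv_lt_0_compat; unfold M; lra. }
  intros h Hh Hlt. apply Rmin_Rgt in Hlt. destruct Hlt as [h1 Hlt]. apply Rmin_Rgt in Hlt. destruct Hlt as [h2 h3].
  change (Cmod (f (z + h)%C - g z)%C < eps)%R. rewrite H by (auto; lra).
  eapply Rle_lt_trans. apply L1; lra.
  replace (pos eps) with (M * (eps / M))%R by (field; unfold M; lra).
  apply Rmult_lt_compat_l; unfold M in *; lra.
Qed.

Lemma simple_zero (f : C -> C) (z l : C) : f z = 0 -> l <> 0 -> cder f z l ->
  exists d, (0 < d)%R /\ forall h : C, h <> 0 -> (Cmod h < d)%R -> f (z + h) <> 0.
Proof.
  intros Z Hl D. assert (P := proj1 (Cmod_gt_0 l) Hl).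
  destruct (D (Cmod l / 2)%R ltac:(lra)) as [d [Hd B]]. exists d. split; auto.
  intros h Hh Hlt E. specialize (B h Hlt). rewrite E, Z in B.
  replace (0 - 0 - l * h) with (- (l * h)) in B by ring. rewrite Cmod_opp, Cmod_mult in B.
  assert (Q := proj1 (Cmod_gt_0 h) Hh). nra.
Qed.

(* The holomorphic extension of [F3_quotient]. *)
Definition FF (s : C) (tau : C) : C := GG tau + s * XX tau / 2.

Lemma cube_ff (s tau : C) : s = 1 \/ s = - (1) -> (0 < Im tau)%R -> cube (ff s tau) = FF s tau.
Proof.
  intros Hs H. unfold FF. replace (GG tau) with (2 * GG tau / 2) by field. rewrite G_eq by auto.
  unfold XX. destruct Hs as [-> | ->]; field.
Qed.

Lemma F3_quotient_eq j tau : (0 < Im tau)%R -> E1m3 tau <> 0 -> F3_quotient j tau = FF (sgn j) tau.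
Proof.
  intros H N. unfold F3_quotient, FF. rewrite E34_eq, X_eta3 by auto. unfold L. field. auto.
Qed.

(* At a multiple zero of [L] both [f_1 f_{-1} = L^2] and [f_1^3 + f_{-1}^3 = 2 GG] would vanish,
   hence also [f_1^3 - f_{-1}^3], which is a multiple of [eta3^3]. *)
Lemma L_zero_simple tau : (0 < Im tau)%R -> L tau = 0 -> DL tau <> 0.
Proof.
  intros H Z ZD.
  assert (G0 : GG tau = 0) by (unfold GG; rewrite Z, ZD; field).
  assert (E : XX tau * XX tau = 0).
  { replace (XX tau * XX tau) with ((cube (ff 1 tau) + cube (ff (- (1)) tau)) * (cube (ff 1 tau) + cube (ff (- (1)) tau))
      - 4 * cube (ff 1 tau * ff (- (1)) tau)) by (unfold XX, cube; ring).
    rewrite <- G_eq, ff_prod, G0, Z by auto. unfold cube. ring. }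
  assert (N := X_neq_0 tau H). exact (Cmult_neq_0 _ _ N N E).
Qed.

Lemma cder_FF (s tau : C) : (0 < Im tau)%R -> exists l, cder (FF s) tau l.
Proof.
  intros H. eexists.
  apply (cder_ext (fun t => GG t + s / 2 * XX t)). intros; unfold FF; field.
  apply cder_plus. apply (qs_cder _ _ tau qs_G H). apply cder_scal. apply (qs_cder _ _ tau qs_X H).
Qed.

Lemma F3_eq j tau : (0 < Im tau)%R -> F3 j tau = FF (sgn j) tau.
Proof.
  intros H. unfold F3. destruct (Ceq_dec (E1m3 tau) 0) as [Z | N]. 2: now apply F3_quotient_eq.
  assert (ZL : L tau = 0) by (unfold L; rewrite Z; ring).
  destruct (simple_zero L tau (tpi * DL tau) ZL) as [d [Hd B]].
  { apply Cmult_neq_0. apply tpi_neq_0. now apply L_zero_simple. }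
  { apply (qs_cder cL L); auto using qs_L. }
  destruct (cder_FF (sgn j) tau H) as [l D].
  apply Clim_removable with l (Rmin d (Im tau)); auto. now apply Rmin_pos.
  intros h Hh Hlt. apply Rmin_Rgt in Hlt. destruct Hlt as [h1 h2].
  apply F3_quotient_eq. now apply half_plane_ball.
  intros E. apply (B h Hh h1). unfold L. rewrite E. ring.
Qed.

(** The point t satisfies W t = t - s, so the laws for W and for the translation combine to f_s(t) =
    z f_s(t) with z = - (1 + s [sqrtm3]) / 2, a primitive cube root of unity. As z differs from 1,
    the value is 0. *)
Lemma ff_zero (s : C) : s = 1 \/ s = - (1) -> ff s ((s * 3 + sqrtm3) / 6) = 0.
Proof.
  intros Hs. set (t := (s * 3 + sqrtm3) / 6).
  assert (Q := sqrtm3_sq). assert (Ss : s * s = 1) by (destruct Hs as [-> | ->]; ring).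
  assert (Ht : (0 < Im t)%R).
  { assert (S3 : (0 < sqrt 3)%R) by (apply sqrt_lt_R0; lra). unfold t, sqrtm3.
    replace ((s * 3 + Ci * sqrt 3) / 6) with (s * (1 / 2)%R + (sqrt 3 / 6)%R * Ci) by (rewrite !RtoC_div by lra; field).
    destruct Hs as [-> | ->]; simpl; lra. }
  assert (N := Im_pos_neq_0 _ Ht).
  assert (Ef : fricke t = t - s).
  { assert (P : 3 * t * (t - s) = - (1)).
    { unfold t. replace (3 * ((s * 3 + sqrtm3) / 6) * ((s * 3 + sqrtm3) / 6 - s)) with ((sqrtm3 * sqrtm3 - 9 * (s * s)) / 12) by field.
      rewrite Q, Ss. field. }
    unfold fricke. rewrite <- P. field. auto. }
  assert (Et : ff (- s) (t - s) = ff s t).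
  { destruct Hs as [-> | ->].
    - rewrite <- ff_T. f_equal. ring.
    - replace (t - - (1)) with (t + 1) by ring. rewrite ff_T. f_equal. ring. }
  assert (E := ff_fricke (- s) t ltac:(rewrite <- Ss; ring) Ht).
  rewrite Ef, Et in E. replace (- - s) with s in E by ring.
  set (X := ff s t) in *.
  replace ((- s * 3 - sqrtm3) / 2 * t) with (- (1 + s * sqrtm3) / 2) in E.
  2:{ unfold t. replace ((- s * 3 - sqrtm3) / 2 * ((s * 3 + sqrtm3) / 6)) with
        (- (9 * (s * s) + 6 * (s * sqrtm3) + sqrtm3 * sqrtm3) / 12) by field.
      rewrite Ss, Q. field. }
  assert (E2 : (3 + s * sqrtm3) / 2 * X = 0).
  { transitivity (X - - (1 + s * sqrtm3) / 2 * X). field. rewrite <- E. ring. }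
  transitivity ((3 - s * sqrtm3) / 6 * ((3 + s * sqrtm3) / 2 * X)).
  - replace ((3 - s * sqrtm3) / 6 * ((3 + s * sqrtm3) / 2 * X)) with ((9 - (s * s) * (sqrtm3 * sqrtm3)) / 12 * X) by field.
    rewrite Ss, Q. field.
  - rewrite E2. ring.
Qed.

Theorem mainTheorem6 :
  forall (j : Z) (tau : C), (0 < Im tau)%R ->
    Cpow (f3 j tau) 3 = F3 j tau
    /\ f3 j tau * f3 (j + 1)%Z tau = E32 tau
    /\ f3 j ((sgn j * 3 + sqrtm3) / 6) = 0
    /\ f3 j (tau + 1) = f3 (j + 1)%Z tau
    /\ f3 j (- (1) / (3 * tau))
       = (sgn j * 3 - sqrtm3) / 2 * tau * f3 (j + 1)%Z tau.
Proof.
  intros j tau H. change f3 with (fun j tau => ff (sgn j) tau). cbv beta. rewrite sgn_succ.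
  assert (Hs := sgn_cases j).
  assert (Ss : sgn j * sgn j = 1) by (destruct Hs as [-> | ->]; ring).
  repeat split.
  - rewrite F3_eq, <- cube_ff by auto. unfold cube. simpl. ring.
  - rewrite <- L_sq, <- ff_prod by auto. destruct Hs as [-> | ->]. reflexivity.
    replace (- - RtoC 1) with (RtoC 1) by ring. ring.
  - now apply ff_zero.
  - apply ff_T.
  - now apply ff_fricke.
Qed.
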